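(* Let $\phi\in C_L(1)$ and let $h\in C_0^\infty$ be fixed. Then, as $x\to0^+$, $$ m_\phi\int_0^\infty h(xu)\,du-\sum_{L_\phi^*(\rho)=0}\int_0^\infty h(xu)u^{\rho}\frac{du}{u} =\int_0^\infty h(xu)\phi(u)\,du-\sum_{\zeta^*(\rho)=0}\int_0^\infty h(xu)\phi(u)u^{\rho}\frac{du}{u}+O(1), $$ where the first sum runs over all zeros of $L_\phi^*$ and the second over all zeros of $\zeta^*$, each counted with multiplicity, and the implied constant depends on $\phi$ and $h$.
   Context: Throughout, $\mathbb R_+=(0,\infty)$, $C_0^\infty$ is the space of smooth compactly supported functions $h:\mathbb R_+\to\mathbb C$, and $\widehat h(s)=\int_0^\infty h(u)u^{s-1}\,du$ is the Mellin transform. The Selberg class $\mathcal S$ consists of functions $L(s)$ such that: (S1) $L(s)=\sum_{n\ge1}a(n)n^{-s}$ converges absolutely for $\mathrm{Re}(s)>1$; (S2) for some integer $m\ge0$, $(s-1)^mL(s)$ extends to an entire function of finite order, and $m_L$ denotes the least such $m$; (S3) there are $Q>0$, $r\ge1$, $\lambda_j>0$, $\mu_j\in\mathbb C$ with $\mathrm{Re}(\mu_j)\ge0$ ($1\le j\le r$) and $|\omega|=1$ such that the completed function $L^*(s):=Q^s\prod_{j=1}^r\Gamma(\lambda_js+\mu_j)L(s)$ satisfies $L^*(s)=\omega\overline{L^*(1-\bar s)}$; (S4) $a(n)\ll_\varepsilon n^{\varepsilon}$ for every $\varepsilon>0$; (S5) $\log L(s)=\sum_{n\ge1}b(n)n^{-s}$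 where $b(n)=0$ unless $n=p^m$ is a prime power with $m\ge1$, and $b(n)\ll n^{\theta}$ for some $\theta<1/2$. Write $-L'(s)/L(s)=\sum_{n\ge1}\Lambda_L(n)n^{-s}$, so $\Lambda_L(n)=b(n)\log n$. Each $L\in\mathcal S$ has an Euler product $L(s)=\prod_pL_p(s)$ with $L_p(s)=\sum_{m\ge0}a(p^m)p^{-ms}$. $L\in\mathcal S$ has a rank $N$ Euler product if for every prime $p$, $L_p(s)=P_p(p^{-s})^{-1}$ with a polynomial $P_p(X)=1-c_1(p)X-\dots-c_N(p)X^N$ and $c_N(p)\ne0$ for all but finitely many $p$; $S_L$ denotes the finite set of primes with $c_N(p)=0$. For a function $\phi:\mathbb R_+\to\mathbb C$ put $L_\phi(s)=\sum_{n\ge1}\phi(n)n^{-s}$. $C_L(N)$ is the set of smooth $\phi:\mathbb R_+\to\mathbb C$ such that $|\phi(u)|\le Cu^2$ for some $C>0$ and all $u>0$, $L_\phi\in\mathcal S$, and $L_\phi$ has a rank $N$ Euler product. For $\phi\in C_L(N)$ write $m_\phi=m_{L_\phi}$, $\Lambda_\phi=\Lambda_{L_\phi}$, $P_{\phi,p}=P_p$, $c_{\phi,l}(p)=c_l(p)$ (with $c_{\phi,l}(p)=0$ for $l>N$) and $S_\phi=S_{L_\phi}$. $\zeta^*(s)=\pi^{-s/2}\Gamma(s/2)\zeta(s)$. Sums over zeros $\rho$ of a completed function run over all its zeros counted with multiplicity. *)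

(* Defs.v *)
From Stdlib Require Import Reals Lra Lia List ZArith Znumtheory ClassicalEpsilon.
From Coquelicot Require Import Coquelicot.
Import ListNotations.

Open Scope R_scope.

Definition cexp (z : C) : C :=
  (exp (Re z) * cos (Im z), exp (Re z) * sin (Im z)).

Definition cpowR (u : R) (s : C) : C := cexp (Cmult s (RtoC (ln u))).

Fixpoint cpown (z : C) (k : nat) : C :=
  match k with O => RtoC 1 | S k' => Cmult z (cpown z k') end.

Fixpoint csum (n : nat) (F : nat -> C) : C :=
  match n with O => RtoC 0 | S n' => Cplus (csum n' F) (F n') end.
Fixpoint cprod (n : nat) (F : nat -> C) : C :=
  match n with O => RtoC 1 | S n' => Cmult (cprod n' F) (F n') end.

Definition npint (z : C) : Prop := exists n : nat, z = RtoC (- INR n).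

(** Euler's Gamma function on C \ {0,-1,-2,...}, via Gauss' limit formula
    Gamma(s) = lim_n n^s n! / (s (s+1) ... (s+n)).
    (At the poles the value is an irrelevant junk value.) *)
Definition gauss_term (s : C) (n : nat) : C :=
  Cdiv (Cmult (cpowR (INR n) s) (RtoC (INR (fact n))))
       (cprod (S n) (fun k => Cplus s (RtoC (INR k)))).

Definition CGamma (s : C) : C :=
  epsilon (inhabits (RtoC 0))
    (fun g => filterlim (gauss_term s) eventually (locally g)).

Definition holo_at (f : C -> C) (z : C) : Prop := ex_derive (K := C_AbsRing) f z.
Definition entire (f : C -> C) : Prop := forall z, holo_at f z.

(** [f] (a function defined away from isolated points, e.g. a meromorphic
    function) has a zero of order exactly [k >= 1] at [rho]:
    f(s) = (s-rho)^k g(s) on a punctured disc, g holomorphic on the disc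
    and g(rho) <> 0. *)
Definition zero_of_order (f : C -> C) (rho : C) (k : nat) : Prop :=
  (1 <= k)%nat /\
  exists (r : R) (g : C -> C), 0 < r /\
    (forall z, Cmod (Cminus z rho) < r -> holo_at g z) /\
    g rho <> RtoC 0 /\
    (forall z, 0 < Cmod (Cminus z rho) < r ->
       f z = Cmult (cpown (Cminus z rho) k) (g z)).

Definition zsum_list (F : C -> C) (l : list (C * nat)) : C :=
  fold_right (fun p acc => Cplus (Cmult (RtoC (INR (snd p))) (F (fst p))) acc)
             (RtoC 0) l.

Definition zero_list (f : C -> C) (l : list (C * nat)) : Prop :=
  NoDup l /\ List.Forall (fun p => zero_of_order f (fst p) (snd p)) l.

(** [sum_over_zeros f F S]: the sum of F(rho) over all zeros rho of f,
    counted with multiplicity, converges (unconditionally, i.e. as a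
    summable family indexed by the zeros) to S. *)
Definition sum_over_zeros (f : C -> C) (F : C -> C) (S : C) : Prop :=
  forall eps : R, 0 < eps ->
    exists l0, zero_list f l0 /\
      forall l, zero_list f l -> incl l0 l ->
        Cmod (Cminus (zsum_list F l) S) < eps.

Definition dterm (a : nat -> C) (s : C) (n : nat) : C :=
  Cmult (a (S n)) (cpowR (INR (S n)) (Copp s)).

Definition prime_nat (p : nat) : Prop := prime (Z.of_nat p).

Definition S1 (a : nat -> C) : Prop :=
  forall s : C, 1 < Re s -> ex_series (fun n => Cmod (dterm a s n)).

Definition S2_with (a : nat -> C) (m : nat) (E : C -> C) : Prop :=
  entire E /\
  (exists A B : R, forall s, Cmod (E s) <= A * exp (Rpower (1 + Cmod s) B)) /\
  (forall s l, 1 < Re s -> is_series (dterm a s) l ->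
     E s = Cmult (cpown (Cminus s (RtoC 1)) m) l).

(** the meromorphic continuation of L, given (S2) data (meaningful for s <> 1) *)
Definition Lcont (m : nat) (E : C -> C) (s : C) : C :=
  Cdiv (E s) (cpown (Cminus s (RtoC 1)) m).

Definition Lstar (m : nat) (E : C -> C) (Q : R) (r : nat)
    (lam : nat -> R) (mu : nat -> C) (s : C) : C :=
  Cmult (Cmult (cpowR Q s)
     (cprod r (fun j => CGamma (Cplus (Cmult (RtoC (lam j)) s) (mu j)))))
     (Lcont m E s).

(** s is a point where L^* is given by its defining formula (no pole of a
    Gamma factor, s <> 1) *)
Definition regular_pt (r : nat) (lam : nat -> R) (mu : nat -> C) (s : C) : Prop :=
  s <> RtoC 1 /\
  forall j, (j < r)%nat -> ~ npint (Cplus (Cmult (RtoC (lam j)) s) (mu j)).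

Definition S3_with (m : nat) (E : C -> C) (Q : R) (r : nat)
    (lam : nat -> R) (mu : nat -> C) (om : C) : Prop :=
  0 < Q /\ (1 <= r)%nat /\
  (forall j, (j < r)%nat -> 0 < lam j /\ 0 <= Re (mu j)) /\
  Cmod om = 1 /\
  forall s, regular_pt r lam mu s ->
            regular_pt r lam mu (Cminus (RtoC 1) (Cconj s)) ->
    Lstar m E Q r lam mu s =
    Cmult om (Cconj (Lstar m E Q r lam mu (Cminus (RtoC 1) (Cconj s)))).

Definition S4 (a : nat -> C) : Prop :=
  forall eps, 0 < eps -> exists K, forall n : nat, (1 <= n)%nat ->
    Cmod (a n) <= K * Rpower (INR n) eps.

Definition S5 (a : nat -> C) : Prop :=
  exists b : nat -> C,
    (forall n, b n <> RtoC 0 ->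
       exists p k, prime_nat p /\ (1 <= k)%nat /\ n = Nat.pow p k) /\
    (exists theta K, theta < 1/2 /\
       forall n : nat, (1 <= n)%nat -> Cmod (b n) <= K * Rpower (INR n) theta) /\
    (forall s l, 1 < Re s -> is_series (dterm a s) l ->
       exists lb, is_series (dterm b s) lb /\ l = cexp lb).

Definition selberg (a : nat -> C) : Prop :=
  S1 a /\ S4 a /\ S5 a /\
  exists m E, S2_with a m E /\
    exists Q r lam mu om, S3_with m E Q r lam mu om.

Definition is_mL (a : nat -> C) (m : nat) : Prop :=
  (exists E, S2_with a m E) /\ forall m' E', S2_with a m' E' -> (m <= m')%nat.

Definition Ppoly (N : nat) (c : nat -> nat -> C) (p : nat) (X : C) : C :=
  Cminus (RtoC 1) (csum N (fun l => Cmult (c (S l) p) (cpown X (S l)))).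

Definition euler_rank (N : nat) (a : nat -> C) : Prop :=
  exists c : nat -> nat -> C,
    (exists B : nat, forall p, prime_nat p -> (B < p)%nat -> c N p <> RtoC 0) /\
    forall p, prime_nat p -> forall s, 1 < Re s ->
      exists lp, is_series (fun k => Cmult (a (Nat.pow p k))
                                           (cpowR (INR p) (Copp (Cmult (RtoC (INR k)) s)))) lp
              /\ Cmult lp (Ppoly N c p (cpowR (INR p) (Copp s))) = RtoC 1.

Definition smooth_pos (f : R -> R) : Prop :=
  forall n u, 0 < u -> ex_derive_n f n u.
Definition csmooth_pos (f : R -> C) : Prop :=
  smooth_pos (fun u => Re (f u)) /\ smooth_pos (fun u => Im (f u)).

Definition C0inf (h : R -> C) : Prop :=
  csmooth_pos h /\
  exists a b, 0 < a /\ a <= b /\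
    forall u, 0 < u -> (u < a \/ b < u) -> h u = RtoC 0.

Definition coef (phi : R -> C) (n : nat) : C := phi (INR n).

Definition CL (N : nat) (phi : R -> C) : Prop :=
  csmooth_pos phi /\
  (exists K, 0 < K /\ forall u, 0 < u -> Cmod (phi u) <= K * u ^ 2) /\
  selberg (coef phi) /\ euler_rank N (coef phi).

Definition int0inf (f : R -> C) : C :=
  RInt_gen (V := C_R_CompleteNormedModule) f (at_right 0) (Rbar_locally p_infty).

Definition zeta_ext (Ez : C -> C) : Prop :=
  entire Ez /\
  forall s l, 1 < Re s -> is_series (dterm (fun _ => RtoC 1) s) l ->
    Ez s = Cmult (Cminus s (RtoC 1)) l.

Definition zeta_star (Ez : C -> C) (s : C) : C :=
  Cmult (Cmult (cpowR PI (Copp (Cdiv s (RtoC 2)))) (CGamma (Cdiv s (RtoC 2))))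
        (Cdiv (Ez s) (Cminus s (RtoC 1))).

(* Main.v *)
(** For L(s) = sum a(n) n^(-s) with E(s) = (s-1)^m L(s) entire, and H a test function supported in (1,oo), the explicit
    formula reads  m * int H - sum_(E(rho)=0) int H(u) u^rho du/u = sum_n Lam_L(n) H(n).  Apply it to L_phi with
    H(u) = h(xu) and to zeta with H(u) = h(xu) phi(u). The sums over n agree: in rank one the Euler factor at p is
    1/(1 - phi(p) p^(-s)), so Lam_phi = phi * Lam on prime powers. The zeros of E that are not zeros of the completed
    function lie at poles of the Gamma factors and contribute O(1).

    The explicit formula is obtained without contour shifts. Jensen's and Borel-Caratheodory's inequalities give the
    partial fractions of E'/E at integer points, in linear combinations that kill polynomials of low degree, so that no
    genus corrections occur. Such a combination is the explicit formula for H(u) = u^(-k) P(1/u), P a polynomial vanishing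
    to high order at 1; by Bernstein approximation it extends to all test functions.

    The continuation of zeta comes from the theta identity, a limit of Polya's discrete Poisson summation for binomial
    weights. *)
Require Import Defs.
From Stdlib Require Import Arith ZArith Znumtheory Zpow_facts Factorial Reals Lra Lia List Permutation Classical ClassicalEpsilon FunctionalExtensionality.
From Coquelicot Require Import Coquelicot.
Open Scope R_scope.
Set Bullet Behavior "Strict Subproofs".

(** Shifting contours would require bounds for [L'/L] inside the strip, whereas finite order only
    controls the number of zeros. Evaluating far to the right, with coefficients [p i] whose moments
    up to order [N] vanish, serves twice: besides cancelling polynomials, it makes the sum of the
    [p i / (i - z)] decay like [|z|^(-N-1)], the rate at which the zeros are known to be summable.
    The explicit formula needs test functions supported to the right of 1. For larger [x] the two
    sums over zeros must still converge; this follows by rescaling, because the zeros of a completed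
    function lie in a vertical strip. The delicate point is 0. With [phi] of size [u^2] the integral
    of [h(xu) phi(u) du/u] need not be bounded. The pole of the Gamma factor of zeta at 0 produces
    it once, the pole of zeta at 1, reflected by the functional equation, produces it once with the
    other sign. At -2, -4, ... the power [u^rho] absorbs [u^2], and since [du/u] is scale invariant
    the resulting geometric series are bounded uniformly in [x]. *)

Lemma INR_S_pos n : 0 < INR (S n). Proof. apply lt_0_INR; lia. Qed.
Lemma exp_le (x y : R) : x <= y -> exp x <= exp y.
Proof. intros [H| ->]; [left; apply exp_increasing; exact H | right; reflexivity]. Qed.

Lemma RtoC_nz (x : R) : x <> 0 -> RtoC x <> RtoC 0.
Proof. intros H E. apply RtoC_inj in E. auto. Qed.
Lemma Cinv_nz (z : C) : z <> RtoC 0 -> (/ z)%C <> RtoC 0.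
Proof. intros H. apply Cmod_gt_0. rewrite Cmod_inv by auto. apply Rinv_0_lt_compat, Cmod_gt_0, H. Qed.
Lemma re_minus (z w : C) : Re (z - w)%C = Re z - Re w.
Proof. reflexivity. Qed.

Create HintDb cx.

Ltac pos := first
  [ assumption | apply exp_pos | apply Cmod_ge_0 | apply pos_INR | apply INR_S_pos | apply Rabs_pos | apply pow2_ge_0 | apply PI_RGT_0 | lra
  | lazymatch goal with
    | |- 0 < _ * _ => apply Rmult_lt_0_compat; pos
    | |- 0 <= _ * _ => apply Rmult_le_pos; pos
    | |- 0 < _ / _ => apply Rdiv_lt_0_compat; pos
    | |- 0 <= _ / _ => apply Rdiv_le_0_compat; pos
    | |- 0 < / _ => apply Rinv_0_lt_compat; pos
    | |- 0 <= / _ => left; apply Rinv_0_lt_compat; pos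
    | |- 0 < _ ^ _ => apply pow_lt; pos
    | |- 0 <= _ ^ _ => apply pow_le; pos
    | |- 0 <= exp _ => left; apply exp_pos
    | |- 0 <= ln _ => rewrite <- ln_1; apply Rcomplements.ln_le; pos
    | |- 0 < Rmin _ _ => apply Rmin_pos; pos
    | |- 0 < INR _ => apply lt_0_INR; lia
    | |- 1 <= INR (S ?n) => rewrite S_INR; pose proof (pos_INR n); lra
    | |- 0 < _ + _ => first [apply Rplus_lt_le_0_compat; pos | apply Rplus_le_lt_0_compat; pos]
    | |- 0 <= _ + _ => apply Rplus_le_le_0_compat; pos
    | |- 0 < Cmod _ => apply Cmod_gt_0; pos
    | |- _ > _ => apply Rlt_gt; pos
    | |- RtoC _ <> RtoC 0 => apply RtoC_nz; pos
    | |- Cinv _ <> RtoC 0 => apply Cinv_nz; pos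
    | |- 1 <= exp _ => rewrite <- exp_0; apply exp_le; pos
    | |- 1 <= _ ^ _ => apply pow_R1_Rle; pos
    | |- _ <> RtoC 0 => first [apply Cmult_neq_0; pos | apply Cpow_nz; pos]
    | |- _ <> 0 => apply Rgt_not_eq; pos
    | |- _ /\ _ => split; pos
    end ].

Ltac mono := first
  [ assumption | pos
  | lazymatch goal with
    | |- ?a * _ <= ?a * _ => apply Rmult_le_compat_l; mono
    | |- _ * ?a <= _ * ?a => apply Rmult_le_compat_r; mono
    | |- _ * _ <= _ * _ => apply Rmult_le_compat; mono
    | |- _ / ?a <= _ / ?a => apply Rmult_le_compat_r; mono
    | |- / _ <= / _ => apply Rinv_le_contravar; mono
    | |- exp _ <= exp _ => apply exp_le; mono
    | |- _ ^ _ <= _ ^ _ => apply pow_incr; split; mono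
    | |- INR _ <= INR _ => apply le_INR; lia
    | |- INR _ < INR _ => apply lt_INR; lia
    | |- / _ <= 1 => rewrite <- Rinv_1; apply Rinv_le_contravar; mono
    | |- Rmin ?a _ <= ?a => apply Rmin_l
    | |- Rmin _ ?a <= ?a => apply Rmin_r
    | |- ?a <= Rmax ?a _ => apply Rmax_l
    | |- ?a <= Rmax _ ?a => apply Rmax_r
    | |- ln _ < ln _ => apply ln_increasing; mono
    | |- ln _ <= ln _ => apply Rcomplements.ln_le; mono
    | |- Cmod (_ + _)%C <= _ => eapply Rle_trans; [apply Cmod_triangle|mono]
    | |- - _ <= - _ => apply Ropp_le_contravar; mono
    | |- _ + _ <= _ + _ => apply Rplus_le_compat; mono
    end
  | auto | nra ].

Notation CN n := (RtoC (INR n)).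
Tactic Notation "le_trans" uconstr(t) := eapply Rle_trans; [apply t|].
Tactic Notation "le_trans2" uconstr(t) := eapply Rle_trans; [|apply t].
Ltac le_mul_l := apply Rmult_le_compat_l.
Ltac le_mul_r := apply Rmult_le_compat_r.
Ltac le_via x := apply Rle_trans with x.

Ltac fin := solve [ auto | lra | lia | mono | eauto with cx ].

(** * First-order calculus for functions on C and on R *)

(** All complex analysis below is done with these epsilon forms and translated by [cdiff_iff]. The
    inequality is not strict, so that [w = z] needs no exception. *)
Definition cdiff (f : C -> C) (z l : C) : Prop :=
  forall eps, 0 < eps -> exists delta, 0 < delta /\
    forall w, Cmod (w - z) < delta ->
      Cmod (f w - f z - l * (w - z)) <= eps * Cmod (w - z).

Definition rdiff (f : R -> C) (t : R) (l : C) : Prop :=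
  forall eps, 0 < eps -> exists delta, 0 < delta /\
    forall u, Rabs (u - t) < delta ->
      Cmod (f u - f t - l * RtoC (u - t)) <= eps * Rabs (u - t).

Definition ccont (f : C -> C) (z : C) : Prop :=
  forall eps, 0 < eps -> exists delta, 0 < delta /\
    forall w, Cmod (w - z) < delta -> Cmod (f w - f z) < eps.

Definition rcont (f : R -> C) (t : R) : Prop :=
  forall eps, 0 < eps -> exists delta, 0 < delta /\
    forall u, Rabs (u - t) < delta -> Cmod (f u - f t) < eps.

Lemma Cmod_le_abs (z : C) : Cmod z <= Rabs (Re z) + Rabs (Im z).
Proof.
 apply Rsqr_incr_0_var.
 - rewrite !Rsqr_pow2, Cmod2_alt, <- (pow2_abs (Re z)), <- (pow2_abs (Im z)).
  pose proof (Rabs_pos (Re z)); pose proof (Rabs_pos (Im z)); nra.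
 - pos.
Qed.

Lemma im_le_Cmod (z : C) : Rabs (Im z) <= Cmod z.
Proof. apply Rle_trans with (2 := Rmax_Cmod z). apply Rmax_r. Qed.

Lemma Cmod_minus_sym (z w : C) : Cmod (z - w) = Cmod (w - z).
Proof. rewrite <- Cmod_opp. f_equal. ring. Qed.

Lemma Cmod_triangle_inv (z w : C) : Cmod z - Cmod w <= Cmod (z - w).
Proof. assert (H : Cmod z <= Cmod (z - w) + Cmod w). { replace z with ((z - w) + w)%C at 1 by ring; fin. } lra. Qed.

Lemma Cmod_minus_le (z w : C) : Cmod (z - w) <= Cmod z + Cmod w.
Proof. rewrite <- (Cmod_opp w). apply Cmod_triangle. Qed.

Lemma Cmod_zero_iff (z : C) : Cmod z <= 0 -> z = 0.
Proof. intros H. apply Cmod_eq_0. pose proof (Cmod_ge_0 z). lra. Qed.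

Lemma Ceq_small (z w : C) : (forall eps, 0 < eps -> Cmod (z - w) <= eps) -> z = w.
Proof. intros H. apply Ceq_minus. apply Cmod_zero_iff. apply le_epsilon. intros e He. rewrite Rplus_0_l. auto. Qed.

Lemma Cmod_self (z : C) : Cmod (z - z) = 0.
Proof. replace (z - z)%C with (RtoC 0) by ring. apply Cmod_0. Qed.

Lemma C_ext (z w : C) : Re z = Re w -> Im z = Im w -> z = w.
Proof. destruct z, w; simpl; congruence. Qed.

(** Limits and first order expansions along [d x -> 0], used for [x] complex ([d x = |x - z|]) and real; derivatives are handled by Caratheodory's slope criterion [der_iff]. *)
Definition tends {X} (d : X -> R) (f : X -> C) (l : C) : Prop :=
  forall eps, 0 < eps -> exists delta, 0 < delta /\ forall x, d x < delta -> Cmod (f x - l) < eps.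
Definition der {X} (d : X -> R) (e f : X -> C) (f0 l : C) : Prop :=
  forall eps, 0 < eps -> exists delta, 0 < delta /\ forall x, d x < delta -> Cmod (f x - f0 - l * e x) <= eps * d x.

Section Limits.
Context {X : Type} (d : X -> R).
Implicit Types f g e q : X -> C.

Lemma near_and (P Q : X -> Prop) : (exists r, 0 < r /\ forall x, d x < r -> P x) -> (exists r, 0 < r /\ forall x, d x < r -> Q x) ->
  exists r, 0 < r /\ forall x, d x < r -> P x /\ Q x.
Proof.
 intros [r1 [R1 H1]] [r2 [R2 H2]]. exists (Rmin r1 r2). split. pos. pose proof (Rmin_l r1 r2).
 pose proof (Rmin_r r1 r2). split; [apply H1|apply H2]; lra.
Qed.

Lemma tends_const c : tends d (fun _ => c) c.
Proof. exists 1. split. lra. rewrite Cmod_self. auto. Qed.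
Lemma tends_plus f g a b : tends d f a -> tends d g b -> tends d (fun x => f x + g x)%C (a + b)%C.
Proof.
 intros H1 H2 e He. destruct (near_and _ _ (H1 (e/2) ltac:(lra)) (H2 (e/2) ltac:(lra))) as [r [Hr K]]. exists r.
 split; auto. intros x Hx. destruct (K x Hx). replace (f x + g x - (a + b))%C with ((f x - a) + (g x - b))%C by ring.
 eapply Rle_lt_trans. apply Cmod_triangle. lra.
Qed.
Lemma tends_mult f g a b : tends d f a -> tends d g b -> tends d (fun x => f x * g x)%C (a * b)%C.
Proof.
 intros H1 H2 e He. pose proof (Cmod_ge_0 a). pose proof (Cmod_ge_0 b). set (c := Rmin 1 (e / (Cmod a + Cmod b + 1))).
 assert (Hc : 0 < c) by (unfold c; pos). assert (Hc1 : c <= 1) by apply Rmin_l.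
 assert (Hc2 : c * (Cmod a + Cmod b + 1) <= e). { le_trans Rmult_le_compat_r. lra. apply Rmin_r. right; field; lra. }
 destruct (near_and _ _ (H1 c Hc) (H2 c Hc)) as [r [Hr K]]. exists r. split; auto. intros x Hx.
 destruct (K x Hx) as [K1 K2].
 replace (f x * g x - a * b)%C with ((f x - a) * (g x - b) + ((f x - a) * b + a * (g x - b)))%C by ring.
 eapply Rle_lt_trans. apply Cmod_triangle. pose proof (Cmod_triangle ((f x - a) * b) (a * (g x - b))).
 rewrite !Cmod_mult in *. pose proof (Cmod_ge_0 (f x - a)). nra.
Qed.
Lemma tends_comp (f : C -> C) g y a : tends (fun w => Cmod (w - y)) f a -> tends d g y -> tends d (fun x => f (g x)) a.
Proof. intros Hf Hg e He. destruct (Hf e He) as [r [Hr H]]. destruct (Hg r Hr) as [r' [Hr' H']]; fin. Qed.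
Lemma tends_ext f g a : (exists r, 0 < r /\ forall x, d x < r -> f x = g x) -> tends d f a -> tends d g a.
Proof.
 intros E H e He. destruct (near_and _ _ E (H e He)) as [r [Hr K]]. exists r. split; auto. intros x Hx.
 destruct (K x Hx) as [<- K2]. auto.
Qed.

Variable e : X -> C.
Hypothesis He : forall x, Cmod (e x) = d x.

Lemma der_iff f (f0 l : C) : der d e f f0 l <-> exists q, tends d q l /\ exists r, 0 < r /\ forall x, d x < r -> f x = (f0 + q x * e x)%C.
Proof.
 split.
 (* Where [e x = 0] the slope takes the limit value, so that it is continuous there. *)
 - exists (fun x => if Ceq_dec (e x) 0 then l else ((f x - f0) / e x)%C). split.
  + intros eps Hp. destruct (H (eps / 2) ltac:(lra)) as [r [Hr K]]. exists r. split; auto. intros x Hx.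
   specialize (K x Hx). destruct (Ceq_dec (e x) 0) as [E|E]. rewrite Cmod_self; auto.
   assert (0 < d x) by (rewrite <- He; apply Cmod_gt_0; auto).
   replace ((f x - f0) / e x - l)%C with ((f x - f0 - l * e x) / e x)%C by (field; auto). rewrite Cmod_div, He by auto.
   apply Rle_lt_trans with (eps / 2); [|lra]. apply Rmult_le_reg_r with (d x); auto. unfold Rdiv at 1.
   rewrite Rmult_assoc, Rinv_l; lra.
  + destruct (H 1 Rlt_0_1) as [r [Hr K]]. exists r. split; auto. intros x Hx. specialize (K x Hx).
   destruct (Ceq_dec (e x) 0) as [E|E]; [|field; auto]. rewrite E in *. rewrite <- He, E, Cmod_0 in K.
   replace (f x - f0 - l * 0)%C with (f x - f0)%C in K by ring. rewrite Cmult_0_r, Cplus_0_r.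
   apply Ceq_minus, Cmod_zero_iff. lra.
 - intros [q [Hq E]] eps Hp. destruct (near_and _ _ (Hq eps Hp) E) as [r [Hr K]]. exists r. split; auto. intros x Hx.
  destruct (K x Hx) as [K1 ->]. replace (f0 + q x * e x - f0 - l * e x)%C with ((q x - l) * e x)%C by ring.
  rewrite Cmod_mult, He. le_mul_r; [rewrite <- He; pos|lra].
Qed.

Lemma tends_e : tends d e 0.
Proof. intros eps Hp. exists eps. split; auto. intros x Hx. replace (e x - 0)%C with (e x) by ring. congruence. Qed.
Lemma der_tends f (f0 l : C) : der d e f f0 l -> tends d f f0.
Proof.
 rewrite der_iff. intros [q [Hq [r [Hr E]]]]. apply tends_ext with (fun x => f0 + q x * e x)%C. exists r. split; auto.
 symmetry; auto. pose proof (tends_plus _ _ _ _ (tends_const f0) (tends_mult _ _ _ _ Hq tends_e)) as T.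
 replace (f0 + l * 0)%C with f0 in T by ring; fin.
Qed.
Lemma der_plus f g (f0 g0 a b : C) : der d e f f0 a -> der d e g g0 b -> der d e (fun x => f x + g x)%C (f0 + g0)%C (a + b)%C.
Proof.
 rewrite !der_iff. intros [q [Hq E]] [q' [Hq' E']]. exists (fun x => q x + q' x)%C. split. apply tends_plus; auto.
 destruct (near_and _ _ E E') as [r [Hr K]]. exists r. split; auto. intros x Hx. destruct (K x Hx) as [-> ->]. ring.
Qed.
Lemma der_mult f g (f0 g0 a b : C) : der d e f f0 a -> der d e g g0 b -> der d e (fun x => f x * g x)%C (f0 * g0)%C (a * g0 + f0 * b)%C.
Proof.
 intros Hf Hg. pose proof (der_tends _ _ _ Hg) as Tg. rewrite der_iff in *.
 destruct Hf as [q [Hq E]], Hg as [q' [Hq' E']]. exists (fun x => q x * g x + f0 * q' x)%C. split.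
 apply tends_plus; apply tends_mult; auto. apply tends_const. destruct (near_and _ _ E E') as [r [Hr K]]. exists r.
 split; auto. intros x Hx. destruct (K x Hx) as [-> ->]. ring.
Qed.
End Limits.

(** The outer map is complex while the inner variable stays abstract, so one proof yields both
    [cdiff_comp] and [cdiff_rdiff]. *)
Lemma der_comp {X} (d : X -> R) (e : X -> C) (f : C -> C) g y a b : (forall x, Cmod (e x) = d x) ->
  der (fun w => Cmod (w - y)) (fun w => w - y)%C f (f y) a -> der d e g y b -> der d e (fun x => f (g x)) (f y) (a * b)%C.
Proof.
 intros He Hf Hg. pose proof (der_tends _ _ He _ _ _ Hg) as Tg. apply (der_iff _ _ (fun _ => eq_refl)) in Hf.
 rewrite (der_iff d e He) in *. destruct Hf as [q [Hq [r [Hr E]]]], Hg as [q' [Hq' E']].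
 exists (fun x => q (g x) * q' x)%C. split. apply tends_mult; auto. apply (tends_comp d q g y); auto.
 destruct (near_and d _ _ (Tg r Hr) E') as [r' [Hr' K]]. exists r'. split; auto. intros x Hx.
 destruct (K x Hx) as [K1 K2]. rewrite (E _ K1), K2. ring.
Qed.

Lemma cdiff_iff (f : C -> C) (z l : C) :
  is_derive (K := C_AbsRing) f z l <-> cdiff f z l.
Proof.
 split.
 - intros [_ H] eps He. destruct (H z (fun P HP => HP) (mkposreal eps He)) as [d Hd]. exists d. split. apply cond_pos.
  intros w Hw. specialize (Hd w Hw).
  replace (f w - f z - l * (w - z))%C with (f w + - f z + - ((w + - z) * l))%C by ring; fin.
 - split. { apply is_linear_scal_l. } intros x Hx. assert (Ex : z = x). {
  apply (is_filter_lim_locally_unique (V := AbsRing_NormedModule C_AbsRing) z x); fin. } subst x. intros eps.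
  destruct (H eps (cond_pos eps)) as [d [Hd H1]]. exists (mkposreal d Hd). intros w Hw.
  unfold minus, plus, opp, scal; simpl. unfold mult; simpl.
  replace (f w + - f z + - ((w + - z) * l))%C with (f w - f z - l * (w - z))%C by ring; fin.
Qed.

Lemma holo_at_iff (f : C -> C) (z : C) : holo_at f z <-> exists l, cdiff f z l.
Proof. split; intros [l H]; exists l; apply cdiff_iff; exact H. Qed.

Lemma cdiff_ccont f z l : cdiff f z l -> ccont f z.
Proof. apply (der_tends (fun w => Cmod (w - z)) (fun w => w - z)%C); auto. Qed.

Lemma rdiff_iff f t l : rdiff f t l <->
  is_derive (fun x => Re (f x)) t (Re l) /\ is_derive (fun x => Im (f x)) t (Im l).
Proof.
 assert (Hg : forall (g : R -> R) (d : R), is_derive g t d <-> forall eps, 0 < eps -> exists delta, 0 < delta /\ forall u, Rabs (u - t) < delta -> Rabs (g u - g t - d * (u - t)) <= eps * Rabs (u - t)).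
 { split.
 - intros [_ H] eps He. destruct (H t (fun P HP => HP) (mkposreal eps He)) as [dl Hd]. exists dl. split. apply cond_pos.
  intros u Hu. replace (g u - g t - d * (u - t)) with (g u + - g t + - ((u + - t) * d)) by ring; fin.
 - split. { apply is_linear_scal_l. } intros x Hx.
  assert (Ex : t = x) by (apply (is_filter_lim_locally_unique t x); exact Hx). subst x. intros eps.
  destruct (H eps (cond_pos eps)) as [dl [Hd H1]]. exists (mkposreal dl Hd). intros u Hu.
  unfold minus, plus, opp, scal; simpl. unfold mult; simpl.
  replace (g u + - g t + - ((u + - t) * d)) with (g u - g t - d * (u - t)) by ring; fin. } rewrite !Hg. split.
 -
  split; intros eps He; destruct (H eps He) as [dl [Hd H1]]; exists dl; (split; [exact Hd|]); intros u Hu; specialize (H1 u Hu); (eapply Rle_trans; [|exact H1]).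
  + apply Rle_trans with (2 := re_le_Cmod _). right. f_equal. unfold Cplus, Re; simpl. ring.
  + apply Rle_trans with (2 := im_le_Cmod _). right. f_equal. unfold Cplus, Im; simpl. ring.
 - intros [H1 H2] eps He. destruct (H1 (eps/2) ltac:(lra)) as [d1 [Hd1 K1]].
  destruct (H2 (eps/2) ltac:(lra)) as [d2 [Hd2 K2]]. exists (Rmin d1 d2). split. pos. intros u Hu.
  specialize (K1 u (Rlt_le_trans _ _ _ Hu (Rmin_l _ _))). specialize (K2 u (Rlt_le_trans _ _ _ Hu (Rmin_r _ _))).
  le_trans Cmod_le_abs.
  match goal with |- Rabs ?a + Rabs ?b <= _ => replace a with (Re (f u) - Re (f t) - Re l * (u - t)) by (unfold Cminus, Cplus, Copp, Cmult, RtoC, Re, Im; simpl; ring); replace b with (Im (f u) - Im (f t) - Im l * (u - t)) by (unfold Cminus, Cplus, Copp, Cmult, RtoC, Re, Im; simpl; ring) end; fin.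
Qed.

Lemma rcont_iff f t : rcont f t <->
  continuous (fun x => Re (f x)) t /\ continuous (fun x => Im (f x)) t.
Proof.
 assert (Hg : forall g : R -> R, continuous g t <-> forall eps, 0 < eps -> exists delta, 0 < delta /\ forall u, Rabs (u - t) < delta -> Rabs (g u - g t) < eps).
 { split.
 - intros H eps He. destruct (proj1 (filterlim_locally _ _) H (mkposreal eps He)) as [d Hd]. exists d. split.
  apply cond_pos. auto.
 - intros H. apply filterlim_locally. intros eps. destruct (H eps (cond_pos eps)) as [d [Hd H1]].
  exists (mkposreal d Hd); fin. } rewrite !Hg. split.
 -
  split; intros eps He; destruct (H eps He) as [dl [Hd H1]]; exists dl; (split; [exact Hd|]); intros u Hu; specialize (H1 u Hu); (eapply Rle_lt_trans; [|exact H1]).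
  + apply Rle_trans with (2 := re_le_Cmod _). right; fin.
  + apply Rle_trans with (2 := im_le_Cmod _). right; fin.
 - intros [H1 H2] eps He. destruct (H1 (eps/2) ltac:(lra)) as [d1 [Hd1 K1]].
  destruct (H2 (eps/2) ltac:(lra)) as [d2 [Hd2 K2]]. exists (Rmin d1 d2). split. pos. intros u Hu.
  specialize (K1 u (Rlt_le_trans _ _ _ Hu (Rmin_l _ _))). specialize (K2 u (Rlt_le_trans _ _ _ Hu (Rmin_r _ _))).
  eapply Rle_lt_trans. apply Cmod_le_abs.
  match goal with |- Rabs ?a + Rabs ?b < _ => replace a with (Re (f u) - Re (f t)) by (unfold Cminus, Cplus, Copp, Cmult, RtoC, Re, Im; simpl; ring); replace b with (Im (f u) - Im (f t)) by (unfold Cminus, Cplus, Copp, Cmult, RtoC, Re, Im; simpl; ring) end; fin.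
Qed.

Lemma e_real t x : Cmod (RtoC (x - t)) = Rabs (x - t).
Proof. apply Cmod_R. Qed.

Lemma rdiff_rcont f t l : rdiff f t l -> rcont f t.
Proof. apply (der_tends (fun u => Rabs (u - t)) (fun u => RtoC (u - t)) (e_real t)). Qed.

Lemma ccont_rcont f g t : ccont f (g t) -> rcont g t -> rcont (fun u => f (g u)) t.
Proof. apply tends_comp. Qed.

Lemma cdiff_ext_loc f g z l : (exists d, 0 < d /\ forall w, Cmod (w - z) < d -> f w = g w) ->
  cdiff f z l -> cdiff g z l.
Proof.
 intros [d0 [Hd0 E]] H eps He. destruct (H eps He) as [d [Hd H1]]. exists (Rmin d0 d). split. pos. intros w Hw.
 rewrite <- !E. apply H1. eapply Rlt_le_trans; [exact Hw|apply Rmin_r]. rewrite Cmod_self; lra.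
 eapply Rlt_le_trans; [exact Hw|apply Rmin_l].
Qed.

Lemma cdiff_ext f g z l : (forall w, f w = g w) -> cdiff f z l -> cdiff g z l.
Proof. intros E. apply cdiff_ext_loc. exists 1. split; [lra|auto]. Qed.

Lemma cdiff_unique f z l l' : cdiff f z l -> cdiff f z l' -> l = l'.
Proof.
 intros H H'. apply Ceq_small. intros eps He. destruct (H (eps/2) ltac:(lra)) as [d [Hd H1]].
 destruct (H' (eps/2) ltac:(lra)) as [d' [Hd' H1']]. set (e := Rmin d d' / 2).
 assert (He0 : 0 < e) by (unfold e; pose proof (Rmin_pos d d' Hd Hd'); lra).
 assert (Ew : (z + RtoC e - z)%C = RtoC e) by ring.
 assert (Em : Cmod (RtoC e) = e) by (rewrite Cmod_R; apply Rabs_pos_eq; lra). specialize (H1 (z + RtoC e)%C).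
 specialize (H1' (z + RtoC e)%C). rewrite Ew, Em in *.
 assert (e < d) by (unfold e; pose proof (Rmin_l d d'); pose proof (Rmin_pos d d' Hd Hd'); lra).
 assert (e < d') by (unfold e; pose proof (Rmin_r d d'); pose proof (Rmin_pos d d' Hd Hd'); lra).
 assert (K : Cmod ((l - l') * RtoC e) <= eps * e). {
 replace ((l - l') * RtoC e)%C with ((f (z + RtoC e) - f z - l' * RtoC e) - (f (z + RtoC e) - f z - l * RtoC e))%C by ring.
 le_trans Cmod_minus_le. lra. } rewrite Cmod_mult in K. nra.
Qed.

Lemma cdiff_const c z : cdiff (fun _ => c) z 0.
Proof.
 apply (der_iff (fun w => Cmod (w - z)) (fun w => w - z)%C); auto. exists (fun _ => RtoC 0). split. apply tends_const.
 exists 1. split. lra. intros; ring.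
Qed.

Lemma cdiff_id z : cdiff (fun w => w) z 1.
Proof.
 apply (der_iff (fun w => Cmod (w - z)) (fun w => w - z)%C); auto. exists (fun _ => RtoC 1). split. apply tends_const.
 exists 1. split. lra. intros; ring.
Qed.

Lemma cdiff_plus f g z a b : cdiff f z a -> cdiff g z b -> cdiff (fun w => f w + g w)%C z (a + b)%C.
Proof. apply (der_plus (fun w => Cmod (w - z)) (fun w => w - z)%C); auto. Qed.

Lemma cdiff_mult f g z a b : cdiff f z a -> cdiff g z b -> cdiff (fun w => f w * g w)%C z (a * g z + f z * b)%C.
Proof. apply (der_mult (fun w => Cmod (w - z)) (fun w => w - z)%C); auto. Qed.

Lemma cdiff_scal c f z a : cdiff f z a -> cdiff (fun w => c * f w)%C z (c * a)%C.
Proof. replace (c * a)%C with (RtoC 0 * f z + c * a)%C by ring. apply (cdiff_mult (fun _ => c)); auto. apply cdiff_const. Qed.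

Lemma cdiff_opp f z a : cdiff f z a -> cdiff (fun w => - f w)%C z (- a)%C.
Proof.
 intros H. replace (- a)%C with (-1 * a)%C by ring. apply cdiff_ext with (fun w => -1 * f w)%C. intros; ring.
 apply cdiff_scal; auto.
Qed.

Lemma cdiff_minus f g z a b : cdiff f z a -> cdiff g z b -> cdiff (fun w => f w - g w)%C z (a - b)%C.
Proof. intros H1 H2. apply cdiff_plus; auto. apply cdiff_opp; auto. Qed.

Lemma cdiff_comp f g z a b : cdiff f (g z) a -> cdiff g z b -> cdiff (fun w => f (g w)) z (a * b)%C.
Proof. apply (der_comp (fun w => Cmod (w - z)) (fun w => w - z)%C); auto. Qed.

Lemma cdiff_rdiff f g t a b : cdiff f (g t) a -> rdiff g t b -> rdiff (fun u => f (g u)) t (a * b)%C.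
Proof. apply (der_comp (fun u => Rabs (u - t)) (fun u => RtoC (u - t)) f g (g t) a b (e_real t)). Qed.

(** The slope of [1/w] at [z] is explicitly [-1/(zw)]; only its limit has to be computed. *)
Lemma cdiff_inv (z : C) : z <> RtoC 0 -> cdiff (fun w => / w)%C z (- / (z * z))%C.
Proof.
 intros Hz. pose proof (proj1 (Cmod_gt_0 z) Hz) as Mz.
 assert (Hw : forall w, Cmod (w - z) < Cmod z / 2 -> w <> RtoC 0 /\ Cmod z / 2 < Cmod w). { intros w H.
 pose proof (Cmod_triangle_inv z w) as T. rewrite Cmod_minus_sym in T. split; [intros ->; rewrite Cmod_0 in T|]; lra. }
 apply (der_iff (fun w => Cmod (w - z)) (fun w => w - z)%C); auto. exists (fun w => - / (z * w))%C. split.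
 - intros eps He. set (m := Cmod z) in *. exists (Rmin (m / 2) (eps * m ^ 3 / 2)). split. pos. intros w H.
  pose proof (Rmin_l (m / 2) (eps * m ^ 3 / 2)). pose proof (Rmin_r (m / 2) (eps * m ^ 3 / 2)).
  destruct (Hw w ltac:(lra)) as [W1 W2].
  replace (- / (z * w) - - / (z * z))%C with ((w - z) / (z * z * w))%C by (field; auto).
  rewrite Cmod_div, !Cmod_mult by pos. apply Rmult_lt_reg_r with (m * m * Cmod w). pos. unfold Rdiv.
  rewrite Rmult_assoc, Rinv_l by pos. assert (m * m * (m / 2) <= m * m * Cmod w) by mono. nra.
 - exists (Cmod z / 2). split. lra. intros w H. destruct (Hw w H). field; auto.
Qed.

Lemma cdiff_div (f g : C -> C) (z a b : C) : g z <> RtoC 0 -> cdiff f z a -> cdiff g z b ->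
  cdiff (fun w => f w / g w)%C z ((a * g z - f z * b) / (g z * g z))%C.
Proof.
 intros Hz Hf Hg.
 replace ((a * g z - f z * b) / (g z * g z))%C with (a * / g z + f z * (- / (g z * g z) * b))%C by (field; auto).
 apply (cdiff_mult f (fun w => / g w)%C); auto. apply (cdiff_comp (fun w => / w)%C g); auto. apply cdiff_inv; auto.
Qed.

Lemma cdiff_pow (z : C) n : cdiff (fun w => w ^ n)%C z (CN n * z ^ (pred n))%C.
Proof.
 induction n.
 - simpl. replace (RtoC 0 * 1)%C with (RtoC 0) by ring. apply cdiff_const.
 - assert (E : (CN (S n) * z ^ pred (S n) = 1 * z ^ n + z * (CN n * z ^ pred n))%C). { rewrite S_INR, RtoC_plus.
  destruct n; simpl; ring. } rewrite E. apply (cdiff_mult (fun w => w) (fun w => w ^ n)%C); auto. apply cdiff_id.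
Qed.

Lemma rdiff_id t : rdiff (fun u => RtoC u) t 1.
Proof.
 apply (der_iff (fun u => Rabs (u - t)) (fun u => RtoC (u - t)) (e_real t)). exists (fun _ => RtoC 1). split.
 apply tends_const. exists 1. split. lra. intros. rewrite RtoC_minus. ring.
Qed.
Lemma rdiff_const c t : rdiff (fun u => c) t 0.
Proof.
 apply (der_iff (fun u => Rabs (u - t)) (fun u => RtoC (u - t)) (e_real t)). exists (fun _ => RtoC 0). split.
 apply tends_const. exists 1. split. lra. intros; ring.
Qed.

Lemma rdiff_plus f g t a b : rdiff f t a -> rdiff g t b -> rdiff (fun u => f u + g u)%C t (a + b)%C.
Proof. apply (der_plus (fun u => Rabs (u - t)) (fun u => RtoC (u - t)) (e_real t)). Qed.

Lemma rdiff_mult f g t a b : rdiff f t a -> rdiff g t b -> rdiff (fun u => f u * g u)%C t (a * g t + f t * b)%C.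
Proof. apply (der_mult (fun u => Rabs (u - t)) (fun u => RtoC (u - t)) (e_real t)). Qed.

Lemma rdiff_scal c f t a : rdiff f t a -> rdiff (fun w => c * f w)%C t (c * a)%C.
Proof.
 intros H. pose proof (rdiff_mult _ _ _ _ _ (rdiff_const c t) H) as K.
 replace (c * a)%C with (RtoC 0 * f t + c * a)%C by ring; fin.
Qed.

Lemma rdiff_ext_loc f g t l : (exists d, 0 < d /\ forall u, Rabs (u - t) < d -> f u = g u) ->
  rdiff f t l -> rdiff g t l.
Proof.
 intros [d0 [Hd0 E]] H eps He. destruct (H eps He) as [d [Hd H1]]. exists (Rmin d0 d). split. pos. intros w Hw.
 rewrite <- !E. apply H1. eapply Rlt_le_trans; [exact Hw|apply Rmin_r]. rewrite Rminus_diag, Rabs_R0; lra.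
 eapply Rlt_le_trans; [exact Hw|apply Rmin_l].
Qed.

Lemma rdiff_R (g : R -> R) t d : is_derive g t d -> rdiff (fun u => RtoC (g u)) t (RtoC d).
Proof. intros H. apply rdiff_iff. split; simpl; auto. apply (is_derive_const (K := R_AbsRing) (V := R_NormedModule)). Qed.

Lemma rdiff_comp_R (f : R -> C) (g : R -> R) t a d : rdiff f (g t) a -> is_derive g t d ->
  rdiff (fun u => f (g u)) t (a * RtoC d)%C.
Proof.
 rewrite !rdiff_iff. intros [H1 H2] H. split.
 - replace (Re (a * RtoC d)) with (d * Re a) by (unfold Cminus, Cplus, Copp, Cmult, RtoC, Re, Im; simpl; ring).
  apply (is_derive_comp (fun x => Re (f x)) g); auto.
 - replace (Im (a * RtoC d)) with (d * Im a) by (unfold Cminus, Cplus, Copp, Cmult, RtoC, Re, Im; simpl; ring).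
  apply (is_derive_comp (fun x => Im (f x)) g); auto.
Qed.

Lemma rcont_const c t : rcont (fun _ => c) t.
Proof. apply tends_const. Qed.
Lemma rcont_plus f g t : rcont f t -> rcont g t -> rcont (fun u => f u + g u)%C t.
Proof. apply tends_plus. Qed.
Lemma rcont_mult f g t : rcont f t -> rcont g t -> rcont (fun u => f u * g u)%C t.
Proof. apply tends_mult. Qed.
Lemma rcont_scal c f t : rcont f t -> rcont (fun u => c * f u)%C t.
Proof. apply rcont_mult; auto. apply rcont_const. Qed.
Lemma rcont_ext_loc f g t : (exists d, 0 < d /\ forall u, Rabs (u - t) < d -> f u = g u) -> rcont f t -> rcont g t.
Proof.
 intros [d0 [Hd0 E]] H eps He. destruct (H eps He) as [d [Hd K]]. exists (Rmin d0 d). split. pos. intros u Hu.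
 rewrite <- !E. apply K. eapply Rlt_le_trans; [exact Hu|apply Rmin_r]. rewrite Rminus_diag, Rabs_R0; lra.
 eapply Rlt_le_trans; [exact Hu|apply Rmin_l].
Qed.
Lemma rcont_ext f g t : (forall u, f u = g u) -> rcont f t -> rcont g t.
Proof. intros E. apply rcont_ext_loc. exists 1; split; auto; lra. Qed.
Lemma rcont_opp f t : rcont f t -> rcont (fun u => - f u)%C t.
Proof. intros H. apply rcont_ext with (fun u => -1 * f u)%C. intros; ring. apply rcont_scal; auto. Qed.
Lemma rcont_minus f g t : rcont f t -> rcont g t -> rcont (fun u => f u - g u)%C t.
Proof. intros. apply rcont_plus; auto. apply rcont_opp; auto. Qed.
Lemma rcont_R (g : R -> R) t : continuous g t -> rcont (fun u => RtoC (g u)) t.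
Proof. intros. apply rcont_iff. split; auto. apply continuous_const. Qed.
Lemma rcont_comp_R (f : R -> C) (g : R -> R) t : rcont f (g t) -> continuous g t -> rcont (fun u => f (g u)) t.
Proof.
 rewrite !rcont_iff. intros [H1 H2] H. split. apply (continuous_comp g (fun x => Re (f x))); auto.
 apply (continuous_comp g (fun x => Im (f x))); auto.
Qed.

Lemma ccont_plus f g z : ccont f z -> ccont g z -> ccont (fun u => f u + g u)%C z.
Proof. apply tends_plus. Qed.
Lemma ccont_mult f g z : ccont f z -> ccont g z -> ccont (fun u => f u * g u)%C z.
Proof. apply tends_mult. Qed.

Lemma cdiff_eq (f : C -> C) (z l l' : C) : cdiff f z l -> l = l' -> cdiff f z l'.
Proof. intros H E. rewrite <- E; fin. Qed.
Lemma rdiff_eq (f : R -> C) t (l l' : C) : rdiff f t l -> l = l' -> rdiff f t l'.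
Proof. intros H E. rewrite <- E; fin. Qed.

Ltac cdd := lazymatch goal with
  | |- cdiff (fun w => w) _ _ => apply cdiff_id
  | |- cdiff (fun _ => ?c) _ _ => apply cdiff_const
  | |- cdiff (fun w => Cplus (@?f w) (@?g w)) _ _ => eapply (cdiff_plus f g); [cdd|cdd]
  | |- cdiff (fun w => Cminus (@?f w) (@?g w)) _ _ => eapply (cdiff_minus f g); [cdd|cdd]
  | |- cdiff (fun w => Copp (@?f w)) _ _ => eapply (cdiff_opp f); cdd
  | |- cdiff (fun w => Cmult (@?f w) (@?g w)) _ _ => eapply (cdiff_mult f g); [cdd|cdd]
  | |- cdiff (fun w => Cdiv (@?f w) (@?g w)) _ _ => eapply (cdiff_div f g); [ |cdd|cdd]
  | |- cdiff (fun w => Cpow w ?n) _ _ => eapply (cdiff_pow _ n)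
  | |- cdiff (fun w => Cpow (@?f w) ?n) _ _ => eapply (cdiff_comp (fun v => Cpow v n) f); [apply cdiff_pow|cdd]
  | |- _ => eauto
  end.

#[global] Hint Resolve rcont_const rcont_plus rcont_mult rcont_scal rcont_opp rcont_minus ccont_plus ccont_mult cdiff_const cdiff_id cdiff_plus cdiff_mult : cx.

(** * Integrals of complex functions over real intervals, and the complex exponential *)

Definition CI (f : R -> C) (a b : R) : C := RInt (V := C_R_CompleteNormedModule) f a b.
Definition is_CI (f : R -> C) (a b : R) (l : C) : Prop := is_RInt (V := C_R_NormedModule) f a b l.
Definition rcont_on (f : R -> C) (a b : R) : Prop := forall t, Rmin a b <= t <= Rmax a b -> rcont f t.

Lemma is_CI_iff f a b l : is_CI f a b l <->
  is_RInt (fun t => Re (f t)) a b (Re l) /\ is_RInt (fun t => Im (f t)) a b (Im l).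
Proof.
 split.
 - split. exact (is_RInt_fct_extend_fst f a b l H). exact (is_RInt_fct_extend_snd f a b l H).
 - intros [H1 H2]. destruct l as [l1 l2]. exact (is_RInt_fct_extend_pair f a b l1 l2 H1 H2).
Qed.

Lemma is_CI_unique f a b l : is_CI f a b l -> CI f a b = l.
Proof. apply (is_RInt_unique (V := C_R_CompleteNormedModule)). Qed.

Lemma is_CI_cont f a b : rcont_on f a b -> is_CI f a b (CI f a b).
Proof.
 intros H. assert (E1 : ex_RInt (fun t => Re (f t)) a b). { apply (ex_RInt_continuous (V := R_CompleteNormedModule)).
 intros z Hz. apply (proj1 (rcont_iff f z) (H z Hz)). } assert (E2 : ex_RInt (fun t => Im (f t)) a b). {
 apply (ex_RInt_continuous (V := R_CompleteNormedModule)). intros z Hz. apply (proj1 (rcont_iff f z) (H z Hz)). }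
 destruct E1 as [l1 E1], E2 as [l2 E2]. assert (K : is_CI f a b (l1, l2)) by (apply is_CI_iff; auto).
 rewrite (is_CI_unique _ _ _ _ K); fin.
Qed.

Lemma is_CI_ext f g a b l : (forall t, Rmin a b < t < Rmax a b -> f t = g t) -> is_CI f a b l -> is_CI g a b l.
Proof. intros H. apply is_RInt_ext. auto. Qed.

Lemma CI_ext f g a b : (forall t, Rmin a b < t < Rmax a b -> f t = g t) -> CI f a b = CI g a b.
Proof. intros H. apply (RInt_ext (V := C_R_CompleteNormedModule)). auto. Qed.

Lemma is_CI_plus f g a b l m : is_CI f a b l -> is_CI g a b m -> is_CI (fun t => f t + g t)%C a b (l + m)%C.
Proof.
 rewrite !is_CI_iff. intros [H1 H2] [H3 H4]. split.
 - apply (is_RInt_plus (fun t => Re (f t)) (fun t => Re (g t))); auto.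
 - apply (is_RInt_plus (fun t => Im (f t)) (fun t => Im (g t))); auto.
Qed.

Lemma is_CI_scal c f a b l : is_CI f a b l -> is_CI (fun t => c * f t)%C a b (c * l)%C.
Proof.
 rewrite !is_CI_iff. intros [H1 H2]. split.
 -
  apply (is_RInt_minus (V := R_NormedModule) (fun t => Re c * Re (f t)) (fun t => Im c * Im (f t))); apply (is_RInt_scal (V := R_NormedModule)); auto.
 -
  apply (is_RInt_plus (V := R_NormedModule) (fun t => Re c * Im (f t)) (fun t => Im c * Re (f t))); apply (is_RInt_scal (V := R_NormedModule)); auto.
Qed.

Lemma is_CI_minus f g a b l m : is_CI f a b l -> is_CI g a b m -> is_CI (fun t => f t - g t)%C a b (l - m)%C.
Proof.
 intros H1 H2. pose proof (is_CI_plus _ _ _ _ _ _ H1 (is_CI_scal (-1) _ _ _ _ H2)) as K.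
 replace (l - m)%C with (l + -1 * m)%C by ring. eapply is_CI_ext; [|exact K]. intros; simpl. ring.
Qed.

Lemma is_CI_const c a b : is_CI (fun _ => c) a b (RtoC (b - a) * c)%C.
Proof. pose proof (is_RInt_const (V := C_R_NormedModule) a b c) as K. rewrite scal_R_Cmult in K; fin. Qed.

Lemma CI_const c a b : CI (fun _ => c) a b = (RtoC (b - a) * c)%C.
Proof. apply is_CI_unique, is_CI_const. Qed.

Lemma CI_plus f g a b : rcont_on f a b -> rcont_on g a b -> CI (fun t => f t + g t)%C a b = (CI f a b + CI g a b)%C.
Proof. intros. apply is_CI_unique, is_CI_plus; apply is_CI_cont; auto. Qed.
Lemma CI_minus f g a b : rcont_on f a b -> rcont_on g a b -> CI (fun t => f t - g t)%C a b = (CI f a b - CI g a b)%C.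
Proof. intros. apply is_CI_unique, is_CI_minus; apply is_CI_cont; auto. Qed.
Lemma CI_scal c f a b : rcont_on f a b -> CI (fun t => c * f t)%C a b = (c * CI f a b)%C.
Proof. intros. apply is_CI_unique, is_CI_scal; apply is_CI_cont; auto. Qed.

Lemma is_CI_Chasles f a b c l m : is_CI f a b l -> is_CI f b c m -> is_CI f a c (l + m)%C.
Proof. apply (is_RInt_Chasles (V := C_R_NormedModule) f a b c l m); auto. Qed.

Lemma CI_point f a : CI f a a = 0.
Proof. apply is_CI_unique. apply (is_RInt_point (V := C_R_NormedModule)). Qed.

(** The product norm is the Euclidean one, which is why integrals are bounded in modulus without a
    factor [sqrt 2]. *)
Lemma C_R_norm (z : C) : norm (V := C_R_NormedModule) z = Cmod z.
Proof.
 unfold norm; simpl. unfold prod_norm, Cmod; simpl. rewrite !Rmult_1_r. rewrite <- !Rabs_mult.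
 rewrite !Rabs_pos_eq; auto; apply Rle_0_sqr.
Qed.

Lemma is_CI_bound f g a b l m : a <= b -> (forall t, a <= t <= b -> Cmod (f t) <= g t) ->
  is_CI f a b l -> is_RInt g a b m -> Cmod l <= m.
Proof.
 intros Hab H Hl Hm. rewrite <- C_R_norm. apply (norm_RInt_le (V := C_R_NormedModule) f g a b l m Hab); auto.
 intros x Hx. rewrite C_R_norm. auto.
Qed.

Lemma is_CI_bound_const f M a b l : a <= b -> (forall t, a <= t <= b -> Cmod (f t) <= M) ->
  is_CI f a b l -> Cmod l <= M * (b - a).
Proof.
 intros Hab H Hl. apply (is_CI_bound f (fun _ => M) a b); auto.
 pose proof (is_RInt_const (V := R_NormedModule) a b M) as K. rewrite Rmult_comm; fin.
Qed.

Lemma CI_bound f M a b : a <= b -> rcont_on f a b -> (forall t, a <= t <= b -> Cmod (f t) <= M) ->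
  Cmod (CI f a b) <= M * (b - a).
Proof. intros. eapply is_CI_bound_const; eauto. apply is_CI_cont; auto. Qed.

Lemma is_CI_FTC F f a b : (forall t, Rmin a b <= t <= Rmax a b -> rdiff F t (f t)) ->
  rcont_on f a b -> is_CI f a b (F b - F a)%C.
Proof.
 intros H C. apply is_CI_iff. split.
 - apply (is_RInt_derive (V := R_CompleteNormedModule) (fun t => Re (F t))).
  + intros x Hx. apply (proj1 (rdiff_iff _ _ _) (H x Hx)).
  + intros x Hx. apply (proj1 (rcont_iff _ _) (C x Hx)).
 - apply (is_RInt_derive (V := R_CompleteNormedModule) (fun t => Im (F t))).
  + intros x Hx. apply (proj1 (rdiff_iff _ _ _) (H x Hx)).
  + intros x Hx. apply (proj1 (rcont_iff _ _) (C x Hx)).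
Qed.

Lemma CI_FTC F f a b : (forall t, Rmin a b <= t <= Rmax a b -> rdiff F t (f t)) ->
  rcont_on f a b -> CI f a b = (F b - F a)%C.
Proof. intros. apply is_CI_unique, is_CI_FTC; auto. Qed.

Lemma CI_Chasles f a b c : a <= b <= c -> rcont_on f a c -> (CI f a b + CI f b c)%C = CI f a c.
Proof.
 intros H C. symmetry.
 apply is_CI_unique, is_CI_Chasles with b; apply is_CI_cont; intros t Ht; apply C; revert Ht; rewrite !Rmin_left, !Rmax_right by lra; lra.
Qed.

Lemma rcont_on_all f a b : (forall t, rcont f t) -> rcont_on f a b.
Proof. intros H t _. auto. Qed.

Lemma rcont_on_le f a b : a <= b -> (forall t, a <= t <= b -> rcont f t) -> rcont_on f a b.
Proof. intros Hab H t. rewrite Rmin_left, Rmax_right by lra. auto. Qed.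

Lemma is_CI_subst f (g dg : R -> R) a b :
  (forall x, Rmin a b <= x <= Rmax a b -> rcont f (g x)) ->
  (forall x, Rmin a b <= x <= Rmax a b -> is_derive g x (dg x) /\ continuous dg x) ->
  is_CI (fun y => RtoC (dg y) * f (g y))%C a b (CI f (g a) (g b)).
Proof.
 intros Hf Hg. eapply is_CI_ext; [| apply (is_RInt_comp (V := C_R_CompleteNormedModule) f g dg a b)].
 - intros t _. apply scal_R_Cmult.
 - intros x Hx. apply filterlim_locally. intros eps. destruct (Hf x Hx (eps) (cond_pos eps)) as [d [Hd K]].
  exists (mkposreal d Hd). intros u Hu. specialize (K u Hu). split.
  + apply Rle_lt_trans with (2 := K). apply Rle_trans with (2 := re_le_Cmod _). right; fin.
  + apply Rle_lt_trans with (2 := K). apply Rle_trans with (2 := im_le_Cmod _). right; fin.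
 - auto.
Qed.

Lemma cexp_plus z w : cexp (z + w) = (cexp z * cexp w)%C.
Proof.
 apply C_ext; destruct z as [a b], w as [c d]; unfold Cplus, Cmult, Re, Im; simpl; rewrite exp_plus.
 rewrite cos_plus; ring. rewrite sin_plus; ring.
Qed.

Lemma cexp_0 : cexp 0 = 1.
Proof. unfold cexp, RtoC; simpl. rewrite exp_0, cos_0, sin_0. f_equal; ring. Qed.

Lemma cexp_opp z : (cexp (- z) * cexp z = 1)%C.
Proof. rewrite <- cexp_plus, <- cexp_0. f_equal. ring. Qed.

Lemma Cmod_cexp z : Cmod (cexp z) = exp (Re z).
Proof.
 unfold Cmod; simpl. rewrite !Rmult_1_r.
 replace (exp (Re z) * cos (Im z) * (exp (Re z) * cos (Im z)) + exp (Re z) * sin (Im z) * (exp (Re z) * sin (Im z))) with (Rsqr (exp (Re z)) * (Rsqr (sin (Im z)) + Rsqr (cos (Im z)))) by (unfold Rsqr; ring).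
 rewrite sin2_cos2, Rmult_1_r. apply sqrt_Rsqr; fin.
Qed.

Lemma cexp_neq_0 z : cexp z <> 0.
Proof. apply Cmod_gt_0. rewrite Cmod_cexp; fin. Qed.

Lemma cexp_opp_inv z : cexp (- z) = (/ cexp z)%C.
Proof.
 rewrite <- (Cmult_1_r (cexp (-z))). rewrite <- (Cinv_r (cexp z)) at 1 by apply cexp_neq_0.
 rewrite Cmult_assoc, cexp_opp. ring.
Qed.

Lemma cexp_R x : cexp (RtoC x) = RtoC (exp x).
Proof. unfold cexp, RtoC; simpl. rewrite cos_0, sin_0. f_equal; ring. Qed.

Lemma cexp_conj z : cexp (Cconj z) = Cconj (cexp z).
Proof. unfold cexp, Cconj. unfold Re, Im; simpl. rewrite cos_neg, sin_neg. f_equal. ring. Qed.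

Lemma rdiff_cexp_line (z : C) t : rdiff (fun u => cexp (RtoC u * z)) t (z * cexp (RtoC t * z))%C.
Proof.
 apply rdiff_iff. destruct z as [a b]. simpl. split.
 - apply (is_derive_ext (fun x => exp (x * a) * cos (x * b))). { intros x. f_equal; f_equal; ring. } auto_derive; auto.
  replace (t * a - 0 * b) with (t * a) by ring. replace (t * b + 0 * a) with (t * b) by ring. ring.
 - apply (is_derive_ext (fun x => exp (x * a) * sin (x * b))). { intros x. f_equal; f_equal; ring. } auto_derive; auto.
  replace (t * a - 0 * b) with (t * a) by ring. replace (t * b + 0 * a) with (t * b) by ring. ring.
Qed.

Lemma Re_le_Cmod z : Re z <= Cmod z.
Proof. eapply Rle_trans; [apply Rle_abs|apply re_le_Cmod]. Qed.

(** [e^z - 1] is the integral of [z e^(tz)] over [0 <= t <= 1]. *)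
Lemma cexp_m1_bound z : Cmod (cexp z - 1) <= Cmod z * exp (Cmod z).
Proof.
 assert (H : is_CI (fun t => z * cexp (RtoC t * z))%C 0 1 (cexp (RtoC 1 * z) - cexp (RtoC 0 * z))%C). {
 apply (is_CI_FTC (fun u => cexp (RtoC u * z))).
 - intros; apply rdiff_cexp_line.
 - apply rcont_on_all. intros t. apply rcont_scal. eapply rdiff_rcont, rdiff_cexp_line. }
  replace (RtoC 1 * z)%C with z in H by ring. replace (RtoC 0 * z)%C with (RtoC 0) in H by ring. rewrite cexp_0 in H.
  replace (Cmod z * exp (Cmod z)) with (Cmod z * exp (Cmod z) * (1 - 0)) by ring.
  refine (is_CI_bound_const _ _ _ _ _ _ _ H); [lra|]. intros t Ht. rewrite Cmod_mult, Cmod_cexp. le_mul_l. pos.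
  apply exp_le. rewrite re_scal_l. pose proof (Re_le_Cmod z). pose proof (Cmod_ge_0 z). nra.
Qed.

(** The same integral with [z] subtracted from the integrand, to which the previous bound
    applies. *)
Lemma cexp_m1z_bound z : Cmod (cexp z - 1 - z) <= Cmod z ^ 2 * exp (Cmod z).
Proof.
 assert (H : is_CI (fun t => z * cexp (RtoC t * z) - z)%C 0 1 ((cexp (RtoC 1 * z) - cexp (RtoC 0 * z)) - RtoC (1 - 0) * z)%C).
 { apply is_CI_minus; [|apply is_CI_const]. apply (is_CI_FTC (fun u => cexp (RtoC u * z))).
 - intros; apply rdiff_cexp_line.
 - apply rcont_on_all. intros t. apply rcont_scal. eapply rdiff_rcont, rdiff_cexp_line. }
  replace (RtoC 1 * z)%C with z in H by ring. replace (RtoC 0 * z)%C with (RtoC 0) in H by ring. rewrite cexp_0 in H.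
  replace (RtoC (1 - 0) * z)%C with z in H by (rewrite Rminus_0_r; ring).
  replace (Cmod z ^ 2 * exp (Cmod z)) with (Cmod z ^ 2 * exp (Cmod z) * (1 - 0)) by ring.
  refine (is_CI_bound_const _ _ _ _ _ _ _ H); [lra|]. intros t Ht.
  replace (z * cexp (RtoC t * z) - z)%C with (z * (cexp (RtoC t * z) - 1))%C by ring. rewrite Cmod_mult. simpl.
  rewrite Rmult_assoc. le_mul_l. pos. le_trans cexp_m1_bound. rewrite Cmod_mult, Cmod_R, Rabs_pos_eq by lra.
  pose proof (Cmod_ge_0 z). apply Rmult_le_compat; try nra. pos. apply exp_le. nra.
Qed.

Lemma cdiff_cexp z : cdiff cexp z (cexp z).
Proof.
 intros eps He. pose proof (exp_pos (Re z)) as Hp. exists (Rmin 1 (eps / (exp (Re z) * exp 1))). split. { pos. }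
 intros w Hw. assert (A1 := Rlt_le_trans _ _ _ Hw (Rmin_l _ _)). assert (A2 := Rlt_le_trans _ _ _ Hw (Rmin_r _ _)).
 set (h := (w - z)%C) in *.
 replace (cexp w) with (cexp z * cexp h)%C by (rewrite <- cexp_plus; f_equal; unfold h; ring).
 replace (cexp z * cexp h - cexp z - cexp z * h)%C with (cexp z * (cexp h - 1 - h))%C by ring.
 rewrite Cmod_mult, Cmod_cexp. pose proof (cexp_m1z_bound h) as B. pose proof (Cmod_ge_0 h) as Hh.
 assert (B2 : exp (Cmod h) <= exp 1) by fin. le_via (exp (Re z) * (Cmod h ^ 2 * exp 1)). { le_mul_l; [lra|]. nra. }
 assert (B3 : Cmod h * (exp (Re z) * exp 1) <= eps). { apply Rmult_le_reg_r with (/ (exp (Re z) * exp 1)). pos.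
 rewrite Rmult_assoc, Rinv_r; fin. } nra.
Qed.

#[global] Hint Resolve rcont_on_all is_CI_cont rdiff_cexp_line cdiff_cexp : cx.

(** * Goursat's theorem on rectangles *)

(** Counterclockwise boundary integral. A corner and two side lengths describe the rectangle, so
    that quartering only halves the last two parameters. *)
Definition RI (f : C -> C) (x y w h : R) : C :=
  (CI (fun t => f (t, y)) x (x + w) + Ci * CI (fun t => f ((x + w)%R, t)) y (y + h)
   - CI (fun t => f (t, (y + h)%R)) x (x + w) - Ci * CI (fun t => f (x, t)) y (y + h))%C.

Definition in_rect (x y w h : R) (z : C) : Prop := x <= Re z <= x + w /\ y <= Im z <= y + h.

Lemma rdiff_horiz y t : rdiff (fun u => (u, y) : C) t 1.
Proof.
 apply rdiff_iff. simpl. split. apply (is_derive_id (K := R_AbsRing)).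
 apply (is_derive_const (K := R_AbsRing) (V := R_NormedModule)).
Qed.
Lemma rdiff_vert x t : rdiff (fun u => (x, u) : C) t Ci.
Proof.
 apply rdiff_iff. simpl. split. 2: apply (is_derive_id (K := R_AbsRing)).
 apply (is_derive_const (K := R_AbsRing) (V := R_NormedModule)).
Qed.
Lemma rcont_horiz f y t : ccont f (t, y) -> rcont (fun u => f (u, y)) t.
Proof. intros. apply (ccont_rcont f (fun u => (u, y))); auto. eapply rdiff_rcont, rdiff_horiz. Qed.
Lemma rcont_vert f x t : ccont f (x, t) -> rcont (fun u => f (x, u)) t.
Proof. intros. apply (ccont_rcont f (fun u => (x, u))); auto. eapply rdiff_rcont, rdiff_vert. Qed.

Section Rect.
Variables (x y w h : R).
Hypothesis (Hw : 0 <= w) (Hh : 0 <= h).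

Lemma rect_sides (f : C -> C) : (forall z, in_rect x y w h z -> ccont f z) ->
  rcont_on (fun t => f (t, y)) x (x + w) /\ rcont_on (fun t => f (t, y + h)) x (x + w) /\
  rcont_on (fun t => f (x + w, t)) y (y + h) /\ rcont_on (fun t => f (x, t)) y (y + h).
Proof.
 repeat split; apply rcont_on_le; try lra; intros t Ht; first [apply rcont_horiz | apply rcont_vert]; apply H; unfold in_rect, Re, Im; simpl; lra.
Qed.

Lemma RI_primitive (F f : C -> C) : (forall z, in_rect x y w h z -> cdiff F z (f z) /\ ccont f z) ->
  RI f x y w h = 0.
Proof.
 intros H. destruct (rect_sides f (fun z Hz => proj2 (H z Hz))) as [S1 [S2 [S3 S4]]]. unfold RI.
 assert (Hor : forall y', y <= y' <= y + h -> rcont_on (fun t => f (t, y')) x (x + w) -> CI (fun t => f (t, y')) x (x + w) = (F ((x + w)%R, y') - F (x, y'))%C).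
 { intros y' Hy' Hc. apply (CI_FTC (fun t => F (t, y'))); auto. intros t. rewrite Rmin_left, Rmax_right by lra.
 intros Ht. replace (f (t, y')) with (f (t, y') * 1)%C by ring. apply cdiff_rdiff. apply H.
 unfold in_rect, Im; simpl; lra. apply rdiff_horiz. }
 assert (Ver : forall x', x <= x' <= x + w -> rcont_on (fun t => f (x', t)) y (y + h) -> (Ci * CI (fun t => f (x', t)) y (y + h))%C = (F (x', (y + h)%R) - F (x', y))%C).
 { intros x' Hx' Hc. rewrite <- CI_scal by auto. apply (CI_FTC (fun t => F (x', t))); auto.
 2: intros t Ht; apply rcont_scal; auto. intros t. rewrite Rmin_left, Rmax_right by lra. intros Ht. rewrite Cmult_comm.
 apply cdiff_rdiff. apply H. unfold in_rect, Im; simpl; lra. apply rdiff_vert. } rewrite Hor, Hor, Ver, Ver by pos.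
 ring.
Qed.

Lemma RI_minus (f g : C -> C) : (forall z, in_rect x y w h z -> ccont f z) -> (forall z, in_rect x y w h z -> ccont g z) ->
  RI (fun z => f z - g z)%C x y w h = (RI f x y w h - RI g x y w h)%C.
Proof.
 intros H1 H2. destruct (rect_sides f H1) as [S1 [S2 [S3 S4]]]. destruct (rect_sides g H2) as [T1 [T2 [T3 T4]]].
 unfold RI. rewrite !CI_minus by auto. ring.
Qed.

Lemma RI_bound (f : C -> C) M : (forall z, in_rect x y w h z -> ccont f z) ->
  (forall z, in_rect x y w h z -> Cmod (f z) <= M) -> Cmod (RI f x y w h) <= M * (2 * (w + h)).
Proof.
 intros H1 H2. destruct (rect_sides f H1) as [S1 [S2 [S3 S4]]].
 assert (B : forall (g : R -> C) a l, 0 <= l -> rcont_on g a (a + l) -> (forall t, a <= t <= a + l -> Cmod (g t) <= M) -> Cmod (CI g a (a + l)) <= M * l).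
 { intros g a l Hl Hg Hb. replace (M * l) with (M * (a + l - a)) by ring. apply CI_bound; auto; lra. }
 pose proof (B _ x w Hw S1) as B1. pose proof (B _ x w Hw S2) as B2. pose proof (B _ y h Hh S3) as B3.
 pose proof (B _ y h Hh S4) as B4.
 do 4 match goal with I : (forall t, _ -> _) -> _ |- _ => specialize (I ltac:(intros; apply H2; unfold in_rect, Re, Im; simpl; lra)) end.
 le_trans Cmod_minus_le. eapply Rle_trans. apply Rplus_le_compat_r, Cmod_minus_le. eapply Rle_trans.
 apply Rplus_le_compat_r, Rplus_le_compat_r, Cmod_triangle. rewrite !Cmod_mult, !Cmod_Ci. lra.
Qed.

Lemma RI_quarter (f : C -> C) : (forall z, in_rect x y w h z -> ccont f z) ->
  RI f x y w h = (RI f x y (w/2)%R (h/2)%R + RI f (x + w/2)%R y (w/2)%R (h/2)%R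
     + RI f x (y + h/2)%R (w/2)%R (h/2)%R + RI f (x + w/2)%R (y + h/2)%R (w/2)%R (h/2)%R)%C.
Proof.
 intros H. unfold RI. replace (x + w/2 + w/2) with (x + w) by field. replace (y + h/2 + h/2) with (y + h) by field.
 assert (Hor : forall y', y <= y' <= y + h -> (CI (fun t => f (t, y')) x (x + w/2)%R + CI (fun t => f (t, y')) (x + w/2)%R (x + w)%R = CI (fun t => f (t, y')) x (x + w)%R)%C).
 { intros y' Hy'. apply CI_Chasles. lra. apply rcont_on_le. lra. intros t Ht. apply rcont_horiz, H.
 unfold in_rect, Im; simpl; lra. }
 assert (Ver : forall x', x <= x' <= x + w -> (CI (fun t => f (x', t)) y (y + h/2)%R + CI (fun t => f (x', t)) (y + h/2)%R (y + h)%R = CI (fun t => f (x', t)) y (y + h)%R)%C).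
 { intros y' Hy'. apply CI_Chasles. lra. apply rcont_on_le. lra. intros t Ht. apply rcont_vert, H.
 unfold in_rect, Im; simpl; lra. } rewrite <- (Hor y), <- (Hor (y + h)), <- (Ver x), <- (Ver (x + w)) by lra. ring.
Qed.
End Rect.

Section Goursat.
Variables (f : C -> C) (x0 y0 w h : R).
Hypothesis (Hw : 0 <= w) (Hh : 0 <= h).
Hypothesis Hf : forall z, in_rect x0 y0 w h z -> exists l, cdiff f z l.

Let wn (n : nat) := w / 2 ^ n.
Let hn (n : nat) := h / 2 ^ n.

Lemma pow2_pos n : 0 < 2 ^ n. Proof. pos. Qed.

(** Quartering divides both sides of the inequality by 4, so a violation is inherited by one of the
    quarters. At the common point of the nested rectangles [f] is close to an affine function, which
    has a primitive and contributes nothing. *)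
Lemma goursat_bound eps : 0 < eps -> Cmod (RI f x0 y0 w h) <= eps * (w + h) ^ 2.
Proof.
 intros He. apply Rnot_lt_le. intros Hbad.
 set (bad := fun n (p : R * R) => eps * (wn n + hn n) ^ 2 < Cmod (RI f (fst p) (snd p) (wn n) (hn n)) /\ x0 <= fst p /\ fst p + wn n <= x0 + w /\ y0 <= snd p /\ snd p + hn n <= y0 + h).
 assert (W0 : forall n, 0 <= wn n). { intros n. unfold wn; fin. } assert (H0 : forall n, 0 <= hn n). { intros n.
 unfold hn; fin. } assert (WS : forall n, wn (S n) = wn n / 2). { intros n. unfold wn. simpl. field; pos. }
 assert (HS : forall n, hn (S n) = hn n / 2). { intros n. unfold hn. simpl. field; pos. }
 assert (Hcont : forall z, in_rect x0 y0 w h z -> ccont f z). { intros z Hz. destruct (Hf z Hz) as [l Hl].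
 eapply cdiff_ccont; eauto. }
 set (sub := fun n (p p' : R * R) => fst p <= fst p' /\ fst p' + wn (S n) <= fst p + wn n /\ snd p <= snd p' /\ snd p' + hn (S n) <= snd p + hn n).
 assert (Step : forall n p, bad n p -> exists p', bad (S n) p' /\ sub n p p'). { intros n [px py] [B [B1 [B2 [B3 B4]]]].
 simpl in *. apply NNPP. intros Hno.
 assert (Q : forall p', px <= fst p' -> fst p' + wn (S n) <= px + wn n -> py <= snd p' -> snd p' + hn (S n) <= py + hn n -> Cmod (RI f (fst p') (snd p') (wn (S n)) (hn (S n))) <= eps * (wn (S n) + hn (S n)) ^ 2).
 { intros p' C1 C2 C3 C4. apply Rnot_lt_le. intros Hlt. apply Hno. exists p'. unfold bad, sub; fin. }
 rewrite WS, HS in Q. pose proof (W0 n). pose proof (H0 n). pose proof (Q (px, py)) as Q1.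
 pose proof (Q (px + wn n / 2, py)) as Q2. pose proof (Q (px, py + hn n / 2)) as Q3.
 pose proof (Q (px + wn n / 2, py + hn n / 2)) as Q4. simpl in Q1, Q2, Q3, Q4. rewrite RI_quarter in B; auto. 2:{
 intros z [Z1 Z2]. apply Hcont. unfold in_rect. lra. }
 match type of B with _ < Cmod (?a + ?b + ?c + ?d) => pose proof (Cmod_triangle (a + b + c) d); pose proof (Cmod_triangle (a + b) c); pose proof (Cmod_triangle a b) end; fin.
 } set (next := fun n p => epsilon (inhabits p) (fun p' => bad (S n) p' /\ sub n p p')).
 set (s := fix s n := match n with O => (x0, y0) | S m => next m (s m) end). assert (Sb : forall n, bad n (s n)). {
 induction n.
 - unfold bad, wn, hn; simpl. replace (w / 1) with w by field. replace (h / 1) with h by field; fin.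
 - apply (epsilon_spec (inhabits (s n)) _ (Step n (s n) IHn)). } assert (Sn : forall n, sub n (s n) (s (S n))). {
  intros n. apply (epsilon_spec (inhabits (s n)) _ (Step n (s n) (Sb n))). }
  (* Nested intervals, with left ends [u] and lengths [v]. *)
  assert (Lim : forall (u v : nat -> R), (forall n, u n <= u (S n)) -> (forall n, u (S n) + v (S n) <= u n + v n) -> (forall n, 0 <= v n) -> exists X, forall n, u n <= X <= u n + v n).
  { intros u v U V Vp. assert (Up : forall n k, u k <= u n + v n). { intros n k.
  destruct (Nat.le_ge_cases n k) as [L|L].
 - pose proof (decreasing_prop (fun n => u n + v n) n k V L). specialize (Vp k). lra.
 - pose proof (tech9 u U k n L). specialize (Vp n). lra. }
  destruct (completeness (fun r => exists n, r = u n)) as [X [X1 X2]].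
 - exists (u 0%nat + v 0%nat). intros r [n Hn]. subst; fin.
 - exists (u 0%nat); fin.
 - exists X. split. fin. apply X2. intros r [k Hk]. subst; fin. }
  destruct (Lim (fun n => fst (s n)) wn) as [X HX]; auto. { apply Sn. } { apply Sn. }
  destruct (Lim (fun n => snd (s n)) hn) as [Y HY]; auto. { apply Sn. } { apply Sn. }
  assert (HZ : in_rect x0 y0 w h (X, Y)). { specialize (HX 0%nat). specialize (HY 0%nat). unfold wn, hn in *.
  simpl in HX, HY. unfold in_rect, Im; simpl; fin. } destruct (Hf _ HZ) as [l Hl].
  destruct (Hl (eps / 2) ltac:(lra)) as [d [Hd K]]. assert (Ex : exists n, wn n + hn n < d). {
  destruct (Pow_x_infinity 2 ltac:(rewrite Rabs_pos_eq; lra) ((w + h) / d + 1)) as [N HN]. exists N.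
  specialize (HN N ltac:(lia)). rewrite Rabs_pos_eq in HN by fin. unfold wn, hn. pose proof (pow2_pos N).
  assert (w + h < d * 2 ^ N). { apply Rlt_le_trans with (d * ((w + h) / d + 1)). field_simplify; lra. fin. }
  replace (w / 2 ^ N + h / 2 ^ N) with ((w + h) / 2 ^ N) by pos. apply Rmult_lt_reg_r with (2 ^ N); auto. unfold Rdiv.
  rewrite Rmult_assoc, Rinv_l by lra. lra. } destruct Ex as [n Hn]. destruct (Sb n) as [B [B1 [B2 [B3 B4]]]].
  set (px := fst (s n)) in *. set (py := snd (s n)) in *. specialize (HX n). specialize (HY n). fold px in HX.
  fold py in HY. specialize (W0 n). specialize (H0 n). set (g := fun z : C => (f (X, Y) + l * (z - (X, Y)))%C).
  assert (Hg : forall z, cdiff g z l). { intros z. unfold g. eapply cdiff_eq. cdd. ring. }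
  assert (Cg : forall z, ccont g z) by (intros z; eapply cdiff_ccont, Hg).
  assert (Cf : forall z, in_rect px py (wn n) (hn n) z -> ccont f z). { intros z [Z1 Z2]. apply Hcont. unfold in_rect.
  lra. } assert (Eg : RI g px py (wn n) (hn n) = 0). {
  apply (RI_primitive _ _ _ _ W0 H0 (fun z => (f (X, Y) * z + l * ((z - (X,Y)) * (z - (X,Y)) * / 2))%C)). split; auto.
  unfold g. eapply cdiff_eq. cdd. field. }
  (* Half the perimeter bounds the distance to [(X, Y)], and the perimeter is twice that; so the
     derivative is used with [eps / 2]. *)
  assert (Bd : Cmod (RI (fun z => f z - g z)%C px py (wn n) (hn n)) <= (eps / 2 * (wn n + hn n)) * (2 * (wn n + hn n))).
  { apply RI_bound; auto.
 - intros z Hz. apply ccont_plus; auto. intros e Hee. destruct (Cg z e Hee) as [dd [Hdd Kd]]. exists dd; split; auto.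
  intros v Hv. replace (- g v - - g z)%C with (- (g v - g z))%C by ring. rewrite Cmod_opp. auto.
 - intros z [Z1 Z2]. assert (D : Cmod (z - (X, Y)) <= wn n + hn n). { le_trans Cmod_le_abs.
  unfold Cplus, Re, Im in *; simpl in *. apply Rplus_le_compat; apply Rabs_le; lra. } unfold g.
  replace (f z - (f (X, Y) + l * (z - (X, Y))))%C with (f z - f (X,Y) - l * (z - (X,Y)))%C by ring. le_trans K. lra.
  fin. } rewrite RI_minus in Bd; auto. rewrite Eg in Bd.
  replace (RI f px py (wn n) (hn n) - 0)%C with (RI f px py (wn n) (hn n)) in Bd by ring; fin.
Qed.

Lemma goursat : RI f x0 y0 w h = 0.
Proof.
 apply Cmod_zero_iff. apply le_epsilon. intros e He. assert (0 < (w + h) ^ 2 + 1) by pos.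
 pose proof (goursat_bound (e / ((w + h) ^ 2 + 1)) ltac:(pos)) as B. eapply Rle_trans. exact B.
 apply Rmult_le_reg_r with ((w + h) ^ 2 + 1); auto.
 replace (e / ((w + h) ^ 2 + 1) * (w + h) ^ 2 * ((w + h) ^ 2 + 1)) with (e * (w + h) ^ 2) by (field; lra). nra.
Qed.
End Goursat.

(** * Means over circles and Cauchy's formula *)

Definition circ (r t : R) : C := (RtoC r * cexp (RtoC t * Ci))%C.
(** Up to the factor [i] this is the contour integral of [f(z)/z]. *)
Definition MV (f : C -> C) (r : R) : C := CI (fun t => f (circ r t)) 0 (2 * PI).
Lemma PI2_pos : 0 < 2 * PI. Proof. pos. Qed.

Lemma Cmod_circ r t : 0 <= r -> Cmod (circ r t) = r.
Proof.
 intros. unfold circ. rewrite Cmod_mult, Cmod_R, Rabs_pos_eq, Cmod_cexp by auto.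
 replace (Re (RtoC t * Ci)) with 0 by (simpl; ring). rewrite exp_0. ring.
Qed.

Lemma rdiff_circ r t : rdiff (circ r) t (Ci * circ r t)%C.
Proof. unfold circ. eapply rdiff_eq. apply rdiff_scal, rdiff_cexp_line. ring. Qed.

Lemma rcont_circ f r t : ccont f (circ r t) -> rcont (fun u => f (circ r u)) t.
Proof. intros. apply (ccont_rcont f (circ r)); auto. eapply rdiff_rcont, rdiff_circ. Qed.

Lemma circ_cexp a t : cexp (a, t) = circ (exp a) t.
Proof. replace ((a, t) : C) with (RtoC a + RtoC t * Ci)%C by (apply C_ext; simpl; ring). rewrite cexp_plus, cexp_R; fin. Qed.

Lemma circ_2PI r : circ r (2 * PI) = circ r 0.
Proof.
 unfold circ. unfold cexp; simpl. replace (2 * PI * 0 - 0 * 1) with 0 by ring.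
 replace (2 * PI * 1 + 0 * 0) with (2 * PI) by ring. replace (0 * 0 - 0 * 1) with 0 by ring.
 replace (0 * 1 + 0 * 0) with 0 by ring. rewrite cos_2PI, sin_2PI, cos_0, sin_0; fin.
Qed.

(** Pulled back by [cexp] the annulus becomes a rectangle of height [2 PI]. Its horizontal sides
    cancel by periodicity and its vertical sides are the two means. *)
Lemma MV_annulus f r1 r2 : 0 < r1 <= r2 -> (forall z, r1 <= Cmod z <= r2 -> exists l, cdiff f z l) -> MV f r1 = MV f r2.
Proof.
 intros Hr Hf. assert (L : ln r1 <= ln r2) by fin. set (F := fun w => f (cexp w)).
 assert (G : RI F (ln r1) 0 (ln r2 - ln r1) (2 * PI) = 0). { apply goursat. lra. pose proof PI2_pos; lra.
 intros z [Z1 Z2]. destruct (Hf (cexp z)) as [l Hl].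
 - rewrite Cmod_cexp. split.
  + rewrite <- (exp_ln r1) by lra; fin.
  + rewrite <- (exp_ln r2) by lra; fin.
 - exists (l * cexp z)%C. apply (cdiff_comp f cexp); auto; fin. } unfold RI in G. rewrite Rplus_0_l in G.
  replace (ln r1 + (ln r2 - ln r1)) with (ln r2) in G by ring.
  assert (E1 : (fun t => F (t, 2 * PI)) = (fun t => F (t, 0))). { apply functional_extensionality. intros t. unfold F.
  rewrite !circ_cexp, circ_2PI; fin. } rewrite E1 in G.
  assert (E2 : forall r, 0 < r -> (fun t => F (ln r, t)) = (fun t => f (circ r t))). { intros r Hr0.
  apply functional_extensionality. intros t. unfold F. rewrite circ_cexp, exp_ln by auto; fin. }
  rewrite !E2 in G by lra. fold (MV f r1) in G. fold (MV f r2) in G. assert (K : (Ci * MV f r2 = Ci * MV f r1)%C). {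
  apply Ceq_minus. rewrite <- G. ring. }
  rewrite <- (Cmult_1_l (MV f r1)), <- (Cmult_1_l (MV f r2)), <- (Cinv_l Ci) by apply Ci_nz.
  rewrite <- !Cmult_assoc, K; fin.
Qed.

(** Compactness of [[a, b]]. The factor 2 arises because both values are compared with the one at
    the node of a covering interval. *)
Lemma compact_unif (g : R -> R -> C) (r0 a b eps : R) :
  (forall t, a <= t <= b -> exists d, 0 < d /\ forall r t', Rabs (r - r0) < d -> Rabs (t' - t) < d -> Cmod (g r t' - g r0 t) < eps) ->
  exists d, 0 < d /\ forall r t, Rabs (r - r0) < d -> a <= t <= b -> Cmod (g r t - g r0 t) < 2 * eps.
Proof.
 intros H.
 assert (H' : forall t, exists d : posreal, a <= t <= b -> forall r t', Rabs (r - r0) < d -> Rabs (t' - t) < d -> Cmod (g r t' - g r0 t) < eps).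
 { intros t. destruct (classic (a <= t <= b)) as [Ht|Ht].
 - destruct (H t Ht) as [d [Hd K]]. exists (mkposreal d Hd). auto.
 - exists (mkposreal 1 Rlt_0_1). tauto. }
  set (delta := fun t => proj1_sig (constructive_indefinite_description _ (H' t))).
  assert (Hdel : forall t, a <= t <= b -> forall r t', Rabs (r - r0) < delta t -> Rabs (t' - t) < delta t -> Cmod (g r t' - g r0 t) < eps).
  { intros t. apply proj2_sig. } destruct (compactness_value_1d a b delta) as [d Hd]. exists d. split. apply cond_pos.
  intros r t Hr Ht. specialize (Hd t Ht). apply NNPP in Hd. destruct Hd as [t0 [T0 [T1 T2]]].
  assert (A1 := Hdel t0 T0 r t ltac:(lra) T1).
  assert (A2 := Hdel t0 T0 r0 t ltac:(rewrite Rminus_diag, Rabs_R0; apply cond_pos) T1).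
  replace (g r t - g r0 t)%C with ((g r t - g r0 t0) - (g r0 t - g r0 t0))%C by ring. eapply Rle_lt_trans.
  apply Cmod_minus_le. lra.
Qed.

Lemma circ_cont2 r0 t0 eps : 0 < eps -> exists d, 0 < d /\ forall r t, Rabs (r - r0) < d -> Rabs (t - t0) < d ->
  Cmod (circ r t - circ r0 t0) < eps.
Proof.
 intros He. destruct (rdiff_rcont _ _ _ (rdiff_circ r0 t0) (eps / 2) ltac:(lra)) as [d [Hd K]].
 exists (Rmin d (eps / 2)). split. pos. intros r t H1 H2.
 replace (circ r t - circ r0 t0)%C with ((circ r t - circ r0 t) + (circ r0 t - circ r0 t0))%C by ring.
 eapply Rle_lt_trans. apply Cmod_triangle. assert (A : Cmod (circ r t - circ r0 t) = Rabs (r - r0)). {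
 replace (circ r t - circ r0 t)%C with (RtoC (r - r0) * circ 1 t)%C by (unfold circ; rewrite RtoC_minus; ring).
 rewrite Cmod_mult, Cmod_R, Cmod_circ by lra. ring. } assert (B := Rlt_le_trans _ _ _ H1 (Rmin_r _ _)).
 specialize (K t (Rlt_le_trans _ _ _ H2 (Rmin_l _ _))). lra.
Qed.

Lemma MV_cont f r0 : 0 < r0 -> (exists d, 0 < d /\ forall z, r0 - d < Cmod z < r0 + d -> ccont f z) ->
  forall eps, 0 < eps -> exists d, 0 < d /\ forall r, Rabs (r - r0) < d -> Cmod (MV f r - MV f r0) <= eps.
Proof.
 intros Hr0 [d0 [Hd0 Hf]] eps He. pose proof PI2_pos. set (e := eps / (2 * PI)).
 assert (0 < e) by (apply Rdiv_lt_0_compat; lra).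
 destruct (compact_unif (fun r t => f (circ r t)) r0 0 (2 * PI) (e / 2)) as [d [Hd K]].
 - intros t Ht. destruct (Hf (circ r0 t)) with (eps := e / 2) as [d1 [Hd1 K1]]; [rewrite Cmod_circ; lra|lra|].
  destruct (circ_cont2 r0 t d1 Hd1) as [d2 [Hd2 K2]]; fin.
 - exists (Rmin d (Rmin d0 r0)). split. pos. intros r Hr. assert (A1 := Rlt_le_trans _ _ _ Hr (Rmin_l _ _)).
  assert (A0 := Rlt_le_trans _ _ _ Hr (Rmin_r _ _)). assert (A2 := Rlt_le_trans _ _ _ A0 (Rmin_l _ _)).
  assert (A3 := Rlt_le_trans _ _ _ A0 (Rmin_r _ _)). apply Rabs_def2 in A2. apply Rabs_def2 in A3.
  assert (C1 : forall r', r0 - d0 < r' < r0 + d0 -> 0 < r' -> rcont_on (fun t => f (circ r' t)) 0 (2 * PI)). {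
  intros r' Hr' Hp. apply rcont_on_all. intros t. apply rcont_circ, Hf. rewrite Cmod_circ; lra. } unfold MV.
  rewrite <- CI_minus by (apply C1; lra).
  replace eps with (2 * (e / 2) * (2 * PI - 0)) by (unfold e; field; pose proof PI_RGT_0; lra). apply CI_bound. lra.
  + intros t Ht. apply rcont_minus; apply C1; lra.
  + left; fin.
Qed.

(** The mean does not change when the circle shrinks, and on small circles continuity at 0 evaluates
    it. *)
Lemma MV_mean f r R : 0 < r < R -> (forall z, 0 < Cmod z < R -> exists l, cdiff f z l) -> ccont f 0 ->
  MV f r = (RtoC (2 * PI) * f 0)%C.
Proof.
 intros Hr Hf H0. pose proof PI2_pos. apply Ceq_small. intros eps He. set (e := eps / (2 * PI)).
 assert (He' : 0 < e) by (apply Rdiv_lt_0_compat; lra). destruct (H0 e He') as [d [Hd K]]. set (s := Rmin r (d / 2)).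
 assert (Hs : 0 < s) by (apply Rmin_pos; lra). assert (s <= r) by apply Rmin_l. assert (s <= d / 2) by apply Rmin_r.
 rewrite <- (MV_annulus f s r). 2: lra. 2: intros z Hz; apply Hf; lra.
 assert (C1 : rcont_on (fun t => f (circ s t)) 0 (2 * PI)). { apply rcont_on_all. intros t. apply rcont_circ.
 destruct (Hf (circ s t)) as [l Hl]. rewrite Cmod_circ; lra. eapply cdiff_ccont; eauto. }
 assert (C2 : is_CI (fun t => f (circ s t) - f 0)%C 0 (2 * PI) (MV f s - RtoC (2 * PI) * f 0)%C). { apply is_CI_minus.
 fin. replace (2 * PI) with (2 * PI - 0) at 2 by ring. apply is_CI_const. }
 replace eps with (e * (2 * PI - 0)) by (unfold e; field; pose proof PI_RGT_0; lra).
 refine (is_CI_bound_const _ _ _ _ _ _ _ C2). lra. left. apply K. replace (circ s t - 0)%C with (circ s t) by ring.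
 rewrite Cmod_circ; lra.
Qed.

(* The exceptional circle is crossed by continuity of the circle means. *)
Lemma MV_mean_exc f r R rho : 0 < r < R -> (forall z, Cmod z < R -> ccont f z) ->
  (forall z, 0 < Cmod z < R -> Cmod z <> rho -> exists l, cdiff f z l) ->
  MV f r = (RtoC (2 * PI) * f 0)%C.
Proof.
 intros Hr Hc Hf. assert (C0 : ccont f 0) by (apply Hc; rewrite Cmod_0; lra). destruct (Rle_lt_dec rho 0) as [Hn|Hp]. {
 apply MV_mean with R; auto. intros z Hz. apply Hf; lra. }
 assert (A : forall s, 0 < s < rho -> s < R -> MV f s = (RtoC (2 * PI) * f 0)%C). { intros s Hs HsR.
 apply MV_mean with (Rmin R rho); auto. split; try lra. apply Rmin_glb_lt; lra. intros z Hz.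
 assert (A1 := Rmin_l R rho). assert (A2 := Rmin_r R rho). apply Hf; lra. }
 assert (B : rho < R -> MV f rho = (RtoC (2 * PI) * f 0)%C). { intros HR. apply Ceq_small. intros eps He.
 destruct (MV_cont f rho Hp) with (eps := eps) as [d [Hd K]]; auto. { exists (R - rho). split. lra. intros z Hz.
 apply Hc. lra. } set (s := rho - Rmin d rho / 2). assert (0 < Rmin d rho) by pos. pose proof (Rmin_l d rho).
 pose proof (Rmin_r d rho). rewrite <- (A s) by (unfold s; lra). rewrite Cmod_minus_sym. apply K. unfold s.
 replace (rho - Rmin d rho / 2 - rho) with (- (Rmin d rho / 2)) by ring. rewrite Rabs_Ropp, Rabs_pos_eq; lra. }
 destruct (Rtotal_order r rho) as [L|[E|G]].
 - apply A; lra.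
 - subst. tauto.
 - rewrite <- (B ltac:(lra)). apply Ceq_small. intros eps He.
  destruct (MV_cont f rho Hp) with (eps := eps) as [d [Hd K]]; auto. { exists (R - rho). split. lra. intros z Hz.
  apply Hc. lra. } set (s := rho + Rmin d (r - rho) / 2). assert (0 < Rmin d (r - rho)) by pos.
  pose proof (Rmin_l d (r-rho)). pose proof (Rmin_r d (r-rho)). rewrite <- (MV_annulus f s r). 2: unfold s; lra. 2:{
  unfold s; intros z Hz; apply Hf; lra. } apply K. unfold s. rewrite Rabs_pos_eq; lra.
Qed.

Lemma Cpow_neq_0 (z : C) n : z <> RtoC 0 -> (z ^ n)%C <> RtoC 0.
Proof. apply Cpow_nz. Qed.

Lemma circ_neq_0 r t : 0 < r -> circ r t <> RtoC 0.
Proof. intros. apply Cmod_gt_0. rewrite Cmod_circ; lra. Qed.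

Lemma MV_plus f g r : (forall t, rcont (fun t => f (circ r t)) t) -> (forall t, rcont (fun t => g (circ r t)) t) ->
  MV (fun z => f z + g z)%C r = (MV f r + MV g r)%C.
Proof. intros. apply (CI_plus (fun t => f (circ r t)) (fun t => g (circ r t))); apply rcont_on_all; auto. Qed.
Lemma MV_scal c f r : (forall t, rcont (fun t => f (circ r t)) t) -> MV (fun z => c * f z)%C r = (c * MV f r)%C.
Proof. intros. apply (CI_scal c (fun t => f (circ r t))); apply rcont_on_all; auto. Qed.
Lemma MV_ext f g r : (forall t, f (circ r t) = g (circ r t)) -> MV f r = MV g r.
Proof. intros. apply CI_ext. auto. Qed.
Lemma MV_bound f M r : (forall t, rcont (fun t => f (circ r t)) t) -> (forall t, 0 <= t <= 2 * PI -> Cmod (f (circ r t)) <= M) ->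
  Cmod (MV f r) <= M * (2 * PI).
Proof. intros. pose proof PI2_pos. replace (2 * PI) with (2 * PI - 0) by ring. apply (CI_bound (fun t => f (circ r t))); fin. Qed.

Lemma rcont_inv f t : rcont f t -> f t <> RtoC 0 -> rcont (fun t => / f t)%C t.
Proof. intros H N. apply (ccont_rcont (fun z => / z)%C f); auto. eapply cdiff_ccont, cdiff_inv, N. Qed.
Lemma rcont_div f g t : rcont f t -> rcont g t -> g t <> RtoC 0 -> rcont (fun t => f t / g t)%C t.
Proof. intros. apply rcont_mult; auto. apply rcont_inv; auto. Qed.
Lemma rcont_pow f t n : rcont f t -> rcont (fun t => f t ^ n)%C t.
Proof. induction n; simpl; fin. Qed.
Lemma rcont_circ_id r t : rcont (circ r) t.
Proof. eapply rdiff_rcont, rdiff_circ. Qed.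
#[global] Hint Resolve rcont_inv rcont_div rcont_pow rcont_circ_id Cpow_neq_0 circ_neq_0 : cx.

Lemma rcont_bounded f a b : a <= b -> (forall t, a <= t <= b -> rcont f t) -> exists M, 0 <= M /\ forall t, a <= t <= b -> Cmod (f t) <= M.
Proof.
 intros Hab H. assert (Hc : forall t, a <= t <= b -> continuity_pt (fun t => Cmod (f t)) t). { intros t Ht.
 apply continuity_pt_filterlim. apply filterlim_locally. intros e. destruct (H t Ht e (cond_pos e)) as [d [Hd K1]].
 exists (mkposreal d Hd). intros u Hu. specialize (K1 u Hu). apply Rle_lt_trans with (2 := K1).
 unfold minus, plus, opp; simpl. apply Rabs_le. pose proof (Cmod_triangle_inv (f u) (f t)).
 pose proof (Cmod_triangle_inv (f t) (f u)). rewrite (Cmod_minus_sym (f t)) in H1; fin. }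
 destruct (continuity_ab_maj _ a b Hab Hc) as [t0 [Ht0 _]]. exists (Cmod (f t0)); fin.
Qed.

Lemma rcont_csum n (F : nat -> R -> C) t : (forall j, (j < n)%nat -> rcont (F j) t) -> rcont (fun u => csum n (fun j => F j u)) t.
Proof. induction n; intros H; simpl. fin. apply rcont_plus; fin. Qed.

Lemma MV_csum n (F : nat -> C -> C) r : (forall j t, (j < n)%nat -> rcont (fun t => F j (circ r t)) t) ->
  MV (fun z => csum n (fun j => F j z)) r = csum n (fun j => MV (F j) r).
Proof.
 induction n; intros H; simpl.
 - unfold MV. rewrite CI_const. ring.
 - rewrite <- IHn by fin. apply MV_plus.
  + intros t. apply (rcont_csum n (fun j t => F j (circ r t))); fin.
  + auto.
Qed.

(** Doubling the radius leaves the mean unchanged by [MV_annulus], yet multiplies it by [2^(-n)] by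
    homogeneity. *)
Lemma MV_inv_pow r n : 0 < r -> (0 < n)%nat -> MV (fun z => / (z ^ n))%C r = 0.
Proof.
 intros Hr Hn. set (q := (/ (RtoC 2 ^ n))%C). assert (Nq : RtoC 2 <> RtoC 0) by pos.
 assert (E : MV (fun z => / (z ^ n))%C r = (q * MV (fun z => / (z ^ n))%C r)%C). { rewrite <- MV_scal by fin.
 rewrite (MV_annulus _ r (2 * r)).
 - apply CI_ext. intros t _. unfold q, circ. rewrite RtoC_mult. rewrite !Cpow_mult_l. field.
  repeat split; apply Cpow_neq_0; auto. apply cexp_neq_0. pos.
 - lra.
 - eexists. apply cdiff_comp. apply cdiff_inv, Cpow_neq_0, Cmod_gt_0; lra. cdd. } assert (N1 : (1 - q)%C <> RtoC 0). {
  intros Q. apply Ceq_minus in Q. apply (f_equal Cmod) in Q. unfold q in Q.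
  rewrite Cmod_1, Cmod_inv, Cmod_pow, Cmod_R, Rabs_pos_eq in Q by pos. pose proof (Rlt_pow_R1 2 n ltac:(lra) Hn).
  apply (f_equal Rinv) in Q. rewrite Rinv_inv, Rinv_1 in Q. lra. } rewrite <- (Cmult_1_l (MV _ r)), <- (Cinv_l _ N1).
  rewrite E at 1. transitivity (/ (1 - q) * (MV (fun z => / (z ^ n)) r - q * MV (fun z => / (z ^ n)) r))%C.
  rewrite <- E at 1. ring. rewrite <- E. ring.
Qed.

Definition Clim (u : nat -> C) (l : C) : Prop := forall e, 0 < e -> exists N, forall n, (N <= n)%nat -> Cmod (u n - l) <= e.
Definition cser (u : nat -> C) (l : C) : Prop := Clim (fun n => csum n u) l.

Lemma csum_ext n f g : (forall j, (j < n)%nat -> f j = g j) -> csum n f = csum n g.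
Proof. induction n; intros H; simpl; auto. rewrite IHn, H; auto. Qed.
Lemma csum_scal c n f : csum n (fun j => c * f j)%C = (c * csum n f)%C.
Proof. induction n; simpl. ring. rewrite IHn. ring. Qed.
Lemma csum_plus n f g : csum n (fun j => f j + g j)%C = (csum n f + csum n g)%C.
Proof. induction n; simpl. ring. rewrite IHn. ring. Qed.

Lemma geom_id (q : C) n : q <> RtoC 1 -> (/ (1 - q) = csum n (fun j => q ^ j) + q ^ n / (1 - q))%C.
Proof.
 intros Hq. assert (H : (1 - q)%C <> RtoC 0). { intros E. apply Ceq_minus in E. auto. } induction n; simpl. field; auto.
 rewrite IHn at 1. field. auto.
Qed.

Lemma pow_small q e : 0 <= q < 1 -> 0 < e -> exists N, forall n, (N <= n)%nat -> q ^ n <= e.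
Proof.
 intros Hq He. destruct (pow_lt_1_zero q ltac:(rewrite Rabs_pos_eq; lra) e He) as [N HN]. exists N. intros n Hn.
 specialize (HN n ltac:(lia)). rewrite Rabs_pos_eq in HN by pos. lra.
Qed.

Lemma geom_lim A q e : 0 <= q < 1 -> 0 < e -> exists N, forall n, (N <= n)%nat -> A * q ^ n <= e.
Proof.
 intros Hq He. assert (HA : 0 < Rabs A + 1) by fin. destruct (pow_small q (e / (Rabs A + 1)) Hq) as [N HN]. pos.
 exists N. intros n Hn. pose proof (Rle_abs A). assert (0 <= q ^ n) by pos. le_via ((Rabs A + 1) * q ^ n). nra.
 le_via ((Rabs A + 1) * (e / (Rabs A + 1))). fin. right; field; lra.
Qed.

Lemma circ_sub_ge w r t : 0 <= r -> r - Cmod w <= Cmod (circ r t - w).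
Proof. intros. pose proof (Cmod_triangle_inv (circ r t) w). rewrite Cmod_circ in H0; lra. Qed.

Lemma circ_sub_nz w r t : Cmod w < r -> (circ r t - w)%C <> RtoC 0.
Proof. intros. pose proof (Cmod_ge_0 w). apply Cmod_gt_0. pose proof (circ_sub_ge w r t). lra. Qed.
#[global] Hint Resolve circ_sub_nz : cx.

Lemma ratio_lt a b : 0 <= a -> a < b -> 0 <= a / b < 1.
Proof. split. pos. apply Rmult_lt_reg_r with b; try lra. unfold Rdiv. rewrite Rmult_assoc, Rinv_l; lra. Qed.

Definition ccoef (f : C -> C) (r : R) (n : nat) : C := (/ RtoC (2 * PI) * MV (fun z => f z / z ^ n)%C r)%C.

Lemma RtoC_2PI_nz : RtoC (2 * PI) <> RtoC 0.
Proof. pos. Qed.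
#[global] Hint Resolve RtoC_2PI_nz : cx.

Lemma ccoef_bound f r n M : 0 < r -> (forall t, rcont (fun t => f (circ r t)) t) ->
  (forall t, 0 <= t <= 2 * PI -> Cmod (f (circ r t)) <= M) -> Cmod (ccoef f r n) * r ^ n <= M.
Proof.
 intros Hr Hc HM. unfold ccoef. pose proof PI2_pos as P. assert (Hrn : 0 < r ^ n) by pos.
 rewrite Cmod_mult, Cmod_inv, Cmod_R, Rabs_pos_eq by fin.
 assert (B : Cmod (MV (fun z => f z / z ^ n)%C r) <= M / r ^ n * (2 * PI)). { apply MV_bound. fin. intros t Ht.
 rewrite Cmod_div, Cmod_pow, Cmod_circ by fin. fin. }
 replace M with (/ (2 * PI) * (M / r ^ n * (2 * PI)) * r ^ n) at 1 by (field; split; try lra; pose proof PI_RGT_0; lra).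
 fin.
Qed.

(** Finite geometric expansion of the Cauchy kernel in powers of [w/z]. Keeping the remainder
    explicit avoids any exchange of limit and integral. *)
Lemma kernel_expand g w r n : 0 < r -> Cmod w < r -> (forall t, rcont (fun t => g (circ r t)) t) ->
  MV (fun z => g z * (z / (z - w)))%C r =
  (csum n (fun j => MV (fun z => g z / z ^ j)%C r * w ^ j) + MV (fun z => g z * ((w / z) ^ n * (z / (z - w)))) r)%C.
Proof.
 intros Hr Hw Hg.
 transitivity (MV (fun z => csum n (fun j => w ^ j * (g z / z ^ j)) + g z * ((w / z) ^ n * (z / (z - w))))%C r).
 - apply MV_ext. intros t. pose proof (circ_neq_0 r t Hr) as NZ. pose proof (circ_sub_nz w r t Hw) as ND.
  set (z := circ r t) in *. assert (Hq : (w / z)%C <> RtoC 1). { intros E. apply ND.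
  replace (z - w)%C with (z * (1 - w / z))%C by (field; auto). rewrite E. ring. }
  replace (csum n (fun j => w ^ j * (g z / z ^ j))%C) with (g z * csum n (fun j => (w / z) ^ j))%C.
  + replace (z / (z - w))%C with (/ (1 - w / z))%C by (field; auto). rewrite (geom_id (w / z) n Hq) at 1. field; pos.
  + rewrite <- csum_scal. apply csum_ext. intros j _. unfold Cdiv. rewrite Cpow_mult_l, Cpow_inv by auto. ring.
 - assert (RI : forall j t, rcont (fun t => g (circ r t) / circ r t ^ j)%C t) by fin.
  rewrite (MV_plus (fun z => csum n (fun j => w ^ j * (g z / z ^ j))%C) (fun z => g z * ((w / z) ^ n * (z / (z - w))))%C).
  2: intros t; apply (rcont_csum n (fun j t => w ^ j * (g (circ r t) / circ r t ^ j))%C); fin.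
  2: intros t; apply rcont_mult; auto; apply rcont_mult; [apply rcont_pow|]; apply rcont_div; fin. f_equal.
  rewrite (MV_csum n (fun j z => w ^ j * (g z / z ^ j))%C) by fin. apply csum_ext. intros j _.
  rewrite (MV_scal (w ^ j)%C (fun z => g z / z ^ j)%C) by fin. ring.
Qed.

Lemma kernel_bound g u w r M q : 0 < r -> Cmod w < r -> (forall t, rcont (fun t => g (circ r t)) t) -> (forall t, rcont (fun t => u (circ r t)) t) ->
  (forall t, 0 <= t <= 2 * PI -> Cmod (g (circ r t)) <= M) -> (forall t, Cmod (u (circ r t)) <= q) -> 0 <= q ->
  Cmod (MV (fun z => g z * (u z * (z / (z - w))))%C r) <= M * (q * (r / (r - Cmod w))) * (2 * PI).
Proof.
 intros Hr Hw Hg Hu HM Hq Q0. apply MV_bound.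
 - intros t. apply rcont_mult; fin.
 - intros t Ht. rewrite !Cmod_mult, Cmod_div, Cmod_circ by fin. pose proof (circ_sub_ge w r t ltac:(lra)).
  assert (0 <= r / Cmod (circ r t - w)) by (apply Rmult_le_pos; [lra|left; apply Rinv_0_lt_compat; lra]).
  apply Rmult_le_compat; auto. pos. pos. apply Rmult_le_compat; auto. pos. le_mul_l; fin.
Qed.

(* The Cauchy formula enters only as the vanishing of [MV (fun z => (f z - f w) * (z / (z - w))) r], a condition stable under uniform limits. *)
Lemma series_of_mean f r w : 0 < r -> Cmod w < r -> (forall t, rcont (fun t => f (circ r t)) t) ->
  MV (fun z => (f z - f w) * (z / (z - w)))%C r = 0 -> cser (fun n => ccoef f r n * w ^ n)%C (f w).
Proof.
 intros Hr Hw Hc H0 e He. pose proof PI2_pos as P. pose proof (Cmod_ge_0 w) as W0. set (g := fun z => (f z - f w)%C).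
 assert (Hg : forall t, rcont (fun t => g (circ r t)) t) by fin.
 destruct (rcont_bounded (fun t => g (circ r t)) 0 (2 * PI)) as [M [M0 HM]]; [lra|auto|].
 pose proof (ratio_lt (Cmod w) r W0 Hw) as Hq.
 destruct (geom_lim (/ (2 * PI) * (M * (r / (r - Cmod w)) * (2 * PI))) (Cmod w / r) e Hq He) as [N HN]. exists (S N).
 intros n Hn. destruct n; [lia|].
 (* Subtracting the constant [f w] changes only the coefficient of index 0, since the other powers
    have mean zero. *)
 assert (E : csum (S n) (fun j => MV (fun z => g z / z ^ j) r * w ^ j)%C = (RtoC (2 * PI) * (csum (S n) (fun j => ccoef f r j * w ^ j) - f w))%C).
 {
 assert (T : forall j, MV (fun z => g z / z ^ j)%C r = (RtoC (2 * PI) * ccoef f r j - f w * MV (fun z => / z ^ j) r)%C).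
 { intros j. rewrite (MV_ext _ (fun z => f z / z ^ j + - f w * / z ^ j)%C) by (intros; unfold g, Cdiv; ring).
 rewrite (MV_plus (fun z => f z / z ^ j)%C (fun z => - f w * / z ^ j)%C), (MV_scal _ (fun z => / z ^ j)%C) by fin.
 unfold ccoef. field. fin. } clear Hn. induction n as [|n IH].
 - change (csum 1 ?h) with (0 + h 0%nat)%C. cbv beta.
  rewrite T, (MV_ext _ (fun _ => RtoC 1)) by (intros; simpl; field; apply C1_nz). unfold MV.
  rewrite CI_const, Rminus_0_r. ring.
 - change (csum (S (S n)) ?h) with (csum (S n) h + h (S n))%C. rewrite IH, T, MV_inv_pow by fin. ring. }
  pose proof (kernel_expand g w r (S n) Hr Hw Hg) as K. unfold g in K at 1. rewrite H0, E in K.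
  set (rem := MV (fun z => g z * ((w / z) ^ S n * (z / (z - w))))%C r) in *.
  assert (B : Cmod rem <= M * ((Cmod w / r) ^ S n * (r / (r - Cmod w))) * (2 * PI)). {
  apply (kernel_bound g (fun z => (w / z) ^ S n)%C); auto. fin. intros t. rewrite Cmod_pow, Cmod_div, Cmod_circ by fin.
  lra. pos. } replace (csum (S n) (fun j => ccoef f r j * w ^ j)%C - f w)%C with (- (/ RtoC (2 * PI) * rem))%C.
 - rewrite Cmod_opp, Cmod_mult, Cmod_inv, Cmod_R, Rabs_pos_eq by fin. eapply Rle_trans; [|apply (HN (S n)); lia].
  le_via (/ (2 * PI) * (M * ((Cmod w / r) ^ S n * (r / (r - Cmod w))) * (2 * PI))); fin.
 - apply Ceq_minus.
  match type of K with _ = (_ * ?a + _)%C => transitivity (- (/ RtoC (2 * PI)) * (RtoC (2 * PI) * a + rem))%C end.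
  field. fin. rewrite <- K. ring.
Qed.

Section Cauchy.
Variables (f : C -> C) (R : R).
Hypothesis Hf : forall z, Cmod z < R -> exists l, cdiff f z l.

Lemma holo_ccont z : Cmod z < R -> ccont f z.
Proof. intros Hz. destruct (Hf z Hz) as [l Hl]. eapply cdiff_ccont; eauto. Qed.

Lemma holo_rcont r t : 0 <= r < R -> rcont (fun t => f (circ r t)) t.
Proof. intros. apply rcont_circ, holo_ccont. rewrite Cmod_circ; lra. Qed.

(** The difference quotient, completed by the derivative at [w], is continuous, and holomorphic away
    from [w]. Its mean is thus given by [MV_mean_exc] with exceptional circle [|z| = |w|]; after
    multiplication by [z] the value at 0 is 0. *)
Lemma cauchy_mean w r : Cmod w < r < R -> MV (fun z => (f z - f w) * (z / (z - w)))%C r = 0.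
Proof.
 intros Hw. pose proof (Cmod_ge_0 w) as W0. destruct (Hf w ltac:(lra)) as [l Hl].
 set (G := fun z => if Ceq_dec z w then l else ((f z - f w) / (z - w))%C).
 assert (NW : forall z, z <> w -> (z - w)%C <> RtoC 0) by (intros z Hz E; apply Hz, Ceq_minus; auto).
 assert (GD : forall z, Cmod z < R -> z <> w -> exists l, cdiff G z l). { intros z Hz Hzw. destruct (Hf z Hz) as [m Hm].
 eexists. apply (cdiff_ext_loc (fun z => (f z - f w) / (z - w))%C).
 - exists (Cmod (z - w)). split. apply Cmod_gt_0; auto. intros v Hv. unfold G. destruct (Ceq_dec v w); auto. subst.
  rewrite Cmod_minus_sym in Hv. lra.
 - cdd. auto. } assert (Gw : ccont G w). { intros e He. destruct (Hl (e/2) ltac:(lra)) as [d [Hd K]]. exists d.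
  split; auto. intros z Hz. unfold G. destruct (Ceq_dec w w); [|congruence]. destruct (Ceq_dec z w) as [|n].
  rewrite Cmod_self; auto.
  replace ((f z - f w) / (z - w) - l)%C with ((f z - f w - l * (z - w)) / (z - w))%C by (field; auto).
  rewrite Cmod_div by auto. specialize (K z Hz). assert (0 < Cmod (z - w)) by (apply Cmod_gt_0; auto).
  apply Rle_lt_trans with (e/2); try lra. apply Rmult_le_reg_r with (Cmod (z - w)); auto. unfold Rdiv at 1.
  rewrite Rmult_assoc, Rinv_l; lra. } rewrite (MV_ext _ (fun z => z * G z)%C). 2:{ intros t. unfold G.
  pose proof (circ_sub_nz w r t ltac:(lra)). destruct (Ceq_dec (circ r t) w) as [E|N]. rewrite E in H.
  exfalso; apply H; ring. field; auto. } rewrite (MV_mean_exc (fun z => z * G z)%C r R (Cmod w)). ring. lra.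
 - intros z Hz. apply ccont_mult. eapply cdiff_ccont, cdiff_id. destruct (Ceq_dec z w). subst; auto.
  destruct (GD z Hz n) as [m Hm]. eapply cdiff_ccont; eauto.
 - intros z Hz Hzw. destruct (GD z) as [m Hm]. lra. congruence. fin.
Qed.

Lemma ccoef_indep r r' n : 0 < r < R -> 0 < r' < R -> ccoef f r n = ccoef f r' n.
Proof.
 assert (K : forall r r', 0 < r < R -> 0 < r' < R -> r <= r' -> ccoef f r n = ccoef f r' n). { intros s s' Hs Hs' L.
 unfold ccoef. f_equal. apply MV_annulus. lra. intros z Hz. destruct (Hf z ltac:(lra)) as [l Hl]. eexists. cdd.
 apply Cpow_neq_0. apply Cmod_gt_0; lra. } destruct (Rle_dec r r'); auto. symmetry. apply K; lra.
Qed.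

Theorem holo_series : 0 < R -> exists c : nat -> C,
  (forall r n, 0 < r < R -> c n = ccoef f r n) /\ (forall z, Cmod z < R -> cser (fun n => c n * z ^ n)%C (f z)).
Proof.
 exists (ccoef f (R / 2)). split.
 - intros r n Hr. apply ccoef_indep; lra.
 - intros w Hw. pose proof (Cmod_ge_0 w). replace (ccoef f (R / 2)) with (ccoef f ((Cmod w + R) / 2)).
  apply series_of_mean; try lra. intros; apply holo_rcont; lra. apply cauchy_mean; lra. apply functional_extensionality.
  intros n. apply ccoef_indep; lra.
Qed.
End Cauchy.

(** * Series, power series and termwise differentiation *)

Fixpoint rsum (n : nat) (F : nat -> R) : R :=
  match n with O => 0 | S n' => rsum n' F + F n' end.

Lemma csum_S n (f : nat -> C) : csum (S n) f = (csum n f + f n)%C.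
Proof. auto. Qed.
Lemma rsum_ext n f g : (forall j, (j < n)%nat -> f j = g j) -> rsum n f = rsum n g.
Proof. induction n; intros H; simpl; auto. rewrite IHn, H; auto. Qed.
Lemma rsum_scal c n f : rsum n (fun j => c * f j) = c * rsum n f.
Proof. induction n; simpl; fin. Qed.
Lemma rsum_plus n f g : rsum n (fun j => f j + g j) = rsum n f + rsum n g.
Proof. induction n; simpl; fin. Qed.
Lemma rsum_le n f g : (forall j, (j < n)%nat -> f j <= g j) -> rsum n f <= rsum n g.
Proof. induction n; intros H; simpl; fin. Qed.
Lemma rsum_pos n f : (forall j, (j < n)%nat -> 0 <= f j) -> 0 <= rsum n f.
Proof. intros H. induction n; simpl. lra. apply Rplus_le_le_0_compat; auto. Qed.
Lemma rsum_mono n m f : (forall j, 0 <= f j) -> (n <= m)%nat -> rsum n f <= rsum m f.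
Proof. intros H L. induction L. lra. simpl. specialize (H m). lra. Qed.
Lemma csum_Cmod n f : Cmod (csum n f) <= rsum n (fun j => Cmod (f j)).
Proof. induction n; simpl. rewrite Cmod_0; lra. le_trans Cmod_triangle. lra. Qed.
Lemma csum_diff_Cmod n m f : (n <= m)%nat -> Cmod (csum m f - csum n f) <= rsum m (fun j => Cmod (f j)) - rsum n (fun j => Cmod (f j)).
Proof.
 intros L. induction L. rewrite Cmod_self; lra. simpl.
 replace (csum m f + f m - csum n f)%C with ((csum m f - csum n f) + f m)%C by ring. le_trans Cmod_triangle. lra.
Qed.

Lemma rsum_cv (f : nat -> R) K : (forall j, 0 <= f j) -> (forall n, rsum n f <= K) ->
  exists S, (forall n, rsum n f <= S) /\ S <= K /\ forall e, 0 < e -> exists N, forall n, (N <= n)%nat -> S - rsum n f <= e.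
Proof.
 intros Hp HK. destruct (completeness (fun r => exists n, r = rsum n f)) as [S [S1 S2]].
 - exists K. intros r [n E]; subst; auto.
 - exists (rsum 0 f); fin.
 - exists S. repeat split.
  + fin.
  + apply S2. intros r [n E]; subst; auto.
  + intros e He. apply NNPP. intros Hno. assert (S <= S - e); [|lra]. apply S2. intros r [n E]; subst. apply Rnot_lt_le.
   intros L. apply Hno. exists n. intros m Hm. pose proof (rsum_mono n m f Hp Hm). lra.
Qed.

Lemma Clim_unique u l l' : Clim u l -> Clim u l' -> l = l'.
Proof.
 intros H H'. apply Ceq_small. intros e He. destruct (H (e/2) ltac:(lra)) as [N HN].
 destruct (H' (e/2) ltac:(lra)) as [N' HN'].
 replace (l - l')%C with ((u (max N N') - l') - (u (max N N') - l))%C by ring. le_trans Cmod_minus_le.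
 specialize (HN (max N N') ltac:(lia)). specialize (HN' (max N N') ltac:(lia)). lra.
Qed.

Lemma C_complete (x : nat -> C) : (forall e, 0 < e -> exists N, forall n m, (N <= n)%nat -> (N <= m)%nat -> Cmod (x m - x n) <= e) ->
  exists l, Clim x l.
Proof.
 intros Cau. destruct (Rcomplete.R_complete (fun n => Re (x n))) as [a Ha]. { intros e He.
 destruct (Cau (e/2) ltac:(lra)) as [N HN]. exists N. intros n m Hn Hm. eapply Rle_lt_trans.
 2: apply Rle_lt_trans with (1 := HN m n Hm Hn); lra. le_trans2 re_le_Cmod. right; fin. }
 destruct (Rcomplete.R_complete (fun n => Im (x n))) as [b Hb]. { intros e He.
 destruct (Cau (e/2) ltac:(lra)) as [N HN]. exists N. intros n m Hn Hm. eapply Rle_lt_trans.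
 2: apply Rle_lt_trans with (1 := HN m n Hm Hn); lra. le_trans2 im_le_Cmod. right; fin. } exists (a, b). intros e He.
 destruct (Ha (e/2) ltac:(lra)) as [N1 H1]. destruct (Hb (e/2) ltac:(lra)) as [N2 H2]. exists (max N1 N2). intros n Hn.
 le_trans Cmod_le_abs. specialize (H1 n ltac:(lia)). specialize (H2 n ltac:(lia)). unfold Rdist in *.
 unfold Cplus, Re, Im, Rminus in *; simpl in *. lra.
Qed.

Lemma inv_INR_small D e : 0 <= D -> 0 < e -> exists N : nat, forall n, (N <= n)%nat -> D * / INR (S n) <= e.
Proof.
 intros HD He. destruct (archimed_cor1 (e / (D + 1)) ltac:(pos)) as [N [H1 H2]]. exists N. intros n Hn.
 assert (/ INR (S n) <= / INR N) by fin. le_via ((D + 1) * (e / (D + 1))). fin. right; field; lra.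
Qed.

Lemma limit_rate (x : nat -> C) (E : nat -> R) : (forall n m, (n <= m)%nat -> Cmod (x m - x n) <= E n) ->
  (forall e, 0 < e -> exists N, forall n, (N <= n)%nat -> E n <= e) -> exists l, forall n, Cmod (l - x n) <= E n.
Proof.
 intros H HE. destruct (C_complete x) as [l Hl]. { intros e He. destruct (HE e He) as [N HN]. exists N.
 intros n m Hn Hm. destruct (Nat.le_ge_cases n m). eapply Rle_trans; auto. rewrite Cmod_minus_sym.
 eapply Rle_trans; auto. } exists l. intros n. apply le_epsilon. intros e He. destruct (Hl e He) as [N HN].
 specialize (HN (max n N) ltac:(lia)). specialize (H n (max n N) ltac:(lia)).
 replace (l - x n)%C with ((x (max n N) - x n) - (x (max n N) - l))%C by ring. le_trans Cmod_minus_le. lra.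
Qed.

Lemma cser_exists (u : nat -> C) K : (forall n, rsum n (fun j => Cmod (u j)) <= K) -> exists l, cser u l.
Proof.
 intros HK. destruct (rsum_cv (fun j => Cmod (u j)) K) as [S [S1 [S2 S3]]]; auto. intros; pos. apply C_complete.
 intros e He. destruct (S3 e He) as [N HN]. exists N.
 assert (G : forall n m, (N <= n)%nat -> (n <= m)%nat -> Cmod (csum m u - csum n u) <= e). { intros n m Hn Hm.
 eapply Rle_trans. apply csum_diff_Cmod; auto. specialize (HN n Hn). specialize (S1 m). lra. } intros n m Hn Hm.
 destruct (Nat.le_ge_cases n m). auto. rewrite Cmod_minus_sym; fin.
Qed.

Lemma cser_unique u l l' : cser u l -> cser u l' -> l = l'.
Proof. apply Clim_unique. Qed.

Lemma cser_ext u v l : (forall n, u n = v n) -> cser u l -> cser v l.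
Proof. intros E. replace v with u; auto. apply functional_extensionality; auto. Qed.

Lemma cser_scal c u l : cser u l -> cser (fun n => c * u n)%C (c * l)%C.
Proof.
 intros H e He. pose proof (Cmod_ge_0 c). destruct (H (e / (Cmod c + 1))) as [N HN]. pos. exists N. intros n Hn.
 rewrite csum_scal. replace (c * csum n u - c * l)%C with (c * (csum n u - l))%C by ring. rewrite Cmod_mult.
 le_via ((Cmod c + 1) * (e / (Cmod c + 1))). fin. right; field; lra.
Qed.

Lemma cser_plus u v l m : cser u l -> cser v m -> cser (fun n => u n + v n)%C (l + m)%C.
Proof.
 intros H H' e He. destruct (H (e/2) ltac:(lra)) as [N HN]. destruct (H' (e/2) ltac:(lra)) as [N' HN'].
 exists (max N N'). intros n Hn. rewrite csum_plus.
 replace (csum n u + csum n v - (l + m))%C with ((csum n u - l) + (csum n v - m))%C by ring. le_trans Cmod_triangle.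
 specialize (HN n ltac:(lia)). specialize (HN' n ltac:(lia)). lra.
Qed.

Lemma cser_bound u l K : (forall n, Cmod (csum n u) <= K) -> cser u l -> Cmod l <= K.
Proof.
 intros H Hl. apply le_epsilon. intros e He. destruct (Hl e He) as [N HN]. specialize (HN N (le_n _)). specialize (H N).
 pose proof (Cmod_triangle_inv l (csum N u)). rewrite Cmod_minus_sym in H0. lra.
Qed.

Lemma cser_abs_bound u l K : (forall n, rsum n (fun j => Cmod (u j)) <= K) -> cser u l -> Cmod l <= K.
Proof. intros H. apply cser_bound. intros n. le_trans csum_Cmod. auto. Qed.

(** A summable quadratic remainder is all that termwise differentiation requires. Power series and
    Dirichlet series are both instances. *)
Lemma cser_deriv (u : nat -> C -> C) (u' : nat -> C) (B : nat -> R) (K d : R) (f : C -> C) (z l : C) :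
  0 < d -> (forall n, rsum n B <= K) ->
  (forall n h, Cmod h < d -> Cmod (u n (z + h)%C - u n z - u' n * h) <= Cmod h ^ 2 * B n) ->
  (forall h, Cmod h < d -> cser (fun n => u n (z + h)%C) (f (z + h)%C)) -> cser u' l -> cdiff f z l.
Proof.
 intros Hd HK HB Hf Hl. assert (K0 : 0 <= K) by (specialize (HK 0%nat); simpl in HK; lra).
 assert (Q : forall h, Cmod h < d -> Cmod (f (z + h)%C - f z - l * h) <= Cmod h ^ 2 * K). { intros h Hh.
 apply (cser_bound (fun n => u n (z + h)%C + (-1) * u n z + (- h) * u' n)%C).
 - intros n. le_trans csum_Cmod. eapply Rle_trans. 2: le_mul_l; [apply pow2_ge_0|apply (HK n)]. rewrite <- rsum_scal.
  apply rsum_le. intros j _. le_trans2 ((HB j h Hh)). right. f_equal. ring.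
 - replace (f (z + h)%C - f z - l * h)%C with (f (z + h)%C + (-1) * f z + (- h) * l)%C by ring. apply cser_plus.
  apply cser_plus. auto. apply cser_scal. replace (f z) with (f (z + 0)%C) by (f_equal; ring).
  apply (cser_ext (fun n => u n (z + 0)%C)). intros n; f_equal; ring. apply Hf. rewrite Cmod_0; auto.
  apply cser_scal; auto. } intros e He. exists (Rmin d (e / (K + 1))). split. pos. intros w Hw.
  assert (A1 := Rlt_le_trans _ _ _ Hw (Rmin_l _ _)). assert (A2 := Rlt_le_trans _ _ _ Hw (Rmin_r _ _)).
  specialize (Q (w - z)%C A1). replace (z + (w - z))%C with w in Q by ring. eapply Rle_trans. exact Q.
  set (x := Cmod (w - z)) in *. assert (0 <= x) by pos. assert (x * (K + 1) <= e). { le_via (e / (K + 1) * (K + 1)).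
  fin. right; field; lra. } nra.
Qed.

Lemma geom_sum_le q n : 0 <= q < 1 -> rsum n (fun j => q ^ j) <= / (1 - q).
Proof.
 intros Hq. assert (E : rsum n (fun j => q ^ j) = (1 - q ^ n) / (1 - q)). { induction n; simpl. lra. rewrite IHn.
 field; lra. } rewrite E. unfold Rdiv. rewrite <- (Rmult_1_l (/ (1 - q))) at 2. le_mul_r. pos.
 pose proof (pow_le q n ltac:(lra)). lra.
Qed.

(** The right-hand side is the full sum. Each multiplication by [1 - q] telescopes and lowers the
    degree of the polynomial factor. *)
Lemma geom_sum2_le q n : 0 <= q < 1 -> rsum n (fun j => (INR j + 1) * (INR j + 2) * q ^ j) <= 2 / (1 - q) ^ 3.
Proof.
 intros Hq.
 assert (E1 : forall n, (1 - q) * rsum n (fun j => (INR j + 1) * q ^ j) = rsum n (fun j => q ^ j) - INR n * q ^ n). {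
 induction n0. simpl; ring. rewrite S_INR. simpl; fin. }
 assert (E2 : forall n, (1 - q) * rsum n (fun j => (INR j + 1) * (INR j + 2) * q ^ j) = 2 * rsum n (fun j => (INR j + 1) * q ^ j) - INR n * (INR n + 1) * q ^ n).
 { induction n0. simpl; ring. rewrite S_INR. simpl; fin. } pose proof (geom_sum_le q n Hq) as G. specialize (E1 n).
 specialize (E2 n). pose proof (pos_INR n). pose proof (pow_le q n ltac:(lra)). assert (0 <= INR n * q ^ n) by (pos).
 assert (0 <= INR n * (INR n + 1) * q ^ n) by pos. apply Rmult_le_reg_l with ((1 - q) ^ 3). pos.
 replace ((1 - q) ^ 3 * (2 / (1 - q) ^ 3)) with 2 by (field; lra).
 replace ((1 - q) ^ 3 * rsum n (fun j => (INR j + 1) * (INR j + 2) * q ^ j)) with ((1 - q) * ((1 - q) * ((1 - q) * rsum n (fun j => (INR j + 1) * (INR j + 2) * q ^ j)))) by ring.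
 assert ((1 - q) * rsum n (fun j => q ^ j) <= 1). { le_via ((1 - q) * / (1 - q)). fin. right; field; lra. }
 le_via ((1 - q) * ((1 - q) * (2 * rsum n (fun j => (INR j + 1) * q ^ j)))). { fin. } nra.
Qed.

(** Cauchy's estimates at every radius below [R]; a radius of convergence of at least [R] without an
    upper limit. *)
Definition coef_ok (c : nat -> C) (R : R) : Prop :=
  forall r, 0 < r < R -> exists M, 0 <= M /\ forall n, Cmod (c n) * r ^ n <= M.

Definition dcoef (c : nat -> C) (n : nat) : C := (CN (S n) * c (S n))%C.

(** Second-order Taylor remainder of a power. The crude factor [n^2] makes the induction close. *)
Lemma pow_dev (z h : C) rho n : 0 < rho -> Cmod z <= rho -> Cmod (z + h) <= rho ->
  Cmod ((z + h) ^ n - z ^ n - CN n * z ^ pred n * h) <= Cmod h ^ 2 * (INR n ^ 2 * rho ^ n / rho ^ 2).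
Proof.
 intros Hr H1 H2. induction n.
 - simpl. replace (1 - 1 - RtoC 0 * 1 * h)%C with (RtoC 0) by ring. rewrite Cmod_0; fin.
 -
  assert (E : ((z + h) ^ S n - z ^ S n - CN (S n) * z ^ pred (S n) * h = (z + h) * ((z + h) ^ n - z ^ n - CN n * z ^ pred n * h) + CN n * z ^ pred n * (h * h))%C).
  { rewrite S_INR, RtoC_plus. destruct n. simpl. ring. simpl Cpow. ring. } rewrite E. le_trans Cmod_triangle.
  rewrite !Cmod_mult, Cmod_R, Cmod_pow. rewrite (Rabs_pos_eq (INR n)) by pos. pose proof (pos_INR n).
  assert (P : INR n * Cmod z ^ pred n <= INR n * (rho ^ n / rho)). { destruct n. simpl; lra. simpl.
  replace (rho * rho ^ n / rho) with (rho ^ n) by (field; lra); fin. }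
  assert (Q : Cmod (z + h) * Cmod ((z + h) ^ n - z ^ n - CN n * z ^ pred n * h) <= rho * (Cmod h ^ 2 * (INR n ^ 2 * rho ^ n / rho ^ 2))).
  { fin. } assert (T : INR n * Cmod z ^ pred n * (Cmod h * Cmod h) <= INR n * (rho ^ n / rho) * (Cmod h * Cmod h)). {
  fin. } eapply Rle_trans. apply Rplus_le_compat; [exact Q|exact T]. rewrite S_INR. simpl pow.
  replace (rho * (Cmod h * (Cmod h * 1) * (INR n * (INR n * 1) * rho ^ n / (rho * (rho * 1)))) + INR n * (rho ^ n / rho) * (Cmod h * Cmod h)) with (Cmod h * Cmod h * (rho ^ n / rho) * (INR n * INR n + INR n)) by (field; lra).
  replace (Cmod h * (Cmod h * 1) * ((INR n + 1) * ((INR n + 1) * 1) * (rho * rho ^ n) / (rho * (rho * 1)))) with (Cmod h * Cmod h * (rho ^ n / rho) * ((INR n + 1) * (INR n + 1))) by (field; lra); fin.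
Qed.

Lemma coef_abs c r M rho n : 0 < r -> (forall n, Cmod (c n) * r ^ n <= M) -> 0 <= rho ->
  Cmod (c n) * rho ^ n <= M * (rho / r) ^ n.
Proof.
 intros Hr H Hrho. unfold Rdiv. rewrite Rpow_mult_distr, pow_inv.
 replace (Cmod (c n) * rho ^ n) with (Cmod (c n) * r ^ n * (rho ^ n * / r ^ n)). 2:{ field; pos. } fin.
Qed.

Section PSer.
Variables (c : nat -> C) (R : R).
Hypothesis Hc : coef_ok c R.

Lemma pser_abs z : Cmod z < R -> exists K, forall n, rsum n (fun j => Cmod (c j * z ^ j)) <= K.
Proof.
 intros Hz. pose proof (Cmod_ge_0 z). set (r := (Cmod z + R) / 2). assert (Hr : Cmod z < r < R) by (unfold r; lra).
 destruct (Hc r ltac:(lra)) as [M [M0 HM]]. pose proof (ratio_lt (Cmod z) r H ltac:(lra)) as Hq.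
 exists (M * / (1 - Cmod z / r)). intros n. eapply Rle_trans. 2: le_mul_l; auto; apply geom_sum_le; auto.
 rewrite <- rsum_scal. apply rsum_le. intros j _. rewrite Cmod_mult, Cmod_pow. apply coef_abs; auto. lra.
Qed.

Lemma pser_exists z : Cmod z < R -> exists l, cser (fun n => c n * z ^ n)%C l.
Proof. intros Hz. destruct (pser_abs z Hz) as [K HK]. eapply cser_exists; eauto. Qed.

Lemma dcoef_ok : coef_ok (dcoef c) R.
Proof.
 intros r Hr. set (r' := (r + R) / 2). assert (Hr' : r < r' < R) by (unfold r'; lra).
 destruct (Hc r' ltac:(lra)) as [M [M0 HM]]. pose proof (ratio_lt r r' ltac:(lra) ltac:(lra)) as Hq.
 exists (M * (2 / (1 - r / r') ^ 3) / r). assert (B : 0 <= 2 / (1 - r / r') ^ 3). { pos. } split. { pos. } intros n.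
 unfold dcoef. rewrite Cmod_mult, Cmod_R, Rabs_pos_eq by pos. apply Rmult_le_reg_r with r. lra.
 replace (M * (2 / (1 - r / r') ^ 3) / r * r) with (M * (2 / (1 - r / r') ^ 3)) by (field; lra).
 replace (INR (S n) * Cmod (c (S n)) * r ^ n * r) with (INR (S n) * (Cmod (c (S n)) * r ^ S n)) by (simpl; ring).
 pose proof (coef_abs c r' M r (S n) ltac:(lra) HM ltac:(lra)) as A.
 pose proof (geom_sum2_le (r / r') (S (S n)) Hq) as G.
 assert (P : forall j, 0 <= (INR j + 1) * (INR j + 2) * (r / r') ^ j). { intros j. pos. }
 assert (G0 := rsum_pos n (fun j => (INR j + 1) * (INR j + 2) * (r / r') ^ j) (fun j _ => P j)). assert (G1 := P n).
 assert (I : INR (S n) * (r / r') ^ S n <= 2 / (1 - r / r') ^ 3). { eapply Rle_trans. 2: exact G.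
 pose proof (pos_INR n). assert (0 <= r / r' * (r / r') ^ n) by fin. destruct n; simpl in *; nra. }
 le_via (INR (S n) * (M * (r / r') ^ S n)). fin. nra.
Qed.

Lemma pser_deriv (f : C -> C) (z l : C) : (forall z, Cmod z < R -> cser (fun n => c n * z ^ n)%C (f z)) ->
  Cmod z < R -> cser (fun n => dcoef c n * z ^ n)%C l -> cdiff f z l.
Proof.
 intros Hf Hz Hl. pose proof (Cmod_ge_0 z) as Z0. set (rho := (Cmod z + R) / 2).
 assert (Hrho : Cmod z < rho < R) by (unfold rho; lra). set (r := (rho + R) / 2).
 assert (Hr : rho < r < R) by (unfold r; lra). destruct (Hc r ltac:(lra)) as [M [M0 HM]].
 pose proof (ratio_lt rho r ltac:(lra) ltac:(lra)) as Hq.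
 apply (cser_deriv (fun n z => c n * z ^ n)%C (fun n => c n * (CN n * z ^ pred n))%C (fun n => M / rho ^ 2 * ((INR n + 1) * (INR n + 2) * (rho / r) ^ n)) (M / rho ^ 2 * (2 / (1 - rho / r) ^ 3)) (rho - Cmod z)).
 - lra.
 - intros n. rewrite rsum_scal. le_mul_l. pos. apply geom_sum2_le; auto.
 - intros n h Hh.
  replace (c n * (z + h) ^ n - c n * z ^ n - c n * (CN n * z ^ pred n) * h)%C with (c n * ((z + h) ^ n - z ^ n - CN n * z ^ pred n * h))%C by ring.
  rewrite Cmod_mult.
  pose proof (pow_dev z h rho n ltac:(lra) ltac:(lra) ltac:(eapply Rle_trans; [apply Cmod_triangle|lra])) as P.
  pose proof (coef_abs c r M rho n ltac:(lra) HM ltac:(lra)) as A. pose proof (pos_INR n).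
  le_via (Cmod (c n) * (Cmod h ^ 2 * (INR n ^ 2 * rho ^ n / rho ^ 2))). fin.
  replace (Cmod (c n) * (Cmod h ^ 2 * (INR n ^ 2 * rho ^ n / rho ^ 2))) with (Cmod h ^ 2 * ((Cmod (c n) * rho ^ n) * INR n ^ 2 / rho ^ 2)) by pos.
  le_mul_l. pos.
  replace (M / rho ^ 2 * ((INR n + 1) * (INR n + 2) * (rho / r) ^ n)) with ((M * (rho / r) ^ n) * ((INR n + 1) * (INR n + 2)) / rho ^ 2) by pos; fin.
 - intros h Hh. apply Hf. eapply Rle_lt_trans. apply Cmod_triangle. lra.
 - intros e He. destruct (Hl e He) as [N HN]. exists (S N). intros n Hn. destruct n; [lia|].
  replace (csum (S n) (fun n0 => c n0 * (CN n0 * z ^ pred n0))%C) with (csum n (fun n0 => dcoef c n0 * z ^ n0)%C).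
  apply HN; lia. clear. induction n. simpl. ring. rewrite csum_S, IHn, (csum_S (S n)). unfold dcoef. simpl pred. ring.
Qed.

End PSer.

Lemma pser_fun c R : coef_ok c R -> exists f f', (forall z, Cmod z < R -> cser (fun n => c n * z ^ n)%C (f z)) /\
  (forall z, Cmod z < R -> cdiff f z (f' z)) /\ (forall z, Cmod z < R -> cser (fun n => dcoef c n * z ^ n)%C (f' z)).
Proof.
 intros Hc. set (f := fun z => epsilon (inhabits (RtoC 0)) (fun l => cser (fun n => c n * z ^ n)%C l)).
 set (f' := fun z => epsilon (inhabits (RtoC 0)) (fun l => cser (fun n => dcoef c n * z ^ n)%C l)).
 assert (A : forall z, Cmod z < R -> cser (fun n => c n * z ^ n)%C (f z)). { intros z Hz. apply epsilon_spec.
 apply pser_exists with R; auto. } assert (B : forall z, Cmod z < R -> cser (fun n => dcoef c n * z ^ n)%C (f' z)). {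
 intros z Hz. apply epsilon_spec. apply pser_exists with R; auto. apply dcoef_ok; auto. } exists f, f'.
 repeat split; auto. intros z Hz. apply (pser_deriv c R Hc); auto.
Qed.

Lemma pser_holo c R f z : coef_ok c R -> (forall z, Cmod z < R -> cser (fun n => c n * z ^ n)%C (f z)) -> Cmod z < R ->
  exists l, cdiff f z l.
Proof.
 intros Hc Hf Hz. destruct (pser_exists (dcoef c) R (dcoef_ok c R Hc) z Hz) as [l Hl]. exists l.
 eapply pser_deriv; eauto.
Qed.

Lemma holo_pser f R : 0 < R -> (forall z, Cmod z < R -> exists l, cdiff f z l) ->
  exists c, coef_ok c R /\ (forall r n, 0 < r < R -> c n = ccoef f r n) /\ forall z, Cmod z < R -> cser (fun n => c n * z ^ n)%C (f z).
Proof.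
 intros HR Hf. destruct (holo_series f R Hf HR) as [c [C1 C2]]. exists c. split; [|split; auto]. intros r Hr.
 assert (Rc : forall t, rcont (fun t => f (circ r t)) t) by (intros; apply (holo_rcont f R); auto; lra).
 destruct (rcont_bounded (fun t => f (circ r t)) 0 (2 * PI)) as [M [M0 HM]]; [pose proof PI2_pos; lra|auto|]. exists M.
 split; auto. intros n. rewrite (C1 r n Hr). apply ccoef_bound; auto. lra.
Qed.

Lemma holo_deriv f R : 0 < R -> (forall z, Cmod z < R -> exists l, cdiff f z l) ->
  exists f', (forall z, Cmod z < R -> cdiff f z (f' z)) /\ (forall z, Cmod z < R -> exists l, cdiff f' z l).
Proof.
 intros HR Hf. destruct (holo_pser f R HR Hf) as [c [C1 [_ C2]]]. destruct (pser_fun c R C1) as [g [f' [G1 [G2 G3]]]].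
 exists f'. split.
 - intros z Hz. apply (pser_deriv c R C1); auto.
 - intros z Hz. apply (pser_holo (dcoef c) R); auto. apply dcoef_ok; auto.
Qed.

(** * Entire functions, orders of vanishing, uniform limits, logarithms *)

Definition Entire (f : C -> C) : Prop := forall z, exists l, cdiff f z l.

Lemma Entire_iff f : entire f <-> Entire f.
Proof. split; intros H z; apply holo_at_iff; auto. Qed.

(** The coefficients are means over any circle of positive radius, hence the expansions on discs of
    different radii coincide. *)
Lemma Entire_pser f : Entire f -> exists c, (forall R, coef_ok c R) /\ forall z, cser (fun n => c n * z ^ n)%C (f z).
Proof.
 intros Hf. destruct (holo_pser f 1 Rlt_0_1 (fun z _ => Hf z)) as [c [C1 [C2 C3]]].
 assert (K : forall R, 0 < R -> coef_ok c R /\ forall z, Cmod z < R -> cser (fun n => c n * z ^ n)%C (f z)). {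
 intros R HR. destruct (holo_pser f R HR (fun z _ => Hf z)) as [c' [D1 [D2 D3]]]. assert (E : c = c'). {
 apply functional_extensionality. intros n. assert (0 < Rmin 1 R) by pos. pose proof (Rmin_l 1 R).
 pose proof (Rmin_r 1 R). rewrite (C2 (Rmin 1 R / 2)), (D2 (Rmin 1 R / 2)); auto; lra. } subst c'. auto. } exists c.
 split.
 - intros R r Hr. apply (proj1 (K R ltac:(lra)) r Hr).
 - intros z. apply (K (Cmod z + 1)); fin.
Qed.

Lemma pser_shift c z l : cser (fun n => c n * z ^ n)%C l -> cser (fun n => z * (c (S n) * z ^ n))%C (l - c 0%nat)%C.
Proof.
 intros H e He. destruct (H e He) as [N HN]. exists N. intros n Hn. specialize (HN (S n) ltac:(lia)).
 replace (csum n (fun n0 => z * (c (S n0) * z ^ n0))%C) with (csum (S n) (fun n0 => c n0 * z ^ n0)%C - c 0%nat)%C.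
 - match goal with |- Cmod ?x <= _ => match type of HN with Cmod ?y <= _ => replace x with y by ring end end; fin.
 - clear. induction n. simpl. ring. rewrite (csum_S n (fun n0 => z * (c (S n0) * z ^ n0))%C), <- IHn, (csum_S (S n)).
  simpl Cpow. ring.
Qed.

Lemma coef_shift_ok c : (forall R, coef_ok c R) -> forall R, coef_ok (fun n => c (S n)) R.
Proof.
 intros Hc R r Hr. destruct (Hc R r Hr) as [M [M0 HM]]. exists (M / r). split. pos. intros n. specialize (HM (S n)).
 simpl in HM. apply Rmult_le_reg_r with r. lra. replace (M / r * r) with M by (field; lra). lra.
Qed.

Lemma factor_pser c f : (forall R, coef_ok c R) -> (forall z, cser (fun n => c n * z ^ n)%C (f z)) -> c 0%nat = RtoC 0 ->
  exists g, (forall z, cser (fun n => c (S n) * z ^ n)%C (g z)) /\ forall z, f z = (z * g z)%C.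
Proof.
 intros Hc Hf H0. pose proof (coef_shift_ok c Hc) as Hs.
 set (g := fun z => epsilon (inhabits (RtoC 0)) (fun l => cser (fun n => c (S n) * z ^ n)%C l)).
 assert (Hg : forall z, cser (fun n => c (S n) * z ^ n)%C (g z)). { intros z. apply epsilon_spec.
 apply (pser_exists (fun n => c (S n)) (Cmod z + 1)); fin. } exists g. split; auto. intros z. eapply cser_unique.
 - replace (f z) with (f z - c 0%nat)%C by (rewrite H0; ring). apply pser_shift; auto.
 - apply cser_scal; auto.
Qed.

Lemma pser_entire c f : (forall R, coef_ok c R) -> (forall z, cser (fun n => c n * z ^ n)%C (f z)) -> Entire f.
Proof. intros Hc Hf z. apply (pser_holo c (Cmod z + 1)); auto. lra. Qed.

Lemma pser_at_0 c f : cser (fun n => c n * 0 ^ n)%C f -> f = c 0%nat.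
Proof.
 intros H. apply (cser_unique (fun n => c n * 0 ^ n)%C); auto. exists 1%nat. destruct n; [lia|].
 assert (E : forall n, csum (S n) (fun n0 => c n0 * 0 ^ n0)%C = c 0%nat). { induction n0. simpl. ring.
 rewrite csum_S, IHn0. simpl. ring. } rewrite E, Cmod_self. lra.
Qed.

Lemma order_pser k : forall c f, (forall R, coef_ok c R) -> (forall z, cser (fun n => c n * z ^ n)%C (f z)) ->
  (forall j, (j < k)%nat -> c j = RtoC 0) -> exists g, Entire g /\ g (RtoC 0) = c k /\ forall z, f z = (z ^ k * g z)%C.
Proof.
 induction k; intros c f Hc Hf Hz.
 - exists f. split; [|split]. eapply pser_entire; eauto. apply pser_at_0; auto. intros; ring.
 - destruct (factor_pser c f Hc Hf (Hz 0%nat ltac:(lia))) as [g [G1 G2]].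
  destruct (IHk (fun n => c (S n)) g (coef_shift_ok c Hc) G1) as [g' [A [B D]]]. intros; apply Hz; lia. exists g'.
  split; auto. split; auto. intros z. rewrite G2, D. simpl. ring.
Qed.

Lemma Entire_comp f g : Entire f -> Entire g -> Entire (fun z => f (g z)).
Proof. intros Hf Hg z. destruct (Hf (g z)) as [a Ha]. destruct (Hg z) as [b Hb]. eexists. apply (cdiff_comp f g); eauto. Qed.
Lemma Entire_mult f g : Entire f -> Entire g -> Entire (fun z => f z * g z)%C.
Proof. intros Hf Hg z. destruct (Hf z) as [a Ha]. destruct (Hg z) as [b Hb]; fin. Qed.
Lemma Entire_plus f g : Entire f -> Entire g -> Entire (fun z => f z + g z)%C.
Proof. intros Hf Hg z. destruct (Hf z) as [a Ha]. destruct (Hg z) as [b Hb]; fin. Qed.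
Lemma Entire_minus f g : Entire f -> Entire g -> Entire (fun z => f z - g z)%C.
Proof. intros Hf Hg z. destruct (Hf z) as [a Ha]. destruct (Hg z) as [b Hb]. eexists. cdd. Qed.
Lemma Entire_const c : Entire (fun _ => c).
Proof. intros z. fin. Qed.
Lemma Entire_id : Entire (fun z => z).
Proof. intros z. fin. Qed.
Lemma Entire_cexp : Entire cexp.
Proof. intros z. fin. Qed.
Lemma Entire_pow f k : Entire f -> Entire (fun z => f z ^ k)%C.
Proof. apply (Entire_comp (fun z => z ^ k)%C f); auto. eexists. cdd. Qed.
Lemma Entire_ext f g : (forall z, f z = g z) -> Entire f -> Entire g.
Proof. intros E H z. destruct (H z) as [l Hl]. exists l. eapply cdiff_ext; eauto. Qed.
Lemma Entire_ccont f z : Entire f -> ccont f z.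
Proof. intros H. destruct (H z). eapply cdiff_ccont; eauto. Qed.
#[global] Hint Resolve Entire_comp Entire_mult Entire_plus Entire_minus Entire_const Entire_id Entire_cexp Entire_pow Entire_ccont : cx.

(** Unlike in [zero_of_order] the cofactor is entire and [k = 0] is allowed, so that an order exists
    at every point and adds up in products. *)
Definition is_ord (f : C -> C) (w : C) (k : nat) : Prop :=
  exists g, Entire g /\ g w <> RtoC 0 /\ forall z, f z = ((z - w) ^ k * g z)%C.

(** The order is the index of the first nonzero Taylor coefficient at [w]. The Taylor series
    converges in the whole plane, so if all coefficients vanish then so does [f]; no connectedness
    argument is involved. *)
Lemma ord_exists f w : Entire f -> (exists z, f z <> RtoC 0) -> exists k, is_ord f w k.
Proof.
 intros Hf [z0 Hz0]. assert (HF : Entire (fun z => f (w + z)%C)). { apply (Entire_comp f (fun z => w + z)%C); auto.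
 eexists; cdd. } destruct (Entire_pser _ HF) as [c [C1 C2]]. destruct (classic (exists n, c n <> RtoC 0)) as [Hn|Hn].
 - destruct Hn as [n Hn]. assert (M : exists k, c k <> RtoC 0 /\ forall j, (j < k)%nat -> c j = RtoC 0). {
  induction n as [n IH] using (well_founded_induction Wf_nat.lt_wf).
  destruct (classic (exists m, (m < n)%nat /\ c m <> RtoC 0)) as [[m [Hm1 Hm2]]|Hno]. eauto. exists n. split; auto.
  intros j Hj. apply NNPP; fin. } destruct M as [k [K1 K2]]. destruct (order_pser k c _ C1 C2 K2) as [g [G1 [G2 G3]]].
  exists k, (fun z => g (z - w)%C). split; [|split].
  + apply (Entire_comp g (fun z => z - w)%C); auto. eexists; cdd.
  + replace (w - w)%C with (RtoC 0) by ring. congruence.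
  + intros z. rewrite <- G3. f_equal. ring.
 - exfalso. apply Hz0. specialize (C2 (z0 - w)%C). replace (w + (z0 - w))%C with z0 in C2 by ring.
  apply (cser_unique (fun n => c n * (z0 - w) ^ n)%C); auto.
  assert (Hall : forall n, c n = RtoC 0) by (intros n; apply NNPP; intros H; apply Hn; eauto). exists 0%nat. intros n _.
  replace (csum n (fun n0 => c n0 * (z0 - w) ^ n0)%C) with (RtoC 0). rewrite Cmod_self; lra. induction n; simpl; auto.
  rewrite <- IHn, Hall. ring.
Qed.

Lemma Entire_nz_near g w : Entire g -> g w <> RtoC 0 -> exists d, 0 < d /\ forall z, Cmod (z - w) < d -> g z <> RtoC 0.
Proof.
 intros Hg Hw. assert (0 < Cmod (g w)) by pos. destruct (Entire_ccont g w Hg (Cmod (g w)) H) as [d [Hd K]].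
 exists d; split; auto. intros z Hz E. specialize (K z Hz). rewrite E in K.
 replace (0 - g w)%C with (- g w)%C in K by ring. rewrite Cmod_opp in K. lra.
Qed.

Lemma identity_thm f w : Entire f -> (forall d, 0 < d -> exists z, 0 < Cmod (z - w) < d /\ f z = RtoC 0) -> forall z, f z = RtoC 0.
Proof.
 intros Hf H z. apply NNPP. intros Hz. destruct (ord_exists f w Hf (ex_intro _ z Hz)) as [k [g [G1 [G2 G3]]]].
 destruct (Entire_nz_near g w G1 G2) as [d [Hd K]]. destruct (H d Hd) as [v [V1 V2]]. rewrite G3 in V2. eapply K.
 apply V1. apply NNPP. intros N. assert (((v - w) ^ k * g v)%C <> RtoC 0). { apply Cmult_neq_0; auto.
 apply Cpow_neq_0, Cmod_gt_0; fin. } auto.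
Qed.

Lemma punctured_ex w d : 0 < d -> exists z, 0 < Cmod (z - w) < d.
Proof.
 exists (w + RtoC (d / 2))%C. replace (w + RtoC (d/2) - w)%C with (RtoC (d/2)) by ring.
 rewrite Cmod_R, Rabs_pos_eq; lra.
Qed.

Lemma punctured_eq f g w d : Entire f -> Entire g -> 0 < d -> (forall z, 0 < Cmod (z - w) < d -> f z = g z) -> forall z, f z = g z.
Proof.
 intros Hf Hg Hd H z. apply Ceq_minus. revert z. apply (identity_thm (fun z => f z - g z)%C w).
 apply Entire_minus; auto. intros d' Hd'. destruct (punctured_ex w (Rmin d d')) as [z Hz]. pos. exists z.
 pose proof (Rmin_l d d'). pose proof (Rmin_r d d'). split. lra. apply (proj1 (Ceq_minus (f z) (g z))). apply H. lra.
Qed.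

Lemma ccont_punctured u v w d : 0 < d -> ccont u w -> ccont v w -> (forall z, 0 < Cmod (z - w) < d -> u z = v z) -> u w = v w.
Proof.
 intros Hd Hu Hv H. apply Ceq_small. intros e He. destruct (Hu (e/2) ltac:(lra)) as [d1 [D1 K1]].
 destruct (Hv (e/2) ltac:(lra)) as [d2 [D2 K2]]. assert (D : 0 < Rmin d (Rmin d1 d2)) by pos.
 destruct (punctured_ex w _ D) as [z Hz]. pose proof (Rmin_l d (Rmin d1 d2)). pose proof (Rmin_r d (Rmin d1 d2)).
 pose proof (Rmin_l d1 d2). pose proof (Rmin_r d1 d2). specialize (K1 z ltac:(lra)). specialize (K2 z ltac:(lra)).
 rewrite (H z ltac:(lra)) in K1. replace (u w - v w)%C with ((v z - v w) - (v z - u w))%C by ring.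
 le_trans Cmod_minus_le. lra.
Qed.

Lemma pow_unit_lt u v w a b d : 0 < d -> ccont u w -> ccont v w -> u w <> RtoC 0 -> (a < b)%nat -> (forall z, 0 < Cmod (z - w) < d -> ((z - w) ^ a * u z = (z - w) ^ b * v z)%C) -> False.
Proof.
 intros Hd Hu Hv Hn L H. apply Hn. rewrite (ccont_punctured u (fun z => (z - w) ^ (b - a) * v z)%C w d); auto.
 - destruct (b - a)%nat eqn:E; [lia|]. simpl. ring.
 - fin.
 - intros z Hz. assert (Z : (z - w)%C <> RtoC 0) by (apply Cmod_gt_0; lra).
  assert (P : ((z - w) ^ a)%C <> RtoC 0) by pos. specialize (H z Hz). replace b with (a + (b - a))%nat in H by lia.
  rewrite Cpow_add_r in H. replace (u z) with (/ (z - w) ^ a * ((z - w) ^ a * u z))%C by (field; auto). rewrite H.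
  field; auto.
Qed.

(** Stated on a punctured disc because a completed function is given by its formula only away from
    isolated points. *)
Lemma pow_unit_eq u v w a b d : 0 < d -> ccont u w -> ccont v w -> u w <> RtoC 0 -> v w <> RtoC 0 -> (forall z, 0 < Cmod (z - w) < d -> ((z - w) ^ a * u z = (z - w) ^ b * v z)%C) -> a = b.
Proof.
 intros Hd Hu Hv U V H. destruct (Nat.lt_trichotomy a b) as [L|[L|L]]; auto; exfalso. eapply (pow_unit_lt u v); eauto.
 eapply (pow_unit_lt v u w b a d); eauto. symmetry; auto.
Qed.

Lemma ord_unique f w k k' : is_ord f w k -> is_ord f w k' -> k = k'.
Proof.
 intros [g [G1 [G2 G3]]] [g' [G1' [G2' G3']]]. apply (pow_unit_eq g g' w k k' 1); auto using Rlt_0_1, Entire_ccont.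
 intros z _. rewrite <- G3. auto.
Qed.

Lemma ord_mult f g w a b : is_ord f w a -> is_ord g w b -> is_ord (fun z => f z * g z)%C w (a + b).
Proof.
 intros [f1 [F1 [F2 F3]]] [g1 [G1 [G2 G3]]]. exists (fun z => f1 z * g1 z)%C. split; [|split]. apply Entire_mult; auto.
 pos. intros z. rewrite F3, G3, Cpow_add_r. ring.
Qed.

Lemma ord_ext f g w k : (forall z, f z = g z) -> is_ord f w k -> is_ord g w k.
Proof. intros E [h [H1 [H2 H3]]]. exists h. repeat split; auto. congruence. Qed.

Lemma ord_zero_iff f w : Entire f -> is_ord f w 0 <-> f w <> RtoC 0.
Proof.
 split.
 - intros [g [G1 [G2 G3]]]. rewrite G3. rewrite Cmult_1_l. auto.
 - exists f. repeat split; auto. intros; ring.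
Qed.

(** The vanishing mean that expresses Cauchy's formula survives uniform limits on a circle;
    [series_of_mean] then provides a power series for the limit. *)
Lemma unif_limit_entire (F : nat -> C -> C) f : (forall n, Entire (F n)) ->
  (forall R e, 0 < R -> 0 < e -> exists N, forall n z, (N <= n)%nat -> Cmod z <= R -> Cmod (F n z - f z) <= e) -> Entire f.
Proof.
 intros HF HU z. pose proof PI2_pos as P. assert (Fc : forall v, ccont f v). { intros v e He. pose proof (Cmod_ge_0 v).
 destruct (HU (Cmod v + 1) (e/4) ltac:(lra) ltac:(lra)) as [N HN].
 destruct (Entire_ccont _ v (HF N) (e/4) ltac:(lra)) as [d [Hd K]]. exists (Rmin d 1). split. pos. intros u Hu.
 assert (A1 := Rlt_le_trans _ _ _ Hu (Rmin_l _ _)). assert (A2 := Rlt_le_trans _ _ _ Hu (Rmin_r _ _)).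
 specialize (K u A1). pose proof (Cmod_triangle_inv u v). pose proof (HN N u (le_n _) ltac:(lra)) as X1.
 pose proof (HN N v (le_n _) ltac:(lra)) as X2.
 replace (f u - f v)%C with ((F N u - F N v) + ((F N v - f v) - (F N u - f u)))%C by ring. eapply Rle_lt_trans.
 apply Cmod_triangle. pose proof (Cmod_minus_le (F N v - f v) (F N u - f u)). lra. } set (r := Cmod z + 1).
 assert (Hr : 0 < r) by (unfold r; pose proof (Cmod_ge_0 z); lra).
 assert (Rc : forall t, rcont (fun t => f (circ r t)) t) by (intros; apply rcont_circ, Fc).
 apply (pser_holo (ccoef f r) r). 3: unfold r; lra. {
 destruct (rcont_bounded (fun t => f (circ r t)) 0 (2 * PI)) as [M [M0 HM]]; [lra|auto|]. exists M. split; auto.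
 intros n. le_via (Cmod (ccoef f r n) * r ^ n). fin. apply ccoef_bound; auto. } intros w Hw. apply series_of_mean; auto.
 apply Cmod_zero_iff, le_epsilon. intros e He. set (A := r / (r - Cmod w) * (2 * PI)).
 assert (HA : 0 < A) by (unfold A; fin). assert (H2A : 0 < e / (2 * A)) by (pos).
 destruct (HU r (e / (2 * A)) Hr H2A) as [N HN]. set (d := fun z => (F N z - f z)%C).
 assert (RF : forall t, rcont (fun t => F N (circ r t)) t) by (intros; apply rcont_circ, Entire_ccont, HF).
 assert (Rd : forall t, rcont (fun t => d (circ r t)) t) by fin.
 pose proof (cauchy_mean (F N) (r + 1) (fun v _ => HF N v) w r ltac:(lra)) as CF.
 rewrite (MV_ext _ (fun z => (F N z - F N w) * (z / (z - w)) + (-1) * ((d z - d w) * (1 * (z / (z - w)))))%C) by (intros; unfold d; ring).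
 assert (RK : forall t, rcont (fun t => circ r t / (circ r t - w))%C t) by fin.
 rewrite (MV_plus (fun z => (F N z - F N w) * (z / (z - w)))%C (fun z => (-1) * ((d z - d w) * (1 * (z / (z - w)))))%C), CF, (MV_scal (-1) (fun z => (d z - d w) * (1 * (z / (z - w))))%C), Cplus_0_l, Cmod_mult by fin.
 replace (Cmod (-1)) with 1 by (rewrite Cmod_R, Rabs_left; lra). rewrite Rmult_1_l. eapply Rle_trans.
 apply (kernel_bound (fun z => (d z - d w)%C) (fun _ => RtoC 1) w r (2 * (e / (2 * A))) 1); auto; try lra.
 - fin.
 - fin.
 - intros t Ht. le_trans Cmod_minus_le. pose proof (HN N w (le_n _) ltac:(lra)).
  pose proof (HN N (circ r t) (le_n _) ltac:(rewrite Cmod_circ; lra)). unfold d. lra.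
 - intros; rewrite Cmod_1; lra.
 - replace (2 * (e / (2 * A)) * (1 * (r / (r - Cmod w))) * (2 * PI)) with (e / A * A) by (unfold A at 2; field; lra).
  right; field; lra.
Qed.

Lemma zero_deriv_const f R : (forall z, Cmod z < R -> cdiff f z 0) -> forall z, Cmod z < R -> f z = f 0.
Proof.
 intros H z Hz. apply Ceq_minus. assert (D : forall t, 0 <= t <= 1 -> rdiff (fun t => f (RtoC t * z)%C) t 0). {
 intros t Ht. eapply rdiff_eq. apply cdiff_rdiff. apply H. rewrite Cmod_mult, Cmod_R, Rabs_pos_eq by lra.
 pose proof (Cmod_ge_0 z). nra. apply rdiff_mult. apply rdiff_id. apply rdiff_const. ring. }
 assert (E : is_CI (fun _ => RtoC 0) 0 1 (f (RtoC 1 * z) - f (RtoC 0 * z))%C). {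
 apply (is_CI_FTC (fun t => f (RtoC t * z)%C)). rewrite Rmin_left, Rmax_right by lra. auto. fin. }
 apply is_CI_unique in E. rewrite CI_const in E. replace (RtoC 1 * z)%C with z in E by ring.
 replace (RtoC 0 * z)%C with (RtoC 0) in E by ring. rewrite <- E. ring.
Qed.

(** The logarithm is the power series obtained by integrating that of [g'/g]; then [g e^(-l)] has
    derivative zero. *)
Lemma holo_log g g' R : 0 < R -> (forall z, Cmod z < R -> cdiff g z (g' z)) -> (forall z, Cmod z < R -> g z <> RtoC 0) ->
  exists l c, coef_ok c R /\ (forall z, Cmod z < R -> cser (fun n => c n * z ^ n)%C (l z)) /\ l 0 = RtoC 0 /\
   (forall z, Cmod z < R -> cdiff l z (g' z / g z)%C) /\ (forall z, Cmod z < R -> g z = (g 0 * cexp (l z))%C).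
Proof.
 intros HR Hg Hnz. destruct (holo_deriv g R HR) as [g'' [D1 D2]]. { fin. }
 assert (Eg : forall z, Cmod z < R -> g'' z = g' z) by (intros z Hz; eapply cdiff_unique; eauto).
 assert (HQ : forall z, Cmod z < R -> exists l, cdiff (fun z => g'' z / g z)%C z l). { intros z Hz.
 destruct (D2 z Hz) as [m Hm]. eexists. apply cdiff_div; eauto. } destruct (holo_pser _ R HR HQ) as [b [B1 [_ B2]]].
 set (c := fun n => match n with O => RtoC 0 | S m => (/ CN (S m) * b m)%C end).
 assert (NS : forall m, CN (S m) <> RtoC 0). { intros m E. apply RtoC_inj in E. rewrite S_INR in E.
 pose proof (pos_INR m). lra. } assert (Hdc : forall n, dcoef c n = b n). { intros n. unfold dcoef.
 change (c (S n)) with (/ CN (S n) * b n)%C. rewrite Cmult_assoc, Cinv_r by fin. ring. } assert (Hc : coef_ok c R). {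
 intros r Hr. destruct (B1 r Hr) as [M [M0 HM]]. exists (M * r). split. nra. destruct n.
 - simpl. rewrite Cmod_0. nra.
 - change (c (S n)) with (/ CN (S n) * b n)%C. rewrite Cmod_mult, Cmod_inv, Cmod_R by fin.
  rewrite (Rabs_pos_eq (INR (S n))) by pos. specialize (HM n). assert (/ INR (S n) <= 1). { rewrite <- Rinv_1; fin. }
  assert (0 < / INR (S n)) by pos.
  replace (/ INR (S n) * Cmod (b n) * r ^ S n) with (/ INR (S n) * (Cmod (b n) * r ^ n) * r) by (simpl; ring). le_mul_r.
  lra. nra. } destruct (pser_fun c R Hc) as [l [l' [L1 [L2 L3]]]].
  assert (El : forall z, Cmod z < R -> l' z = (g' z / g z)%C). { intros z Hz. rewrite <- (Eg z Hz).
  apply (cser_unique (fun n => b n * z ^ n)%C); auto. apply (cser_ext (fun n => dcoef c n * z ^ n)%C). congruence. auto.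
  } assert (Hl : forall z, Cmod z < R -> cdiff l z (g' z / g z)%C) by (intros z Hz; rewrite <- El; auto).
  assert (Hl0 : l 0 = RtoC 0). { apply (pser_at_0 c). apply L1. rewrite Cmod_0; auto. } exists l, c. repeat split; auto.
  intros z Hz. assert (K : (g z * cexp (- l z) = g 0 * cexp (- l 0))%C). {
  apply (zero_deriv_const (fun z => g z * cexp (- l z))%C R); auto. intros v Hv. eapply cdiff_eq. apply cdiff_mult.
  auto. apply cdiff_comp. fin. apply cdiff_opp. apply Hl; auto. cbv beta. generalize (cexp (- l v)). intros q. field.
  auto. } rewrite Hl0 in K. replace (- RtoC 0)%C with (RtoC 0) in K by ring. rewrite cexp_0, Cmult_1_r in K.
  rewrite <- K, <- Cmult_assoc, cexp_opp. ring.
Qed.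

(** * Unconditional sums over divisors *)

Definition lsumC (F : C -> C) (l : list C) : C := fold_right (fun z acc => Cplus (F z) acc) (RtoC 0) l.
Definition lsumR (F : C -> R) (l : list C) : R := fold_right (fun z acc => F z + acc) 0 l.
Definition lprod (F : C -> C) (l : list C) : C := fold_right (fun z acc => Cmult (F z) acc) (RtoC 1) l.

Lemma lsumC_perm F l l' : Permutation l l' -> lsumC F l = lsumC F l'.
Proof. induction 1; simpl; try congruence. ring. Qed.
Lemma lsumR_perm F l l' : Permutation l l' -> lsumR F l = lsumR F l'.
Proof. induction 1; simpl; try congruence. ring. Qed.
Lemma lsumC_app F l l' : lsumC F (l ++ l') = (lsumC F l + lsumC F l')%C.
Proof. induction l; simpl. ring. rewrite IHl. ring. Qed.
Lemma lsumR_app F l l' : lsumR F (l ++ l') = lsumR F l + lsumR F l'.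
Proof. induction l; simpl; fin. Qed.
Lemma lsumC_Cmod F l : Cmod (lsumC F l) <= lsumR (fun z => Cmod (F z)) l.
Proof. induction l; simpl. rewrite Cmod_0; lra. fin. Qed.
Lemma lsumR_le F G l : (forall z, In z l -> F z <= G z) -> lsumR F l <= lsumR G l.
Proof. induction l; simpl; intros H; fin. Qed.
Lemma lsumR_scal c F l : lsumR (fun z => c * F z) l = c * lsumR F l.
Proof. induction l; simpl; fin. Qed.
Lemma lsumC_scal c F l : lsumC (fun z => c * F z)%C l = (c * lsumC F l)%C.
Proof. induction l; simpl. ring. rewrite IHl. ring. Qed.
Lemma lsumC_plus F G l : lsumC (fun z => F z + G z)%C l = (lsumC F l + lsumC G l)%C.
Proof. induction l; simpl. ring. rewrite IHl. ring. Qed.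
Lemma lsumC_ext F G l : (forall z, In z l -> F z = G z) -> lsumC F l = lsumC G l.
Proof. induction l; simpl; intros H; auto. rewrite H, IHl; auto. Qed.
Lemma lsumR_ext F G l : (forall z, In z l -> F z = G z) -> lsumR F l = lsumR G l.
Proof. induction l; simpl; intros H; auto. rewrite H, IHl; auto. Qed.

Lemma incl_perm (l l' : list C) : NoDup l -> incl l l' -> exists r, Permutation l' (l ++ r).
Proof.
 revert l'. induction l as [|a l IH]; intros l' Hn Hi.
 - exists l'; fin.
 - destruct (in_split a l' (Hi a (or_introl eq_refl))) as [l1 [l2 E]]. inversion Hn; subst.
  destruct (IH (l1 ++ l2)) as [r Hr]; auto.
  + intros x Hx. specialize (Hi x (or_intror Hx)). apply in_app_or in Hi. apply in_or_app.
   destruct Hi as [Hi|[Hi|Hi]]; auto. congruence.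
  + exists r. simpl. rewrite <- Hr. symmetry. apply Permutation_middle.
Qed.

Lemma NoDup_ext_list (l l0 : list C) : NoDup l -> exists l', NoDup l' /\ incl l l' /\ incl l0 l' /\ (forall z, In z l' -> In z l \/ In z l0).
Proof.
 exists (nodup Ceq_dec (l ++ l0)). split; [apply NoDup_nodup|].
 repeat split; try (intros x Hx; apply nodup_In, in_or_app; auto). intros z Hz. apply nodup_In, in_app_or in Hz. auto.
Qed.

Definition wsum (d : C -> R) (F : C -> C) (l : list C) : C := lsumC (fun z => RtoC (d z) * F z)%C l.

(** Summable family over all points of C with real weights [d]. Real weights can be added and
    subtracted, which is how the zeros of [E] are later split into zeros of the completed function
    and poles of Gamma factors. *)
Definition SumDiv (d : C -> R) (F : C -> C) (S : C) : Prop :=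
  forall eps, 0 < eps -> exists l0, NoDup l0 /\
    forall l, NoDup l -> incl l0 l -> Cmod (wsum d F l - S) <= eps.

Lemma SD_unique d F S S' : SumDiv d F S -> SumDiv d F S' -> S = S'.
Proof.
 intros H H'. apply Ceq_small. intros e He. destruct (H (e/2) ltac:(lra)) as [l [N K]].
 destruct (H' (e/2) ltac:(lra)) as [l' [N' K']]. destruct (NoDup_ext_list l l' N) as [L [L1 [L2 [L3 _]]]].
 specialize (K L L1 L2). specialize (K' L L1 L3).
 replace (S - S')%C with ((wsum d F L - S') - (wsum d F L - S))%C by ring. le_trans Cmod_minus_le. lra.
Qed.

Lemma SD_plus d1 d2 F S1 S2 : SumDiv d1 F S1 -> SumDiv d2 F S2 -> SumDiv (fun z => d1 z + d2 z) F (S1 + S2)%C.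
Proof.
 intros H H' e He. destruct (H (e/2) ltac:(lra)) as [l [N K]]. destruct (H' (e/2) ltac:(lra)) as [l' [N' K']].
 destruct (NoDup_ext_list l l' N) as [L [L1 [L2 [L3 _]]]]. exists L. split; auto. intros M M1 M2.
 specialize (K M M1 (incl_tran L2 M2)). specialize (K' M M1 (incl_tran L3 M2)).
 replace (wsum (fun z => d1 z + d2 z) F M) with (wsum d1 F M + wsum d2 F M)%C.
 - replace (wsum d1 F M + wsum d2 F M - (S1 + S2))%C with ((wsum d1 F M - S1) + (wsum d2 F M - S2))%C by ring; fin.
 - unfold wsum. rewrite <- lsumC_plus. apply lsumC_ext. intros; rewrite RtoC_plus; ring.
Qed.

Lemma SD_scal c d F S : SumDiv d F S -> SumDiv (fun z => c * d z) F (RtoC c * S)%C.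
Proof.
 intros H e He. pose proof (Rabs_pos c). destruct (H (e / (Rabs c + 1))) as [l [N K]]. pos. exists l. split; auto.
 intros M M1 M2. replace (wsum (fun z => c * d z) F M) with (RtoC c * wsum d F M)%C.
 - replace (RtoC c * wsum d F M - RtoC c * S)%C with (RtoC c * (wsum d F M - S))%C by ring. rewrite Cmod_mult, Cmod_R.
  le_via ((Rabs c + 1) * (e / (Rabs c + 1))). 2: right; field; lra. fin.
 - unfold wsum. rewrite <- lsumC_scal. apply lsumC_ext. intros; rewrite RtoC_mult; ring.
Qed.

Lemma SD_ext d d' F F' S : (forall z, d z = d' z) -> (forall z, d z <> 0 -> F z = F' z) -> SumDiv d F S -> SumDiv d' F' S.
Proof.
 intros Hd HF H e He. destruct (H e He) as [l [N K]]. exists l. split; auto. intros M M1 M2.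
 replace (wsum d' F' M) with (wsum d F M); auto. apply lsumC_ext. intros z _. rewrite <- Hd.
 destruct (Req_dec (d z) 0) as [E|E]. rewrite E. ring. rewrite HF; auto.
Qed.

Lemma SD_indicator (z0 : C) F : SumDiv (fun z => if Ceq_dec z z0 then 1 else 0) F (F z0).
Proof.
 intros e He. exists (z0 :: nil). split. repeat constructor; auto. intros l Hl Hi.
 assert (E : wsum (fun z => if Ceq_dec z z0 then 1 else 0) F l = F z0). {
 destruct (incl_perm (z0 :: nil) l) as [r Hr]; auto. repeat constructor; auto. unfold wsum.
 rewrite (lsumC_perm _ _ _ Hr). simpl. destruct (Ceq_dec z0 z0); [|congruence].
 assert (NoDup (z0 :: r)) by (eapply Permutation_NoDup; eauto). inversion H.
 rewrite (lsumC_ext _ (fun _ => RtoC 0 * RtoC 0)%C). rewrite lsumC_scal. ring. intros z Hz. destruct (Ceq_dec z z0).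
 congruence. ring. } rewrite E, Cmod_self. lra.
Qed.

Lemma wsum_ext_zero d F l L : NoDup l -> NoDup L -> incl l L -> (forall z, In z L -> In z l \/ d z = 0) -> wsum d F L = wsum d F l.
Proof.
 intros N NL I H. destruct (incl_perm l L N I) as [r Hr]. unfold wsum. rewrite (lsumC_perm _ _ _ Hr), lsumC_app.
 rewrite (lsumC_ext _ (fun _ => RtoC 0 * RtoC 0)%C r). rewrite lsumC_scal. ring. intros z Hz.
 assert (HL : NoDup (l ++ r)) by (eapply Permutation_NoDup; eauto). destruct (H z) as [Hi|E]. { eapply Permutation_in.
 symmetry; exact Hr. apply in_or_app; auto. } 2: rewrite E; ring. exfalso. clear - HL Hz Hi. induction l. tauto.
 inversion HL. destruct Hi. subst. apply H1, in_or_app; auto. auto.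
Qed.

Section Abs.
Variables (d : C -> R) (F : C -> C) (W : C -> R) (M : R).
Hypothesis Hd : forall z, 0 <= d z.
Hypothesis HW : forall z, 0 <= W z.
Hypothesis HM : forall l, NoDup l -> lsumR (fun z => d z * W z) l <= M.

Lemma abs_tail : forall e, 0 < e -> exists l0, NoDup l0 /\ forall l, NoDup l -> incl l0 l ->
   lsumR (fun z => d z * W z) l <= lsumR (fun z => d z * W z) l0 + e.
Proof.
 intros e He. destruct (completeness (fun r => exists l, NoDup l /\ r = lsumR (fun z => d z * W z) l)) as [S [S1 S2]].
 - exists M. intros r [l [N E]]; subst; auto.
 - exists 0. exists nil. split; auto. constructor.
 - apply NNPP. intros Hno. assert (S <= S - e); [|lra]. apply S2. intros r [l [N E]]. apply Rnot_lt_le. intros Hlt.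
  apply Hno. exists l. split; auto. intros l' N' _. assert (lsumR (fun z => d z * W z) l' <= S); fin.
Qed.

Lemma wsum_diff l l' : NoDup l -> incl l l' -> (forall z, d z <> 0 -> Cmod (F z) <= W z) ->
  Cmod (wsum d F l' - wsum d F l) <= lsumR (fun z => d z * W z) l' - lsumR (fun z => d z * W z) l.
Proof.
 intros N I HF. destruct (incl_perm l l' N I) as [r Hr]. unfold wsum.
 rewrite (lsumC_perm _ _ _ Hr), (lsumR_perm _ _ _ Hr), lsumC_app, lsumR_app.
 match goal with |- Cmod (?a + ?b - ?a) <= _ => replace (a + b - a)%C with b by ring end. le_trans lsumC_Cmod.
 match goal with |- _ <= ?a + ?b - ?a => replace (a + b - a) with b by ring end. apply lsumR_le. intros z _.
 rewrite Cmod_mult, Cmod_R, Rabs_pos_eq by auto. destruct (Req_dec (d z) 0) as [E|E]. rewrite E; lra. fin.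
Qed.

(** Absolute convergence gives a Cauchy net of finite sums; the limit is reached along finite sets
    [L n] with error [1/(n+1)]. *)
Lemma SD_exists : (forall z, d z <> 0 -> Cmod (F z) <= W z) -> exists S, SumDiv d F S.
Proof.
 intros HF.
 assert (Q : forall n : nat, exists l0, NoDup l0 /\ forall l l', NoDup l -> NoDup l' -> incl l0 l -> incl l0 l' -> Cmod (wsum d F l - wsum d F l') <= / INR (S n)).
 { intros n. assert (P : 0 < / INR (S n)) by fin. destruct (abs_tail (/ INR (S n) / 2) ltac:(lra)) as [l0 [N0 K]].
 exists l0. split; auto. intros l l' N N' I I'. pose proof (wsum_diff l0 l N0 I HF).
 pose proof (wsum_diff l0 l' N0 I' HF). specialize (K l N I) as K1. specialize (K l' N' I') as K2.
 replace (wsum d F l - wsum d F l')%C with ((wsum d F l - wsum d F l0) - (wsum d F l' - wsum d F l0))%C by ring.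
 le_trans Cmod_minus_le. lra. } set (L := fun n => proj1_sig (constructive_indefinite_description _ (Q n))).
 assert (HL : forall n, NoDup (L n) /\ forall l l', NoDup l -> NoDup l' -> incl (L n) l -> incl (L n) l' -> Cmod (wsum d F l - wsum d F l') <= / INR (S n)).
 { intros n. apply proj2_sig. }
 assert (Hu : forall n m, Cmod (wsum d F (L m) - wsum d F (L n)) <= / INR (S n) + / INR (S m)). { intros n m.
 destruct (NoDup_ext_list (L n) (L m) (proj1 (HL n))) as [l [L1 [L2 [L3 _]]]].
 pose proof (proj2 (HL n) l (L n) L1 (proj1 (HL n)) L2 (incl_refl _)).
 pose proof (proj2 (HL m) l (L m) L1 (proj1 (HL m)) L3 (incl_refl _)).
 replace (wsum d F (L m) - wsum d F (L n))%C with ((wsum d F l - wsum d F (L n)) - (wsum d F l - wsum d F (L m)))%C by ring.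
 le_trans Cmod_minus_le. lra. } destruct (limit_rate (fun n => wsum d F (L n)) (fun n => 2 * / INR (S n))) as [S HS]. {
 intros n m Hnm. le_trans Hu. assert (/ INR (S m) <= / INR (S n)) by fin. lra. } { intros e He.
 apply inv_INR_small; lra. } exists S. intros e He. destruct (inv_INR_small 3 e ltac:(lra) He) as [n Hn].
 specialize (Hn n (le_n _)). exists (L n). split. apply HL. intros l Nl Il.
 pose proof (proj2 (HL n) l (L n) Nl (proj1 (HL n)) Il (incl_refl _)). specialize (HS n). rewrite Cmod_minus_sym in HS.
 replace (wsum d F l - S)%C with ((wsum d F l - wsum d F (L n)) + (wsum d F (L n) - S))%C by ring; fin.
Qed.

(** Absolute convergence already provides some sum. To identify it, partial sums over suitable
    finite sets suffice, for instance over the zeros in large discs. *)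
Lemma SD_along (S : C) : (forall z, d z <> 0 -> Cmod (F z) <= W z) ->
  (forall eps l0, 0 < eps -> NoDup l0 -> exists l, NoDup l /\ (forall z, In z l0 -> d z <> 0 -> In z l) /\ Cmod (wsum d F l - S) <= eps) -> SumDiv d F S.
Proof.
 intros HF H. destruct (SD_exists HF) as [S' HS]. replace S with S'; auto. apply Ceq_small. intros e He.
 destruct (HS (e/2) ltac:(lra)) as [l0 [N0 K]]. destruct (H (e/2) l0 ltac:(lra) N0) as [l [N [I Q]]].
 destruct (NoDup_ext_list l l0 N) as [L [L1 [L2 [L3 L4]]]]. specialize (K L L1 L3).
 assert (E : wsum d F L = wsum d F l). { apply wsum_ext_zero; auto. intros z Hz. destruct (L4 z Hz) as [|H0]; auto.
 destruct (Req_dec (d z) 0); auto. } rewrite E in K.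
 replace (S' - S)%C with ((wsum d F l - S) - (wsum d F l - S'))%C by ring. le_trans Cmod_minus_le. lra.
Qed.
End Abs.

(** The sum is continuous in [F] for the norm [sup |F| / W]. This carries the explicit formula from
    polynomials to all test functions. *)
Lemma SD_approx (d : C -> R) (W : C -> R) M F S : (forall z, 0 <= d z) -> (forall z, 0 <= W z) ->
  (forall l, NoDup l -> lsumR (fun z => d z * W z) l <= M) ->
  (forall eps, 0 < eps -> exists F' S', SumDiv d F' S' /\ Cmod (S' - S) <= eps /\ forall z, d z <> 0 -> Cmod (F' z - F z) <= eps * W z) ->
  SumDiv d F S.
Proof.
 intros Hd HW HM H e He. assert (M0 : 0 <= M). { specialize (HM nil (NoDup_nil _)); fin. } set (e' := e / (M + 2)).
 assert (He' : 0 < e') by (apply Rdiv_lt_0_compat; lra). destruct (H e' He') as [F' [S' [H1 [H2 H3]]]].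
 destruct (H1 e' He') as [l0 [N0 K]]. exists l0. split; auto. intros l N I. specialize (K l N I).
 replace (wsum d F l - S)%C with ((-1) * wsum d (fun z => F' z - F z) l + ((wsum d F' l - S') + (S' - S)))%C.
 - le_trans Cmod_triangle. rewrite Cmod_mult, Cmod_R. replace (Rabs (-1)) with 1 by (rewrite Rabs_left; lra).
  assert (B : Cmod (wsum d (fun z => F' z - F z)%C l) <= e' * M). { le_trans lsumC_Cmod. eapply Rle_trans.
  2: le_mul_l; [lra|apply (HM l N)]. rewrite <- lsumR_scal. apply lsumR_le. intros z _.
  rewrite Cmod_mult, Cmod_R, Rabs_pos_eq by auto. destruct (Req_dec (d z) 0) as [E|E]. rewrite E; lra.
  specialize (H3 z E). specialize (Hd z). nra. } pose proof (Cmod_triangle (wsum d F' l - S') (S' - S)).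
  le_via (e' * (M + 2)). 2: right; unfold e'; field; lra. lra.
 - assert (E : wsum d (fun z => F' z - F z)%C l = (wsum d F' l + (-1) * wsum d F l)%C). { unfold wsum.
  rewrite <- lsumC_scal, <- lsumC_plus. apply lsumC_ext. intros; ring. } rewrite E. ring.
Qed.

Lemma SD_translate d F S s : SumDiv d F S -> SumDiv (fun z => d (s + z)%C) (fun z => F (s + z)%C) S.
Proof.
 assert (Inj : forall x y : C, (s + x)%C = (s + y)%C -> x = y). { intros x y E. apply Ceq_minus. apply Ceq_minus in E.
 rewrite <- E. ring. } assert (Inj' : forall x y : C, (x - s)%C = (y - s)%C -> x = y). { intros x y E. apply Ceq_minus.
 apply Ceq_minus in E. rewrite <- E. ring. } intros H e He. destruct (H e He) as [l0 [N0 K]].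
 exists (map (fun z => z - s)%C l0). split. { apply FinFun.Injective_map_NoDup; auto. } intros l N I.
 assert (E : wsum d F (map (fun z => s + z)%C l) = wsum (fun z => d (s + z)%C) (fun z => F (s + z)%C) l). { clear.
 induction l; simpl; auto. congruence. } rewrite <- E. apply K. apply FinFun.Injective_map_NoDup; auto. intros z Hz.
 apply in_map_iff. exists (z - s)%C. split. ring. apply I. apply in_map_iff; fin.
Qed.

(** In [sum_over_zeros] the finite sets consist of pairs of a zero and its order. Since the order is
    determined by the zero, such lists have distinct first components. *)
Lemma SD_zeros (f F : C -> C) (n : C -> nat) (d : C -> R) S : (forall z k, zero_of_order f z k <-> (1 <= k)%nat /\ k = n z) ->
  (forall z, d z = INR (n z)) -> SumDiv d F S -> sum_over_zeros f F S.
Proof.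
 intros Hn Hd H e He. destruct (H (e/2) ltac:(lra)) as [l0 [N0 K]].
 set (nz := fun z => if Nat.eq_dec (n z) 0 then false else true). exists (map (fun z => (z, n z)) (filter nz l0)).
 split.
 - split.
  + apply FinFun.Injective_map_NoDup. congruence. apply NoDup_filter; auto.
  + apply Forall_forall. intros [z k] Hz. apply in_map_iff in Hz. destruct Hz as [z' [E Hz]]. inversion E; subst.
   apply filter_In in Hz. unfold nz in Hz. simpl. apply Hn. destruct (Nat.eq_dec (n z) 0); fin.
 - intros l [Nl Fl] Il. rewrite Forall_forall in Fl. assert (Ord : forall p, In p l -> snd p = n (fst p)). {
  intros p Hp. specialize (Fl p Hp). apply Hn in Fl. tauto. } assert (Nf : NoDup (map fst l)). { clear - Nl Ord.
  induction l. constructor. inversion Nl. constructor.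
 - intros Hin. apply in_map_iff in Hin. destruct Hin as [p [E Hp]]. destruct p as [p1 p2], a as [a1 a2]. simpl in E.
  subst. pose proof (Ord (a1, a2) (or_introl eq_refl)). pose proof (Ord (a1, p2) (or_intror Hp)). simpl in *.
  congruence.
 - apply IHl; auto. intros p Hp; apply Ord; right; auto. } assert (E : zsum_list F l = wsum d F (map fst l)). {
  clear - Ord Hd. induction l as [|p l IH]; simpl; auto. rewrite IH by (intros; apply Ord; right; auto).
  rewrite Hd, <- Ord by (left; auto); fin. } rewrite E.
  destruct (NoDup_ext_list (map fst l) l0 Nf) as [L [L1 [L2 [L3 L4]]]]. specialize (K L L1 L3).
  assert (E2 : wsum d F L = wsum d F (map fst l)). { apply wsum_ext_zero; auto. intros z Hz.
  destruct (L4 z Hz) as [|H0]; auto. destruct (Nat.eq_dec (n z) 0) as [Ez|Ez]. rewrite Hd, Ez; auto. left.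
  apply in_map_iff. exists (z, n z). split; auto. apply Il, in_map_iff. exists z. split; auto. apply filter_In.
  unfold nz. destruct (Nat.eq_dec (n z) 0); auto. } rewrite <- E2. lra.
Qed.

(** * Zero counting and partial fractions of the logarithmic derivative *)

Lemma pow_ge_1 x k : 1 <= x -> 1 <= x ^ k.
Proof. intros. pos. Qed.

(** Maximum principle for circles centred at the point in question. *)
Lemma Entire_mean g z r : Entire g -> 0 < r -> forall M, (forall v, Cmod (v - z) = r -> Cmod (g v) <= M) -> Cmod (g z) <= M.
Proof.
 intros Hg Hr M HM. pose proof PI2_pos. assert (HG : Entire (fun v => g (z + v)%C)). { fin. }
 pose proof (MV_mean (fun v => g (z + v)%C) r (r + 1) ltac:(lra) (fun v _ => HG v) (Entire_ccont _ _ HG)) as E.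
 cbv beta in E. replace (z + 0)%C with z in E by ring. assert (B : Cmod (MV (fun v => g (z + v)%C) r) <= M * (2 * PI)).
 { apply MV_bound. intros t. apply (rcont_circ (fun v => g (z + v)%C)); fin. intros t _. apply HM.
 replace (z + circ r t - z)%C with (circ r t) by ring. apply Cmod_circ; lra. }
 rewrite E, Cmod_mult, Cmod_R, Rabs_pos_eq in B by lra. nra.
Qed.

Section PF.
Variables (f f' : C -> C) (n : C -> nat) (K : R) (N : nat).
Hypothesis Hf : Entire f.
Hypothesis Hf' : forall z, cdiff f z (f' z).
Hypothesis Hn : forall z, is_ord f z (n z).
Hypothesis HK : 0 <= K.
Hypothesis Hg : forall z, Cmod (f z) <= exp (K * (1 + Cmod z) ^ N).
Hypothesis Hf0 : f 0 <> RtoC 0.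

Definition rootprod (l : list C) (z : C) : C := lprod (fun w => (z - w) ^ n w)%C l.
Definition lsumN (l : list C) : nat := fold_right (fun w a => (n w + a)%nat) O l.

(** The cofactor keeps the orders outside the list, so the zeros can be divided out one at a
    time. *)
Lemma factor_list l : NoDup l -> exists g, Entire g /\ (forall z, f z = (rootprod l z * g z)%C) /\
  (forall w, In w l -> g w <> RtoC 0) /\ (forall w, ~ In w l -> is_ord g w (n w)).
Proof.
 induction l as [|a l IH]; intros Hl.
 - exists f. split; auto. split. intros; simpl; ring. auto.
 - inversion Hl. destruct (IH H2) as [g [G1 [G2 [G3 G4]]]]. destruct (G4 a H1) as [h [E1 [E2 E3]]]. exists h.
  split; auto. split; [|split].
  + intros z. rewrite G2, E3. unfold rootprod; simpl. ring.
  + intros w [Hw|Hw]. subst; auto. specialize (G3 w Hw). rewrite E3 in G3. intros E. apply G3. rewrite E. ring.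
  + intros w Hw. assert (Hw' : ~ In w l /\ a <> w) by (simpl in Hw; tauto). destruct Hw' as [W1 W2].
   destruct (ord_exists h w E1 (ex_intro _ a E2)) as [k Hk]. assert (O0 : is_ord (fun z => (z - a) ^ n a)%C w 0). {
   apply ord_zero_iff. fin. apply Cpow_neq_0. intros E. apply W2. symmetry. apply Ceq_minus; auto. }
   pose proof (ord_ext _ _ _ _ (fun z => eq_sym (E3 z)) (ord_mult _ _ _ _ _ O0 Hk)) as O2. replace (n w) with k; auto.
   apply (ord_unique g w); auto.
Qed.

Lemma rootprod_ge l z rho : 0 <= rho -> (forall w, In w l -> rho <= Cmod (z - w)) -> rho ^ lsumN l <= Cmod (rootprod l z).
Proof. intros Hr. induction l; simpl; intros H. rewrite Cmod_1; lra. rewrite Cmod_mult, Cmod_pow, pow_add; fin. Qed.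
Lemma rootprod_le l z rho : (forall w, In w l -> Cmod (z - w) <= rho) -> Cmod (rootprod l z) <= rho ^ lsumN l.
Proof. induction l; simpl; intros H. rewrite Cmod_1; lra. rewrite Cmod_mult, Cmod_pow, pow_add; fin. Qed.

Lemma f_circle_bound z X : Cmod z <= X -> Cmod (f z) <= exp (K * (1 + X) ^ N).
Proof. intros H. eapply Rle_trans; fin. Qed.

(** On the circle of radius [6R] about [z] all moduli lie between [5R] and [7R], hence every factor
    of the product of roots is at least [4R] there. *)
Lemma g_bound l g R z : NoDup l -> 1 <= R -> (forall w, In w l -> Cmod w <= R) -> Entire g -> (forall z, f z = (rootprod l z * g z)%C) ->
  Cmod z <= R -> Cmod (g z) * (4 * R) ^ lsumN l <= exp (K * (1 + 7 * R) ^ N).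
Proof.
 intros Hl HR Hin G1 G2 Hz. set (D := lsumN l). assert (P : 0 < (4 * R) ^ D) by pos.
 assert (B : Cmod (g z) <= exp (K * (1 + 7 * R) ^ N) / (4 * R) ^ D). { apply (Entire_mean g z (6 * R)); auto. lra.
 intros v Hv. assert (V1 : Cmod v <= 7 * R). { pose proof (Cmod_triangle_inv v z). lra. } assert (V2 : 5 * R <= Cmod v).
 { pose proof (Cmod_triangle (v - z) z). pose proof (Cmod_triangle_inv (v - z) (- z)).
 replace (v - z - - z)%C with v in H0 by ring. rewrite Cmod_opp in H0. lra. }
 assert (V3 : (4 * R) ^ D <= Cmod (rootprod l v)). { apply rootprod_ge. lra. intros w Hw. specialize (Hin w Hw).
 pose proof (Cmod_triangle_inv v w). lra. } pose proof (f_circle_bound v (7 * R) V1) as F1. rewrite G2, Cmod_mult in F1.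
 apply Rmult_le_reg_r with ((4 * R) ^ D); auto.
 replace (exp (K * (1 + 7 * R) ^ N) / (4 * R) ^ D * (4 * R) ^ D) with (exp (K * (1 + 7 * R) ^ N)) by (field; lra).
 eapply Rle_trans. 2: exact F1. rewrite Rmult_comm; fin. }
 le_via (exp (K * (1 + 7 * R) ^ N) / (4 * R) ^ D * (4 * R) ^ D). fin. right; field; lra.
Qed.

(** Growth constant of [f / f(0)]; it absorbs the size of [f(0)]. *)
Definition Af : R := K + Rabs (ln (Cmod (f 0))).

Lemma Af_pos : 0 <= Af. Proof. unfold Af; fin. Qed.

Lemma exp_over_f0 X : 1 <= X -> exp (K * X ^ N) / Cmod (f 0) <= exp (Af * X ^ N).
Proof.
 intros HX. assert (H0 : 0 < Cmod (f 0)) by pos. unfold Rdiv. rewrite <- (exp_ln (Cmod (f 0))) at 1 by auto.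
 rewrite <- exp_Ropp, <- exp_plus. apply exp_le. unfold Af. pose proof (pow_ge_1 X N HX).
 pose proof (Rle_abs (- ln (Cmod (f 0)))). rewrite Rabs_Ropp in H1. pose proof (Rabs_pos (ln (Cmod (f 0)))). nra.
Qed.

Lemma f0_le l g R : 1 <= R -> (forall w, In w l -> Cmod w <= R) -> (forall z, f z = (rootprod l z * g z)%C) ->
  Cmod (f 0) <= R ^ lsumN l * Cmod (g 0).
Proof.
 intros HR Hin G2. rewrite G2, Cmod_mult. le_mul_r. pos. apply rootprod_le. intros w Hw.
 replace (0 - w)%C with (- w)%C by ring. rewrite Cmod_opp. auto.
Qed.

(** Jensen's inequality in multiplicative form. With [D] zeros the product of roots is at most [R^D]
    at 0, while the cofactor is smaller by [(4R)^D] than the growth bound; so [4^D |f(0)|] is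
    bounded, and [e <= 4] turns this into a bound for [D]. *)
Lemma count_bound l R : NoDup l -> 1 <= R -> (forall w, In w l -> Cmod w <= R) -> INR (lsumN l) <= Af * (1 + 7 * R) ^ N.
Proof.
 intros Hl HR Hin. destruct (factor_list l Hl) as [g [G1 [G2 _]]]. set (D := lsumN l).
 pose proof (g_bound l g R 0 Hl HR Hin G1 G2 ltac:(rewrite Cmod_0; lra)) as B. fold D in B.
 pose proof (f0_le l g R HR Hin G2) as F0. assert (H0 : 0 < Cmod (f 0)) by pos. rewrite Rpow_mult_distr in B.
 assert (Q : 4 ^ D * Cmod (f 0) <= exp (K * (1 + 7 * R) ^ N)). { eapply Rle_trans. 2: exact B.
 replace (Cmod (g 0) * (4 ^ D * R ^ D)) with (4 ^ D * (R ^ D * Cmod (g 0))) by ring; fin. }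
 assert (Q2 : exp (INR D) <= exp (Af * (1 + 7 * R) ^ N)). { eapply Rle_trans. 2: apply exp_over_f0; lra.
 apply Rmult_le_reg_r with (Cmod (f 0)); auto. unfold Rdiv. rewrite Rmult_assoc, Rinv_l, Rmult_1_r by lra.
 eapply Rle_trans. 2: exact Q. le_mul_r. lra. replace (exp (INR D)) with (exp 1 ^ D). apply pow_incr.
 pose proof (exp_pos 1). pose proof exp_le_3. lra. clear. induction D. symmetry; apply exp_0. rewrite S_INR, exp_plus.
 simpl. rewrite IHD. ring. } destruct (Rle_lt_dec (INR D) (Af * (1 + 7 * R) ^ N)) as [L|L]; auto.
 apply exp_increasing in L. lra.
Qed.

Lemma lsumN_ge_length l : (forall z, In z l -> n z <> O) -> (length l <= lsumN l)%nat.
Proof.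
 induction l; simpl; intros H. lia. specialize (IHl (fun z Hz => H z (or_intror Hz))).
 specialize (H a (or_introl eq_refl)). lia.
Qed.

(** A list that misses a zero can be lengthened, and [count_bound] limits the length. *)
Lemma zeros_list R : 1 <= R -> exists l, NoDup l /\ (forall z, In z l -> Cmod z <= R /\ n z <> O) /\ (forall z, Cmod z <= R -> n z <> O -> In z l).
Proof.
 intros HR. destruct (INR_unbounded (Af * (1 + 7 * R) ^ N)) as [B HB].
 set (P := fun l => NoDup l /\ forall z, In z l -> Cmod z <= R /\ n z <> O).
 assert (Bd : forall l, P l -> (length l <= B)%nat). { intros l [P1 P2].
 pose proof (count_bound l R P1 HR (fun z Hz => proj1 (P2 z Hz))).
 pose proof (lsumN_ge_length l (fun z Hz => proj2 (P2 z Hz))). apply le_INR in H0.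
 assert (INR (length l) < INR B) by lra. apply INR_lt in H1. lia. }
 assert (G : forall k l, P l -> (B - length l <= k)%nat -> exists l', P l' /\ forall z, Cmod z <= R -> n z <> O -> In z l').
 { induction k; intros l Pl Hk.
 - exists l. split; auto. intros z Hz Hnz. apply NNPP. intros Hno. assert (Q : P (z :: l)). { destruct Pl as [P1 P2].
  split. constructor; auto. intros v [E|Hv]; subst; auto. } specialize (Bd _ Q). simpl in Bd. lia.
 - destruct (classic (exists z, Cmod z <= R /\ n z <> O /\ ~ In z l)) as [[z [Z1 [Z2 Z3]]]|Hno].
  + apply (IHk (z :: l)). destruct Pl as [P1 P2]. split. constructor; auto. intros v [E|Hv]; subst; auto. simpl. lia.
  + exists l. split; auto. intros z Z1 Z2. apply NNPP. intros Z3. fin. } destruct (G B nil) as [l [[P1 P2] P3]]. split.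
   constructor. intros z []. lia. fin.
Qed.

(** Dyadic decomposition of the zeros, using the counting bound. *)
Lemma weight_bound : exists M, forall l, NoDup l -> lsumR (fun z => INR (n z) * / (1 + Cmod z) ^ (N + 1)) l <= M.
Proof.
 set (q := / 2). assert (Hq : 0 <= q < 1) by (unfold q; lra). set (p := (N + 1)%nat). exists (2 ^ p * (Af * 8 ^ N * 2)).
 intros l Hl. assert (HAf := Af_pos).
 (* Some [j] with [|z| <= 2^j] also satisfies [2^j <= 2 (1 + |z|)]; the remaining terms of the sum
    are nonnegative. Using all [j] keeps the bound linear in the counting indicators. *)
 assert (Dy : forall z J, Cmod z <= 2 ^ J -> / (1 + Cmod z) ^ p <= 2 ^ p * rsum (S J) (fun j => (q ^ j) ^ p * (if Rle_dec (Cmod z) (2 ^ j) then 1 else 0))).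
 { intros z J HJ. pose proof (Cmod_ge_0 z) as Z0.
 assert (Ex : exists j, (j <= J)%nat /\ Cmod z <= 2 ^ j /\ 2 ^ j <= 2 * (1 + Cmod z)). { induction J.
 - exists 0%nat. repeat split; auto; lra.
 - destruct (Rle_lt_dec (Cmod z) (2 ^ J)) as [L|L]. destruct (IHJ L) as [j [? ?]]; fin. exists (S J).
  repeat split; auto. simpl. lra. } destruct Ex as [j [J1 [J2 J3]]].
  assert (T0 : forall i, 0 <= (q ^ i) ^ p * (if Rle_dec (Cmod z) (2 ^ i) then 1 else 0)). { intros i.
  apply Rmult_le_pos. pos. destruct (Rle_dec (Cmod z) (2 ^ i)); lra. }
  assert (T : (q ^ j) ^ p * (if Rle_dec (Cmod z) (2 ^ j) then 1 else 0) <= rsum (S J) (fun j => (q ^ j) ^ p * (if Rle_dec (Cmod z) (2 ^ j) then 1 else 0))).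
  { eapply Rle_trans. 2: apply (rsum_mono (S j) (S J)); auto; lia. simpl.
  pose proof (rsum_pos j (fun j => (q ^ j) ^ p * (if Rle_dec (Cmod z) (2 ^ j) then 1 else 0)) (fun i _ => T0 i)). lra. }
  destruct (Rle_dec (Cmod z) (2 ^ j)); [|lra]. rewrite Rmult_1_r in T. le_via (2 ^ p * (q ^ j) ^ p).
  2: le_mul_l; auto; apply pow_le; lra. unfold q. rewrite pow_inv, <- Rpow_mult_distr, <- pow_inv. apply pow_incr.
  split. pos. assert (0 < 2 ^ j) by pos. apply Rmult_le_reg_r with (2 ^ j * (1 + Cmod z)). nra.
  replace (/ (1 + Cmod z) * (2 ^ j * (1 + Cmod z))) with (2 ^ j) by (field; lra).
  replace (2 * / 2 ^ j * (2 ^ j * (1 + Cmod z))) with (2 * (1 + Cmod z)) by (field; lra). auto. }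
  assert (ExJ : exists J, forall z, In z l -> Cmod z <= 2 ^ J). { clear. induction l. exists 0%nat. intros z [].
  destruct IHl as [J HJ]. destruct (Pow_x_infinity 2 ltac:(rewrite Rabs_pos_eq; lra) (Cmod a)) as [J' HJ'].
  exists (max J J'). intros z [E|Hz]. subst. specialize (HJ' (max J J') ltac:(lia)). rewrite Rabs_pos_eq in HJ'; fin.
  specialize (HJ z Hz). eapply Rle_trans. exact HJ. apply Rle_pow; fin. } destruct ExJ as [J HJ].
  le_via (lsumR (fun z => INR (n z) * (2 ^ p * rsum (S J) (fun j => (q ^ j) ^ p * (if Rle_dec (Cmod z) (2 ^ j) then 1 else 0)))) l).
  { apply lsumR_le. intros z Hz. fin. }
  assert (Swap : forall m, lsumR (fun z => INR (n z) * (2 ^ p * rsum m (fun j => (q ^ j) ^ p * (if Rle_dec (Cmod z) (2 ^ j) then 1 else 0)))) l = 2 ^ p * rsum m (fun j => (q ^ j) ^ p * lsumR (fun z => INR (n z) * (if Rle_dec (Cmod z) (2 ^ j) then 1 else 0)) l)).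
  { induction m. simpl. rewrite (lsumR_ext _ (fun z => 0 * 0)). rewrite lsumR_scal; ring. intros; ring. simpl rsum.
  rewrite Rmult_plus_distr_l, <- IHm. clear. induction l; simpl lsumR; fin. } rewrite Swap. le_mul_l. pos.
  assert (Cnt : forall j, lsumR (fun z => INR (n z) * (if Rle_dec (Cmod z) (2 ^ j) then 1 else 0)) l <= Af * (8 ^ N * (2 ^ j) ^ N)).
  { intros j. set (l' := filter (fun z => if Rle_dec (Cmod z) (2 ^ j) then true else false) l).
  assert (E : lsumR (fun z => INR (n z) * (if Rle_dec (Cmod z) (2 ^ j) then 1 else 0)) l = INR (lsumN l')). { unfold l'.
  clear. induction l; simpl; auto. rewrite IHl. destruct (Rle_dec (Cmod a) (2 ^ j)); simpl; rewrite ?plus_INR; ring. }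
  rewrite E. le_trans (count_bound l' (2 ^ j)). apply NoDup_filter; auto. pos. intros w Hw. apply filter_In in Hw.
  destruct (Rle_dec (Cmod w) (2 ^ j)); auto; fin. le_mul_l; auto. rewrite <- Rpow_mult_distr. apply pow_incr.
  pose proof (pow_ge_1 2 j ltac:(lra)). lra. } le_via (rsum (S J) (fun j => Af * 8 ^ N * q ^ j)). { apply rsum_le.
  intros j _. le_via ((q ^ j) ^ p * (Af * (8 ^ N * (2 ^ j) ^ N))). fin. right. unfold p. rewrite pow_add, pow_1.
  assert (E : (q ^ j) ^ N * (2 ^ j) ^ N = 1). { rewrite <- Rpow_mult_distr, <- Rpow_mult_distr. unfold q.
  replace (/ 2 * 2) with 1 by field. rewrite !pow1. auto. }
  replace ((q ^ j) ^ N * q ^ j * (Af * (8 ^ N * (2 ^ j) ^ N))) with ((q ^ j) ^ N * (2 ^ j) ^ N * (Af * 8 ^ N * q ^ j)) by ring.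
  rewrite E. ring. } rewrite rsum_scal. le_mul_l. pos. eapply Rle_trans. apply geom_sum_le; auto. unfold q. lra.
Qed.

Lemma logderiv_list l g z a b : cdiff f z a -> cdiff g z b -> (forall v, f v = (rootprod l v * g v)%C) -> f z <> RtoC 0 -> ~ In z l ->
  (a / f z = lsumC (fun w => CN (n w) * / (z - w)) l + b / g z)%C.
Proof.
 intros Ha Hb E Hz Hin. assert (HR : cdiff (rootprod l) z (rootprod l z * lsumC (fun w => CN (n w) * / (z - w)) l)%C). {
 clear - Hin. induction l.
 - unfold rootprod. simpl. eapply cdiff_eq. fin. ring.
 - unfold rootprod in *. simpl in Hin. assert (NZ : (z - a)%C <> RtoC 0). { intros EE. apply Hin. left. symmetry.
  apply Ceq_minus; auto. } eapply cdiff_eq.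
  + apply (cdiff_mult (fun z => (z - a) ^ n a)%C (fun z => lprod (fun w => (z - w) ^ n w)%C l)). cdd. auto.
  + simpl. destruct (n a). simpl. ring. simpl Cpow. field. auto. }
   assert (EE : a = (rootprod l z * lsumC (fun w => CN (n w) * / (z - w)) l * g z + rootprod l z * b)%C). {
   eapply cdiff_unique. exact Ha. eapply cdiff_ext. symmetry; apply E. apply cdiff_mult; auto. } rewrite EE, E.
   rewrite E in Hz. field. split; intros Q; apply Hz; rewrite Q; ring.
Qed.
End PF.

Lemma is_CI_conj f a b l : is_CI f a b l -> is_CI (fun t => Cconj (f t)) a b (Cconj l).
Proof. rewrite !is_CI_iff. intros [H1 H2]. split; auto. apply (is_RInt_opp (V := R_NormedModule) (fun t => Im (f t))). auto. Qed.

Lemma Cmult_conj_R (z : C) : (z * Cconj z)%C = RtoC (Cmod z ^ 2).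
Proof. rewrite <- Cmod2_conj; fin. Qed.

(** For [n >= 1] neither the conjugate of [f] nor a constant contributes to the coefficient, which
    is therefore that of [2 (Re f - Y)]. This function has constant sign, so its absolute mean is
    its mean up to sign, and that is known from [f 0 = 0]. *)
Lemma borel_caratheodory (f : C -> C) R Y r n : (forall z, Cmod z < R -> exists l, cdiff f z l) ->
  f 0 = RtoC 0 -> (forall z, Cmod z < R -> Re (f z) <= Y) -> 0 < r < R -> (1 <= n)%nat ->
  Cmod (ccoef f r n) * r ^ n <= 2 * Y.
Proof.
 intros Hf H0 HY Hr Hn. pose proof PI2_pos as P. assert (N2 : RtoC (2 * PI) <> RtoC 0) by pos.
 assert (Nr : RtoC r <> RtoC 0) by pos. assert (Rf : forall t, rcont (fun t => f (circ r t)) t). { intros t.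
 apply rcont_circ. destruct (Hf (circ r t)) as [l Hl]. rewrite Cmod_circ; lra. eapply cdiff_ccont; eauto. }
 assert (NZ : forall t, circ r t <> RtoC 0) by (intros; apply circ_neq_0; lra).
  (* the negative Fourier coefficient vanishes, hence so does that of the conjugate *)
  assert (B : CI (fun t => f (circ r t) * (circ r t / RtoC r) ^ n)%C 0 (2 * PI) = 0). {
 change (MV (fun z => f z * (z / RtoC r) ^ n)%C r = 0). rewrite (MV_mean (fun z => f z * (z / RtoC r) ^ n)%C r R); auto.
 - rewrite H0. ring.
 - intros z Hz. destruct (Hf z ltac:(lra)) as [l Hl]. eexists. cdd. auto.
 - destruct (Hf 0) as [l Hl]. rewrite Cmod_0; lra. eapply cdiff_ccont. cdd. auto. }
  assert (B' : is_CI (fun t => Cconj (f (circ r t)) * (RtoC r / circ r t) ^ n)%C 0 (2 * PI) 0). {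
  assert (Q : is_CI (fun t => f (circ r t) * (circ r t / RtoC r) ^ n)%C 0 (2 * PI) 0). { rewrite <- B.
  apply is_CI_cont, rcont_on_all; fin. } apply is_CI_conj in Q.
  replace (Cconj 0) with (RtoC 0) in Q by (unfold Cconj, RtoC; simpl; f_equal; ring). eapply is_CI_ext; [|exact Q].
  intros t _. cbv beta. rewrite Cmult_conj. f_equal. rewrite Cpow_conj. f_equal. rewrite Cdiv_conj by auto.
  pose proof (Cmult_conj_R (circ r t)) as E. rewrite Cmod_circ in E by lra.
  replace (Cconj (RtoC r)) with (RtoC r) by (unfold Cconj, RtoC; simpl; f_equal; ring).
  assert (E2 : Cconj (circ r t) = (RtoC r * RtoC r / circ r t)%C). { rewrite <- RtoC_mult.
  replace (r * r) with (r ^ 2) by ring. rewrite <- E. field. auto. } rewrite E2. field. auto. }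
  assert (A : is_CI (fun t => f (circ r t) * (RtoC r / circ r t) ^ n)%C 0 (2 * PI) (RtoC (2 * PI) * (ccoef f r n * RtoC r ^ n))%C).
  { assert (E : (RtoC (2 * PI) * (ccoef f r n * RtoC r ^ n))%C = (RtoC r ^ n * MV (fun z => f z / z ^ n) r)%C). {
  unfold ccoef. field. auto. } rewrite E. eapply is_CI_ext; [|apply is_CI_scal, is_CI_cont; apply rcont_on_all].
 - intros t _. unfold Cdiv. rewrite Cpow_mult_l, Cpow_inv by auto. ring.
 - fin. } assert (D : is_CI (fun t => (RtoC r / circ r t) ^ n)%C 0 (2 * PI) 0). {
  replace (RtoC 0) with (RtoC r ^ n * MV (fun z => / z ^ n) r)%C. 2: rewrite MV_inv_pow by (lra || lia); ring.
  eapply is_CI_ext; [|apply is_CI_scal, is_CI_cont; apply rcont_on_all].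
 - intros t _. unfold Cdiv. rewrite Cpow_mult_l, Cpow_inv by auto. ring.
 - fin. } pose proof (is_CI_plus _ _ _ _ _ _ (is_CI_plus _ _ _ _ _ _ A B') (is_CI_scal (RtoC (-2 * Y)) _ _ _ _ D)) as T.
  assert (M0 : is_CI (fun t => f (circ r t)) 0 (2 * PI) 0). { replace (RtoC 0) with (MV f r). fin.
  rewrite (MV_mean f r R), H0; auto. ring. intros z Hz; apply Hf; lra. destruct (Hf 0) as [l Hl]. rewrite Cmod_0; lra.
  eapply cdiff_ccont; eauto. } apply is_CI_iff in M0. destruct M0 as [M0 _].
  assert (G : is_RInt (fun t => 2 * Y - 2 * Re (f (circ r t))) 0 (2 * PI) (2 * Y * (2 * PI) - 2 * 0)). {
  apply (is_RInt_minus (V := R_NormedModule) (fun _ => 2 * Y)).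
 - replace (2 * Y * (2 * PI)) with (scal (2 * PI - 0) (2 * Y)). apply (is_RInt_const (V := R_NormedModule)).
  unfold scal; simpl; unfold mult; simpl. ring.
 - apply (is_RInt_scal (V := R_NormedModule)); fin. } assert (P0 : 0 <= 2 * PI) by lra.
  pose proof (fun H => is_CI_bound _ _ _ _ _ _ P0 H T G) as Bd.
  replace (RtoC (2 * PI) * (ccoef f r n * RtoC r ^ n) + 0 + RtoC (-2 * Y) * 0)%C with (RtoC (2 * PI) * (ccoef f r n * RtoC r ^ n))%C in Bd by ring.
  rewrite !Cmod_mult, Cmod_pow, !Cmod_R, !Rabs_pos_eq in Bd by lra.
  assert (2 * PI * (Cmod (ccoef f r n) * r ^ n) <= 2 * Y * (2 * PI) - 2 * 0). { apply Bd. intros t _.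
  replace (f (circ r t) * (RtoC r / circ r t) ^ n + Cconj (f (circ r t)) * (RtoC r / circ r t) ^ n + RtoC (-2 * Y) * (RtoC r / circ r t) ^ n)%C with (RtoC (2 * Re (f (circ r t)) - 2 * Y) * (RtoC r / circ r t) ^ n)%C.
 - rewrite Cmod_mult, Cmod_pow, Cmod_div, !Cmod_R, Cmod_circ, (Rabs_pos_eq r) by fin.
  replace (r / r) with 1 by (field; lra). rewrite pow1. specialize (HY (circ r t) ltac:(rewrite Cmod_circ; lra)).
  rewrite Rabs_left1 by lra. lra.
 - rewrite RtoC_minus, RtoC_mult. rewrite re_alt. rewrite (RtoC_mult (-2) Y). rewrite RtoC_mult. field. } nra.
Qed.

Lemma csum_swap n m (F : nat -> nat -> C) : csum n (fun i => csum m (fun j => F i j)) = csum m (fun j => csum n (fun i => F i j)).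
Proof.
 induction n; simpl.
 - induction m; simpl; auto. rewrite <- IHm. ring.
 - rewrite IHn, <- csum_plus; fin.
Qed.

Lemma cser_tail u l k T : (forall n, rsum n (fun j => Cmod (u (k + j)%nat)) <= T) -> cser u l -> Cmod (l - csum k u) <= T.
Proof.
 intros HT Hl. apply (cser_abs_bound (fun j => u (k + j)%nat)); auto. intros e He. destruct (Hl e He) as [N HN].
 exists N. intros n Hn. specialize (HN (k + n)%nat ltac:(lia)).
 assert (E : csum n (fun j => u (k + j)%nat) = (csum (k + n) u - csum k u)%C). { clear. induction n.
 rewrite Nat.add_0_r. simpl. ring. rewrite Nat.add_succ_r. simpl. rewrite IHn. ring. } rewrite E.
 replace (csum (k + n) u - csum k u - (l - csum k u))%C with (csum (k + n) u - l)%C by ring. auto.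
Qed.

Section PFlim.
Variables (f f' : C -> C) (n : C -> nat) (K : R) (N : nat) (p : nat -> C) (I : nat).
Hypothesis Hf : Entire f.
Hypothesis Hf' : forall z, cdiff f z (f' z).
Hypothesis Hn : forall z, is_ord f z (n z).
Hypothesis HK : 0 <= K.
Hypothesis Hg : forall z, Cmod (f z) <= exp (K * (1 + Cmod z) ^ N).
Hypothesis Hfi : forall i, f (CN i) <> RtoC 0.
Hypothesis Hmom : forall j, (j < N + 1)%nat -> csum I (fun i => p i * CN i ^ j)%C = RtoC 0.

Let k := (N + 1)%nat.
Let A := Af f K.
Let Cp := rsum I (fun i => Cmod (p i)).

Lemma Hf00 : f 0 <> RtoC 0. Proof. exact (Hfi 0). Qed.

(** Dividing out the zeros with [|z| <= R] leaves [g] without zeros in the open disc and with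
    [|g| <= e^Y |g(0)|]. Borel-Caratheodory on the circle of radius [R/2] then bounds the Taylor
    coefficients of its logarithm. The moment conditions remove the first [k = N + 1] coefficients
    of [g'/g], and [4 I <= R] makes the rest a geometric tail of ratio at most [1/2]. *)
Lemma PF_quotient_bound R l : 1 <= R -> 4 * INR I <= R -> NoDup l -> (forall z, In z l -> Cmod z <= R /\ n z <> O) ->
  (forall z, Cmod z <= R -> n z <> O -> In z l) ->
  Cmod (lsumC (fun w => CN (n w) * csum I (fun i => p i * / (CN i - w))) l - csum I (fun i => p i * (f' (CN i) / f (CN i))))%C
    <= Cp * (2 * (A * (1 + 7 * R) ^ N) * (2 / R) ^ (k + 1) * INR I ^ k * (INR k + 1) * 16).
Proof.
 intros HR HRI Hl Hin Hall. destruct (factor_list f n Hf Hn l Hl) as [g [G1 [G2 [G3 G4]]]].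
 destruct (holo_deriv g (R + 1) ltac:(lra) (fun z _ => G1 z)) as [g' [D1 _]].
 assert (Gnz : forall z, Cmod z < R -> g z <> RtoC 0). { intros z Hz. destruct (in_dec Ceq_dec z l) as [Hi|Hi]. auto.
 apply ord_zero_iff; auto. replace 0%nat with (n z). auto. destruct (Nat.eq_dec (n z) 0); auto.
 exfalso; apply Hi, Hall; auto; lra. } set (Y := A * (1 + 7 * R) ^ N). assert (Y0 : 0 <= Y). { apply Rmult_le_pos.
 apply Af_pos; auto. pos. } assert (H0 : 0 < Cmod (f 0)) by (apply Cmod_gt_0, Hf00). assert (Gz0 : 0 < Cmod (g 0)). {
 apply Cmod_gt_0, Gnz. rewrite Cmod_0; lra. } assert (Gr : forall z, Cmod z < R -> Cmod (g z) <= exp Y * Cmod (g 0)). {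
 intros z Hz. pose proof (g_bound f n K N HK Hg l g R z Hl HR (fun w Hw => proj1 (Hin w Hw)) G1 G2 ltac:(lra)) as B.
 pose proof (f0_le f n l g R HR (fun w Hw => proj1 (Hin w Hw)) G2) as F0. set (D := lsumN n l) in *.
 assert (P : 0 < R ^ D) by pos. pose proof (exp_over_f0 f K N Hf00 (1 + 7 * R) ltac:(lra)) as E.
 assert (B2 : Cmod (g z) * R ^ D <= exp (K * (1 + 7 * R) ^ N)). { eapply Rle_trans. 2: exact B. fin. }
 apply Rmult_le_reg_r with (R ^ D); auto. eapply Rle_trans. exact B2. eapply Rle_trans.
 - apply Rmult_le_reg_r with (/ Cmod (f 0)). pos. rewrite (Rmult_assoc (exp Y)), Rinv_r, Rmult_1_r by lra; fin.
 - rewrite Rmult_assoc; fin. } destruct (holo_log g g' R ltac:(lra)) as [lg [c0 [_ [_ [L0 [L1 L2]]]]]]; auto. {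
  intros z Hz. apply D1. lra. } destruct (holo_pser lg R ltac:(lra)) as [c [C1 [C2 C3]]]. { fin. }
  assert (LRe : forall z, Cmod z < R -> Re (lg z) <= Y). { intros z Hz. specialize (Gr z Hz).
  rewrite L2, Cmod_mult, Cmod_cexp in Gr by auto. rewrite Rmult_comm in Gr. apply Rmult_le_reg_r in Gr; auto.
  destruct (Rle_lt_dec (Re (lg z)) Y) as [|Q]; auto. apply exp_increasing in Q. lra. } set (r := R / 2).
  assert (Cb : forall j, (1 <= j)%nat -> Cmod (c j) * r ^ j <= 2 * Y). { intros j Hj. rewrite (C2 r) by (unfold r; lra).
  apply (borel_caratheodory lg R Y); auto. fin. unfold r; lra. }
  assert (Dc : forall j, Cmod (dcoef c j) <= (INR j + 1) * (2 * Y * (2 / R) ^ (j + 1))). { intros j. unfold dcoef.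
  rewrite Cmod_mult, Cmod_R, Rabs_pos_eq, S_INR by pos. pose proof (pos_INR j). le_mul_l. lra.
  specialize (Cb (S j) ltac:(lia)). assert (0 < r ^ S j) by (apply pow_lt; unfold r; lra).
  apply Rmult_le_reg_r with (r ^ S j); auto. eapply Rle_trans. exact Cb. right. replace (j + 1)%nat with (S j) by lia.
  rewrite Rmult_assoc, <- Rpow_mult_distr. unfold r. replace (2 / R * (R / 2)) with 1 by (field; lra). rewrite pow1.
  (* The factor 16 is the value [2 / (1 - q)^3] of [geom_sum2_le] at [q = 1/2]. *)
  ring. } set (T := 2 * Y * (2 / R) ^ (k + 1) * INR I ^ k * (INR k + 1) * 16).
  assert (Tail : forall i, (i < I)%nat -> Cmod (g' (CN i) / g (CN i) - csum k (fun j => dcoef c j * CN i ^ j))%C <= T).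
  { intros i Hi. assert (HiI : INR i <= INR I) by fin. pose proof (pos_INR i) as Hi0. assert (I1 : 1 <= INR I). {
  apply (le_INR 1). lia. } assert (HiR : Cmod (CN i) < R). { rewrite Cmod_R, Rabs_pos_eq by auto. lra. }
  apply cser_tail. 2:{ destruct (pser_exists (dcoef c) R (dcoef_ok c R C1) (CN i) HiR) as [l' Hl'].
  replace (g' (CN i) / g (CN i))%C with l'; auto. eapply cdiff_unique. 2: apply L1; auto.
  apply (pser_deriv c R C1); auto. } intros m. set (B0 := 2 * Y * (2 / R) ^ (k + 1) * INR I ^ k * (INR k + 1)).
  assert (HB0 : 0 <= B0). { unfold B0; fin. } le_via (rsum m (fun j => B0 * ((INR j + 1) * (INR j + 2) * (/2) ^ j))).
  2:{ rewrite rsum_scal. eapply Rle_trans. le_mul_l; auto. apply geom_sum2_le; lra. right. unfold T. fold B0. field. }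
  apply rsum_le. intros j _. rewrite Cmod_mult, Cmod_pow, Cmod_R, Rabs_pos_eq by auto. pose proof (pos_INR j) as Hj0.
  pose proof (pos_INR k) as Hk0.
  assert (X1 : Cmod (dcoef c (k + j)) * INR i ^ (k + j) <= (INR (k + j) + 1) * (2 * Y * (2 / R) ^ (k + j + 1)) * INR I ^ (k + j)).
  { fin. } eapply Rle_trans. exact X1.
  assert (E : (INR (k + j) + 1) * (2 * Y * (2 / R) ^ (k + j + 1)) * INR I ^ (k + j) = 2 * Y * (2 / R) ^ (k + 1) * INR I ^ k * (INR (k + j) + 1) * (2 / R * INR I) ^ j).
  { rewrite !pow_add, Rpow_mult_distr. ring. } rewrite E. unfold B0. rewrite !(Rmult_assoc (2 * Y)). le_mul_l. lra.
  rewrite !Rmult_assoc. le_mul_l. pos. le_mul_l. pos. rewrite <- !Rmult_assoc. apply Rmult_le_compat. pos. pos.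
  rewrite plus_INR. nra. apply pow_incr. split. pos. apply Rmult_le_reg_r with R. lra.
  replace (2 / R * INR I * R) with (2 * INR I) by (field; lra). lra. }
  assert (Hsum : (lsumC (fun w => CN (n w) * csum I (fun i => p i * / (CN i - w))) l - csum I (fun i => p i * (f' (CN i) / f (CN i))))%C = (- csum I (fun i => p i * (g' (CN i) / g (CN i))))%C).
  {
  assert (S1 : forall i, (i < I)%nat -> (f' (CN i) / f (CN i) = lsumC (fun w => CN (n w) * / (CN i - w)) l + g' (CN i) / g (CN i))%C).
  { intros i Hi. assert (HiI : INR i <= INR I) by fin. pose proof (pos_INR i) as Hi0.
  apply (logderiv_list f n l g); auto.
 - apply D1. rewrite Cmod_R, Rabs_pos_eq; lra.
 - intros Hi'. destruct (Hin _ Hi') as [_ Hnz]. apply NNPP. intros Hf1. apply Hnz. apply (ord_unique f (CN i)); auto.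
  apply ord_zero_iff; auto. }
  assert (S2 : lsumC (fun w => CN (n w) * csum I (fun i => p i * / (CN i - w)))%C l = csum I (fun i => p i * lsumC (fun w => CN (n w) * / (CN i - w)) l)%C).
  { clear. induction l; simpl.
 - replace (csum I (fun i => p i * 0)%C) with (csum I (fun i => 0 * p i)%C) by (apply csum_ext; intros; ring).
  rewrite csum_scal. ring.
 - rewrite IHl, <- csum_scal, <- csum_plus. apply csum_ext. intros; ring. } rewrite S2. apply Ceq_minus.
  match goal with |- (?a - ?b - - ?c)%C = _ => replace (a - b - - c)%C with (a + c + (-1) * b)%C by ring end.
  rewrite <- csum_scal, <- !csum_plus. rewrite (csum_ext _ _ (fun i => 0 * 0)%C). rewrite csum_scal. ring. intros i Hi.
  rewrite S1 by auto. ring. } rewrite Hsum, Cmod_opp.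
  assert (E2 : csum I (fun i => p i * (g' (CN i) / g (CN i)))%C = csum I (fun i => p i * (g' (CN i) / g (CN i) - csum k (fun j => dcoef c j * CN i ^ j)))%C).
  { assert (Z : csum I (fun i => p i * csum k (fun j => dcoef c j * CN i ^ j))%C = RtoC 0). {
  rewrite (csum_ext _ _ (fun i => csum k (fun j => dcoef c j * (p i * CN i ^ j)))%C). 2:{ intros i _.
  rewrite <- csum_scal. apply csum_ext. intros; ring. } rewrite csum_swap. rewrite (csum_ext _ _ (fun j => 0 * 0)%C).
  rewrite csum_scal; ring. intros j Hj. rewrite csum_scal, Hmom by auto. ring. }
  transitivity (csum I (fun i => p i * (g' (CN i) / g (CN i)))%C + (-1) * csum I (fun i => p i * csum k (fun j => dcoef c j * CN i ^ j))%C)%C.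
  rewrite Z; ring. rewrite <- csum_scal, <- csum_plus. apply csum_ext. intros; ring. } rewrite E2. le_trans csum_Cmod.
  unfold Cp. rewrite Rmult_comm, <- rsum_scal. apply rsum_le. intros i Hi. rewrite Cmod_mult, Rmult_comm; fin.
Qed.

(** The bound is of size [R^N] times [R^(-N-2)], which is why [N + 1] vanishing moments are imposed;
    here it is only compared with [B / R]. *)
Lemma PF_limit eps : 0 < eps -> exists R0, 1 <= R0 /\ forall R l, R0 <= R -> NoDup l -> (forall z, In z l -> Cmod z <= R /\ n z <> O) ->
  (forall z, Cmod z <= R -> n z <> O -> In z l) ->
  Cmod (lsumC (fun w => CN (n w) * csum I (fun i => p i * / (CN i - w))) l - csum I (fun i => p i * (f' (CN i) / f (CN i))))%C <= eps.
Proof.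
 set (B := Cp * (2 * (A * 8 ^ N) * 2 ^ (k + 1) * INR I ^ k * (INR k + 1) * 16)).
 assert (CpP : 0 <= Cp) by (apply rsum_pos; intros; pos). assert (AP : 0 <= A) by (apply Af_pos; auto).
 exists (Rmax (Rmax 1 (4 * INR I)) (B / eps)). split. { eapply Rle_trans; [apply (Rmax_l 1 (4 * INR I))|apply Rmax_l]. }
 intros R l HR Hl Hin Hall. assert (R1 : 1 <= R). { eapply Rle_trans. 2: exact HR.
 eapply Rle_trans; [apply (Rmax_l 1 (4 * INR I))|apply Rmax_l]. } assert (R2 : 4 * INR I <= R). { eapply Rle_trans.
 2: exact HR. eapply Rle_trans; [apply (Rmax_r 1 (4 * INR I))|apply Rmax_l]. } assert (R3 : B / eps <= R). {
 eapply Rle_trans. 2: exact HR. fin. } eapply Rle_trans. apply PF_quotient_bound with (R := R); auto. le_via (B / R).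
 -
  replace (B / R) with (Cp * (2 * (A * 8 ^ N) * 2 ^ (k + 1) * INR I ^ k * (INR k + 1) * 16 * / R)) by (unfold B, Rdiv; ring).
  unfold Rdiv. le_mul_l; auto. assert (E : (2 * / R) ^ (k + 1) = 2 ^ (k + 1) * (/ R ^ N * (/ R * / R))). { unfold k.
  rewrite Rpow_mult_distr. f_equal. replace (N + 1 + 1)%nat with (N + 2)%nat by lia. rewrite pow_add, pow_inv; fin. }
  rewrite E. assert (RN : 0 < R ^ N) by pos. assert (Q : (1 + 7 * R) ^ N * / R ^ N <= 8 ^ N). {
  apply Rmult_le_reg_r with (R ^ N); auto. rewrite Rmult_assoc, Rinv_l, Rmult_1_r, <- Rpow_mult_distr by lra; fin. }
  assert (RR : 0 < / R) by (pos). assert (RR1 : / R <= 1) by fin.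
  replace (2 * (A * (1 + 7 * R) ^ N) * (2 ^ (k + 1) * (/ R ^ N * (/ R * / R))) * INR I ^ k * (INR k + 1) * 16) with ((2 * A * 2 ^ (k + 1) * INR I ^ k * (INR k + 1) * 16) * (((1 + 7 * R) ^ N * / R ^ N) * (/ R * / R))) by ring.
  replace (2 * (A * 8 ^ N) * 2 ^ (k + 1) * INR I ^ k * (INR k + 1) * 16 * / R) with ((2 * A * 2 ^ (k + 1) * INR I ^ k * (INR k + 1) * 16) * (8 ^ N * / R)) by ring.
  le_mul_l. pos. apply Rmult_le_compat; auto. pos. nra. nra.
 - apply Rmult_le_reg_r with R. lra. unfold Rdiv. rewrite Rmult_assoc, Rinv_l by lra. apply Rmult_le_reg_r with (/ eps).
  pos. replace (eps * R * / eps) with R by (field; lra); fin.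
Qed.

(** Landau's form of the partial fraction expansion of [f'/f]: a combination killing polynomials of degree [<= N]
   makes the sum over zeros converge, without any genus correction. *)
Theorem PF_SumDiv C0 : (forall z, n z <> O -> Cmod (csum I (fun i => p i * / (CN i - z)))%C <= C0 * / (1 + Cmod z) ^ (N + 1)) ->
  SumDiv (fun z => INR (n z)) (fun z => csum I (fun i => p i * / (CN i - z)))%C (csum I (fun i => p i * (f' (CN i) / f (CN i))))%C.
Proof.
 intros HC. destruct (weight_bound f n K N Hf Hn HK Hg Hf00) as [M HM].
 assert (HW0 : forall z, 0 < / (1 + Cmod z) ^ (N + 1)). { intros z. pos. }
 apply (SD_along _ _ (fun z => (Rabs C0) * / (1 + Cmod z) ^ (N + 1)) (Rabs C0 * M)).
 - intros; pos.
 - intros l Hl. rewrite (lsumR_ext _ (fun z => Rabs C0 * (INR (n z) * / (1 + Cmod z) ^ (N + 1)))) by (intros; ring).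
  rewrite lsumR_scal; fin.
 - intros z Hz. le_trans HC. intros E. apply Hz. rewrite E; fin. le_mul_r. pos. apply Rle_abs.
 - intros eps l0 He N0. destruct (PF_limit eps He) as [R0 [R1 HR]].
  set (R := fold_right (fun z a => Rmax (Cmod z) a) R0 l0). assert (HR' : R0 <= R /\ forall z, In z l0 -> Cmod z <= R).
  { unfold R. clear. induction l0; simpl. split; fin. destruct IHl0 as [I1 I2]. split. eapply Rle_trans; fin.
  intros z [E|Hz]. subst; apply Rmax_l. eapply Rle_trans; fin. } destruct HR' as [HR1 HR2].
  destruct (zeros_list f n K N Hf Hn HK Hg Hf00 R ltac:(lra)) as [l [L1 [L2 L3]]]. exists l. split; auto. split.
  + intros z Hz Hnz. apply L3; auto. intros E. apply Hnz. rewrite E; auto.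
  + fin.
Qed.
End PFlim.

(** * Complex powers and Mellin integrals over the unit interval *)

Lemma cpow_plus u s t : cpowR u (s + t) = (cpowR u s * cpowR u t)%C.
Proof. unfold cpowR. rewrite <- cexp_plus. f_equal. ring. Qed.
Lemma cpow_0 u : cpowR u 0 = RtoC 1.
Proof. unfold cpowR. rewrite <- cexp_0. f_equal. ring. Qed.
Lemma cpow_1 u : 0 < u -> cpowR u 1 = RtoC u.
Proof. intros. unfold cpowR. replace (RtoC 1 * RtoC (ln u))%C with (RtoC (ln u)) by ring. rewrite cexp_R, exp_ln; auto. Qed.
Lemma cpow_neq_0 u s : cpowR u s <> RtoC 0.
Proof. apply cexp_neq_0. Qed.
Lemma cpow_opp u s : cpowR u (- s) = (/ cpowR u s)%C.
Proof. unfold cpowR. rewrite <- cexp_opp_inv. f_equal. ring. Qed.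
Lemma cpow_minus_1 u s : 0 < u -> cpowR u (s - 1) = (cpowR u s / RtoC u)%C.
Proof. intros. replace (s - 1)%C with (s + - (1))%C by ring. rewrite cpow_plus, cpow_opp, cpow_1; auto. Qed.
Lemma Cmod_cpow u s : Cmod (cpowR u s) = exp (Re s * ln u).
Proof. unfold cpowR. rewrite Cmod_cexp. rewrite re_scal_r; fin. Qed.
Lemma cpow_nat u n : 0 < u -> cpowR u (CN n) = (RtoC u ^ n)%C.
Proof. intros Hu. induction n. apply cpow_0. rewrite S_INR, RtoC_plus, cpow_plus, IHn, cpow_1 by auto. simpl. ring. Qed.
Lemma cpow_mult_base u v s : 0 < u -> 0 < v -> cpowR (u * v) s = (cpowR u s * cpowR v s)%C.
Proof. intros. unfold cpowR. rewrite ln_mult, <- cexp_plus by auto. f_equal. rewrite RtoC_plus. ring. Qed.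
Lemma cpow_inv_base u s : 0 < u -> cpowR (/ u) s = cpowR u (- s).
Proof. intros. unfold cpowR. rewrite ln_Rinv by auto. f_equal. rewrite RtoC_opp. ring. Qed.
Lemma rdiff_cpow w t : 0 < t -> rdiff (fun y => cpowR y w) t (w * cpowR t (w - 1))%C.
Proof.
 intros Ht. rewrite cpow_minus_1 by auto. assert (L : rdiff (fun y => RtoC (ln y)) t (RtoC (/ t))). { apply rdiff_R.
 apply is_derive_ln. auto. } eapply rdiff_eq. apply cdiff_rdiff. fin. apply rdiff_scal, L. unfold cpowR.
 rewrite RtoC_inv by lra. field. pos.
Qed.

(** Extended by 0 to [y <= 0], the power is differentiable on the whole line once [Re w > 1].
    Integration by parts down to 0 thus involves no improper integral. *)
Definition pw (y : R) (w : C) : C := if Rle_dec y 0 then RtoC 0 else cpowR y w.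

Lemma pw_pos y w : 0 < y -> pw y w = cpowR y w.
Proof. unfold pw. destruct (Rle_dec y 0); auto; lra. Qed.
Lemma pw_neg y w : y <= 0 -> pw y w = RtoC 0.
Proof. unfold pw. destruct (Rle_dec y 0); auto; lra. Qed.
Lemma pw_1 w : pw 1 w = RtoC 1.
Proof. rewrite pw_pos by lra. unfold cpowR. rewrite ln_1. rewrite <- cexp_0. f_equal. ring. Qed.

Lemma pw_bound y w : y <= 1 -> 0 <= Re w -> Cmod (pw y w) <= 1.
Proof.
 intros Hy Hw. unfold pw. destruct (Rle_dec y 0). rewrite Cmod_0; lra. rewrite Cmod_cpow. rewrite <- exp_0.
 apply exp_le. assert (ln y <= 0). { destruct (Req_dec y 1). subst; rewrite ln_1; lra. rewrite <- ln_1; fin. } nra.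
Qed.

Lemma rdiff_pw w t : 1 < Re w -> rdiff (fun y => pw y w) t (w * pw t (w - 1))%C.
Proof.
 intros Hw. destruct (Rtotal_order t 0) as [L|[E|G]].
 - rewrite (pw_neg t) by lra. apply (rdiff_ext_loc (fun _ => RtoC 0)).
  + exists (- t). split. lra. intros u Hu. apply Rabs_def2 in Hu. rewrite pw_neg; auto. lra.
  + eapply rdiff_eq. apply rdiff_const. ring.
 - subst. rewrite (pw_neg 0 (w - 1)) by lra. intros eps He. set (d := exp (ln eps / (Re w - 1))). exists d. split. pos.
  intros u Hu. rewrite (pw_neg 0) by lra. replace (pw u w - 0 - w * 0 * RtoC (u - 0))%C with (pw u w) by ring.
  rewrite Rminus_0_r in *. unfold pw. destruct (Rle_dec u 0). { rewrite Cmod_0; fin. } assert (Hu0 : 0 < u) by lra.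
  rewrite Rabs_pos_eq in * by lra. rewrite Cmod_cpow. replace (Re w * ln u) with ((Re w - 1) * ln u + ln u) by ring.
  rewrite exp_plus, exp_ln by auto. le_mul_r. lra. rewrite <- (exp_ln eps) by auto. apply exp_le.
  assert (ln u < ln eps / (Re w - 1)). { rewrite <- (ln_exp (ln eps / (Re w - 1))); fin. }
  apply Rmult_le_reg_r with (/ (Re w - 1)). pos.
  replace ((Re w - 1) * ln u * / (Re w - 1)) with (ln u) by (field; lra); fin.
 - rewrite (pw_pos t) by lra. apply (rdiff_ext_loc (fun y => cpowR y w)).
  + exists t. split; auto. intros u Hu. apply Rabs_def2 in Hu. rewrite pw_pos; auto. lra.
  + apply rdiff_cpow; auto.
Qed.

Lemma rcont_pw w t : 1 < Re w -> rcont (fun y => pw y w) t.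
Proof. intros. eapply rdiff_rcont, rdiff_pw; auto. Qed.

Lemma is_CI_eq f a b l l' : is_CI f a b l -> l = l' -> is_CI f a b l'.
Proof. intros H E. rewrite <- E; fin. Qed.

(** The Mellin transform at [w] of a function supported in [[0, 1]]. *)
Definition Tw (w : C) (Q : R -> C) : C := CI (fun y => pw y (w - 1) * Q y)%C 0 1.

(** The [k]-th derivative is bounded by [M] on [[0, 1]] and all lower ones vanish at 1: what [k]
    integrations by parts require. *)
Fixpoint VC (k : nat) (M : R) (Q : R -> C) : Prop :=
  match k with
  | O => (forall t, rcont Q t) /\ forall t, 0 <= t <= 1 -> Cmod (Q t) <= M
  | S k' => Q 1 = RtoC 0 /\ exists Q', (forall t, rdiff Q t (Q' t)) /\ VC k' M Q'
  end.

Lemma VC_rcont k M Q : VC k M Q -> forall t, rcont Q t.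
Proof. destruct k; simpl. tauto. intros [_ [Q' [H _]]] t. eapply rdiff_rcont; eauto. Qed.

Lemma VC_sup k M Q : VC k M Q -> forall t, 0 <= t <= 1 -> Cmod (Q t) <= M.
Proof.
 revert Q. induction k; simpl; intros Q H. tauto. destruct H as [H1 [Q' [D V]]]. intros t Ht.
 assert (E : is_CI Q' t 1 (Q 1 - Q t)%C). { apply is_CI_FTC; auto. apply rcont_on_all. apply (VC_rcont k M); auto. }
 rewrite H1 in E. replace (RtoC 0 - Q t)%C with (- Q t)%C in E by ring. rewrite <- Cmod_opp. assert (0 <= M). {
 eapply Rle_trans; fin. } eapply Rle_trans. refine (is_CI_bound_const _ M _ _ _ _ _ E). lra. intros u Hu.
 apply (IHk Q' V); lra. nra.
Qed.

(** Each integration by parts gains a factor [1/w] and moves [w] to [w + 1], whose modulus is not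
    smaller. The boundary term at 1 vanishes by [VC], the one at 0 by [pw]. *)
Lemma Tw_bound k : forall M Q w, VC k M Q -> 2 < Re w -> Cmod (Tw w Q) <= M * / Cmod w ^ k.
Proof.
 induction k; intros M Q w H Hw.
 - simpl. rewrite Rinv_1, Rmult_1_r. destruct H as [H1 H2]. replace M with (M * (1 - 0)) by ring. apply CI_bound. lra.
  apply rcont_on_all. intros t. apply rcont_mult; auto. apply rcont_pw. rewrite re_minus. simpl. lra. intros t Ht.
  rewrite Cmod_mult. specialize (H2 t Ht). assert (Cmod (pw t (w - 1)) <= 1). { apply pw_bound. lra.
  rewrite re_minus; simpl; lra. } pose proof (Cmod_ge_0 (Q t)). nra.
 - destruct H as [H1 [Q' [D V]]]. assert (W0 : 0 < Cmod w). { apply Rlt_le_trans with (Re w). lra. apply Re_le_Cmod. }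
  assert (Wn : w <> RtoC 0) by (apply Cmod_gt_0; auto). assert (RW1 : 1 < Re (w - 1)) by (rewrite re_minus; simpl; lra).
  assert (Cq : forall t, rcont Q' t) by (apply (VC_rcont k M); auto).
  assert (Cq0 : forall t, rcont Q t) by (intros t; eapply rdiff_rcont; eauto).
  assert (Cw : forall t, rcont (fun y => pw y w) t) by (intros; apply rcont_pw; lra).
  assert (Cw1 : forall t, rcont (fun y => pw y (w - 1)%C) t) by (intros; apply rcont_pw; auto).
  assert (E : is_CI (fun y => w * pw y (w - 1) * Q y + pw y w * Q' y)%C 0 1 (pw 1 w * Q 1 - pw 0 w * Q 0)%C). {
  apply (is_CI_FTC (fun y => pw y w * Q y)%C).
 - intros t _. apply rdiff_mult; auto. apply rdiff_pw; lra.
 - apply rcont_on_all; fin. } rewrite H1, (pw_neg 0) in E by lra.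
  replace (pw 1 w * 0 - 0 * Q 0)%C with (RtoC 0) in E by ring.
  assert (E1 : (w * Tw w Q + CI (fun y => pw y w * Q' y)%C 0 1)%C = RtoC 0). { rewrite <- (is_CI_unique _ _ _ _ E).
  unfold Tw. rewrite <- CI_scal, <- CI_plus.
 - apply CI_ext. intros; ring.
 - fin.
 - fin.
 - fin. } assert (E2 : CI (fun y => pw y w * Q' y)%C 0 1 = Tw (w + 1) Q'). { apply CI_ext. intros t _. do 2 f_equal.
  ring. } rewrite E2 in E1. assert (E3 : (Tw w Q = - (/ w * Tw (w + 1) Q'))%C). {
  transitivity (/ w * (w * Tw w Q + Tw (w + 1) Q') - / w * Tw (w + 1) Q')%C. field; auto. rewrite E1. ring. }
  rewrite E3, Cmod_opp, Cmod_mult, Cmod_inv by auto.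
  assert (B := IHk M Q' (w + 1)%C V ltac:(rewrite re_plus; simpl; lra)). assert (M0 : 0 <= M). { eapply Rle_trans. pos.
  apply (VC_sup k M Q' V 0). lra. } assert (Wle : Cmod w <= Cmod (w + 1)). { apply Rsqr_incr_0_var; [|apply Cmod_ge_0].
  rewrite !Rsqr_pow2, !Cmod2_alt. rewrite re_plus, im_plus. simpl. nra. }
  assert (B2 : M * / Cmod (w + 1) ^ k <= M * / Cmod w ^ k). { fin. }
  replace (M * / Cmod w ^ S k) with (/ Cmod w * (M * / Cmod w ^ k)). 2:{ simpl. field; pos. } fin.
Qed.

(** Polynomials are given by their coefficient sequences. *)
Definition peval (p : nat -> C) (I : nat) (y : R) : C := csum I (fun i => p i * RtoC y ^ i)%C.

Lemma rdiff_pow y i : rdiff (fun y => RtoC y ^ i)%C y (CN i * RtoC y ^ pred i)%C.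
Proof. eapply rdiff_eq. apply (cdiff_rdiff (fun z => z ^ i)%C (fun y => RtoC y)). apply cdiff_pow. apply rdiff_id. ring. Qed.

Lemma rdiff_csum I (F F' : nat -> R -> C) t : (forall i, (i < I)%nat -> rdiff (F i) t (F' i t)) ->
  rdiff (fun y => csum I (fun i => F i y)) t (csum I (fun i => F' i t)).
Proof. induction I; intros H; simpl. apply rdiff_const. apply rdiff_plus; fin. Qed.

Lemma rcont_peval p I t : rcont (peval p I) t.
Proof. apply rcont_csum. intros j _. apply rcont_scal. eapply rdiff_rcont, rdiff_pow. Qed.

Lemma peval_bound p I t : 0 <= t <= 1 -> Cmod (peval p I t) <= rsum I (fun i => Cmod (p i)).
Proof.
 intros Ht. le_trans csum_Cmod. apply rsum_le. intros j _. rewrite Cmod_mult, Cmod_pow, Cmod_R, Rabs_pos_eq by lra.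
 rewrite <- (Rmult_1_r (Cmod (p j))) at 2. le_mul_l. pos. rewrite <- (pow1 j); fin.
Qed.

(** Monomials transform into simple poles; this is the link between polynomials and partial
    fractions. *)
Lemma Tw_peval w p I : 2 < Re w -> Tw w (peval p I) = csum I (fun i => p i * / (CN i + w))%C.
Proof.
 intros Hw. unfold Tw. rewrite (CI_ext _ (fun y => csum I (fun i => p i * (pw y (w - 1) * RtoC y ^ i)))%C). 2:{
 intros t _. unfold peval. rewrite <- csum_scal. apply csum_ext. intros; ring. }
 assert (M : forall i, is_CI (fun y => pw y (w - 1) * RtoC y ^ i)%C 0 1 (/ (CN i + w))%C). { intros i.
 set (s := (CN i + w)%C). assert (Rs : 1 < Re (s - 1)). { unfold s, Cminus. rewrite !re_plus. simpl.
 pose proof (pos_INR i). lra. } assert (Hs : s <> RtoC 0). { apply Cmod_gt_0. apply Rlt_le_trans with (Re s). unfold s.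
 rewrite re_plus; fin. apply Re_le_Cmod. } eapply is_CI_ext with (f := fun y => (/ s * (s * pw y (s - 1)))%C).
 - intros t. rewrite Rmin_left by lra. intros Ht. rewrite !pw_pos by lra. rewrite <- cpow_nat, <- cpow_plus by lra.
  replace (s - 1)%C with (w - 1 + CN i)%C by (unfold s; ring). field. auto.
 - apply is_CI_eq with (/ s * (pw 1 s - pw 0 s))%C. 2: rewrite pw_1, pw_neg by lra; ring. apply is_CI_scal.
  apply (is_CI_FTC (fun y => pw y s)).
  + intros t _. apply rdiff_pw. unfold s. rewrite re_plus, re_RtoC. pose proof (pos_INR i). lra.
  + apply rcont_on_all. intros. apply rcont_scal, rcont_pw; auto. } apply is_CI_unique. induction I; simpl.
 - eapply is_CI_eq. apply is_CI_const. ring.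
 -
  apply (is_CI_plus (fun y => csum I (fun i => p i * (pw y (w - 1) * RtoC y ^ i)))%C (fun y => p I * (pw y (w - 1) * RtoC y ^ I))%C); auto.
  apply (is_CI_scal (p I) (fun y => pw y (w - 1) * RtoC y ^ I)%C); fin.
Qed.

(** * Polynomial approximation with vanishing to high order at 1 *)

(** Counterpart of [VC] for the function to be approximated: the top derivative is Lipschitz, as the
    rate of Bernstein's polynomials demands. *)
Fixpoint SC (k : nat) (G : R -> C) : Prop :=
  match k with
  | O => (forall t, rcont G t) /\ exists L, 0 <= L /\ forall s t, 0 <= s <= 1 -> 0 <= t <= 1 -> Cmod (G s - G t) <= L * Rabs (s - t)
  | S k' => G 1 = RtoC 0 /\ exists G', (forall t, rdiff G t (G' t)) /\ SC k' G'
  end.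

(** Bernstein's operator, as the expectation of [g] at a random walk stopped at time [n]. *)
Fixpoint bern (n : nat) (g : nat -> C) (y : R) : C :=
  match n with O => g O | S n' => (RtoC (1 - y) * bern n' g y + RtoC y * bern n' (fun i => g (S i)) y)%C end.
Fixpoint bernR (n : nat) (g : nat -> R) (y : R) : R :=
  match n with O => g O | S n' => (1 - y) * bernR n' g y + y * bernR n' (fun i => g (S i)) y end.

Lemma bernR_le n : forall g g' y, 0 <= y <= 1 -> (forall i, (i <= n)%nat -> g i <= g' i) -> bernR n g y <= bernR n g' y.
Proof.
 induction n; intros g g' y Hy H; simpl. auto.
 apply Rplus_le_compat; le_mul_l; try lra; apply IHn; auto; intros; apply H; lia.
Qed.
Lemma bern_Cmod n : forall g y, 0 <= y <= 1 -> Cmod (bern n g y) <= bernR n (fun i => Cmod (g i)) y.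
Proof. induction n; intros g y Hy; simpl. lra. le_trans Cmod_triangle. rewrite !Cmod_mult, !Cmod_R, !Rabs_pos_eq by lra; fin. Qed.
Lemma bern_minus_const n : forall g c y, bern n (fun i => g i - c)%C y = (bern n g y - c)%C.
Proof. induction n; intros; simpl. auto. rewrite (IHn g), (IHn (fun i => g (S i))), RtoC_minus. ring. Qed.
Lemma bernR_lin n : forall a b g y, bernR n (fun i => a + b * g i) y = a + b * bernR n g y.
Proof. induction n; intros; simpl. auto. rewrite (IHn a b g), (IHn a b (fun i => g (S i))). ring. Qed.
(** Variance of the binomial distribution plus the squared bias, by conditioning on the first
    step. *)
Lemma bernR_var n : forall a y, bernR n (fun i => (INR i - a) ^ 2) y = INR n * y * (1 - y) + (INR n * y - a) ^ 2.
Proof.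
 induction n; intros a y. simpl. ring.
 change (bernR (S n) (fun i => (INR i - a) ^ 2) y) with ((1 - y) * bernR n (fun i => (INR i - a) ^ 2) y + y * bernR n (fun i => (INR (S i) - a) ^ 2) y).
 replace (fun i => (INR (S i) - a) ^ 2) with (fun i => (INR i - (a - 1)) ^ 2). 2:{
 apply functional_extensionality; intros i. rewrite S_INR; fin. } rewrite !IHn, S_INR. ring.
Qed.

(** The coefficients are zero from [I] on, so that two polynomials can be padded to a common
    length. *)
Definition is_poly (f : R -> C) : Prop := exists I p, (forall i, (I <= i)%nat -> p i = RtoC 0) /\ forall y, f y = peval p I y.

Lemma peval_pad p I J : (forall i, (I <= i)%nat -> p i = RtoC 0) -> (I <= J)%nat -> forall y, peval p J y = peval p I y.
Proof. intros H L y. induction L; auto. unfold peval in *. simpl. rewrite IHL, H by lia. ring. Qed.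

Lemma is_poly_plus f g : is_poly f -> is_poly g -> is_poly (fun y => f y + g y)%C.
Proof.
 intros [I [p [P1 P2]]] [J [q [Q1 Q2]]]. exists (max I J), (fun i => p i + q i)%C. split.
 - intros i Hi. rewrite P1, Q1 by lia. ring.
 - intros y. rewrite P2, Q2, <- (peval_pad p I (max I J)), <- (peval_pad q J (max I J)) by fin. unfold peval.
  rewrite <- csum_plus. apply csum_ext. intros; ring.
Qed.
Lemma is_poly_scal c f : is_poly f -> is_poly (fun y => c * f y)%C.
Proof.
 intros [I [p [P1 P2]]]. exists I, (fun i => c * p i)%C. split. intros i Hi; rewrite P1 by auto; ring. intros y.
 rewrite P2. unfold peval. rewrite <- csum_scal. apply csum_ext. intros; ring.
Qed.
Lemma is_poly_ext f g : (forall y, f y = g y) -> is_poly f -> is_poly g.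
Proof. intros E [I [p [P1 P2]]]. exists I, p. split; auto. congruence. Qed.
Lemma is_poly_X f : is_poly f -> is_poly (fun y => RtoC y * f y)%C.
Proof.
 intros [I [p [P1 P2]]]. exists (S I), (fun i => match i with O => RtoC 0 | S j => p j end). split.
 - intros [|i] Hi; auto. apply P1; lia.
 - intros y. rewrite P2. unfold peval. clear. induction I. simpl. ring. rewrite csum_S, (csum_S (S I)), <- IHI.
  simpl Cpow. ring.
Qed.
Lemma is_poly_bern n : forall g, is_poly (bern n g).
Proof.
 induction n; intros g; simpl.
 - exists 1%nat, (fun i => match i with O => g O | _ => RtoC 0 end). split. intros [|i] Hi; auto; lia. intros y.
  unfold peval. simpl. ring.
 -
  apply (is_poly_ext (fun y => bern n g y + (RtoC (-1) * (RtoC y * bern n g y) + RtoC y * bern n (fun i => g (S i)) y))%C).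
  intros y. rewrite RtoC_minus. ring. apply is_poly_plus; auto. apply is_poly_plus. apply is_poly_scal, is_poly_X; auto.
  apply is_poly_X; auto.
Qed.

(** The inequality [|x| <= d/2 + x^2/(2d)] reduces the Lipschitz error to the variance, which is at
    most [1/(4n)]; then [n > 1/d^2] is enough. *)
Lemma weierstrass_lip G L : 0 <= L -> (forall s t, 0 <= s <= 1 -> 0 <= t <= 1 -> Cmod (G s - G t) <= L * Rabs (s - t)) ->
  forall eps, 0 < eps -> exists P, is_poly P /\ forall y, 0 <= y <= 1 -> Cmod (G y - P y) <= eps.
Proof.
 intros HL HG eps He. set (d := eps / (L + 1)). assert (Hd : 0 < d) by (apply Rdiv_lt_0_compat; lra).
 destruct (INR_unbounded (/ (d * d))) as [n Hn]. assert (Hdd : 0 < / (d * d)) by fin. assert (Hn0 : 0 < INR n) by lra.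
 exists (bern n (fun i => G (INR i / INR n))). split. apply is_poly_bern. intros y Hy.
 rewrite Cmod_minus_sym, <- bern_minus_const. eapply Rle_trans. apply bern_Cmod; auto.
 le_via (bernR n (fun i => L * (d / 2) + L * / (2 * d * INR n ^ 2) * (INR i - INR n * y) ^ 2) y).
 - apply bernR_le; auto. intros i Hi. assert (Hin : 0 <= INR i / INR n <= 1). { split. pos.
  apply Rmult_le_reg_r with (INR n); auto. unfold Rdiv. rewrite Rmult_assoc, Rinv_l, Rmult_1_l, Rmult_1_r by lra; fin. }
  eapply Rle_trans. auto. rewrite Rmult_assoc, <- Rmult_plus_distr_l. le_mul_l; auto. set (x := INR i / INR n - y).
  replace (INR i - INR n * y) with (INR n * x) by (unfold x; field; lra).
  replace (/ (2 * d * INR n ^ 2) * (INR n * x) ^ 2) with (x ^ 2 / (2 * d)) by (field; lra). rewrite <- (pow2_abs x).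
  pose proof (pow2_ge_0 (Rabs x - d)). apply Rmult_le_reg_r with (2 * d). lra.
  replace ((d / 2 + Rabs x ^ 2 / (2 * d)) * (2 * d)) with (d ^ 2 + Rabs x ^ 2) by (field; lra). nra.
 - rewrite bernR_lin, bernR_var. replace ((INR n * y - INR n * y) ^ 2) with 0 by ring.
  replace (L * (d / 2) + L * / (2 * d * INR n ^ 2) * (INR n * y * (1 - y) + 0)) with (L * (d / 2 + y * (1 - y) * / (2 * d * INR n))) by (field; lra).
  le_via (L * d). 2:{ unfold d. apply Rmult_le_reg_r with (L + 1). lra.
  replace (L * (eps / (L + 1)) * (L + 1)) with (L * eps) by (field; lra). nra. } le_mul_l; auto.
  assert (y * (1 - y) * / (2 * d * INR n) <= d / 2); [|lra]. assert (Hq : / (d * d) * (d * d) = 1) by (field; lra).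
  assert (P : 0 < 2 * d * INR n) by nra. apply Rmult_le_reg_r with (2 * d * INR n); auto.
  rewrite Rmult_assoc, Rinv_l by lra. nra.
Qed.

(** The antiderivative normalised to vanish at 1. *)
Definition pint (p : nat -> C) (I : nat) (i : nat) : C :=
  match i with O => (- csum I (fun j => p j * / CN (S j)))%C | S j => (p j * / CN (S j))%C end.

Lemma csum_shift I (f : nat -> C) : csum (S I) f = (f O + csum I (fun j => f (S j)))%C.
Proof. induction I. simpl. ring. rewrite csum_S, IHI. simpl. ring. Qed.

Lemma pint_1 p I : peval (pint p I) (S I) 1 = RtoC 0.
Proof.
 unfold peval. rewrite csum_shift. unfold pint at 1.
 rewrite (csum_ext I (fun j => pint p I (S j) * 1 ^ S j)%C (fun j => p j * / CN (S j))%C). ring. intros j _.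
 rewrite Cpow_1_l. simpl. ring.
Qed.
Lemma pint_deriv p I t : rdiff (peval (pint p I) (S I)) t (peval p I t).
Proof.
 unfold peval. eapply rdiff_eq.
 apply (rdiff_csum (S I) (fun i y => pint p I i * RtoC y ^ i)%C (fun i t => pint p I i * (CN i * RtoC t ^ pred i))%C).
 intros i _. apply rdiff_scal, rdiff_pow. rewrite csum_shift. simpl pred. replace (CN 0) with (RtoC 0) by fin.
 rewrite (csum_ext I _ (fun i => p i * RtoC t ^ i)%C). ring. intros j _. unfold pint. field; pos.
Qed.

(** Vanishing of [(y d/dy)^j P] at 1 for all [j < k], that is, a zero of order [k] of the polynomial
    [P] at 1. *)
Definition moments (k : nat) (p : nat -> C) (I : nat) : Prop :=
  forall j, (j < k)%nat -> csum I (fun i => p i * CN i ^ j)%C = RtoC 0.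

Lemma moments_shift k p I : moments k p I -> forall j l, (j + l < k)%nat -> csum I (fun i => p i * (CN i ^ l * CN (S i) ^ j))%C = RtoC 0.
Proof.
 induction j; intros l Hl.
 - rewrite <- (H l ltac:(lia)). apply csum_ext. intros; ring.
 - rewrite (csum_ext I _ (fun i => p i * (CN i ^ S l * CN (S i) ^ j) + p i * (CN i ^ l * CN (S i) ^ j))%C).
  rewrite csum_plus, !IHj by lia. ring. intros i _. cbn [Cpow]. rewrite S_INR, RtoC_plus. ring.
Qed.

Lemma pint_moments k p I : moments k p I -> moments (S k) (pint p I) (S I).
Proof.
 intros H j Hj. destruct j.
 - rewrite <- (pint_1 p I). apply csum_ext. intros i _. rewrite Cpow_1_l; fin.
 - rewrite csum_shift. replace (CN 0 ^ S j)%C with (RtoC 0) by (simpl; ring).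
  rewrite (csum_ext I _ (fun i => p i * (CN i ^ 0 * CN (S i) ^ j))%C). rewrite (moments_shift k p I H) by lia. ring.
  intros i _. unfold pint. cbn [Cpow]. field; pos.
Qed.

(** Only the top derivative is approximated; [k] antiderivatives from 1 then restore the function.
    Each of them preserves the error in the sense of [VC] and adds one vanishing moment. *)
Lemma poly_approx k : forall G, SC k G -> forall eps, 0 < eps -> exists I p,
  VC k eps (fun y => G y - peval p I y)%C /\ (exists M, VC k M (peval p I)) /\ moments k p I.
Proof.
 induction k; intros G HG eps He.
 - destruct HG as [G1 [L [L0 GL]]]. destruct (weierstrass_lip G L L0 GL eps He) as [P [[I [p [P1 P2]]] P3]].
  exists I, p. split; [split|split].
  + intros t. apply rcont_minus; auto. apply rcont_peval.
  + intros t Ht. rewrite <- P2. auto.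
  + exists (rsum I (fun i => Cmod (p i))). split. apply rcont_peval. apply peval_bound; auto.
  + intros j Hj. lia.
 - destruct HG as [G1 [G' [D HG']]]. destruct (IHk G' HG' eps He) as [I [p [V1 [[M V2] Mo]]]]. exists (S I), (pint p I).
  split; [|split].
  + split. rewrite G1, pint_1. ring. exists (fun y => G' y - peval p I y)%C. split; auto. intros t.
   apply (rdiff_ext_loc (fun y => G y + (-1) * peval (pint p I) (S I) y)%C). exists 1. split. lra. intros; ring.
   eapply rdiff_eq. apply rdiff_plus. apply D. apply rdiff_scal, pint_deriv. ring.
  + exists M. split. apply pint_1. exists (peval p I). split; auto. apply pint_deriv.
  + apply pint_moments; auto.
Qed.

(** * Smooth functions on the half-line and their Mellin transforms *)

Fixpoint CkP (k : nat) (f : R -> C) : Prop :=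
  match k with
  | O => forall t, 0 < t -> rcont f t
  | S k' => exists f', (forall t, 0 < t -> rdiff f t (f' t)) /\ CkP k' f'
  end.

Lemma near_pos t u : 0 < t -> Rabs (u - t) < t -> 0 < u.
Proof. intros H H'. apply Rabs_def2 in H'. lra. Qed.

Lemma CkP_rcont k f : CkP k f -> forall t, 0 < t -> rcont f t.
Proof. destruct k; auto. intros [f' [H _]] t Ht. eapply rdiff_rcont; eauto. Qed.

Lemma CkP_down k : forall f, CkP (S k) f -> CkP k f.
Proof.
 induction k; intros f [f' [H1 H2]].
 - intros t Ht. eapply rdiff_rcont; eauto.
 - exists f'; fin.
Qed.

Lemma CkP_ext k f g : (forall t, 0 < t -> f t = g t) -> CkP k f -> CkP k g.
Proof.
 intros E. destruct k.
 - intros H t Ht. apply (rcont_ext_loc f); auto. exists t. split; auto. intros u Hu. apply E. eapply near_pos; eauto.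
 - intros [f' [H1 H2]]. exists f'. split; auto. intros t Ht. apply (rdiff_ext_loc f); auto. exists t. split; auto.
  intros u Hu. apply E. eapply near_pos; eauto.
Qed.

Lemma CkP_plus k : forall f g, CkP k f -> CkP k g -> CkP k (fun t => f t + g t)%C.
Proof.
 induction k; simpl; intros f g.
 - fin.
 - intros [f' [A1 A2]] [g' [B1 B2]]. exists (fun t => f' t + g' t)%C. split; auto. intros; apply rdiff_plus; auto.
Qed.

Lemma CkP_mult k : forall f g, CkP k f -> CkP k g -> CkP k (fun t => f t * g t)%C.
Proof.
 induction k; intros f g.
 - simpl; fin.
 - intros Hf Hg. pose proof (CkP_down k f Hf) as Df. pose proof (CkP_down k g Hg) as Dg. destruct Hf as [f' [A1 A2]].
  destruct Hg as [g' [B1 B2]]. exists (fun t => f' t * g t + f t * g' t)%C. split. intros; apply rdiff_mult; auto.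
  apply CkP_plus; auto.
Qed.

Lemma CkP_const k : forall c, CkP k (fun _ => c).
Proof. induction k; intros c; simpl. fin. exists (fun _ => RtoC 0). split; auto. intros; apply rdiff_const. Qed.

Lemma CkP_scal k c f : CkP k f -> CkP k (fun t => c * f t)%C.
Proof. apply CkP_mult. apply CkP_const. Qed.

Lemma CkP_cpow k : forall w, CkP k (fun y => cpowR y w).
Proof.
 induction k; intros w. intros t Ht. eapply rdiff_rcont, rdiff_cpow; auto. exists (fun t => w * cpowR t (w - 1))%C.
 split. apply rdiff_cpow; auto. apply CkP_scal; auto.
Qed.

Lemma CkP_comp_scale k x : 0 < x -> forall f, CkP k f -> CkP k (fun u => f (x * u)).
Proof.
 intros Hx. induction k; intros f.
 - intros H t Ht. apply rcont_comp_R. apply H. nra. apply (ex_derive_continuous (K := R_AbsRing) (V := R_NormedModule)).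
  auto_derive; auto.
 - intros [f' [A1 A2]]. exists (fun u => RtoC x * f' (x * u)%R)%C. split.
  + intros t Ht. eapply rdiff_eq. apply rdiff_comp_R. apply A1. nra. instantiate (1 := x). auto_derive; auto; ring.
   ring.
  + apply CkP_scal; auto.
Qed.

Lemma CkP_comp_inv k : forall f, CkP k f -> CkP k (fun u => f (/ u)).
Proof.
 induction k; intros f.
 - intros H t Ht. apply rcont_comp_R. apply H; fin. apply (ex_derive_continuous (K := R_AbsRing) (V := R_NormedModule)).
  auto_derive. lra.
 - intros [f' [A1 A2]]. exists (fun u => RtoC (-1) * (cpowR u (RtoC (-2)) * f' (/ u)%R))%C. split.
  + intros t Ht. eapply rdiff_eq. apply rdiff_comp_R. apply A1; fin. instantiate (1 := - (/ (t * t))). auto_derive; fin.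
   replace (RtoC (-2)) with (- CN 2)%C by (rewrite <- RtoC_opp; f_equal; simpl; ring).
   rewrite cpow_opp, cpow_nat by auto. rewrite RtoC_opp, RtoC_inv, RtoC_mult by nra. field; pos.
  + apply CkP_scal, CkP_mult; auto. apply CkP_cpow.
Qed.

(** The induction runs over all iterated derivatives at once, since the derivative of one is the
    next. *)
Lemma csmooth_CkP h : csmooth_pos h -> forall k, CkP k h.
Proof.
 intros [H1 H2] k.
 assert (G : forall k j, CkP k (fun u => (Derive_n (fun u => Re (h u)) j u, Derive_n (fun u => Im (h u)) j u) : C)). {
 induction k0; intros j.
 - intros t Ht. apply rcont_iff. split; simpl; apply (ex_derive_continuous (K := R_AbsRing) (V := R_NormedModule)).
  apply (H1 (S j) t Ht). apply (H2 (S j) t Ht).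
 - exists (fun u => (Derive_n (fun u => Re (h u)) (S j) u, Derive_n (fun u => Im (h u)) (S j) u)). split; auto.
  intros t Ht. apply rdiff_iff. split; simpl; apply Derive_correct. apply (H1 (S j) t Ht). apply (H2 (S j) t Ht). }
  eapply CkP_ext. 2: apply (G k 0%nat). intros t _. simpl. destruct (h t); reflexivity.
Qed.

(** For a function that vanishes near 0 this extension is as smooth on the whole line as it is on
    the half-line, the form in which [VC] and [SC] are stated. *)
Definition zext (G : R -> C) (y : R) : C := if Rle_dec y 0 then RtoC 0 else G y.
Lemma zext_pos G y : 0 < y -> zext G y = G y.
Proof. unfold zext. destruct (Rle_dec y 0); auto; lra. Qed.

Lemma zext_loc_zero G eta t : 0 < eta -> (forall y, 0 < y < eta -> G y = RtoC 0) -> t < eta ->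
  exists d, 0 < d /\ forall u, Rabs (u - t) < d -> RtoC 0 = zext G u.
Proof.
 intros He H Ht. exists (eta - t). split. lra. intros u Hu. apply Rabs_def2 in Hu. unfold zext.
 destruct (Rle_dec u 0); auto. symmetry. apply H. lra.
Qed.
Lemma zext_loc_pos G t : 0 < t -> exists d, 0 < d /\ forall u, Rabs (u - t) < d -> G u = zext G u.
Proof. exists t. split; auto. intros u Hu. rewrite zext_pos; auto. eapply near_pos; eauto. Qed.

Lemma rdiff_unique f t l l' : rdiff f t l -> rdiff f t l' -> l = l'.
Proof.
 rewrite !rdiff_iff. intros [A1 A2] [B1 B2]. apply C_ext. rewrite <- (is_derive_unique _ _ _ A1).
 apply is_derive_unique; auto. rewrite <- (is_derive_unique _ _ _ A2). apply is_derive_unique; auto.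
Qed.

Lemma rdiff_loc_zero f t l : rdiff f t l -> (exists d, 0 < d /\ forall u, Rabs (u - t) < d -> RtoC 0 = f u) -> l = RtoC 0.
Proof. intros H E. eapply rdiff_unique. exact H. apply (rdiff_ext_loc (fun _ => RtoC 0)); auto. apply rdiff_const. Qed.

Lemma zext_rcont G eta : 0 < eta -> (forall y, 0 < y < eta -> G y = RtoC 0) -> (forall t, 0 < t -> rcont G t) -> forall t, rcont (zext G) t.
Proof.
 intros He H HG t. destruct (Rle_lt_dec t 0).
 - eapply rcont_ext_loc. apply zext_loc_zero with eta; auto. lra. fin.
 - eapply rcont_ext_loc. apply zext_loc_pos; auto. auto.
Qed.

Lemma zext_rdiff G G' eta : 0 < eta -> (forall y, 0 < y < eta -> G y = RtoC 0) -> (forall t, 0 < t -> rdiff G t (G' t)) ->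
  forall t, rdiff (zext G) t (zext G' t).
Proof.
 intros He H HG t. destruct (Rle_lt_dec t 0).
 - unfold zext at 2. destruct (Rle_dec t 0); [|lra]. eapply rdiff_ext_loc. apply zext_loc_zero with eta; auto. lra.
  apply rdiff_const.
 - rewrite (zext_pos G') by auto. eapply rdiff_ext_loc. apply zext_loc_pos; auto. auto.
Qed.

Lemma deriv_support G G' eta c : 0 < c -> (forall y, 0 < y < eta -> G y = RtoC 0) -> (forall y, c < y -> G y = RtoC 0) ->
  (forall t, 0 < t -> rdiff G t (G' t)) -> (forall y, 0 < y < eta -> G' y = RtoC 0) /\ (forall y, c < y -> G' y = RtoC 0).
Proof.
 intros Hc H1 H2 D. split; intros y Hy.
 - eapply rdiff_loc_zero. apply D; lra. exists (Rmin y (eta - y)). split. pos. intros u Hu.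
  assert (A := Rlt_le_trans _ _ _ Hu (Rmin_l _ _)). assert (B := Rlt_le_trans _ _ _ Hu (Rmin_r _ _)).
  apply Rabs_def2 in A. apply Rabs_def2 in B. symmetry; apply H1. lra.
 - eapply rdiff_loc_zero. apply D; lra. exists (y - c). split. lra. intros u Hu. apply Rabs_def2 in Hu.
  symmetry; apply H2. lra.
Qed.

Lemma CkP_VC k : forall G eta c, CkP k G -> 0 < eta -> 0 < c < 1 -> (forall y, 0 < y < eta -> G y = RtoC 0) -> (forall y, c < y -> G y = RtoC 0) ->
  exists M, VC k M (zext G).
Proof.
 induction k; intros G eta c HG He Hc H1 H2.
 - pose proof (zext_rcont G eta He H1 HG) as R.
  destruct (rcont_bounded (zext G) 0 1 ltac:(lra) (fun t _ => R t)) as [M [M0 HM]]. exists M. split; auto.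
 - destruct HG as [G' [D HG']]. destruct (deriv_support G G' eta c ltac:(lra) H1 H2 D) as [S1 S2].
  destruct (IHk G' eta c HG' He Hc S1 S2) as [M HM]. exists M. split. rewrite zext_pos by lra. apply H2; lra.
  exists (zext G'). split; auto. apply (zext_rdiff G G' eta); auto.
Qed.

Lemma CkP_SC k : forall G eta c, CkP (S k) G -> 0 < eta -> 0 < c < 1 -> (forall y, 0 < y < eta -> G y = RtoC 0) -> (forall y, c < y -> G y = RtoC 0) ->
  SC k (zext G).
Proof.
 induction k; intros G eta c HG He Hc H1 H2.
 - pose proof (CkP_rcont _ _ HG) as HR. destruct HG as [G' [D HG']].
  destruct (deriv_support G G' eta c ltac:(lra) H1 H2 D) as [S1 S2].
  destruct (CkP_VC 0 G' eta c HG' He Hc S1 S2) as [M [R' HM]].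
  assert (M0 : 0 <= M) by (eapply Rle_trans; [pos|apply (HM 0); lra]). pose proof (zext_rdiff G G' eta He H1 D) as D'.
  split. apply (zext_rcont G eta); auto. exists M. split; auto.
  assert (Q : forall s t, 0 <= s <= 1 -> 0 <= t <= 1 -> s <= t -> Cmod (zext G t - zext G s) <= M * (t - s)). {
  intros s t Hs Ht L. assert (E : is_CI (zext G') s t (zext G t - zext G s)%C). { apply is_CI_FTC; fin. }
  refine (is_CI_bound_const _ M _ _ _ _ _ E); auto. intros u Hu. apply HM; lra. } intros s t Hs Ht.
  destruct (Rle_dec s t) as [L|L]. rewrite Cmod_minus_sym, Rabs_left1 by lra.
  replace (- (s - t)) with (t - s) by ring; fin. rewrite Rabs_pos_eq by lra. apply Q; lra.
 - destruct HG as [G' [D HG']]. destruct (deriv_support G G' eta c ltac:(lra) H1 H2 D) as [S1 S2]. split.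
  rewrite zext_pos by lra. apply H2; lra. exists (zext G'). split. apply (zext_rdiff G G' eta); auto. fin.
Qed.

Lemma int0inf_support f a b l : 0 < a -> a <= b -> (forall u, 0 < u -> u < a \/ b < u -> f u = RtoC 0) -> is_CI f a b l -> int0inf f = l.
Proof.
 intros Ha Hab Hz Hl. unfold int0inf. apply (is_RInt_gen_unique (V := C_R_CompleteNormedModule)). intros P HP.
 apply (Filter_prod _ _ _ (fun x => 0 < x < a) (fun y => b < y)).
 - exists (mkposreal a Ha). intros y Hy Hy0. apply Rabs_def2 in Hy. unfold minus, plus, opp in Hy; simpl in Hy. lra.
 - exists b. auto.
 - intros x y Hx Hy. exists l. split. 2: apply (locally_singleton _ _ HP).
  assert (Z : forall c d, (forall t, Rmin c d < t < Rmax c d -> f t = RtoC 0) -> is_CI f c d 0). { intros c d H.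
  apply is_CI_ext with (f := fun _ => RtoC 0). symmetry; auto. eapply is_CI_eq. apply is_CI_const. ring. }
  apply (is_CI_eq f x y (0 + l + 0)%C). 2: ring. apply is_CI_Chasles with b. apply is_CI_Chasles with a; auto. apply Z.
  rewrite Rmin_left, Rmax_right by lra. intros; apply Hz; lra. apply Z. rewrite Rmin_left, Rmax_right by lra.
  intros; apply Hz; lra.
Qed.

Definition test (H : R -> C) (a b : R) : Prop :=
  (forall k, CkP k H) /\ 0 < a /\ a <= b /\ forall u, 0 < u -> u < a \/ b < u -> H u = RtoC 0.

Definition MT (H : R -> C) (a b : R) (z : C) : C := CI (fun u => H u * cpowR u (z - 1))%C a b.

Lemma test_rcont H a b z : test H a b -> rcont_on (fun u => H u * cpowR u (z - 1))%C a b.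
Proof.
 intros [T1 [T2 [T3 T4]]]. apply rcont_on_le; auto. intros t Ht. apply (CkP_rcont 0 (fun u => H u * cpowR u (z - 1))%C).
 apply CkP_mult. apply T1. apply CkP_cpow. lra.
Qed.

Lemma int0inf_MT H a b z : test H a b -> int0inf (fun u => Cdiv (Cmult (H u) (cpowR u z)) (RtoC u)) = MT H a b z.
Proof.
 intros HT. pose proof (test_rcont H a b z HT) as RC. destruct HT as [T1 [T2 [T3 T4]]].
 apply int0inf_support with a b; auto.
 - intros u Hu Hs. rewrite T4 by auto. field; pos.
 - eapply is_CI_ext. 2: apply is_CI_cont, RC. intros t. rewrite Rmin_left by lra. intros Ht.
  rewrite cpow_minus_1 by lra. field; pos.
Qed.

(** Substitution [y = 1/u]. The factor [y^(-sigma)] turns [z] into [sigma - z], and [a > 1] places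
    the support inside [(0, 1)]. *)
Lemma MT_Tw H a b sigma z : test H a b -> 1 < a ->
  Tw (sigma - z) (zext (fun y => H (/ y)%R * cpowR y (- sigma))%C) = MT H a b z.
Proof.
 intros HT Ha1. destruct HT as [T1 [T2 [T3 T4]]]. assert (Ib : 0 < / b) by (pos). assert (Iab : / b <= / a) by fin.
 assert (Ia : / a < 1) by (rewrite <- Rinv_1; apply Rinv_lt_contravar; lra). apply is_CI_unique.
 set (F := fun y => (pw y (sigma - z - 1) * zext (fun y => H (/ y)%R * cpowR y (- sigma)) y)%C).
 assert (Z : forall c d, (forall t, Rmin c d < t < Rmax c d -> F t = RtoC 0) -> is_CI F c d 0). { intros c d HH.
 apply is_CI_ext with (f := fun _ => RtoC 0). symmetry; auto. eapply is_CI_eq. apply is_CI_const. ring. }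
 apply (is_CI_eq F 0 1 (0 + MT H a b z + 0)%C). 2: ring. eapply is_CI_Chasles. apply is_CI_Chasles with (/ b).
 - apply Z. rewrite Rmin_left, Rmax_right by lra. intros t Ht. unfold F. rewrite zext_pos by lra. rewrite T4. ring. pos.
  right. rewrite <- (Rinv_inv b). apply Rinv_lt_contravar; fin.
 -
  assert (S : is_CI (fun y => RtoC (- (/ (y * y))) * (H (/ y)%R * cpowR (/ y)%R (z - 1)))%C (/ a) (/ b) (CI (fun u => H u * cpowR u (z - 1))%C (/ / a) (/ / b))).
  { apply is_CI_subst.
 - intros x. rewrite Rmin_right by lra. intros Hx. apply (CkP_rcont 0 (fun u => H u * cpowR u (z - 1))%C).
  apply CkP_mult. apply T1. apply CkP_cpow. pos.
 - rewrite Rmin_right by lra. split. auto_derive; fin.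
  apply (ex_derive_continuous (K := R_AbsRing) (V := R_NormedModule)). auto_derive. nra. } rewrite !Rinv_inv in S.
  assert (S' : is_CI (fun y => RtoC (- (/ (y * y))) * (H (/ y)%R * cpowR (/ y)%R (z - 1)))%C (/ b) (/ a) (- MT H a b z)%C).
  { apply (is_RInt_swap (V := C_R_NormedModule)); fin. } apply (is_CI_scal (RtoC (-1))) in S'.
  apply is_CI_eq with (RtoC (-1) * - MT H a b z)%C. 2: ring. eapply is_CI_ext; [|exact S']. intros t.
  rewrite Rmin_left by lra. intros Ht. unfold F. rewrite zext_pos, pw_pos by lra. rewrite cpow_inv_base by lra.
  replace (sigma - z - 1)%C with (- (z - 1) + sigma + - CN 2)%C by (simpl; rewrite RtoC_plus; ring).
  rewrite !cpow_plus, (cpow_opp t sigma), (cpow_opp t (CN 2)), cpow_nat by lra.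
  rewrite RtoC_opp, RtoC_inv, RtoC_mult by nra. field. split; [apply cpow_neq_0|intros E; apply RtoC_inj in E; lra].
 - apply Z. rewrite Rmin_left by lra. intros t Ht. unfold F. rewrite zext_pos by lra. rewrite T4. ring. pos. left.
  rewrite <- (Rinv_inv a). apply Rinv_lt_contravar; fin.
Qed.

Lemma Tw_minus w P Q : 2 < Re w -> (forall t, rcont P t) -> (forall t, rcont Q t) -> Tw w (fun y => P y - Q y)%C = (Tw w P - Tw w Q)%C.
Proof.
 intros Hw HP HQ. unfold Tw. assert (forall t, rcont (fun y => pw y (w - 1)%C) t). { intros t. apply rcont_pw.
 rewrite re_minus, re_RtoC. lra. } rewrite <- CI_minus. apply CI_ext. intros; ring. fin. fin.
Qed.

Lemma csum_cser I (p : nat -> C) (u : nat -> nat -> C) (L : nat -> C) : (forall i, cser (u i) (L i)) ->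
  cser (fun j => csum I (fun i => p i * u i j)%C) (csum I (fun i => p i * L i)%C).
Proof.
 intros H. induction I; simpl.
 - exists 0%nat. intros n _. replace (csum n (fun _ => RtoC 0)) with (RtoC 0). rewrite Cmod_self; lra.
  induction n; simpl; auto. rewrite <- IHn; ring.
 - apply cser_plus; auto. apply cser_scal; auto.
Qed.

(** * The explicit formula for a test function supported to the right of 1 *)

Section EF.
Variables (E E' : C -> C) (n : C -> nat) (K : R) (N m : nat) (Lam : nat -> C) (sigma B : R).
Hypothesis HE : Entire E.
Hypothesis HE' : forall z, cdiff E z (E' z).
Hypothesis Hn : forall z, is_ord E z (n z).
Hypothesis HK : 0 <= K.
Hypothesis Hg : forall z, Cmod (E z) <= exp (K * (1 + Cmod z) ^ N).
Hypothesis Hsig : 3 < sigma.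
Hypothesis Hz : forall z, n z <> O -> Re z <= sigma - 3.
Hypothesis HL : forall i : nat, exists L, cser (fun j => Lam (S j) * cpowR (INR (S j)) (- RtoC (sigma + INR i)))%C L /\
   (E' (RtoC (sigma + INR i)) / E (RtoC (sigma + INR i)))%C = (CN m / (RtoC (sigma + INR i) - 1) - L)%C.
Hypothesis HB : forall J, rsum J (fun j => Cmod (Lam (S j) * cpowR (INR (S j)) (- RtoC sigma))%C) <= B.

(** Translation by [sigma] moves the evaluation points [sigma + i] to the natural numbers and all
    zeros to [Re v <= -3]. *)
Let f1 (v : C) : C := E (RtoC sigma + v)%C.
Let n1 (v : C) : nat := n (RtoC sigma + v)%C.
Let k := (N + 1)%nat.
Let K1 := K * (1 + sigma) ^ N.

Lemma f1_entire : Entire f1.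
Proof. apply (Entire_comp E (fun v => RtoC sigma + v)%C); auto; fin. Qed.
Lemma f1_ord v : is_ord f1 v (n1 v).
Proof.
 destruct (Hn (RtoC sigma + v)%C) as [g [G1 [G2 G3]]]. exists (fun v => g (RtoC sigma + v)%C). split; [|split]; auto.
 fin. intros z. unfold f1. rewrite G3. do 2 f_equal. ring.
Qed.
Lemma K1_pos : 0 <= K1. Proof. apply Rmult_le_pos; fin. Qed.
Lemma f1_growth v : Cmod (f1 v) <= exp (K1 * (1 + Cmod v) ^ N).
Proof.
 unfold K1. le_trans Hg. apply exp_le. rewrite Rmult_assoc, <- Rpow_mult_distr. le_mul_l; auto. apply pow_incr.
 pose proof (Cmod_triangle (RtoC sigma) v) as T. rewrite Cmod_R, Rabs_pos_eq in T by lra. pose proof (Cmod_ge_0 v).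
 pose proof (Cmod_ge_0 (RtoC sigma + v)). nra.
Qed.
Lemma f1_nz i : f1 (CN i) <> RtoC 0.
Proof.
 apply (ord_zero_iff f1 _ f1_entire). pose proof (f1_ord (CN i)) as O. replace 0%nat with (n1 (CN i)); auto.
 destruct (Nat.eq_dec (n1 (CN i)) 0) as [e|e]; auto. apply Hz in e. rewrite re_plus, !re_RtoC in e.
 pose proof (pos_INR i). lra.
Qed.

Lemma zero_far v : n1 v <> O -> 2 < Re (- v).
Proof. intros H. apply Hz in H. rewrite re_plus, re_RtoC in H. rewrite re_opp. lra. Qed.

Lemma far_weight v : 2 < Re (- v) -> / Cmod (- v) ^ k <= 2 ^ k * / (1 + Cmod v) ^ k.
Proof.
 intros H. pose proof (Re_le_Cmod (- v)). rewrite Cmod_opp in *. set (x := Cmod v) in *.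
 rewrite <- pow_inv, <- pow_inv, <- Rpow_mult_distr. apply pow_incr. split. pos.
 apply Rmult_le_reg_r with (x * (1 + x)). nra. replace (/ x * (x * (1 + x))) with (1 + x) by (field; lra).
 replace (2 * / (1 + x) * (x * (1 + x))) with (2 * x) by (field; lra). lra.
Qed.

Section WithTest.
Variables (H : R -> C) (a b : R).
Hypothesis HT : test H a b.
Hypothesis Ha1 : 1 < a.

Let G := zext (fun y => H (/ y)%R * cpowR y (- RtoC sigma))%C.

Lemma G_facts : SC k G /\ exists M, VC k M G.
Proof.
 destruct HT as [T1 [T2 [T3 T4]]]. assert (Ib : 0 < / b) by (pos). assert (Ia0 : 0 < / a) by (pos).
 assert (Ia : / a < 1) by (rewrite <- Rinv_1; apply Rinv_lt_contravar; lra).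
 assert (Ck : forall q, CkP q (fun y => H (/ y)%R * cpowR y (- RtoC sigma))%C). { intros q. apply CkP_mult.
 apply CkP_comp_inv; auto. apply CkP_cpow. }
 assert (S1 : forall y, 0 < y < / b -> (H (/ y)%R * cpowR y (- RtoC sigma))%C = RtoC 0). { intros y Hy. rewrite T4.
 ring. pos. right. rewrite <- (Rinv_inv b). apply Rinv_lt_contravar; fin. }
 assert (S2 : forall y, / a < y -> (H (/ y)%R * cpowR y (- RtoC sigma))%C = RtoC 0). { intros y Hy. rewrite T4. ring.
 pos. left. rewrite <- (Rinv_inv a). apply Rinv_lt_contravar; fin. } split. apply (CkP_SC k _ (/ b) (/ a)); auto.
 apply (CkP_VC k _ (/ b) (/ a)); auto.
Qed.

Lemma G_rcont t : rcont G t.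
Proof. destruct G_facts as [_ [M HM]]. apply (VC_rcont k M); auto. Qed.

Lemma MT_weight : exists A, forall z, n z <> O -> Cmod (MT H a b z) <= A * / (1 + Cmod (z - RtoC sigma)) ^ k.
Proof.
 destruct G_facts as [_ [M HM]]. exists (M * 2 ^ k). intros z Hnz. rewrite <- (MT_Tw H a b sigma z HT Ha1).
 set (v := (z - RtoC sigma)%C). replace (RtoC sigma - z)%C with (- v)%C by (unfold v; ring). assert (F : 2 < Re (- v)).
 { apply zero_far. unfold n1, v. replace (RtoC sigma + (z - RtoC sigma))%C with z by ring. auto. } eapply Rle_trans.
 apply Tw_bound; eauto. rewrite Rmult_assoc. le_mul_l. eapply Rle_trans. pos. apply (VC_sup k M G HM 0). lra.
 apply far_weight; auto.
Qed.

(** For [H(u) = u^(-sigma) P(1/u)] this is [PF_SumDiv]: the combination of the values of [E'/E]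
    splits into the pole at 1 and a Dirichlet series. The general case follows by approximating
    [H(1/y) y^(-sigma)] in the sense of [VC]. *)
Theorem explicit_formula LH : cser (fun j => Lam (S j) * H (INR (S j)))%C LH ->
  SumDiv (fun z => INR (n z)) (MT H a b) (CN m * MT H a b 1 - LH)%C.
Proof.
 intros HLH. destruct G_facts as [GS _].
 destruct (weight_bound f1 n1 K1 N f1_entire f1_ord K1_pos f1_growth (f1_nz 0)) as [M HM].
 assert (B0 : 0 <= B) by (apply (HB 0)). assert (HW0 : forall z, 0 < / (1 + Cmod z) ^ k). { intros z. pos. }
 assert (Main : SumDiv (fun v => INR (n1 v)) (fun v => Tw (- v) G) (CN m * MT H a b 1 - LH)%C). {
 apply (SD_approx _ (fun v => / (1 + Cmod v) ^ k) M).
 - intros; pos.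
 - intros; pos.
 - exact HM.
 (* An approximation error [e] costs at most [2^k e] in the weighted sum over zeros, [m e] at the
    pole and [B e] in the Dirichlet series. *)
 - intros eps He. set (D := 2 ^ k + INR m + B + 1). pose proof (pos_INR m) as Hm0. assert (H2k : 0 < 2 ^ k) by pos.
  set (e := eps / D). assert (HD : 0 < D) by (unfold D; lra). assert (He' : 0 < e) by (apply Rdiv_lt_0_compat; auto).
  destruct (poly_approx k G GS e He') as [I [p [V1 [[Mp V2] Mo]]]]. set (f1' := fun v => E' (RtoC sigma + v)%C).
  assert (Hf1' : forall v, cdiff f1 v (f1' v)). { intros v. unfold f1'. eapply cdiff_eq.
  apply (cdiff_comp E (fun v => RtoC sigma + v)%C); fin. ring. }
  assert (TP : forall v, 2 < Re (- v) -> csum I (fun i => p i * / (CN i - v))%C = Tw (- v) (peval p I)). { intros v Hv.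
  rewrite Tw_peval by auto; fin. }
  exists (fun v => csum I (fun i => p i * / (CN i - v)))%C, (csum I (fun i => p i * (f1' (CN i) / f1 (CN i))))%C.
  assert (VP := Tw_bound k Mp (peval p I)). split; [|split].
  + apply (PF_SumDiv f1 f1' n1 K1 N p I f1_entire Hf1' f1_ord K1_pos f1_growth f1_nz Mo (Mp * 2 ^ k)). intros v Hv.
   apply zero_far in Hv. rewrite TP by auto. eapply Rle_trans. auto. rewrite Rmult_assoc. le_mul_l. eapply Rle_trans.
   pos. apply (VC_sup k Mp _ V2 0); lra. apply far_weight; auto.
  +
   assert (Lx : exists L : nat -> C, forall i, cser (fun j => Lam (S j) * cpowR (INR (S j)) (- RtoC (sigma + INR i)))%C (L i) /\ (E' (RtoC (sigma + INR i)) / E (RtoC (sigma + INR i)))%C = (CN m / (RtoC (sigma + INR i) - 1) - L i)%C).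
   {
   apply (choice (fun i L => cser (fun j => Lam (S j) * cpowR (INR (S j)) (- RtoC (sigma + INR i)))%C L /\ (E' (RtoC (sigma + INR i)) / E (RtoC (sigma + INR i)))%C = (CN m / (RtoC (sigma + INR i) - 1) - L)%C)); fin.
   } destruct Lx as [L HLx]. set (w1 := (RtoC sigma - 1)%C).
   assert (Hw1 : 2 < Re w1) by (unfold w1, Cminus; rewrite re_plus, re_opp, !re_RtoC; lra).
   assert (ES : csum I (fun i => p i * (f1' (CN i) / f1 (CN i)))%C = (CN m * Tw w1 (peval p I) - csum I (fun i => p i * L i))%C).
   { rewrite Tw_peval by auto.
   match goal with |- _ = (?c * ?x - ?y)%C => replace (c * x - y)%C with (c * x + (-1) * y)%C by ring end.
   rewrite <- !csum_scal, <- csum_plus. apply csum_ext. intros i _. unfold f1', f1. rewrite <- RtoC_plus.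
   rewrite (proj2 (HLx i)). unfold w1. rewrite RtoC_plus. unfold Cdiv.
   replace (CN i + (RtoC sigma - 1))%C with (RtoC sigma + CN i - 1)%C by ring. ring. } rewrite ES.
   assert (EG : MT H a b 1 = Tw w1 G) by (symmetry; apply (MT_Tw H a b (RtoC sigma) 1 HT Ha1)). rewrite EG.
   assert (CP : cser (fun j => Lam (S j) * cpowR (INR (S j)) (- RtoC sigma) * peval p I (/ INR (S j)))%C (csum I (fun i => p i * L i)%C)).
   { eapply cser_ext.
   2: apply (csum_cser I p (fun i j => Lam (S j) * cpowR (INR (S j)) (- RtoC (sigma + INR i)))%C L (fun i => proj1 (HLx i))).
   intros j. unfold peval. rewrite <- csum_scal. apply csum_ext. intros i _. assert (0 < INR (S j)) by pos.
   rewrite RtoC_plus. replace (- (RtoC sigma + CN i))%C with (- RtoC sigma + - CN i)%C by ring.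
   rewrite cpow_plus, (cpow_opp _ (CN i)), cpow_nat by auto. rewrite RtoC_inv by lra. rewrite Cpow_inv. ring. pos. }
   assert (CG : cser (fun j => Lam (S j) * cpowR (INR (S j)) (- RtoC sigma) * G (/ INR (S j)))%C LH). { eapply cser_ext.
   2: exact HLH. intros j. assert (0 < INR (S j)) by pos. assert (0 < / INR (S j)) by (pos). unfold G.
   rewrite zext_pos by auto. rewrite Rinv_inv, cpow_inv_base by auto. rewrite !cpow_opp. field. apply cpow_neq_0. }
   replace (CN m * Tw w1 (peval p I) - csum I (fun i => p i * L i) - (CN m * Tw w1 G - LH))%C with ((-1) * (CN m * (Tw w1 G - Tw w1 (peval p I))) + (LH + (-1) * csum I (fun i => p i * L i)))%C by ring.
   rewrite <- Tw_minus by (auto; try apply G_rcont; apply rcont_peval).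
   assert (Bd1 : Cmod (Tw w1 (fun y => G y - peval p I y)%C) <= e). { eapply Rle_trans. apply Tw_bound; eauto.
   rewrite <- (Rmult_1_r e) at 2. le_mul_l. lra. rewrite <- Rinv_1. apply Rinv_le_contravar. lra. apply pow_ge_1.
   pose proof (Re_le_Cmod w1). lra. } assert (Bd2 : Cmod (LH + (-1) * csum I (fun i => p i * L i))%C <= e * B). {
   pose proof (cser_plus _ _ _ _ CG (cser_scal (-1) _ _ CP)) as CD. eapply cser_abs_bound. 2: exact CD. intros J.
   eapply Rle_trans. 2: le_mul_l; [lra|apply (HB J)]. rewrite <- rsum_scal. apply rsum_le. intros j _.
   replace (Lam (S j) * cpowR (INR (S j)) (- RtoC sigma) * G (/ INR (S j)) + -1 * (Lam (S j) * cpowR (INR (S j)) (- RtoC sigma) * peval p I (/ INR (S j))))%C with (Lam (S j) * cpowR (INR (S j)) (- RtoC sigma) * (G (/ INR (S j))%R - peval p I (/ INR (S j))%R))%C by ring.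
   rewrite Cmod_mult, Rmult_comm. le_mul_r. pos. apply (VC_sup k e _ V1). split; fin. } le_trans Cmod_triangle.
   rewrite !Cmod_mult, !Cmod_R. rewrite (Rabs_pos_eq (INR m)) by auto.
   replace (Rabs (-1)) with 1 by (rewrite Rabs_left; lra). assert (e * D = eps) by (unfold e; field; lra).
   unfold D in H0. nra.
  + intros v Hv. assert (Hv' : n1 v <> O) by (intros EE; apply Hv; rewrite EE; reflexivity). apply zero_far in Hv'.
   rewrite TP by auto. rewrite Cmod_minus_sym, <- Tw_minus by (auto; try apply G_rcont; apply rcont_peval).
   eapply Rle_trans. apply Tw_bound; eauto. le_trans Rmult_le_compat_l. lra. apply far_weight; auto.
   rewrite <- Rmult_assoc. le_mul_r. pos. assert (e * D = eps) by (unfold e; field; lra). unfold D in H0. nra. }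
   apply (SD_translate _ _ _ (- RtoC sigma)%C) in Main. eapply SD_ext. 3: exact Main.
 - intros z. unfold n1. do 2 f_equal. ring.
 - intros z _. rewrite <- (MT_Tw H a b sigma z HT Ha1). f_equal. ring.
Qed.
End WithTest.

Lemma zeros_weight : exists M, forall l, NoDup l -> lsumR (fun z => INR (n z) * / (1 + Cmod (z - RtoC sigma)) ^ k) l <= M.
Proof.
 destruct (weight_bound f1 n1 K1 N f1_entire f1_ord K1_pos f1_growth (f1_nz 0)) as [M HM]. exists M. intros l Hl.
 assert (EQ : lsumR (fun z => INR (n1 z) * / (1 + Cmod z) ^ (N + 1)) (map (fun z => z - RtoC sigma)%C l) = lsumR (fun z => INR (n z) * / (1 + Cmod (z - RtoC sigma)) ^ k) l).
 { clear. induction l; simpl; auto. rewrite IHl. unfold n1.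
 replace (RtoC sigma + (a - RtoC sigma))%C with a by ring; fin. } rewrite <- EQ. apply HM.
 apply FinFun.Injective_map_NoDup; auto. intros x y Exy. apply Ceq_minus. apply Ceq_minus in Exy. rewrite <- Exy. ring.
Qed.
End EF.

(** * The reciprocal Gamma function *)

Lemma rsum_S n f : rsum (S n) f = rsum n f + f n.
Proof. auto. Qed.
Lemma cprod_S n F : cprod (S n) F = (cprod n F * F n)%C.
Proof. auto. Qed.

Lemma Clim_ext u v l : (exists N, forall n, (N <= n)%nat -> u n = v n) -> Clim u l -> Clim v l.
Proof. intros [N0 E] H e He. destruct (H e He) as [N HN]. exists (max N N0). intros n Hn. rewrite <- E by lia. apply HN; lia. Qed.

Lemma Clim_bounded u l : Clim u l -> exists M N, 0 < M /\ forall n, (N <= n)%nat -> Cmod (u n) <= M.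
Proof.
 intros H. destruct (H 1 Rlt_0_1) as [N HN]. exists (Cmod l + 1), N. split. pos. intros n Hn. specialize (HN n Hn).
 pose proof (Cmod_triangle_inv (u n) l). lra.
Qed.

Lemma Clim_mult u v l m : Clim u l -> Clim v m -> Clim (fun n => u n * v n)%C (l * m)%C.
Proof.
 intros H H' e He. destruct (Clim_bounded v m H') as [M [N0 [M0 HM]]]. pose proof (Cmod_ge_0 l).
 destruct (H (e / (2 * M))) as [N HN]. pos. destruct (H' (e / (2 * (Cmod l + 1)))) as [N' HN']. pos.
 exists (max N0 (max N N')). intros n Hn. specialize (HM n ltac:(lia)). specialize (HN n ltac:(lia)).
 specialize (HN' n ltac:(lia)). replace (u n * v n - l * m)%C with ((u n - l) * v n + l * (v n - m))%C by ring.
 le_trans Cmod_triangle. rewrite !Cmod_mult. le_via (e / (2 * M) * M + (Cmod l + 1) * (e / (2 * (Cmod l + 1)))).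
 2: right; field; lra. fin.
Qed.

Lemma Clim_const c : Clim (fun _ => c) c.
Proof. exists 0%nat. intros. rewrite Cmod_self. lra. Qed.

Lemma Clim_inv u l : l <> RtoC 0 -> Clim u l -> Clim (fun n => / u n)%C (/ l)%C.
Proof.
 intros Hl H e He. destruct (cdiff_ccont _ _ _ (cdiff_inv l Hl) e He) as [d [Hd K]].
 destruct (H (d/2) ltac:(lra)) as [N HN]. exists N. intros n Hn. left. apply K. specialize (HN n Hn). lra.
Qed.

(* Sequences are indexed so that the n-th term belongs to the integer [n + 1]. *)
Lemma telescoping_limit (x : nat -> C) D : 0 <= D -> (forall n, Cmod (x (S n) - x n) <= D * (/ INR (S n) - / INR (S (S n)))) ->
  exists l, forall n, Cmod (x n - l) <= D * / INR (S n).
Proof.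
 intros HD H. assert (Hi : forall n, 0 < / INR (S n)) by (intros; apply Rinv_0_lt_compat, INR_S_pos).
 assert (G : forall n k, Cmod (x (n + k)%nat - x n) <= D * (/ INR (S n) - / INR (S (n + k)))). { induction k.
 rewrite Nat.add_0_r, Cmod_self. lra. rewrite Nat.add_succ_r.
 replace (x (S (n + k)) - x n)%C with ((x (S (n + k)) - x (n + k)%nat) + (x (n + k)%nat - x n))%C by ring.
 le_trans Cmod_triangle. specialize (H (n + k)%nat). lra. }
 destruct (limit_rate x (fun n => D * / INR (S n))) as [l Hl].
 - intros n m L. replace m with (n + (m - n))%nat by lia. le_trans G. le_mul_l; auto. specialize (Hi (n + (m - n))%nat).
  lra.
 - intros e. apply inv_INR_small; auto.
 - exists l. intros n. rewrite Cmod_minus_sym. auto.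
Qed.

(** [Gn n] is the reciprocal of Gauss' expression at [n + 1]. *)
Definition Gn (n : nat) (s : C) : C :=
  (cprod (S (S n)) (fun k => s + CN k) * / RtoC (INR (fact (S n))) * cpowR (INR (S n)) (- s))%C.

(** Ratio of consecutive approximants: [(1 + s/N) (N/(N-1))^(-s)] with [N = n + 2]. *)
Definition gfac (n : nat) (s : C) : C := ((1 + s * RtoC (/ INR (S (S n)))) * cexp (- (s * RtoC (ln (INR (S (S n)) / INR (S n))))))%C.

Lemma fact_neq n : CN (fact n) <> RtoC 0.
Proof. intros E. apply RtoC_inj in E. apply (INR_fact_neq_0 n E). Qed.

Lemma Gn_S n s : Gn (S n) s = (Gn n s * gfac n s)%C.
Proof.
 unfold Gn, gfac.
 change (cprod (S (S (S n))) (fun k => (s + CN k)%C)) with (cprod (S (S n)) (fun k => (s + CN k)%C) * (s + RtoC (INR (S (S n)))))%C.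
 replace (fact (S (S n))) with (S (S n) * fact (S n))%nat by fin. rewrite mult_INR, RtoC_mult. unfold cpowR.
 rewrite ln_div by fin. rewrite RtoC_inv by fin.
 replace (- s * RtoC (ln (INR (S (S n)))))%C with (- s * RtoC (ln (INR (S n))) + - (s * RtoC (ln (INR (S (S n))) - ln (INR (S n)))))%C by (rewrite RtoC_minus; ring).
 rewrite cexp_plus. field. split. pos. apply fact_neq.
Qed.

Lemma ln_ratio n : / INR (S (S n)) <= ln (INR (S (S n)) / INR (S n)) <= / INR (S n).
Proof.
 pose proof (INR_S_pos n). pose proof (INR_S_pos (S n)). assert (E : INR (S (S n)) = INR (S n) + 1) by fin.
 assert (L : forall x, 0 < x -> ln x <= x - 1). { intros x Hx. destruct (Req_dec x 1). subst. rewrite ln_1; lra.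
 pose proof (exp_ineq1 (ln x)) as Q. rewrite exp_ln in Q by auto. assert (ln x <> 0). { intros EE. apply H1.
 rewrite <- (exp_ln x), EE, exp_0; auto. } lra. } split.
 - assert (Q := L (INR (S n) / INR (S (S n))) ltac:(pos)). rewrite ln_div in * by auto.
  assert (INR (S n) / INR (S (S n)) = 1 - / INR (S (S n))). { rewrite E. field. lra. } lra.
 - assert (Q := L (INR (S (S n)) / INR (S n)) ltac:(pos)). assert (INR (S (S n)) / INR (S n) = 1 + / INR (S n)). {
  rewrite E. field. lra. } lra.
Qed.

Definition Dg (X : R) : R := 2 * X + 2 * X ^ 2 + (1 + X) * (4 * X ^ 2 * exp (2 * X)).
Lemma Dg_pos X : 0 <= X -> 0 <= Dg X.
Proof. intros. unfold Dg; fin. Qed.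

(** The terms linear in [s] cancel up to [1/(n+1) - 1/(n+2)], and the quadratic ones are of the same
    size. A telescoping majorant gives the rate of convergence without a separate summation. *)
Lemma gfac_bound n s X : Cmod s <= X -> Cmod (gfac n s - 1) <= Dg X * (/ INR (S n) - / INR (S (S n))).
Proof.
 intros Hs. pose proof (Cmod_ge_0 s) as Hs0. destruct (ln_ratio n) as [L1 L2]. set (a := / INR (S (S n))) in *.
 set (b := ln (INR (S (S n)) / INR (S n))) in *. set (c := / INR (S n)) in *. pose proof (INR_S_pos n) as P1.
 assert (E : INR (S (S n)) = INR (S n) + 1) by fin. assert (Hc : c <= 1). { unfold c; fin. }
 assert (Hc0 : 0 < c) by (apply Rinv_0_lt_compat; auto). assert (Eca : c - a = a * c). { unfold c, a. rewrite E. field.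
 lra. } assert (Hca : c <= 2 * a) by nra. rewrite Eca. set (w := (- (s * RtoC b))%C). assert (Hw : Cmod w <= X * c). {
 unfold w. rewrite Cmod_opp, Cmod_mult, Cmod_R, Rabs_pos_eq by lra. nra. } assert (Hw1 : Cmod w <= X) by nra.
 unfold gfac. fold a. fold b. fold w.
 replace ((1 + s * RtoC a) * cexp w - 1)%C with (s * RtoC (a - b) - s * s * RtoC (a * b) + (1 + s * RtoC a) * (cexp w - 1 - w))%C.
 2:{ unfold w. rewrite RtoC_minus, RtoC_mult. ring. } le_trans Cmod_triangle. eapply Rle_trans.
 apply Rplus_le_compat_r, Cmod_minus_le. rewrite !Cmod_mult, !Cmod_R. pose proof (cexp_m1z_bound w) as B.
 assert (B1 : Cmod (cexp w - 1 - w) <= (X * c) ^ 2 * exp (2 * X)). { eapply Rle_trans; fin. }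
 assert (B2 : Cmod (1 + s * RtoC a) <= 1 + X). { le_trans Cmod_triangle.
 rewrite Cmod_1, Cmod_mult, Cmod_R, Rabs_pos_eq by lra. nra. }
 assert (B3 : Rabs (a - b) <= a * c) by (rewrite Rabs_left1; lra).
 assert (B4 : Rabs (a * b) <= a * c) by (rewrite Rabs_pos_eq; nra).
 assert (T1 : Cmod s * Rabs (a - b) <= X * (a * c)) by fin.
 assert (T2 : Cmod s * Cmod s * Rabs (a * b) <= X * X * (a * c)) by fin.
 assert (T3 : Cmod (1 + s * RtoC a) * Cmod (cexp w - 1 - w) <= (1 + X) * ((X * c) ^ 2 * exp (2 * X))). { fin. }
 assert (T4 : (1 + X) * ((X * c) ^ 2 * exp (2 * X)) <= (1 + X) * (4 * X ^ 2 * exp (2 * X)) * (a * c)). {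
 rewrite Rmult_assoc. le_mul_l. lra. replace ((X * c) ^ 2 * exp (2 * X)) with ((X ^ 2 * exp (2 * X)) * (c * c)) by ring.
 replace (4 * X ^ 2 * exp (2 * X) * (a * c)) with ((X ^ 2 * exp (2 * X)) * (4 * a * c)) by ring; fin. } unfold Dg. nra.
Qed.

Definition harm (n : nat) : R := rsum n (fun j => / INR (S j)).

Lemma harm_bounds n : 0 <= harm (S n) - ln (INR (S n)) <= 1.
Proof.
 split.
 - assert (ln (INR (S (S n))) <= harm (S n)). { induction n. unfold harm. simpl. replace (1 + 1) with 2 by ring.
  pose proof (ln_ratio 0) as [_ L]. simpl in L. replace ((1 + 1) / 1) with 2 in L by field. lra. unfold harm in *.
  destruct (ln_ratio (S n)) as [_ L]. rewrite ln_div in L by fin.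
  change (rsum (S (S n)) (fun j => / INR (S j))) with (rsum (S n) (fun j => / INR (S j)) + / INR (S (S n))). lra. }
  assert (ln (INR (S n)) <= ln (INR (S (S n)))); fin.
 - induction n. unfold harm. simpl. rewrite ln_1. lra. destruct (ln_ratio n) as [L _]. rewrite ln_div in L by fin.
  unfold harm in *.
  change (rsum (S (S n)) (fun j => / INR (S j))) with (rsum (S n) (fun j => / INR (S j)) + / INR (S (S n))). lra.
Qed.

Lemma Cmod_1p_bound w : Cmod (1 + w) <= exp (Re w + Cmod w ^ 2 / 2).
Proof.
 apply Rsqr_incr_0_var. 2: pos. rewrite Rsqr_pow2, Cmod2_alt, re_plus, im_plus, re_RtoC, im_RtoC. unfold Rsqr.
 rewrite <- exp_plus. rewrite Cmod2_alt. le_trans2 exp_ineq1_le. nra.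
Qed.

Lemma inv_sq_sum n : rsum n (fun j => / INR (S j) ^ 2) <= 2.
Proof.
 assert (H : forall n, rsum (S n) (fun j => / INR (S j) ^ 2) <= 2 - / INR (S n)). { induction n0. simpl. lra.
 change (rsum (S (S n0)) (fun j => / INR (S j) ^ 2)) with (rsum (S n0) (fun j => / INR (S j) ^ 2) + / INR (S (S n0)) ^ 2).
 pose proof (INR_S_pos n0). assert (E : INR (S (S n0)) = INR (S n0) + 1) by fin. rewrite E.
 assert (/ (INR (S n0) + 1) ^ 2 <= / INR (S n0) - / (INR (S n0) + 1)). {
 replace (/ INR (S n0) - / (INR (S n0) + 1)) with (/ (INR (S n0) * (INR (S n0) + 1))) by (field; lra); fin. } lra. }
 destruct n. simpl; lra. specialize (H n). assert (0 < / INR (S n)) by fin. lra.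
Qed.

Lemma Gn_prod n s : Gn n s = (s * cprod (S n) (fun j => 1 + s * RtoC (/ INR (S j))) * cpowR (INR (S n)) (- s))%C.
Proof.
 unfold Gn. f_equal. induction n.
 - simpl. rewrite Rinv_1. field.
 -
  change (cprod (S (S (S n))) (fun k => (s + CN k)%C)) with (cprod (S (S n)) (fun k => (s + CN k)%C) * (s + RtoC (INR (S (S n)))))%C.
  change (cprod (S (S n)) (fun j => (1 + s * RtoC (/ INR (S j)))%C)) with (cprod (S n) (fun j => (1 + s * RtoC (/ INR (S j)))%C) * (1 + s * RtoC (/ INR (S (S n)))))%C.
  replace (fact (S (S n))) with (S (S n) * fact (S n))%nat by fin. rewrite mult_INR, RtoC_mult.
  rewrite Cmult_assoc, <- IHn. rewrite RtoC_inv by fin. field. split. pos. apply fact_neq.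
Qed.

(** In the exponent the harmonic sum from the product and the logarithm from the power cancel up to
    1; only terms quadratic in [|s|] remain. Being uniform in [n], the bound passes to the limit. *)
Lemma Gn_growth n s : Cmod (Gn n s) <= exp ((1 + Cmod s) ^ 2).
Proof.
 rewrite Gn_prod, !Cmod_mult, Cmod_cpow.
 assert (P : forall m, Cmod (cprod m (fun j => (1 + s * RtoC (/ INR (S j)))%C)) <= exp (Re s * harm m + Cmod s ^ 2 / 2 * rsum m (fun j => / INR (S j) ^ 2))).
 { induction m. simpl. rewrite Cmod_1. replace (Re s * 0 + _) with 0 by ring; fin. rewrite cprod_S, Cmod_mult.
 unfold harm in *. rewrite !rsum_S.
 replace (Re s * (rsum m (fun j => / INR (S j)) + / INR (S m)) + Cmod s ^ 2 / 2 * (rsum m (fun j => / INR (S j) ^ 2) + / INR (S m) ^ 2)) with ((Re s * rsum m (fun j => / INR (S j)) + Cmod s ^ 2 / 2 * rsum m (fun j => / INR (S j) ^ 2)) + (Re s * / INR (S m) + (Cmod s * / INR (S m)) ^ 2 / 2)).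
 2:{ field; pos. } rewrite exp_plus. apply Rmult_le_compat; [pos|apply Cmod_ge_0|exact IHm|]. le_trans Cmod_1p_bound.
 rewrite re_scal_r, Cmod_mult, Cmod_R, Rabs_pos_eq; fin. } pose proof (inv_sq_sum (S n)) as I2.
 pose proof (harm_bounds n) as [H1 H2]. pose proof (Re_le_Cmod s) as R1. assert (R2 : - Cmod s <= Re s). {
 pose proof (re_le_Cmod s). pose proof (Rle_abs (- Re s)). rewrite Rabs_Ropp in H0. lra. }
 le_via (exp (Cmod s) * exp (Re s * harm (S n) + Cmod s ^ 2 / 2 * rsum (S n) (fun j => / INR (S j) ^ 2)) * exp (- Re s * ln (INR (S n)))).
 - le_mul_r. pos. apply Rmult_le_compat; auto; try pos. pose proof (exp_ineq1_le (Cmod s)). lra.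
 - rewrite <- !exp_plus. apply exp_le. nra.
Qed.

Lemma Entire_cpow u : Entire (fun s => cpowR u s).
Proof. unfold cpowR; fin. Qed.

Lemma Entire_cprod n (F : nat -> C -> C) : (forall k, Entire (F k)) -> Entire (fun s => cprod n (fun k => F k s)).
Proof. induction n; simpl; fin. Qed.

Lemma Gn_entire n : Entire (Gn n).
Proof.
 apply Entire_mult. apply Entire_mult. apply (Entire_cprod (S (S n)) (fun k s => s + CN k)%C); fin. fin.
 apply (Entire_comp (fun s => cpowR (INR (S n)) s) (fun s => - s)%C). apply Entire_cpow. eexists; cdd.
Qed.

Lemma Gn_step n s X : Cmod s <= X -> Cmod (Gn (S n) s - Gn n s) <= (exp ((1 + X) ^ 2) * Dg X) * (/ INR (S n) - / INR (S (S n))).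
Proof.
 intros Hs. rewrite Gn_S. replace (Gn n s * gfac n s - Gn n s)%C with (Gn n s * (gfac n s - 1))%C by ring.
 rewrite Cmod_mult, Rmult_assoc. apply Rmult_le_compat; try pos. le_trans Gn_growth. fin. apply gfac_bound; auto.
Qed.

Lemma GK_pos X : 0 <= X -> 0 <= exp ((1 + X) ^ 2) * Dg X.
Proof. intros. pose proof (Dg_pos X H). pos. Qed.

(** [GP] is [1/Gamma]. *)
Definition GP (s : C) : C := epsilon (inhabits (RtoC 0)) (fun l => Clim (fun n => Gn n s) l).

Lemma GP_rate s X n : Cmod s <= X -> Cmod (Gn n s - GP s) <= exp ((1 + X) ^ 2) * Dg X * / INR (S n).
Proof.
 intros Hs. pose proof (GK_pos X ltac:(pose proof (Cmod_ge_0 s); lra)) as D0.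
 destruct (telescoping_limit (fun n => Gn n s) _ D0 (fun n => Gn_step n s X Hs)) as [l Hl].
 assert (L : Clim (fun n => Gn n s) l). { intros e He. destruct (inv_INR_small _ e D0 He) as [N HN]. exists N.
 intros m Hm. eapply Rle_trans; auto. } replace (GP s) with l; auto. apply (Clim_unique (fun n => Gn n s)); auto.
 apply (epsilon_spec (inhabits (RtoC 0)) (fun l => Clim (fun n => Gn n s) l)); fin.
Qed.

Lemma GP_unif X e : 0 <= X -> 0 < e -> exists N, forall n z, (N <= n)%nat -> Cmod z <= X -> Cmod (Gn n z - GP z) <= e.
Proof.
 intros HX He. destruct (inv_INR_small _ e (GK_pos X HX) He) as [N HN]. exists N. intros m z Hm Hz. eapply Rle_trans.
 apply (GP_rate z X); auto. auto.
Qed.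

Lemma GP_lim s : Clim (fun n => Gn n s) (GP s).
Proof. intros e He. destruct (GP_unif (Cmod s) e (Cmod_ge_0 s) He) as [N HN]. exists N. intros; apply HN; auto; lra. Qed.

Lemma GP_entire : Entire GP.
Proof. apply (unif_limit_entire Gn GP Gn_entire). intros X e HX. apply GP_unif. lra. Qed.

Lemma GP_growth s : Cmod (GP s) <= exp ((1 + Cmod s) ^ 2).
Proof.
 apply le_epsilon. intros e He. destruct (GP_lim s e He) as [N HN]. specialize (HN N (le_n _)).
 pose proof (Gn_growth N s). pose proof (Cmod_triangle_inv (GP s) (Gn N s)). rewrite Cmod_minus_sym in H0. lra.
Qed.

Lemma cprod_shift n (F : nat -> C) : cprod (S n) F = (F O * cprod n (fun k => F (S k)))%C.
Proof. induction n. simpl. ring. change (cprod (S (S n)) F) with (cprod (S n) F * F (S n))%C. rewrite IHn. simpl. ring. Qed.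

Lemma cprod_ext n F G : (forall k, (k < n)%nat -> F k = G k) -> cprod n F = cprod n G.
Proof. induction n; intros H; simpl; auto. rewrite IHn, H; auto. Qed.

Lemma GP_rec s : GP s = (s * GP (s + 1))%C.
Proof.
 apply (Clim_unique (fun n => s * Gn n (s + 1))%C).
 - apply Clim_ext with (u := fun n => (Gn n s * (1 + (s + 1) * RtoC (/ INR (S n))))%C).
  + exists 0%nat. intros n _. unfold Gn. rewrite (cprod_shift (S n) (fun k => s + CN k)%C).
   change (cprod (S (S n)) (fun k => (s + 1 + CN k)%C)) with (cprod (S n) (fun k => (s + 1 + CN k)%C) * (s + 1 + CN (S n)))%C.
   rewrite (cprod_ext (S n) (fun k => (s + CN (S k))%C) (fun k => (s + 1 + CN k)%C)). 2:{ intros k _.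
   rewrite S_INR, RtoC_plus. ring. } replace (- (s + 1))%C with (- s + - (1))%C by ring.
   rewrite cpow_plus, (cpow_opp _ 1), cpow_1 by fin. rewrite RtoC_inv by fin. replace (CN 0) with (RtoC 0) by fin.
   field. split. pos. apply fact_neq.
  + rewrite <- (Cmult_1_r (GP s)). apply Clim_mult. apply GP_lim. intros e He.
   destruct (inv_INR_small _ e (Cmod_ge_0 (s + 1)) He) as [N HN]. exists N. intros n Hn. specialize (HN n Hn).
   replace (1 + (s + 1) * RtoC (/ INR (S n)) - 1)%C with ((s + 1) * RtoC (/ INR (S n)))%C by ring.
   assert (0 < / INR (S n)) by fin. rewrite Cmod_mult, Cmod_R, Rabs_pos_eq by lra. lra.
 - apply Clim_mult. apply Clim_const. apply GP_lim.
Qed.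

Lemma cprod_neq_0 n F : (forall k, (k < n)%nat -> F k <> RtoC 0) -> cprod n F <> RtoC 0.
Proof. induction n; simpl; intros H. pos. apply Cmult_neq_0; auto. Qed.

Lemma npint_iff s : npint s <-> exists n : nat, (s + CN n)%C = RtoC 0.
Proof.
 split; intros [n Hn]; exists n. rewrite Hn, RtoC_opp. ring. rewrite RtoC_opp. transitivity (s + CN n + - CN n)%C. ring.
 rewrite Hn. ring.
Qed.

Lemma Gn_neq_0 n s : ~ npint s -> Gn n s <> RtoC 0.
Proof.
 intros H. apply Cmult_neq_0. apply Cmult_neq_0. apply cprod_neq_0. intros k _ E. apply H, npint_iff. eauto.
 apply Cmod_gt_0. rewrite Cmod_inv by apply fact_neq. apply Rinv_0_lt_compat, Cmod_gt_0, fact_neq. apply cpow_neq_0.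
Qed.

(** From some index [J] on, the factors differ from 1 by a telescoping amount of total at most
    [1/2], so the modulus never drops below half of its value at [J], which is not zero. *)
Lemma GP_neq_0 s : ~ npint s -> GP s <> RtoC 0.
Proof.
 intros H. set (D := Dg (Cmod s)). assert (D0 : 0 <= D) by (apply Dg_pos, Cmod_ge_0).
 destruct (inv_INR_small D (/ 2) D0 ltac:(lra)) as [J HJ]. specialize (HJ J (le_n _)) as HJ2.
 assert (Hi : forall n, 0 < / INR (S n)) by (intros; apply Rinv_0_lt_compat, INR_S_pos).
 assert (G0 : 0 < Cmod (Gn J s)) by (apply Cmod_gt_0, Gn_neq_0; auto).
 assert (Q : forall k, Cmod (Gn J s) * (1 - D * (/ INR (S J) - / INR (S (J + k)))) <= Cmod (Gn (J + k) s)). {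
 induction k. rewrite Nat.add_0_r; fin. rewrite Nat.add_succ_r, Gn_S, Cmod_mult.
 pose proof (gfac_bound (J + k) s (Cmod s) (Rle_refl _)) as B. fold D in B.
 pose proof (Cmod_triangle_inv 1 (1 - gfac (J + k) s)) as T.
 replace (1 - (1 - gfac (J + k) s))%C with (gfac (J + k) s) in T by ring. rewrite Cmod_1, Cmod_minus_sym in T.
 pose proof (Hi (J + k)%nat) as I1. pose proof (Hi (S (J + k))) as I2.
 pose proof (Cmod_ge_0 (gfac (J + k) s - 1)) as C0. set (x := D * (/ INR (S J) - / INR (S (J + k)))) in *.
 set (y := D * (/ INR (S (J + k)) - / INR (S (S (J + k))))) in *. assert (Hx : x <= / 2) by (unfold x; nra).
 assert (Hy : y <= / 2). { assert (/ INR (S (J + k)) <= / INR (S J)) by fin. unfold y. nra. } assert (Hx0 : 0 <= x). {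
 unfold x. assert (/ INR (S (J + k)) <= / INR (S J)); fin. } le_via (Cmod (Gn J s) * (1 - x) * (1 - y)).
 - replace (D * (/ INR (S J) - / INR (S (S (J + k))))) with (x + y) by (unfold x, y; ring). rewrite Rmult_assoc.
  le_mul_l. lra. nra.
 - fin. } assert (Q2 : forall n, (J <= n)%nat -> Cmod (Gn J s) / 2 <= Cmod (Gn n s)). { intros n Hn.
  specialize (Q (n - J)%nat). replace (J + (n - J))%nat with n in Q by lia. eapply Rle_trans. 2: exact Q.
  specialize (Hi n). le_mul_l. lra. nra. } intros E. destruct (GP_lim s (Cmod (Gn J s) / 4)) as [N HN]. lra.
  specialize (HN (max N J) ltac:(lia)). specialize (Q2 (max N J) ltac:(lia)). rewrite E in HN.
  replace (Gn (max N J) s - 0)%C with (Gn (max N J) s) in HN by ring. lra.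
Qed.

Lemma GP_rec_n k s : GP s = (cprod k (fun j => s + CN j) * GP (s + CN k))%C.
Proof.
 induction k. simpl. replace (s + 0)%C with s by ring. ring. rewrite IHk, (GP_rec (s + CN k)). simpl cprod.
 rewrite S_INR, RtoC_plus. replace (s + CN k + 1)%C with (s + (CN k + 1))%C by ring. ring.
Qed.

Lemma not_npint_pos s : 0 < Re s -> ~ npint s.
Proof. intros H [n E]. rewrite E, re_RtoC in H. pose proof (pos_INR n). lra. Qed.

(** At [s = -k] the functional equation exhibits one vanishing factor [z + k]; what is left is
    nonzero at [s], the remaining Gamma factor being evaluated at 1. *)
Lemma GP_ord_pole s : npint s -> is_ord GP s 1.
Proof.
 intros [k E]. assert (O1 : is_ord (fun z => cprod k (fun j => z + CN j))%C s 0). { apply ord_zero_iff.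
 apply (Entire_cprod k (fun j z => z + CN j)%C); fin. apply cprod_neq_0. intros j Hj EE. rewrite E, <- RtoC_plus in EE.
 apply RtoC_inj in EE. apply lt_INR in Hj. lra. } assert (O2 : is_ord (fun z => z + CN k)%C s 1). {
 exists (fun _ => RtoC 1). split. fin. split. pos. intros z. rewrite E, RtoC_opp. ring. }
 assert (O3 : is_ord (fun z => GP (z + CN k + 1))%C s 0). { apply ord_zero_iff. apply Entire_comp. apply GP_entire. fin.
 apply GP_neq_0, not_npint_pos. rewrite E. rewrite !re_plus, !re_RtoC. lra. }
 pose proof (ord_mult _ _ _ _ _ O1 (ord_mult _ _ _ _ _ O2 O3)) as O. eapply ord_ext. 2: exact O. intros z.
 rewrite (GP_rec_n k z), (GP_rec (z + CN k)); fin.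
Qed.

Lemma GP_ord s : is_ord GP s (if excluded_middle_informative (npint s) then 1 else 0).
Proof.
 destruct (excluded_middle_informative (npint s)). apply GP_ord_pole; auto. apply ord_zero_iff. apply GP_entire.
 apply GP_neq_0; auto.
Qed.

Lemma filterlim_Clim u (l : C) : filterlim u eventually (locally l) <-> Clim u l.
Proof.
 split.
 - intros H e He. assert (Q : locally l (fun z => Cmod (z - l) <= e)). {
  (* Balls for the product structure on C are squares, hence the factor [sqrt 2]. *)
  assert (Hs : 0 < sqrt 2) by (apply sqrt_lt_R0; lra). assert (H2 : 0 < e / sqrt 2) by (pos). exists (mkposreal _ H2).
  intros z Hz. pose proof (C_NormedModule_mixin_compat2 l z _ Hz) as B. simpl in B.
  replace (sqrt 2 * (e / sqrt 2)) with e in B by (field; lra). left; fin. } destruct (H _ Q) as [N HN]; fin.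
 - intros H P [e He]. destruct (H (e/2) ltac:(destruct e; simpl; lra)) as [N HN]. exists N. intros n Hn. apply He.
  apply C_NormedModule_mixin_compat1. specialize (HN n Hn). eapply Rle_lt_trans. exact HN. destruct e; simpl; lra.
Qed.

Lemma CGamma_lim s : ~ npint s -> Clim (gauss_term s) (/ GP s)%C.
Proof.
 intros H. pose proof (GP_neq_0 s H) as HG. pose proof (Clim_inv _ _ HG (GP_lim s)) as L. intros e He.
 destruct (L e He) as [N HN]. exists (S N). intros n Hn. destruct n; [lia|]. specialize (HN n ltac:(lia)).
 replace (gauss_term s (S n)) with (/ Gn n s)%C; auto. unfold Gn, gauss_term. rewrite cpow_opp.
 assert (cprod (S (S n)) (fun k => (s + CN k)%C) <> RtoC 0). { apply cprod_neq_0. intros k _ E. apply H, npint_iff.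
 eauto. } field. auto using fact_neq, cpow_neq_0.
Qed.

Lemma CGamma_GP s : ~ npint s -> CGamma s = (/ GP s)%C.
Proof.
 intros H. pose proof (CGamma_lim s H) as L.
 assert (S0 : filterlim (gauss_term s) eventually (locally (epsilon (inhabits (RtoC 0)) (fun g => filterlim (gauss_term s) eventually (locally g))))).
 { apply epsilon_spec. exists (/ GP s)%C. apply filterlim_Clim; auto. } apply filterlim_Clim in S0.
 apply (Clim_unique (gauss_term s)); auto.
Qed.

#[global] Hint Resolve Entire_cpow Entire_cprod : cx.

(** * Limits of real sequences, Tannery's theorem and binomial weights *)

Definition rlim (u : nat -> R) (l : R) : Prop := forall e, 0 < e -> exists N, forall n, (N <= n)%nat -> Rabs (u n - l) <= e.

Lemma rlim_Un_cv u l : rlim u l <-> Un_cv u l.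
Proof.
 split; intros H e He. destruct (H (e/2) ltac:(lra)) as [N HN]. exists N. intros n Hn. specialize (HN n Hn).
 unfold Rdist. lra. destruct (H e He) as [N HN]. exists N. intros n Hn. specialize (HN n Hn). unfold Rdist in HN. lra.
Qed.
Lemma rlim_plus u v a b : rlim u a -> rlim v b -> rlim (fun n => u n + v n) (a + b).
Proof. rewrite !rlim_Un_cv. apply CV_plus. Qed.
Lemma rlim_mult u v a b : rlim u a -> rlim v b -> rlim (fun n => u n * v n) (a * b).
Proof. rewrite !rlim_Un_cv. apply CV_mult. Qed.
Lemma rlim_const a : rlim (fun _ => a) a.
Proof. exists 0%nat. intros. rewrite Rminus_diag, Rabs_R0. lra. Qed.
Lemma rlim_unique u a b : rlim u a -> rlim u b -> a = b.
Proof. rewrite !rlim_Un_cv. apply UL_sequence. Qed.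
Lemma rlim_ext u v a : (exists N, forall n, (N <= n)%nat -> u n = v n) -> rlim u a -> rlim v a.
Proof. intros [N0 E] H e He. destruct (H e He) as [N HN]. exists (max N N0). intros n Hn. rewrite <- E by lia. apply HN; lia. Qed.
Lemma rlim_squeeze u v w a : (exists N, forall n, (N <= n)%nat -> u n <= v n <= w n) -> rlim u a -> rlim w a -> rlim v a.
Proof.
 intros [N0 E] H H' e He. destruct (H e He) as [N HN]. destruct (H' e He) as [N' HN']. exists (max N0 (max N N')).
 intros n Hn. specialize (E n ltac:(lia)). specialize (HN n ltac:(lia)). specialize (HN' n ltac:(lia)).
 apply Rabs_le_between in HN. apply Rabs_le_between in HN'. apply Rabs_le. lra.
Qed.
Lemma rlim_inv u a : a <> 0 -> rlim u a -> rlim (fun n => / u n) (/ a).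
Proof.
 intros Ha H. rewrite rlim_Un_cv in *. apply is_lim_seq_Reals. apply is_lim_seq_Reals in H.
 apply (is_lim_seq_inv u a) in H. exact H. congruence.
Qed.
Lemma rlim_exp u a : rlim u a -> rlim (fun n => exp (u n)) (exp a).
Proof.
 rewrite !rlim_Un_cv. intros H. apply is_lim_seq_Reals. apply is_lim_seq_Reals in H.
 apply (is_lim_seq_continuous exp u a); auto. apply derivable_continuous, derivable_exp.
Qed.

Lemma rlim_rsum J (a : nat -> nat -> R) (l : nat -> R) : (forall j, rlim (fun N => a N j) (l j)) -> rlim (fun N => rsum J (a N)) (rsum J l).
Proof. intros H. induction J; simpl. apply rlim_const. apply rlim_plus; auto. Qed.

Lemma rsum_split J K f : (J <= K)%nat -> rsum K f = rsum J f + rsum (K - J) (fun j => f (J + j)%nat).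
Proof.
 intros L. replace K with (J + (K - J))%nat at 1 by lia. generalize (K - J)%nat. intros q. induction q; simpl.
 rewrite Nat.add_0_r; ring. rewrite Nat.add_succ_r. simpl; fin.
Qed.

Lemma rsum_Rabs n f : Rabs (rsum n f) <= rsum n (fun j => Rabs (f j)).
Proof. induction n; simpl. rewrite Rabs_R0; lra. le_trans Rabs_triang. lra. Qed.

(** Dominated convergence for sums of varying length. It serves for both sides of the theta identity
    and for products of Dirichlet series. *)
Lemma tannery (a : nat -> nat -> R) (l B : nat -> R) (rg : nat -> nat) K N0 :
  (forall j, rlim (fun N => a N j) (l j)) -> (forall n, rsum n B <= K) -> (forall N j, (N0 <= N)%nat -> Rabs (a N j) <= B j) ->
  (forall N j, (rg N <= j)%nat -> a N j = 0) -> exists S, rlim (fun N => rsum (rg N) (a N)) S /\ rlim (fun n => rsum n l) S.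
Proof.
 intros Ha HK HB Hr. assert (B0 : forall j, 0 <= B j). { intros j. le_trans Rabs_pos. auto. }
 assert (lB : forall j, Rabs (l j) <= B j). { intros j. apply le_epsilon. intros e He. destruct (Ha j e He) as [N HN].
 specialize (HN (max N N0) ltac:(lia)). specialize (HB (max N N0) j ltac:(lia)).
 replace (l j) with (a (max N N0) j - (a (max N N0) j - l j)) by ring. le_trans Rabs_triang. rewrite Rabs_Ropp. lra. }
 destruct (rsum_cv B K B0 HK) as [SB [S1 [S2 S3]]].
 assert (Tail : forall J K' f, (J <= K')%nat -> (forall j, Rabs (f j) <= B j) -> Rabs (rsum K' f - rsum J f) <= SB - rsum J B).
 { intros J K' f L Hf. rewrite (rsum_split J K') by auto.
 replace (rsum J f + rsum (K' - J) (fun j => f (J + j)%nat) - rsum J f) with (rsum (K' - J) (fun j => f (J + j)%nat)) by ring.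
 le_trans rsum_Rabs. le_via (rsum (K' - J) (fun j => B (J + j)%nat)). apply rsum_le; auto. specialize (S1 K').
 rewrite (rsum_split J K' B) in S1 by auto. lra. } destruct (Rcomplete.R_complete (fun n => rsum n l)) as [S HS]. {
 intros e He. destruct (S3 (e/3) ltac:(lra)) as [N HN]. exists N. intros n m Hn Hm. unfold Rdist.
 pose proof (Tail N n l Hn lB). pose proof (Tail N m l Hm lB). specialize (HN N (le_n _)).
 replace (rsum n l - rsum m l) with ((rsum n l - rsum N l) - (rsum m l - rsum N l)) by ring. eapply Rle_lt_trans.
 apply Rabs_triang. rewrite Rabs_Ropp. lra. } apply rlim_Un_cv in HS. exists S. split; auto. intros e He.
 destruct (S3 (e/4) ltac:(lra)) as [N1 HN1]. destruct (HS (e/4) ltac:(lra)) as [N2 HN2]. set (J := max N1 N2).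
 destruct (rlim_rsum J a l Ha (e/4) ltac:(lra)) as [N3 HN3]. exists (max N0 N3). intros N HN.
 specialize (HN1 J ltac:(lia)). specialize (HN2 J ltac:(lia)). specialize (HN3 N ltac:(lia)).
 assert (E : rsum (rg N) (a N) = rsum (max J (rg N)) (a N)). { rewrite (rsum_split (rg N) (max J (rg N))) by lia.
 rewrite (rsum_ext (max J (rg N) - rg N) _ (fun j => 0 * 0)). rewrite rsum_scal; ring. intros j _. rewrite Hr by lia.
 ring. } rewrite E. pose proof (Tail J (max J (rg N)) (a N) ltac:(lia) (fun j => HB N j ltac:(lia))).
 replace (rsum (max J (rg N)) (a N) - S) with ((rsum (max J (rg N)) (a N) - rsum J (a N)) + ((rsum J (a N) - rsum J l) + (rsum J l - S))) by ring.
 le_trans Rabs_triang. pose proof (Rabs_triang (rsum J (a N) - rsum J l) (rsum J l - S)). lra.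
Qed.

(** Binomial weights [wb N i = C(N,i) / 2^N]. *)
Definition wb (N i : nat) : R := bernR N (fun j => if Nat.eq_dec j i then 1 else 0) (/ 2).

Lemma bernR_0 n : forall g y, (forall i, g i = 0) -> bernR n g y = 0.
Proof. induction n; intros g y H; simpl; auto. rewrite !IHn; auto. ring. Qed.

Lemma wb_S_0 N : wb (S N) 0 = / 2 * wb N 0.
Proof. unfold wb. simpl. rewrite (bernR_0 N (fun i => if Nat.eq_dec (S i) 0 then 1 else 0)); fin. Qed.
Lemma wb_S_S N i : wb (S N) (S i) = / 2 * wb N (S i) + / 2 * wb N i.
Proof.
 unfold wb.
 change (bernR (S N) (fun j => if Nat.eq_dec j (S i) then 1 else 0) (/ 2)) with ((1 - / 2) * bernR N (fun j => if Nat.eq_dec j (S i) then 1 else 0) (/ 2) + / 2 * bernR N (fun j => if Nat.eq_dec (S j) (S i) then 1 else 0) (/ 2)).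
 replace (fun j => if Nat.eq_dec (S j) (S i) then 1 else 0) with (fun j => if Nat.eq_dec j i then 1 else 0). field.
 apply functional_extensionality. intros j. destruct (Nat.eq_dec (S j) (S i)), (Nat.eq_dec j i); auto; lia.
Qed.

Lemma bernR_ext n : forall g g' y, (forall i, (i <= n)%nat -> g i = g' i) -> bernR n g y = bernR n g' y.
Proof.
 induction n; intros g g' y H; simpl. auto.
 rewrite (IHn g g'), (IHn (fun i => g (S i)) (fun i => g' (S i))); auto; intros; apply H; lia.
Qed.

Lemma bernR_plus n : forall g h y, bernR n (fun i => g i + h i) y = bernR n g y + bernR n h y.
Proof. induction n; intros; simpl. auto. rewrite (IHn g h), (IHn (fun i => g (S i)) (fun i => h (S i))). ring. Qed.
Lemma bernR_scal n c g y : bernR n (fun i => c * g i) y = c * bernR n g y.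
Proof. rewrite (bernR_ext n _ (fun i => 0 + c * g i)) by (intros; ring). rewrite bernR_lin. ring. Qed.
Lemma bernR_rsum n J (F : nat -> nat -> R) y : bernR n (fun i => rsum J (fun j => F j i)) y = rsum J (fun j => bernR n (F j) y).
Proof. induction J; simpl. apply bernR_0; auto. rewrite bernR_plus; fin. Qed.

Lemma bernR_wb N g : bernR N g (/ 2) = rsum (S N) (fun i => g i * wb N i).
Proof.
 transitivity (bernR N (fun j => rsum (S N) (fun i => g i * (if Nat.eq_dec j i then 1 else 0))) (/ 2)).
 - apply bernR_ext. intros i Hi.
  assert (G : forall J, rsum J (fun k => g k * (if Nat.eq_dec i k then 1 else 0)) = if le_lt_dec J i then 0 else g i). {
  induction J. auto. simpl rsum. rewrite IHJ.
  destruct (Nat.eq_dec i J), (le_lt_dec J i), (le_lt_dec (S J) i); subst; try lia; try ring. } rewrite G.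
  destruct (le_lt_dec (S N) i); auto. lia.
 - rewrite (bernR_rsum N (S N) (fun i j => g i * (if Nat.eq_dec j i then 1 else 0))). apply rsum_ext. intros i _.
  rewrite bernR_scal; fin.
Qed.

Lemma wb_ratio N : forall i, (INR i + 1) * wb N (S i) = (INR N - INR i) * wb N i.
Proof.
 induction N; intros i.
 - unfold wb. destruct i; simpl; ring.
 - rewrite wb_S_S. destruct i.
  + rewrite wb_S_0. specialize (IHN 0%nat). change (INR 0) with 0 in *. rewrite S_INR. nra.
  + rewrite wb_S_S. pose proof (IHN i) as I1. pose proof (IHN (S i)) as I2. rewrite !S_INR in *. nra.
Qed.

Lemma wb_nonneg N i : 0 <= wb N i.
Proof.
 le_via (bernR N (fun _ => 0) (/ 2)). rewrite bernR_0 by auto; lra. apply bernR_le. lra. intros j _.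
 destruct (Nat.eq_dec j i); lra.
Qed.

Lemma wb_pos N i : (i <= N)%nat -> 0 < wb N i.
Proof.
 revert i. induction N; intros i Hi. assert (i = 0)%nat by lia. subst. unfold wb; simpl. lra. destruct i.
 rewrite wb_S_0. specialize (IHN 0%nat ltac:(lia)). lra. rewrite wb_S_S. specialize (IHN i ltac:(lia)).
 pose proof (wb_nonneg N (S i)). lra.
Qed.

Lemma wb_zero N i : (N < i)%nat -> wb N i = 0.
Proof. revert i. induction N; intros i Hi. destruct i; [lia|]; fin. destruct i; [lia|]. rewrite wb_S_S, !IHN by lia. ring. Qed.

(** Weight at distance [k] from the centre, relative to the central one: for [k <= n] it is
    [n!^2 / ((n-k)! (n+k)!)], close to the Gaussian [exp(-k^2/n)]. *)
Definition rb (n k : nat) : R := wb (2 * n) (n + k) / wb (2 * n) n.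

Lemma wb_center_pos n : 0 < wb (2 * n) n. Proof. apply wb_pos. lia. Qed.

Lemma wb_step_up n k : (INR n + INR k + 1) * wb (2 * n) (n + S k) = (INR n - INR k) * wb (2 * n) (n + k).
Proof.
 rewrite Nat.add_succ_r. pose proof (wb_ratio (2 * n) (n + k)) as H. rewrite plus_INR, mult_INR in H.
 simpl (INR 2) in H; fin.
Qed.

Lemma wb_sym n k : (k <= n)%nat -> wb (2 * n) (n - k) = wb (2 * n) (n + k).
Proof.
 induction k; intros Hk. rewrite Nat.add_0_r, Nat.sub_0_r. auto. specialize (IHk ltac:(lia)).
 pose proof (wb_step_up n k) as U. pose proof (wb_ratio (2 * n) (n - S k)) as D.
 replace (S (n - S k)) with (n - k)%nat in D by lia. rewrite IHk in D. rewrite minus_INR, mult_INR, S_INR in D by lia.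
 simpl (INR 2) in D.
 assert (E : (INR n + INR k + 1) * wb (2 * n) (n - S k) = (INR n + INR k + 1) * wb (2 * n) (n + S k)). { lra. }
 pose proof (pos_INR n). pose proof (pos_INR k). nra.
Qed.

Lemma rb_0 n : rb n 0 = 1.
Proof. unfold rb. rewrite Nat.add_0_r. field. apply Rgt_not_eq, wb_center_pos. Qed.

Lemma rb_S n k : rb n (S k) = (INR n - INR k) / (INR n + INR k + 1) * rb n k.
Proof.
 unfold rb. pose proof (wb_step_up n k) as U. pose proof (wb_center_pos n). pose proof (pos_INR n).
 pose proof (pos_INR k). apply Rmult_eq_reg_l with (INR n + INR k + 1); [|lra].
 replace ((INR n + INR k + 1) * (wb (2 * n) (n + S k) / wb (2 * n) n)) with ((INR n + INR k + 1) * wb (2 * n) (n + S k) / wb (2 * n) n) by pos.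
 rewrite U. field. lra.
Qed.

(** A product of factors [1 - (2j+1)/(n+j+1)], each at most [exp(-(2j+1)/(n+K))]; the odd numbers
    add up to [k^2]. *)
Lemma rb_upper n k K : (k <= K)%nat -> (k <= n)%nat -> rb n k <= exp (- (INR k ^ 2 / (INR n + INR K))).
Proof.
 induction k; intros HK Hn.
 - rewrite rb_0. simpl; fin.
 - rewrite rb_S. pose proof (pos_INR k). assert (H1 : INR (S k) <= INR n) by fin.
  assert (H2 : INR (S k) <= INR K) by fin. rewrite S_INR in *. specialize (IHk ltac:(lia) ltac:(lia)).
  replace (- ((INR k + 1) ^ 2 / (INR n + INR K))) with (- ((2 * INR k + 1) / (INR n + INR K)) + - (INR k ^ 2 / (INR n + INR K))) by pos.
  rewrite exp_plus. apply Rmult_le_compat.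
  + pos.
  + apply Rmult_le_pos. apply wb_nonneg. left; apply Rinv_0_lt_compat, wb_center_pos.
  + pose proof (exp_ineq1_le (- ((2 * INR k + 1) / (INR n + INR K)))) as Q. eapply Rle_trans. 2: exact Q.
   replace ((INR n - INR k) / (INR n + INR k + 1)) with (1 + - ((2 * INR k + 1) / (INR n + INR k + 1))) by (field; lra).
   apply Rplus_le_compat_l, Ropp_le_contravar. le_mul_l; fin.
  + auto.
Qed.

(** The reciprocal factors are [1 + (2j+1)/(n-j)], each at most [exp((2j+1)/(n-K))]. *)
Lemma rb_lower n k K : (k <= K)%nat -> (K < n)%nat -> exp (- (INR k ^ 2 / (INR n - INR K))) <= rb n k.
Proof.
 induction k; intros HK Hn.
 - rewrite rb_0. simpl. replace (- (0 * (0 * 1) / (INR n - INR K))) with 0 by fin. rewrite exp_0. lra.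
 - rewrite rb_S. pose proof (pos_INR k). assert (H1 : INR K < INR n) by fin. assert (H2 : INR (S k) <= INR K) by fin.
  rewrite S_INR in *. specialize (IHk ltac:(lia) ltac:(lia)).
  replace (- ((INR k + 1) ^ 2 / (INR n - INR K))) with (- ((2 * INR k + 1) / (INR n - INR K)) + - (INR k ^ 2 / (INR n - INR K))) by pos.
  rewrite exp_plus. apply Rmult_le_compat; try (left; pos). 2: exact IHk. rewrite exp_Ropp.
  rewrite <- (Rinv_inv ((INR n - INR k) / (INR n + INR k + 1))). apply Rinv_le_contravar. pos.
  pose proof (exp_ineq1_le ((2 * INR k + 1) / (INR n - INR K))) as Q. eapply Rle_trans. 2: exact Q.
  replace (/ ((INR n - INR k) / (INR n + INR k + 1))) with (1 + (2 * INR k + 1) / (INR n - INR k)) by (field; lra).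
  apply Rplus_le_compat_l. le_mul_l; fin.
Qed.

Lemma wb_center_S n : wb (2 * S n) (S n) = (2 * INR n + 1) / (2 * INR n + 2) * wb (2 * n) n.
Proof.
 replace (2 * S n)%nat with (S (S (2 * n))) by lia. rewrite wb_S_S. pose proof (wb_ratio (S (2 * n)) n) as R1.
 rewrite S_INR, mult_INR in R1. simpl (INR 2) in R1. assert (E1 : wb (S (2 * n)) (S n) = wb (S (2 * n)) n). {
 pose proof (pos_INR n). nra. } rewrite E1.
 assert (E2 : (INR n + 1) * wb (S (2 * n)) (S n) = / 2 * (2 * INR n + 1) * wb (2 * n) n). { rewrite wb_S_S.
 pose proof (wb_ratio (2 * n) n) as R2. rewrite mult_INR in R2. simpl (INR 2) in R2. nra. } rewrite E1 in E2.
 pose proof (pos_INR n). apply Rmult_eq_reg_l with (INR n + 1); [|lra]. transitivity ((INR n + 1) * wb (S (2 * n)) n).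
 field. rewrite E2. field. lra.
Qed.

(** The sequence increases, while [(2n+1) wb(2n,n)^2] decreases from 1. The value [1/PI] of the
    limit is not computed here but read off from the theta identity at [u = 1]. *)
Lemma wallis : exists c, 0 < c /\ rlim (fun n => INR n * wb (2 * n) n ^ 2) c.
Proof.
 set (v := fun n => INR n * wb (2 * n) n ^ 2). assert (Inc : forall n, v n <= v (S n)). { intros n. unfold v.
 rewrite wb_center_S, S_INR. pose proof (pos_INR n). rewrite Rpow_mult_distr, <- Rmult_assoc. le_mul_r. pos.
 apply Rmult_le_reg_r with ((2 * INR n + 2) ^ 2). nra.
 replace ((INR n + 1) * ((2 * INR n + 1) / (2 * INR n + 2)) ^ 2 * (2 * INR n + 2) ^ 2) with ((INR n + 1) * (2 * INR n + 1) ^ 2) by (field; lra).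
 nra. } assert (Bd : forall n, (2 * INR n + 1) * wb (2 * n) n ^ 2 <= 1). { induction n. unfold wb; simpl. lra.
 rewrite wb_center_S, S_INR. pose proof (pos_INR n). rewrite Rpow_mult_distr, <- Rmult_assoc.
 le_via ((2 * INR n + 1) * wb (2 * n) n ^ 2); auto. le_mul_r. pos. apply Rmult_le_reg_r with ((2 * INR n + 2) ^ 2). nra.
 replace ((2 * (INR n + 1) + 1) * ((2 * INR n + 1) / (2 * INR n + 2)) ^ 2 * (2 * INR n + 2) ^ 2) with ((2 * (INR n + 1) + 1) * (2 * INR n + 1) ^ 2) by (field; lra).
 nra. } destruct (growing_cv v Inc) as [c Hc]. { exists 1. intros x [n E]. subst. specialize (Bd n). unfold v. nra. }
 exists c. split. 2: apply rlim_Un_cv; exact Hc. apply Rlt_le_trans with (v 1%nat). unfold v.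
 pose proof (wb_center_pos 1); fin. apply (growing_ineq v c Inc Hc).
Qed.

(** Real part of the characteristic function: the mean of [e^(2iXx)] is
    [((1 + e^(2ix))/2)^n = (cos x)^n e^(inx)]. *)
Lemma bernR_cos n x : forall phi, bernR n (fun i => cos (2 * INR i * x + phi)) (/ 2) = cos x ^ n * cos (INR n * x + phi).
Proof.
 induction n; intros phi.
 - simpl. rewrite Rmult_1_l. f_equal. ring.
 -
  change (bernR (S n) (fun i => cos (2 * INR i * x + phi)) (/ 2)) with ((1 - / 2) * bernR n (fun i => cos (2 * INR i * x + phi)) (/ 2) + / 2 * bernR n (fun i => cos (2 * INR (S i) * x + phi)) (/ 2)).
  rewrite (bernR_ext n (fun i => cos (2 * INR (S i) * x + phi)) (fun i => cos (2 * INR i * x + (phi + 2 * x)))). 2:{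
  intros i _. f_equal. rewrite S_INR. ring. } rewrite !IHn, S_INR.
  replace (INR n * x + (phi + 2 * x)) with (((INR n + 1) * x + phi) + x) by ring.
  replace (INR n * x + phi) with (((INR n + 1) * x + phi) - x) by ring. rewrite cos_plus, cos_minus. simpl. field.
Qed.

(** Multiplication by [2 sin a] telescopes the sum, and its two ends cancel. *)
Lemma cos_sum_zero m r : (0 < r < m)%nat -> rsum m (fun j => cos (2 * PI * INR j * INR r / INR m)) = 0.
Proof.
 intros Hr. assert (Hm : 0 < INR m) by pos. assert (Hrm : INR r < INR m) by fin. pose proof PI_RGT_0 as P.
 set (a := PI * INR r / INR m). assert (Ha : 0 < a < PI). { unfold a. split. pos.
 apply Rmult_lt_reg_r with (INR m); auto. unfold Rdiv. rewrite Rmult_assoc, Rinv_l by lra. nra. }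
 assert (G : forall J, 2 * sin a * rsum J (fun j => cos (2 * PI * INR j * INR r / INR m)) = sin ((2 * INR J - 1) * a) + sin a).
 { induction J. simpl. replace ((2 * 0 - 1) * a) with (- a) by ring. rewrite sin_neg. ring.
 change (rsum (S J) ?f) with (rsum J f + f J). rewrite Rmult_plus_distr_l, IHJ, S_INR.
 replace (2 * PI * INR J * INR r / INR m) with (2 * INR J * a) by (unfold a; field; lra).
 replace ((2 * (INR J + 1) - 1) * a) with (2 * INR J * a + a) by ring.
 replace ((2 * INR J - 1) * a) with (2 * INR J * a - a) by ring. rewrite sin_plus, sin_minus. ring. } specialize (G m).
 replace ((2 * INR m - 1) * a) with (- a + 2 * INR r * PI) in G by (unfold a; field; lra).
 rewrite sin_period, sin_neg in G. assert (0 < sin a) by (apply sin_gt_0; lra). nra.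
Qed.

Lemma cos_sum m k : (0 < m)%nat -> rsum m (fun j => cos (2 * PI * INR j * INR k / INR m)) = if Nat.eq_dec (k mod m) 0 then INR m else 0.
Proof.
 intros Hm. assert (Hm0 : 0 < INR m) by pos.
 assert (E : forall j, cos (2 * PI * INR j * INR k / INR m) = cos (2 * PI * INR j * INR (k mod m) / INR m)). { intros j.
 rewrite (Nat.div_mod k m) at 1 by lia. rewrite plus_INR, mult_INR.
 replace (2 * PI * INR j * (INR m * INR (k / m) + INR (k mod m)) / INR m) with (2 * PI * INR j * INR (k mod m) / INR m + 2 * INR (j * (k / m)) * PI) by (rewrite mult_INR; field; lra).
 apply cos_period. } rewrite (rsum_ext m _ (fun j => cos (2 * PI * INR j * INR (k mod m) / INR m))) by fin.
 destruct (Nat.eq_dec (k mod m) 0) as [e|e].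
 - rewrite e. rewrite (rsum_ext m _ (fun _ => 1)). clear. induction m; simpl rsum. auto. rewrite IHm, S_INR. ring.
  intros j _. simpl (INR 0). replace (2 * PI * INR j * 0 / INR m) with 0 by pos. apply cos_0.
 - apply cos_sum_zero. pose proof (Nat.mod_upper_bound k m ltac:(lia)). lia.
Qed.

Lemma rsum_mult_index m L (g : nat -> R) : (0 < m)%nat -> (forall k, (k mod m <> 0)%nat -> g k = 0) ->
  rsum (m * L) (fun i => g (S i)) = rsum L (fun l => g (m * S l)%nat).
Proof.
 intros Hm Hg. induction L. rewrite Nat.mul_0_r; fin. rewrite (rsum_split (m * L) (m * S L)) by lia. rewrite IHL.
 simpl rsum. f_equal. replace (m * S L - m * L)%nat with m by lia. destruct m; [lia|]. rewrite rsum_S.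
 rewrite (rsum_ext m _ (fun _ => 0 * 0)). rewrite (rsum_scal 0 m (fun _ => 0)), Rmult_0_l, Rplus_0_l. f_equal. lia.
 intros j Hj. rewrite Hg. ring. replace (S (S m * L + j)) with (S j + L * S m)%nat by lia. rewrite Nat.Div0.mod_add.
 rewrite Nat.mod_small by lia. lia.
Qed.

Lemma rsum_rev N : forall f, rsum N f = rsum N (fun j => f (N - S j)%nat).
Proof.
 induction N; intros f. auto. rewrite (rsum_split 1 (S N) (fun j => f (S N - S j)%nat)) by lia. simpl rsum.
 rewrite Nat.sub_0_r. rewrite IHN; fin.
Qed.

(** Polya's identity: discrete Poisson summation for the binomial distribution. *)
Lemma polya m n : (0 < m)%nat -> rsum m (fun j => cos (PI * INR j / INR m) ^ (2 * n)) =
  INR m * wb (2 * n) n * (1 + 2 * rsum n (fun l => rb n (m * S l))).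
Proof.
 set (g := fun k : nat => if Nat.eq_dec (k mod m) 0 then INR m else 0).
 set (dist := fun i => if le_lt_dec n i then (i - n)%nat else (n - i)%nat).
 (* Both sides are [m] times the probability that a binomial variable with [2n] trials is congruent
    to [n] modulo [m]: detected by roots of unity on the left, summed directly on the right. *)
 transitivity (bernR (2 * n) (fun i => g (dist i)) (/ 2)).
 -
  rewrite (bernR_ext (2 * n) (fun i => g (dist i)) (fun i => rsum m (fun j => cos (2 * INR i * (PI * INR j / INR m) + - (2 * INR n * (PI * INR j / INR m)))))).
  2:{ intros i _. unfold g. rewrite <- cos_sum by auto. apply rsum_ext. intros j _. unfold dist.
  destruct (le_lt_dec n i). rewrite minus_INR by lia. f_equal; fin. rewrite minus_INR by lia. rewrite <- cos_neg.
  f_equal; fin. }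
  rewrite (bernR_rsum (2 * n) m (fun j i => cos (2 * INR i * (PI * INR j / INR m) + - (2 * INR n * (PI * INR j / INR m))))).
  apply rsum_ext. intros j _. rewrite bernR_cos. rewrite mult_INR. simpl (INR 2).
  replace ((1 + 1) * INR n * (PI * INR j / INR m) + - (2 * INR n * (PI * INR j / INR m))) with 0 by ring. rewrite cos_0.
  ring.
 - rewrite bernR_wb. replace (S (2 * n)) with (n + S n)%nat by lia. rewrite (rsum_split n (n + S n)) by lia.
  replace (n + S n - n)%nat with (S n) by lia.
  assert (S1 : rsum n (fun i => g (dist i) * wb (2 * n) i) = rsum n (fun j => g (S j) * wb (2 * n) (n + S j))). {
  rewrite rsum_rev. apply rsum_ext. intros j Hj. unfold dist. destruct (le_lt_dec n (n - S j)%nat); [lia|].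
  rewrite wb_sym by lia. do 2 f_equal. lia. }
  assert (S2 : rsum (S n) (fun j => g (dist (n + j)%nat) * wb (2 * n) (n + j)) = INR m * wb (2 * n) n + rsum n (fun j => g (S j) * wb (2 * n) (n + S j))).
  { rewrite (rsum_split 1 (S n)) by lia. replace (S n - 1)%nat with n by lia. rewrite rsum_S. rewrite Rplus_0_l.
  f_equal.
 - rewrite Nat.add_0_r. unfold dist. destruct (le_lt_dec n n); [|lia]. rewrite Nat.sub_diag. unfold g.
  rewrite Nat.Div0.mod_0_l; fin.
 - apply rsum_ext. intros j _. unfold dist. destruct (le_lt_dec n (n + (1 + j))%nat); [|lia].
  replace (n + (1 + j) - n)%nat with (S j) by lia; fin. }
  assert (S3 : rsum n (fun j => g (S j) * wb (2 * n) (n + S j)) = INR m * wb (2 * n) n * rsum n (fun l => rb n (m * S l))).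
  { transitivity (rsum (m * n) (fun j => g (S j) * wb (2 * n) (n + S j))).
 - rewrite (rsum_split n (m * n)) by nia. rewrite (rsum_ext (m * n - n) _ (fun _ => 0 * 0)). rewrite rsum_scal; ring.
  intros j _. rewrite wb_zero by lia. ring.
 - rewrite (rsum_mult_index m n (fun k => g k * wb (2 * n) (n + k))); auto. 2:{ intros k Hk. unfold g.
  destruct (Nat.eq_dec (k mod m) 0); [lia|]. ring. } rewrite <- rsum_scal. apply rsum_ext. intros l _. unfold g.
  rewrite Nat.mul_comm, Nat.Div0.mod_mul. simpl (if Nat.eq_dec 0 0 then _ else _). unfold rb. field.
  apply Rgt_not_eq, wb_center_pos. } lra.
Qed.

(** * The theta identity *)

Lemma cos_upper x : 0 <= x <= PI / 2 -> cos x <= 1 - x ^ 2 / 2 + x ^ 4 / 24.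
Proof. intros Hx. destruct (cos_bound x 0) as [_ H]; try lra. unfold cos_approx in H. unfold cos_term in H. simpl in H; fin. Qed.
Lemma cos_lower x : 0 <= x <= PI / 2 -> 1 - x ^ 2 / 2 <= cos x.
Proof. intros Hx. destruct (cos_bound x 0) as [H _]; try lra. unfold cos_approx in H. unfold cos_term in H. simpl in H; fin. Qed.

Lemma exp_pow_n x n : exp x ^ n = exp (INR n * x).
Proof.
 induction n. rewrite Rmult_0_l, exp_0. auto. rewrite S_INR. change (exp x ^ S n) with (exp x * exp x ^ n).
 rewrite IHn, <- exp_plus. f_equal. ring.
Qed.

Lemma exp_sq_geom c j : 0 <= c -> exp (- (c * INR (S j) ^ 2)) <= exp (- c) ^ j.
Proof. intros Hc. rewrite exp_pow_n. apply exp_le. rewrite S_INR. pose proof (pos_INR j). nra. Qed.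

Lemma exp_neg_lt1 c : 0 < c -> 0 <= exp (- c) < 1.
Proof. split. pos. rewrite <- exp_0. apply exp_increasing. lra. Qed.

Definition wterm (u : R) (j : nat) : R := exp (- (PI * INR (S j) ^ 2 * u)).
Definition W (u : R) : R := epsilon (inhabits 0) (fun l => rlim (fun n => rsum n (wterm u)) l).

Lemma wterm_pos u j : 0 < wterm u j. Proof. pos. Qed.

Lemma wterm_geom u j : 0 < u -> wterm u j <= exp (- (PI * u)) ^ j.
Proof.
 intros Hu. unfold wterm. pose proof PI_RGT_0. replace (PI * INR (S j) ^ 2 * u) with (PI * u * INR (S j) ^ 2) by ring.
 apply exp_sq_geom. nra.
Qed.

Lemma wsum_bound u n : 0 < u -> rsum n (wterm u) <= / (1 - exp (- (PI * u))).
Proof.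
 intros Hu. pose proof PI_RGT_0. le_trans rsum_le. intros; apply wterm_geom; auto. apply geom_sum_le. apply exp_neg_lt1.
 nra.
Qed.

Lemma W_lim u : 0 < u -> rlim (fun n => rsum n (wterm u)) (W u).
Proof.
 intros Hu. apply (epsilon_spec (inhabits 0) (fun l => rlim (fun n => rsum n (wterm u)) l)).
 destruct (rsum_cv (wterm u) (/ (1 - exp (- (PI * u))))) as [S [S1 [S2 S3]]]. left; apply wterm_pos.
 intros; apply wsum_bound; auto. exists S. intros e He. destruct (S3 e He) as [N HN]. exists N. intros n Hn.
 specialize (HN n Hn). specialize (S1 n). apply Rabs_le. lra.
Qed.

Lemma one_minus_lower y : 0 <= y <= 1 / 2 -> exp (- (y + 2 * y ^ 2)) <= 1 - y.
Proof.
 intros Hy. rewrite exp_Ropp. eapply Rmult_le_reg_r. pos. rewrite Rinv_l by fin.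
 pose proof (exp_ineq1_le (y + 2 * y ^ 2)). nra.
Qed.

Lemma one_minus_upper y : 1 - y <= exp (- y).
Proof. pose proof (exp_ineq1_le (- y)). lra. Qed.

(** The cosines at [j] and [m - j] are opposite and the exponent is even. For odd [m] the indices
    pair off, and the representatives have angles below [PI/2]. *)
Lemma odd_cos_sum M n : let m := (2 * M + 1)%nat in
  rsum m (fun j => cos (PI * INR j / INR m) ^ (2 * n)) = 1 + 2 * rsum M (fun j => cos (PI * INR (S j) / INR m) ^ (2 * n)).
Proof.
 intros m. assert (Hm : 0 < INR m) by pos. set (f := fun j => cos (PI * INR j / INR m) ^ (2 * n)).
 rewrite (rsum_split 1 m) by lia. rewrite (rsum_S 0 f). change (rsum 0 f) with 0. assert (E0 : f 0%nat = 1). { unfold f.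
 change (INR 0) with 0. replace (PI * 0 / INR m) with 0 by pos. rewrite cos_0. apply pow1. } rewrite E0.
 replace (m - 1)%nat with (M + M)%nat by lia. rewrite (rsum_split M (M + M)) by lia.
 replace (M + M - M)%nat with M by lia. rewrite (rsum_rev M (fun j => f (1 + (M + j))%nat)).
 rewrite (rsum_ext M (fun j => f (1 + (M + (M - S j)))%nat) (fun j => f (1 + j)%nat)).
 change (fun j => f (1 + j)%nat) with (fun j => cos (PI * INR (S j) / INR m) ^ (2 * n)). ring. intros j Hj. unfold f.
 replace (PI * INR (1 + (M + (M - S j))) / INR m) with (PI - PI * INR (1 + j) / INR m). 2:{
 replace (1 + (M + (M - S j)))%nat with (m - (1 + j))%nat by lia. rewrite minus_INR by lia. field. lra. }
 rewrite Rtrigo_facts.cos_pi_minus. rewrite !pow_mult. f_equal. ring.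
Qed.

Lemma rlim_inv_odd : rlim (fun M => / INR (2 * M + 1)) 0.
Proof.
 intros e He. destruct (inv_INR_small 1 e ltac:(lra) He) as [N HN]. exists (S N). intros n Hn.
 rewrite Rminus_0_r, Rabs_pos_eq by pos. specialize (HN N (le_n _)). le_via (/ INR (S N)); fin.
Qed.

Lemma rlim_ext_l u a b : a = b -> rlim u a -> rlim u b. Proof. intros ->; auto. Qed.
Lemma rlim_opp u a : rlim u a -> rlim (fun n => - u n) (- a).
Proof.
 intros H. apply rlim_ext with (fun n => -1 * u n). exists O; intros; ring. apply rlim_ext_l with (-1 * a). ring.
 apply rlim_mult; auto. apply rlim_const.
Qed.

Section Theta.
Variable u : R.
Hypothesis Hu : 0 < u.
Variable nf : nat -> nat.
(** With [m = 2M + 1] and [n] about [u m^2 / PI], the term [cos(PI j/m)^(2n)] tends to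
    [exp(-PI j^2 u)] and [rb n (m l)] to [exp(-PI l^2 / u)], so both sides of Polya's identity
    become theta series. *)
Hypothesis Hnf : forall M, INR (nf M) <= u * INR (2 * M + 1) ^ 2 / PI < INR (nf M) + 1.
Let r M := INR (nf M) * (/ INR (2 * M + 1)) ^ 2.
Let iv M := / INR (2 * M + 1).

Lemma odd_pos M : 0 < INR (2 * M + 1). Proof. pos. Qed.

Lemma r_upper M : r M <= u / PI.
Proof.
 unfold r. pose proof (odd_pos M). destruct (Hnf M) as [H1 _]. apply Rmult_le_reg_r with (INR (2 * M + 1) ^ 2). pos.
 replace (INR (nf M) * (/ INR (2 * M + 1)) ^ 2 * INR (2 * M + 1) ^ 2) with (INR (nf M)) by (field; lra); fin.
Qed.
Lemma r_lower M : u / PI - iv M ^ 2 <= r M.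
Proof.
 unfold r, iv. pose proof (odd_pos M). pose proof PI_RGT_0. destruct (Hnf M) as [_ H1].
 apply Rmult_le_reg_r with (INR (2 * M + 1) ^ 2). pos.
 replace (INR (nf M) * (/ INR (2 * M + 1)) ^ 2 * INR (2 * M + 1) ^ 2) with (INR (nf M)) by (field; lra).
 replace ((u / PI - (/ INR (2 * M + 1)) ^ 2) * INR (2 * M + 1) ^ 2) with (u * INR (2 * M + 1) ^ 2 / PI - 1) by (field; lra).
 lra.
Qed.
Lemma r_pos M : 0 <= r M.
Proof. unfold r; fin. Qed.
Lemma r_lim : rlim r (u / PI).
Proof.
 apply rlim_squeeze with (fun M => u / PI + - (iv M * iv M)) (fun _ => u / PI).
 - exists O. intros M _. pose proof (r_upper M). pose proof (r_lower M); fin.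
 - apply rlim_ext_l with (u / PI + - (0 * 0)). ring. apply rlim_plus. apply rlim_const.
  apply rlim_opp, rlim_mult; apply rlim_inv_odd.
 - apply rlim_const.
Qed.
Lemma uPI_pos : 0 < u / PI. Proof. pos. Qed.
Lemma r_half : exists N, forall M, (N <= M)%nat -> u / PI / 2 <= r M.
Proof.
 pose proof uPI_pos. destruct (r_lim (u / PI / 2) ltac:(lra)) as [N HN]. exists N. intros M HM. specialize (HN M HM).
 apply Rabs_le_between in HN. lra.
Qed.

Lemma ang_range M j : (j < M)%nat -> 0 <= PI * INR (S j) * iv M <= PI / 2.
Proof.
 pose proof PI_RGT_0. pose proof (odd_pos M). unfold iv. split.
 - pos.
 - apply Rmult_le_reg_r with (INR (2 * M + 1)); auto. rewrite Rmult_assoc, Rinv_l by lra.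
  assert (INR (S j) <= INR M) by fin. rewrite plus_INR, mult_INR. simpl (INR 2). simpl (INR 1). nra.
Qed.

Lemma cos_term_upper M j : (j < M)%nat -> cos (PI * INR (S j) / INR (2 * M + 1)) ^ (2 * nf M) <=
  exp (- ((PI * INR (S j)) ^ 2 * r M) + (PI * INR (S j)) ^ 4 * (r M * (iv M * iv M)) / 12).
Proof.
 intros Hj. pose proof (ang_range M j Hj) as Ha. unfold Rdiv at 1. fold (iv M). set (x := PI * INR (S j) * iv M) in *.
 pose proof (cos_upper x Ha) as C1. pose proof (cos_ge_0 x ltac:(lra) ltac:(lra)) as C0.
 pose proof (one_minus_upper (x ^ 2 / 2 - x ^ 4 / 24)) as C2. le_via (exp (- (x ^ 2 / 2 - x ^ 4 / 24)) ^ (2 * nf M)).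
 fin. rewrite exp_pow_n. apply exp_le. right. rewrite mult_INR. simpl (INR 2). unfold r. fold (iv M). unfold x. field.
Qed.
(** The angle is at most 2, so the quartic correction is at most a third of the main exponent [A];
    the remaining [2A/3] is at least [PI u (j+1)^2 / 3]. *)
Lemma cos_term_dom M j : (j < M)%nat -> u / PI / 2 <= r M -> cos (PI * INR (S j) / INR (2 * M + 1)) ^ (2 * nf M) <= exp (- (PI * u / 3)) ^ j.
Proof.
 intros Hj Hr. pose proof (ang_range M j Hj) as Ha. pose proof PI_RGT_0. pose proof PI_4. eapply Rle_trans.
 apply cos_term_upper; auto. eapply Rle_trans. 2: apply exp_sq_geom; nra. apply exp_le.
 replace ((PI * INR (S j)) ^ 4 * (r M * (iv M * iv M)) / 12) with ((PI * INR (S j) * iv M) ^ 2 * ((PI * INR (S j)) ^ 2 * r M) / 12) by field.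
 set (x := PI * INR (S j) * iv M) in *. set (A := (PI * INR (S j)) ^ 2 * r M).
 assert (A0 : 0 <= A) by (apply Rmult_le_pos; [apply pow2_ge_0|apply r_pos]). assert (x ^ 2 <= 4) by nra.
 assert (PI * u * INR (S j) ^ 2 <= 2 * A). { unfold A.
 replace (PI * u * INR (S j) ^ 2) with (2 * (PI ^ 2 * INR (S j) ^ 2 * (u / PI / 2))) by (field; lra); fin. } nra.
Qed.
Lemma cos_term_lower M j : (j < M)%nat -> (PI * INR (S j) * iv M) ^ 2 / 2 <= 1 / 2 ->
  exp (- ((PI * INR (S j)) ^ 2 * r M) - (PI * INR (S j)) ^ 4 * (r M * (iv M * iv M))) <= cos (PI * INR (S j) / INR (2 * M + 1)) ^ (2 * nf M).
Proof.
 intros Hj Hs. pose proof (ang_range M j Hj) as Ha. unfold Rdiv at 1. fold (iv M).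
 set (x := PI * INR (S j) * iv M) in *. pose proof (cos_lower x Ha) as C1.
 pose proof (one_minus_lower (x ^ 2 / 2) ltac:(pose proof (pow2_ge_0 x); lra)) as C2.
 le_via (exp (- (x ^ 2 / 2 + 2 * (x ^ 2 / 2) ^ 2)) ^ (2 * nf M)). 2:{ fin. } rewrite exp_pow_n. apply exp_le. right.
 rewrite mult_INR. simpl (INR 2). unfold r. fold (iv M). unfold x. field.
Qed.

Lemma theta_left : rlim (fun M => rsum M (fun j => cos (PI * INR (S j) / INR (2 * M + 1)) ^ (2 * nf M))) (W u).
Proof.
 destruct r_half as [N0 HN0]. pose proof PI_RGT_0. assert (L2 : forall c, rlim (fun M => c * (r M * (iv M * iv M))) 0).
 { intros c. apply rlim_ext_l with (c * (u / PI * (0 * 0))). ring. apply rlim_mult. apply rlim_const. apply rlim_mult.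
 apply r_lim. apply rlim_mult; apply rlim_inv_odd. }
 assert (L1 : forall j, rlim (fun M => - ((PI * INR (S j)) ^ 2 * r M)) (- (PI * INR (S j) ^ 2 * u))). { intros j.
 apply rlim_opp. apply rlim_ext_l with ((PI * INR (S j)) ^ 2 * (u / PI)). field; lra. apply rlim_mult. apply rlim_const.
 apply r_lim. }
 destruct (tannery (fun M j => if lt_dec j M then cos (PI * INR (S j) / INR (2 * M + 1)) ^ (2 * nf M) else 0) (wterm u) (fun j => exp (- (PI * u / 3)) ^ j) (fun M => M) (/ (1 - exp (- (PI * u / 3)))) N0) as [S [S1 S2]].
 - intros j.
  apply rlim_squeeze with (fun M => exp (- ((PI * INR (S j)) ^ 2 * r M) + - ((PI * INR (S j)) ^ 4 * (r M * (iv M * iv M))))) (fun M => exp (- ((PI * INR (S j)) ^ 2 * r M) + (PI * INR (S j)) ^ 4 / 12 * (r M * (iv M * iv M)))).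
  +
   destruct (rlim_mult _ _ _ _ (rlim_const ((PI * INR (S j)) ^ 2 / 2)) (rlim_mult _ _ _ _ rlim_inv_odd rlim_inv_odd) (1/2) ltac:(lra)) as [N HN].
   exists (max N (S j)). intros M HM. destruct (lt_dec j M); [|lia]. specialize (HN M ltac:(lia)). fold (iv M) in HN.
   split. apply cos_term_lower; auto. apply Rabs_le_between in HN; fin. eapply Rle_trans. apply cos_term_upper; auto.
   fin.
  + apply rlim_exp. apply rlim_ext_l with (- (PI * INR (S j) ^ 2 * u) + - 0). ring. apply rlim_plus; auto.
   apply rlim_opp; auto.
  + apply rlim_exp. apply rlim_ext_l with (- (PI * INR (S j) ^ 2 * u) + 0). ring. apply rlim_plus; auto.
 - intros n. apply geom_sum_le. apply exp_neg_lt1. nra.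
 - intros M j HM. destruct (lt_dec j M). rewrite Rabs_pos_eq. apply cos_term_dom; auto. rewrite pow_mult; fin.
  rewrite Rabs_R0; fin.
 - intros M j Hj. destruct (lt_dec j M); [lia|auto].
 - rewrite (rlim_unique _ _ _ (W_lim u Hu) S2). eapply rlim_ext. 2: exact S1. exists O. intros M _. apply rsum_ext.
  intros j Hj. destruct (lt_dec j M); [auto|lia].
Qed.

Lemma theta_right : rlim (fun M => rsum (nf M) (fun l => rb (nf M) ((2 * M + 1) * S l))) (W (/ u)).
Proof.
 pose proof PI_RGT_0. assert (Hu' : 0 < / u) by pos. assert (Rb0 : forall n k, 0 <= rb n k). { intros n k.
 apply Rmult_le_pos. apply wb_nonneg. left; apply Rinv_0_lt_compat, wb_center_pos. }
 assert (RbZ : forall n k, (n < k)%nat -> rb n k = 0). { intros n k Hk. unfold rb. rewrite wb_zero by lia; fin. }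
 destruct (tannery (fun M l => rb (nf M) ((2 * M + 1) * S l)) (wterm (/ u)) (fun l => exp (- (PI * / u / 2)) ^ l) nf (/ (1 - exp (- (PI * / u / 2)))) 0) as [S [S1 S2]].
 - intros l. assert (P : forall M, INR ((2 * M + 1) * S l) = INR (2 * M + 1) * INR (S l)) by (intros; apply mult_INR).
  assert (Lm : rlim (fun M => r M + - (INR (S l) * iv M)) (u / PI)). {
  apply rlim_ext_l with (u / PI + - (INR (S l) * 0)). ring. apply rlim_plus. apply r_lim. apply rlim_opp, rlim_mult.
  apply rlim_const. apply rlim_inv_odd. } assert (Lp : rlim (fun M => r M + INR (S l) * iv M) (u / PI)). {
  apply rlim_ext_l with (u / PI + INR (S l) * 0). ring. apply rlim_plus. apply r_lim. apply rlim_mult. apply rlim_const.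
  apply rlim_inv_odd. } pose proof uPI_pos.
  assert (G : forall v, rlim v (u / PI) -> rlim (fun M => exp (- (INR (S l) ^ 2 * / v M))) (wterm (/ u) l)). {
  intros v Hv. apply rlim_exp, rlim_opp. apply rlim_ext_l with (INR (S l) ^ 2 * / (u / PI)). field; lra.
  apply rlim_mult. apply rlim_const. apply rlim_inv; auto. lra. }
  apply rlim_squeeze with (fun M => exp (- (INR (S l) ^ 2 * / (r M + - (INR (S l) * iv M))))) (fun M => exp (- (INR (S l) ^ 2 * / (r M + INR (S l) * iv M)))); auto.
  destruct (Lm (u / PI / 2) ltac:(lra)) as [N HN]. exists N. intros M HM. specialize (HN M HM).
  apply Rabs_le_between in HN. pose proof (odd_pos M) as Om. pose proof (INR_S_pos l).
  assert (E1 : INR (nf M) = r M * INR (2 * M + 1) ^ 2) by (unfold r; field; lra).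
  assert (E2 : INR (2 * M + 1) * iv M = 1) by (unfold iv; field; lra). assert (Hk : ((2 * M + 1) * S l < nf M)%nat). {
  apply INR_lt. rewrite P, E1. apply Rle_lt_trans with ((INR (S l) * iv M) * INR (2 * M + 1) ^ 2). right. unfold iv.
  field. lra. apply Rmult_lt_compat_r; fin. } split.
  + eapply Rle_trans. 2: apply (rb_lower _ _ ((2 * M + 1) * S l)); auto. apply exp_le. right. rewrite P, E1. unfold iv.
   field. assert (0 < r M * INR (2 * M + 1) - INR (S l)). 2:{ nra. } nra.
  + eapply Rle_trans. apply (rb_upper _ _ ((2 * M + 1) * S l)); auto. lia. apply exp_le. right. rewrite P, E1.
   unfold iv. field. pose proof (r_pos M); fin.
 - intros n. apply geom_sum_le. apply exp_neg_lt1. nra.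
 - intros M l _. rewrite Rabs_pos_eq by auto. destruct (le_lt_dec ((2 * M + 1) * S l) (nf M)) as [Hk|Hk]. 2:{
  rewrite RbZ by auto; fin. } eapply Rle_trans. apply (rb_upper _ _ (nf M)); auto. eapply Rle_trans.
  2: apply exp_sq_geom; nra. apply exp_le. apply Ropp_le_contravar. assert (Hn : 0 < INR (nf M)) by pos.
  pose proof (r_upper M) as Hr. rewrite mult_INR. pose proof (odd_pos M) as Om.
  assert (E : INR (2 * M + 1) ^ 2 * (u / PI) >= INR (nf M)). { apply Rle_ge.
  le_via (INR (2 * M + 1) ^ 2 * (INR (nf M) * (/ INR (2 * M + 1)) ^ 2)). right; field; lra. fin. }
  apply Rmult_le_reg_r with (2 * INR (nf M)). lra.
  replace ((INR (2 * M + 1) * INR (S l)) ^ 2 / (INR (nf M) + INR (nf M)) * (2 * INR (nf M))) with (INR (S l) ^ 2 * INR (2 * M + 1) ^ 2) by (field; lra).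
  replace (PI * / u / 2 * INR (S l) ^ 2 * (2 * INR (nf M))) with (INR (S l) ^ 2 * (PI * / u * INR (nf M))) by pos.
  le_mul_l. pos. apply Rmult_le_reg_r with (u / PI). pos.
  replace (PI * / u * INR (nf M) * (u / PI)) with (INR (nf M)) by (field; lra). lra.
 - intros M l Hl. apply RbZ. nia.
 - rewrite (rlim_unique _ _ _ (W_lim _ Hu') S2); fin.
Qed.

(** Polya's identity is squared because only the square of the central weight, multiplied by [n], is
    known to converge. *)
Lemma theta_sq c : rlim (fun n => INR n * wb (2 * n) n ^ 2) c -> (1 + 2 * W u) ^ 2 * (u / PI) = c * (1 + 2 * W (/ u)) ^ 2.
Proof.
 intros Hc. pose proof PI_RGT_0. pose proof uPI_pos.
 assert (Hinf : forall N, exists N', forall M, (N' <= M)%nat -> (N <= nf M)%nat). { intros N.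
 destruct r_half as [N0 HN0].
 destruct (rlim_mult _ _ _ _ (rlim_const (INR N)) rlim_inv_odd (u / PI / 2) ltac:(lra)) as [N1 HN1]. exists (max N0 N1).
 intros M HM. specialize (HN0 M ltac:(lia)). specialize (HN1 M ltac:(lia)). apply Rabs_le_between in HN1. apply INR_le.
 assert (1 <= INR (2 * M + 1)). { change 1 with (INR 1) at 1; fin. } assert (INR N * / INR (2 * M + 1) <= r M) by lra.
 unfold r in *. apply Rmult_le_reg_r with (/ INR (2 * M + 1)). pos. le_trans H2.
 replace (INR (nf M) * (/ INR (2 * M + 1)) ^ 2) with (INR (nf M) * / INR (2 * M + 1) * / INR (2 * M + 1)) by ring.
 rewrite <- (Rmult_1_r (INR (nf M) * / INR (2 * M + 1))) at 2; fin. }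
 assert (Hc' : rlim (fun M => INR (nf M) * wb (2 * nf M) (nf M) ^ 2) c). { intros e He. destruct (Hc e He) as [N HN].
 destruct (Hinf N) as [N' HN']; fin. }
 assert (L : forall v a, rlim v a -> rlim (fun M => (1 + 2 * v M) * (1 + 2 * v M)) ((1 + 2 * a) * (1 + 2 * a))). {
 intros v a Hv. assert (rlim (fun M => 1 + 2 * v M) (1 + 2 * a)). { apply rlim_plus. apply rlim_const.
 apply rlim_mult; auto. apply rlim_const. } apply rlim_mult; auto. }
 assert (A := rlim_mult _ _ _ _ (L _ _ theta_left) r_lim). assert (B := rlim_mult _ _ _ _ Hc' (L _ _ theta_right)).
 simpl. rewrite !Rmult_1_r. apply (rlim_unique _ _ _ A). eapply rlim_ext. 2: exact B. exists O. intros M _.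
 rewrite <- (odd_cos_sum M (nf M)). rewrite polya by lia. unfold r. field; pos.
Qed.
End Theta.

(** At [u = 1] the squared identity forces [c = 1/PI]; nonnegativity of [W] then permits taking
    square roots. *)
Theorem theta u : 0 < u -> (1 + 2 * W u) * sqrt u = 1 + 2 * W (/ u).
Proof.
 intros Hu. destruct wallis as [c [c0 Hc]].
 assert (G : forall v, 0 < v -> (1 + 2 * W v) ^ 2 * (v / PI) = c * (1 + 2 * W (/ v)) ^ 2). { intros v Hv.
 assert (F : forall M, 0 <= v * INR (2 * M + 1) ^ 2 / PI) by (intros; fin).
 apply (theta_sq v Hv (fun M => proj1_sig (nfloor_ex _ (F M)))); auto. intros M. apply proj2_sig. }
 assert (W0 : forall v, 0 < v -> 0 <= W v). { intros v Hv. apply le_epsilon. intros e He.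
 destruct (W_lim v Hv e He) as [N HN]. specialize (HN N (le_n _)). apply Rabs_le_between in HN.
 assert (0 <= rsum N (wterm v)) by (apply rsum_pos; intros; left; apply wterm_pos). lra. } pose proof (W0 u Hu).
 pose proof (W0 (/ u) ltac:(pos)). pose proof (W0 1 Rlt_0_1). assert (Ec : c = / PI). { pose proof (G 1 Rlt_0_1) as G1.
 rewrite Rinv_1 in G1. nra. } pose proof (G u Hu) as Gu. assert (G2 : (1 + 2 * W u) ^ 2 * u = (1 + 2 * W (/ u)) ^ 2). {
 nra. } rewrite <- (sqrt_pow2 (1 + 2 * W (/ u))) by lra. rewrite <- G2. rewrite sqrt_mult by pos.
 rewrite sqrt_pow2 by lra. auto.
Qed.

(** * Euler's integral for the Gamma function *)

Lemma rcont_Rd (f : R -> R) t : ex_derive f t -> rcont (fun t => RtoC (f t)) t.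
Proof. intros H. apply rcont_R. apply (ex_derive_continuous f t H). Qed.

Lemma rcont_line p t : rcont (fun t => cexp (RtoC t * p)%C) t.
Proof. eapply rdiff_rcont, rdiff_cexp_line. Qed.

Lemma Cmod_line p t : Cmod (cexp (RtoC t * p)%C) = exp (t * Re p).
Proof. rewrite Cmod_cexp. f_equal. destruct p; simpl; ring. Qed.

Lemma Cmod_exp x : Cmod (RtoC (exp x)) = exp x.
Proof. rewrite Cmod_R, Rabs_pos_eq; fin. Qed.

(** From [t^2/4 <= e^t] by completing the square. *)
Lemma exp_decay k t : 0 <= t -> exp (k * t - exp t) <= exp ((k + 1) ^ 2) * exp (- t).
Proof.
 intros Ht. rewrite <- exp_plus. apply exp_le. assert (E : t ^ 2 / 4 <= exp t). {
 replace t with (t / 2 + t / 2) at 2 by field. rewrite exp_plus. pose proof (exp_ineq1_le (t / 2)). nra. }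
 pose proof (pow2_ge_0 (t / 2 - (k + 1))). nra.
Qed.

Lemma CI_exp_le f K a b : a <= b -> rcont_on f a b -> (forall t, a <= t <= b -> Cmod (f t) <= K * exp t) -> 0 <= K -> Cmod (CI f a b) <= K * exp b.
Proof.
 intros Hab Hc H HK. eapply Rle_trans.
 apply (is_CI_bound f (fun t => K * exp t) a b (CI f a b) (K * exp b - K * exp a)); auto. fin.
 apply (is_RInt_derive (fun t => K * exp t)). intros x _. auto_derive; auto; ring. intros x _.
 apply (ex_derive_continuous (fun t => K * exp t)). auto_derive; auto. pose proof (exp_pos a). nra.
Qed.
Lemma CI_exp_ge f K a b : a <= b -> rcont_on f a b -> (forall t, a <= t <= b -> Cmod (f t) <= K * exp (- t)) -> 0 <= K -> Cmod (CI f a b) <= K * exp (- a).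
Proof.
 intros Hab Hc H HK. eapply Rle_trans.
 apply (is_CI_bound f (fun t => K * exp (- t)) a b (CI f a b) (- (K * exp (- b)) - - (K * exp (- a)))); auto. fin.
 apply (is_RInt_derive (fun t => - (K * exp (- t)))). intros x _. auto_derive; auto; ring. intros x _.
 apply (ex_derive_continuous (fun t => K * exp (- t))). auto_derive; auto. pose proof (exp_pos (- b)). nra.
Qed.

Lemma exp_neg_small D e : 0 <= D -> 0 < e -> exists N : nat, forall n, (N <= n)%nat -> D * exp (- INR n) <= e.
Proof.
 intros HD He. destruct (inv_INR_small D e HD He) as [N HN]. exists N. intros n Hn.
 eapply Rle_trans; [|apply HN; eauto]. le_mul_l; auto. rewrite exp_Ropp, S_INR. pose proof (pos_INR n).
 apply Rinv_le_contravar. lra. pose proof (exp_ineq1_le (INR n)). lra.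
Qed.

Lemma improper_CI f K : (forall t, rcont f t) -> (forall t, Cmod (f t) <= K * exp t) -> (forall t, Cmod (f t) <= K * exp (- t)) ->
  exists I, forall A B, - A <= B -> Cmod (I - CI f (- A) B) <= K * (exp (- A) + exp (- B)).
Proof.
 intros Hc H1 H2. assert (HK : 0 <= K). { specialize (H1 0). rewrite exp_0 in H1. pose proof (Cmod_ge_0 (f 0)). lra. }
 assert (D : forall A B A' B', - A <= B -> A <= A' -> B <= B' -> Cmod (CI f (- A') B' - CI f (- A) B) <= K * (exp (- A) + exp (- B))).
 { intros A B A' B' L1 L2 L3. rewrite <- (CI_Chasles f (- A') (- A) B') by fin.
 rewrite <- (CI_Chasles f (- A) B B') by fin.
 replace (CI f (- A') (- A) + (CI f (- A) B + CI f B B') - CI f (- A) B)%C with (CI f (- A') (- A) + CI f B B')%C by ring.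
 le_trans Cmod_triangle. rewrite Rmult_plus_distr_l. apply Rplus_le_compat. apply CI_exp_le; fin. apply CI_exp_ge; fin.
 } destruct (limit_rate (fun n => CI f (- INR n) (INR n)) (fun n => 2 * K * exp (- INR n))) as [I HI]. { intros n m L.
 le_trans D. pose proof (pos_INR n); lra. fin. fin. lra. } { intros e He. apply exp_neg_small; lra. } exists I.
 intros A B HAB. apply le_epsilon. intros e He. destruct (exp_neg_small (2 * K) e ltac:(lra) He) as [N HN].
 destruct (nfloor_ex (Rmax 0 (Rmax A B)) (Rmax_l _ _)) as [M HM]. set (n := max N (S M)). specialize (HN n ltac:(lia)).
 specialize (HI n). assert (LM : Rmax 0 (Rmax A B) <= INR n). { le_via (INR (S M)). rewrite S_INR. lra. fin. }
 pose proof (Rmax_r 0 (Rmax A B)). pose proof (Rmax_l A B). pose proof (Rmax_r A B).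
 specialize (D A B (INR n) (INR n) HAB ltac:(lra) ltac:(lra)).
 replace (I - CI f (- A) B)%C with ((CI f (- INR n) (INR n) - CI f (- A) B) + (I - CI f (- INR n) (INR n)))%C by ring; fin.
Qed.

(** Euler's integral for Gamma after the substitution [u = exp t]. *)
Definition Gf (p : C) (t : R) : C := (RtoC (exp (- exp t)) * cexp (RtoC t * p))%C.

Lemma rcont_Gf p t : rcont (Gf p) t.
Proof. apply rcont_mult. apply rcont_Rd. auto_derive; auto. apply rcont_line. Qed.

Lemma Cmod_Gf p t : Cmod (Gf p t) = exp (Re p * t - exp t).
Proof. unfold Gf. rewrite Cmod_mult, Cmod_exp, Cmod_line, <- exp_plus. f_equal. ring. Qed.

Lemma Gf_real_bound k t : 1 <= k -> exp (k * t - exp t) <= exp ((k + 1) ^ 2) * exp t /\ exp (k * t - exp t) <= exp ((k + 1) ^ 2) * exp (- t).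
Proof.
 intros Hk. pose proof (exp_pos t). assert (E1 : 1 <= exp ((k + 1) ^ 2)) by pos. destruct (Rle_dec 0 t) as [Ht|Ht].
 - pose proof (exp_decay k t Ht). split; auto. eapply Rle_trans; fin.
 - assert (exp (k * t - exp t) <= exp t). { apply exp_le. nra. } assert (exp t <= exp (- t)) by fin. nra.
Qed.
Lemma Gf_bound p t : 1 <= Re p -> Cmod (Gf p t) <= exp ((Re p + 1) ^ 2) * exp t /\ Cmod (Gf p t) <= exp ((Re p + 1) ^ 2) * exp (- t).
Proof. rewrite Cmod_Gf. apply Gf_real_bound. Qed.

(** The Beta integral with [u = e^t]. A further factor [1 - e^t] replaces the integral at [p] by its
    difference with the one at [p + 1]; the truncation errors add, hence [2^n]. *)
Lemma beta_int n : forall p, 1 <= Re p -> forall A, 0 <= A ->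
  Cmod (CN (fact n) / cprod (S n) (fun k => p + CN k) - CI (fun t => RtoC ((1 - exp t) ^ n) * cexp (RtoC t * p)) (- A) 0)%C <= 2 ^ n * exp (- A).
Proof.
 assert (Rc : forall n p t, rcont (fun t => RtoC ((1 - exp t) ^ n) * cexp (RtoC t * p))%C t). { intros k p t.
 apply rcont_mult. apply rcont_Rd. auto_derive; auto. apply rcont_line. }
 assert (Hnz : forall p k, 1 <= Re p -> (p + CN k)%C <> RtoC 0). { intros p k Hp E. apply (f_equal Re) in E.
 rewrite re_plus in E. simpl in E. pose proof (pos_INR k). lra. } induction n; intros p Hp A HA.
 - rewrite cprod_S. change (cprod 0 ?f) with (RtoC 1). change (INR 0) with 0. simpl (INR (fact 0)).
  assert (Pn := Hnz p 0%nat Hp). change (INR 0) with 0 in Pn. assert (Pn' : p <> RtoC 0) by (intros ->; apply Pn; ring).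
  rewrite (is_CI_unique _ (- A) 0 ((1 - cexp (- (RtoC A * p))) / p)%C).
  + replace (1 / (1 * (p + 0)) - (1 - cexp (- (RtoC A * p))) / p)%C with (cexp (- (RtoC A * p)) / p)%C by (field; auto).
   unfold Cdiv. rewrite Cmod_mult, Cmod_inv by auto.
   replace (- (RtoC A * p))%C with (RtoC (- A) * p)%C by (rewrite RtoC_opp; ring). rewrite Cmod_line.
   pose proof (Re_le_Cmod p). rewrite Rmult_1_l. rewrite <- (Rmult_1_r (exp (- A))). apply Rmult_le_compat. pos. pos.
   apply exp_le. nra. fin.
  + apply (is_CI_ext (fun t => cexp (RtoC t * p))%C). intros t _. simpl. ring. eapply is_CI_eq.
   apply (is_CI_FTC (fun t => (/ p) * cexp (RtoC t * p))%C).
   * intros t _. eapply rdiff_eq. apply rdiff_scal, rdiff_cexp_line. field. auto.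
   * apply rcont_on_all. apply rcont_line.
   * replace (0 * p)%C with (RtoC 0) by ring. rewrite cexp_0.
    replace (RtoC (- A) * p)%C with (- (RtoC A * p))%C by (rewrite RtoC_opp; ring). field. auto.
 - assert (Hp1 : 1 <= Re (p + 1)%C) by (rewrite re_plus; simpl; lra). pose proof (IHn p Hp A HA) as I1.
  pose proof (IHn (p + 1)%C Hp1 A HA) as I2.
  replace (CI (fun t => RtoC ((1 - exp t) ^ S n) * cexp (RtoC t * p))%C (- A) 0) with (CI (fun t => RtoC ((1 - exp t) ^ n) * cexp (RtoC t * p)) (- A) 0 - CI (fun t => RtoC ((1 - exp t) ^ n) * cexp (RtoC t * (p + 1))) (- A) 0)%C.
  2:{ rewrite <- CI_minus by fin. apply CI_ext. intros t _. rewrite Cmult_plus_distr_l, Cmult_1_r, cexp_plus, cexp_R.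
  change ((1 - exp t) ^ S n) with ((1 - exp t) * (1 - exp t) ^ n). rewrite (RtoC_mult (1 - exp t)), RtoC_minus. ring. }
  replace (RtoC (INR (fact (S n))) / cprod (S (S n)) (fun k => p + CN k))%C with (CN (fact n) / cprod (S n) (fun k => p + CN k) - CN (fact n) / cprod (S n) (fun k => p + 1 + CN k))%C.
  +
   match goal with |- Cmod (?a - ?b - (?c - ?d)) <= _ => replace (a - b - (c - d))%C with ((a - c) - (b - d))%C by ring end.
   le_trans Cmod_minus_le. change (2 ^ S n) with (2 * 2 ^ n). lra.
  + set (q := cprod n (fun k => p + 1 + CN k)%C). assert (Q0 : q <> RtoC 0). { apply cprod_neq_0; fin. }
   assert (E1 : cprod (S n) (fun k => p + CN k)%C = (p * q)%C). { rewrite cprod_shift. rewrite Cplus_0_r. f_equal.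
   apply cprod_ext. intros k _. rewrite S_INR, RtoC_plus. ring. }
   assert (E2 : cprod (S n) (fun k => p + 1 + CN k)%C = (q * (p + 1 + CN n))%C) by fin.
   assert (E3 : cprod (S (S n)) (fun k => p + CN k)%C = (p * q * (p + 1 + CN n))%C). { rewrite cprod_S, E1.
   rewrite S_INR, RtoC_plus. ring. } rewrite E1, E2, E3. rewrite fact_simpl, mult_INR, S_INR, RtoC_mult, RtoC_plus.
   assert (P0 := Hnz p 0%nat Hp). field. repeat split; auto. intros ->. apply P0. change (INR 0) with 0. ring.
Qed.

Lemma exp_gauss x n : 0 <= x <= INR n -> (0 < n)%nat -> 0 <= exp (- x) - (1 - x / INR n) ^ n <= x ^ 2 * exp (- x) / INR n.
Proof.
 intros Hx Hn. assert (Hn0 : 0 < INR n) by pos. assert (Q : 0 <= x / INR n <= 1). { split. pos.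
 apply Rmult_le_reg_r with (INR n); auto. unfold Rdiv. rewrite Rmult_assoc, Rinv_l by lra. lra. }
 set (y := x / INR n) in *. assert (Ey : x = INR n * y) by (unfold y; field; lra).
 assert (E : exp (- x) = exp (- y) ^ n) by (rewrite exp_pow_n; f_equal; rewrite Ey; ring).
 assert (Bern : forall k z, 0 <= z <= 1 -> 1 - INR k * z <= (1 - z) ^ k). { induction k; intros z Hz. simpl. lra.
 rewrite S_INR. change ((1 - z) ^ S k) with ((1 - z) * (1 - z) ^ k). specialize (IHk z Hz). pose proof (pos_INR k). nra.
 } split.
 - assert ((1 - y) ^ n <= exp (- y) ^ n); [|lra]. apply pow_incr. split. lra. apply one_minus_upper.
 - specialize (Bern n (y ^ 2) ltac:(nra)). assert (F : exp (- x) * (1 - y ^ 2) ^ n <= (1 - y) ^ n). {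
  rewrite E, <- Rpow_mult_distr. apply pow_incr. pose proof (exp_pos (- y)). split. apply Rmult_le_pos; nra.
  replace (1 - y) with (exp (- y) * (exp y * (1 - y))) by (rewrite <- Rmult_assoc, <- exp_plus, Rplus_opp_l, exp_0; ring).
  le_mul_l. lra. pose proof (exp_ineq1_le y). nra. } pose proof (exp_pos (- x)).
  replace (x ^ 2 * exp (- x) / INR n) with (exp (- x) * (INR n * y ^ 2)) by (rewrite Ey; field; lra). nra.
Qed.

(** Shifting [t] by [ln n] turns the Beta integral over [u <= 1] into that of [(1 - u/n)^n] over
    [u <= n]. *)
Lemma gauss_int p n A : 1 <= Re p -> (0 < n)%nat -> 0 <= A ->
  Cmod (gauss_term p n - CI (fun t => RtoC ((1 - exp t / INR n) ^ n) * cexp (RtoC t * p)) (- A) (ln (INR n)))%C <= INR n * exp (Re p * ln (INR n)) * 2 ^ n * exp (- A).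
Proof.
 intros Hp Hn HA. assert (Hn0 : 1 <= INR n) by (change 1 with (INR 1); apply le_INR; lia). set (L := ln (INR n)).
 assert (HL : 0 <= L) by (unfold L; rewrite <- ln_1; apply Rcomplements.ln_le; lra).
 pose proof (beta_int n p Hp (A + L) ltac:(lra)) as B.
 set (f := fun t => (RtoC ((1 - exp t / INR n) ^ n) * cexp (RtoC t * p))%C) in *. assert (Rc : forall t, rcont f t). {
 intros t. apply rcont_mult. apply rcont_Rd. auto_derive; auto. apply rcont_line. }
 assert (E : CI f (- A) L = (cpowR (INR n) p * CI (fun t => RtoC ((1 - exp t) ^ n) * cexp (RtoC t * p))%C (- (A + L)) 0)%C).
 { pose proof (is_CI_subst f (fun t => t + L) (fun _ => 1) (- (A + L)) 0 (fun x _ => Rc _)) as S. cbv beta in S.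
 replace (- (A + L) + L) with (- A) in S by ring. rewrite Rplus_0_l in S. rewrite <- CI_scal. 2:{ apply rcont_on_all.
 intros t. apply rcont_mult. apply rcont_Rd. auto_derive; auto. apply rcont_line. } symmetry. apply is_CI_unique.
 eapply is_CI_ext. 2: apply S. 2:{ split. auto_derive; auto. apply continuous_const. } intros t _. unfold f.
 rewrite exp_plus. replace (exp t * exp L / INR n) with (exp t) by (unfold L; rewrite exp_ln by lra; field; lra).
 rewrite RtoC_plus, Cmult_plus_distr_r, cexp_plus. unfold cpowR. fold L.
 replace (p * RtoC L)%C with (RtoC L * p)%C by ring. ring. } rewrite E. unfold gauss_term.
 match type of B with Cmod (?a - ?b) <= _ => replace (Cdiv (Cmult (cpowR (INR n) p) (CN (fact n))) (cprod (S n) (fun k => Cplus p (CN k))) - cpowR (INR n) p * b)%C with (cpowR (INR n) p * (a - b))%C by (unfold Cdiv; ring) end.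
 rewrite Cmod_mult, Cmod_cpow. fold L. le_via (exp (Re p * L) * (2 ^ n * exp (- (A + L)))). fin.
 assert (exp (- (A + L)) <= INR n * exp (- A)). { le_via (1 * exp (- A)). rewrite Rmult_1_l; fin. fin. }
 replace (INR n * exp (Re p * L) * 2 ^ n * exp (- A)) with (exp (Re p * L) * (2 ^ n * (INR n * exp (- A)))) by ring; fin.
Qed.

(** Up to [u = n] the integrand [(1 - u/n)^n] differs from [e^(-u)] by at most [u^2 e^(-u) / n], and
    the tail beyond [n] is also [O(1/n)]. So Gauss' expressions converge to the integral,
    quantitatively. *)
Lemma Gamma_integral p : 1 <= Re p -> forall A B, - A <= B -> Cmod (/ GP p - CI (Gf p) (- A) B)%C <= exp ((Re p + 1) ^ 2) * (exp (- A) + exp (- B)).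
Proof.
 intros Hp. destruct (improper_CI (Gf p) (exp ((Re p + 1) ^ 2))) as [I HI]; try (intros; apply Gf_bound; auto).
 apply rcont_Gf. enough (E : (/ GP p)%C = I) by (rewrite E; auto). eapply Clim_unique. apply CGamma_lim.
 apply not_npint_pos. lra. set (K := exp ((Re p + 2 + 1) ^ 2)). set (K0 := exp ((Re p + 1) ^ 2)) in *.
 pose proof (exp_pos ((Re p + 2 + 1) ^ 2)) as KP. fold K in KP.
 assert (G : forall n, (0 < n)%nat -> Cmod (gauss_term p n - I) <= (K0 + 2 * K) * / INR n). { intros n Hn.
 assert (Hn0 : 1 <= INR n) by (change 1 with (INR 1); apply le_INR; lia). set (L := ln (INR n)).
 assert (HL : 0 <= L) by (unfold L; rewrite <- ln_1; apply Rcomplements.ln_le; lra).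
 assert (EL : exp (- L) = / INR n) by (rewrite exp_Ropp; unfold L; rewrite exp_ln by lra; auto).
 set (f := fun t => (RtoC ((1 - exp t / INR n) ^ n) * cexp (RtoC t * p))%C) in *. assert (Rc : forall t, rcont f t). {
 intros t. apply rcont_mult. apply rcont_Rd. auto_derive; auto. apply rcont_line. }
 assert (Rd : forall t, rcont (fun t => Gf p t - f t)%C t) by (intros; apply rcont_minus; [apply rcont_Gf|auto]).
 assert (D : forall t, t <= L -> Cmod (Gf p t - f t) <= / INR n * exp ((Re p + 2) * t - exp t)). { intros t Ht.
 unfold Gf, f.
 replace (RtoC (exp (- exp t)) * cexp (RtoC t * p) - RtoC ((1 - exp t / INR n) ^ n) * cexp (RtoC t * p))%C with (RtoC (exp (- exp t) - (1 - exp t / INR n) ^ n) * cexp (RtoC t * p))%C by (rewrite RtoC_minus; ring).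
 rewrite Cmod_mult, Cmod_line, Cmod_R. pose proof (exp_pos t). assert (exp t <= INR n). {
 rewrite <- (exp_ln (INR n)) by lra; fin. } pose proof (exp_gauss (exp t) n ltac:(lra) Hn). rewrite Rabs_pos_eq by lra.
 le_via ((exp t ^ 2 * exp (- exp t) / INR n) * exp (t * Re p)). fin. rewrite exp_pow_n. simpl (INR 2).
 replace ((Re p + 2) * t - exp t) with ((1 + 1) * t + - exp t + t * Re p) by ring. rewrite !exp_plus; fin. }
 assert (T : forall A, 0 <= A -> Cmod (gauss_term p n - I) <= INR n * exp (Re p * ln (INR n)) * 2 ^ n * exp (- A) + K0 * exp (- A) + (K0 + 2 * K) * / INR n).
 { intros A HA. pose proof (gauss_int p n A Hp Hn HA) as G1. fold L in G1. fold f in G1. specialize (HI A L ltac:(lra)).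
 rewrite EL in HI. assert (DD : Cmod (CI (fun t => Gf p t - f t)%C (- A) L) <= 2 * K * / INR n). {
 rewrite <- (CI_Chasles _ (- A) 0 L) by fin. le_trans Cmod_triangle.
 assert (B1 : Cmod (CI (fun t => Gf p t - f t)%C (- A) 0) <= (/ INR n * K) * exp 0). { apply CI_exp_le. lra. fin.
 intros t Ht. eapply Rle_trans. apply D; lra. rewrite Rmult_assoc. le_mul_l. pos. apply Gf_real_bound. lra. pos. }
 assert (B2 : Cmod (CI (fun t => Gf p t - f t)%C 0 L) <= (/ INR n * K) * exp (- 0)). { apply CI_exp_ge. lra. fin.
 intros t Ht. eapply Rle_trans. apply D; lra. rewrite Rmult_assoc. le_mul_l. pos. apply Gf_real_bound. lra. pos. }
 rewrite Ropp_0 in B2. rewrite exp_0 in *. lra. }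
 rewrite CI_minus in DD by (apply rcont_on_all; auto; intros; apply rcont_Gf). fold L.
 replace (gauss_term p n - I)%C with ((gauss_term p n - CI f (- A) L) - (I - CI (Gf p) (- A) L) - (CI (Gf p) (- A) L - CI f (- A) L))%C by ring.
 le_trans Cmod_minus_le. le_trans Rplus_le_compat_r. apply Cmod_minus_le. lra. } apply le_epsilon. intros e He.
 (* The lower end of integration goes to minus infinity with [n] fixed, which removes the factor
    [2^n]. *)
 set (K1 := INR n * exp (Re p * ln (INR n)) * 2 ^ n + K0) in *. assert (KP1 : 0 < K1). { unfold K1; fin. }
 destruct (exp_neg_small K1 e ltac:(lra) He) as [N HN]. specialize (HN N (le_n _)). specialize (T (INR N) (pos_INR N)).
 unfold K1 in *. lra. } intros e He.
 assert (KQ : 0 <= K0 + 2 * K) by (unfold K0; pose proof (exp_pos ((Re p + 1) ^ 2)); lra).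
 destruct (inv_INR_small (K0 + 2 * K) e KQ He) as [N HN]. exists (S N). intros n Hn. destruct n; [lia|]. le_trans G.
 lia. apply HN. lia.
Qed.

#[global] Hint Resolve rcont_line : cx.

(** * The theta series and the entire part of the completed zeta function *)

Lemma rlim_bound v a K : (forall n, Rabs (v n) <= K) -> rlim v a -> Rabs a <= K.
Proof.
 intros H Hl. apply le_epsilon. intros e He. destruct (Hl e He) as [N HN]. specialize (HN N (le_n _)). specialize (H N).
 replace a with (v N - (v N - a)) by ring. le_trans Rabs_triang. rewrite Rabs_Ropp. lra.
Qed.

Lemma wterm_mono c u j : c <= u -> wterm u j <= wterm c j.
Proof. intros H. unfold wterm. pose proof PI_RGT_0; fin. Qed.

(** Tails decrease in [u], so on [[c, oo)] they are controlled by the tail at [c]. The case [N = 0]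
    gives nonnegativity and monotonicity of [W]. *)
Lemma W_tail c u N : 0 < c -> c <= u -> 0 <= W u - rsum N (wterm u) <= W c - rsum N (wterm c).
Proof.
 intros Hc Hu. pose proof (W_lim c Hc) as Lc. pose proof (W_lim u ltac:(lra)) as Lu.
 split; apply le_epsilon; intros e He; destruct (Lc (e/2) ltac:(lra)) as [N1 H1]; destruct (Lu (e/2) ltac:(lra)) as [N2 H2]; set (M := (N + max N1 N2)%nat); specialize (H1 M ltac:(lia)); specialize (H2 M ltac:(lia)); apply Rabs_le_between in H1; apply Rabs_le_between in H2; rewrite (rsum_split N M (wterm u)) in H2 by lia; rewrite (rsum_split N M (wterm c)) in H1 by lia.
 - pose proof (rsum_pos (M - N) (fun j => wterm u (N + j)) ltac:(intros; left; apply wterm_pos)). lra.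
 -
  pose proof (rsum_le (M - N) (fun j => wterm u (N + j)) (fun j => wterm c (N + j)) ltac:(intros; apply wterm_mono; auto)).
  lra.
Qed.

Lemma W_nonneg u : 0 < u -> 0 <= W u.
Proof. intros H. pose proof (W_tail u u 0 H (Rle_refl _)). simpl in H0. lra. Qed.

Lemma W_le_exp u : 1 <= u -> W u <= W 1 * exp (- (u - 1)).
Proof.
 intros Hu. apply le_epsilon. intros e He. destruct (W_lim u ltac:(lra) e He) as [N HN]. specialize (HN N (le_n _)).
 apply Rabs_le_between in HN. pose proof (W_tail 1 1 N Rlt_0_1 (Rle_refl _)) as T.
 assert (rsum N (wterm u) <= exp (- (u - 1)) * rsum N (wterm 1)). { rewrite <- rsum_scal. apply rsum_le. intros j _.
 unfold wterm. rewrite <- exp_plus. apply exp_le. pose proof PI2_3_2. rewrite S_INR. pose proof (pos_INR j).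
 assert (1 <= PI * (INR j + 1) ^ 2) by nra. nra. } pose proof (exp_pos (- (u - 1))). nra.
Qed.

(** Terms are differenced individually: [y e^(-cy/2) <= 2/c] absorbs the derivative and leaves the
    convergent series at [c/2]. *)
Lemma W_lip c u v : 0 < c -> c <= u -> c <= v -> Rabs (W u - W v) <= 2 / c * W (c / 2) * Rabs (u - v).
Proof.
 intros Hc Hu Hv.
 assert (G : forall u v j, c <= u -> u <= v -> 0 <= wterm u j - wterm v j <= 2 / c * wterm (c / 2) j * (v - u)). {
 clear u v Hu Hv. intros u v j Hu Hv. split. pose proof (wterm_mono u v j Hv). lra. unfold wterm.
 set (y := PI * INR (S j) ^ 2). assert (Hy : 0 <= y). { unfold y. pose proof PI_RGT_0; fin. }
 assert (exp (- (y * v)) = exp (- (y * u)) * exp (- (y * (v - u)))) as -> by (rewrite <- exp_plus; f_equal; ring).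
 pose proof (one_minus_upper (y * (v - u))). pose proof (exp_pos (- (y * u))).
 assert (exp (- (y * u)) <= exp (- (y * (c / 2))) * exp (- (y * (c / 2)))) by (rewrite <- exp_plus; apply exp_le; nra).
 assert (y * exp (- (y * (c / 2))) <= 2 / c). { pose proof (exp_ineq1_le (y * (c / 2))). rewrite exp_Ropp.
 pose proof (exp_pos (y * (c / 2))). apply Rmult_le_reg_r with (exp (y * (c / 2)) * (c / 2)). nra.
 replace (y * / exp (y * (c / 2)) * (exp (y * (c / 2)) * (c / 2))) with (y * (c / 2)) by (field; lra).
 replace (2 / c * (exp (y * (c / 2)) * (c / 2))) with (exp (y * (c / 2))) by (field; lra). lra. }
 le_via (exp (- (y * u)) * (y * (v - u))). nra.
 le_via ((exp (- (y * (c / 2))) * exp (- (y * (c / 2)))) * (y * (v - u))). fin.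
 replace (exp (- (y * (c / 2))) * exp (- (y * (c / 2))) * (y * (v - u))) with ((y * exp (- (y * (c / 2)))) * (exp (- (y * (c / 2))) * (v - u))) by ring.
 rewrite (Rmult_assoc (2 / c)); fin. }
 assert (P : forall u v, c <= u -> u <= v -> Rabs (W u - W v) <= 2 / c * W (c / 2) * (v - u)). { intros a b La Lb.
 apply (rlim_bound (fun n => rsum n (wterm a) + - rsum n (wterm b))). 2:{ apply rlim_plus. apply W_lim; lra.
 apply rlim_opp, W_lim; lra. } intros n.
 replace (rsum n (wterm a) + - rsum n (wterm b)) with (rsum n (fun j => wterm a j - wterm b j)). 2:{
 rewrite <- (Rmult_1_l (rsum n (wterm b))), Ropp_mult_distr_l, <- rsum_scal, <- rsum_plus. apply rsum_ext. intros; ring.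
 } le_trans rsum_Rabs. le_via (2 / c * (b - a) * rsum n (wterm (c / 2))). rewrite <- rsum_scal. apply rsum_le.
 intros j _. specialize (G a b j La Lb). rewrite Rabs_pos_eq by lra. lra.
 pose proof (W_tail (c / 2) (c / 2) n ltac:(lra) (Rle_refl _)).
 replace (2 / c * W (c / 2) * (b - a)) with (2 / c * (b - a) * W (c / 2)) by ring; fin. } destruct (Rle_dec u v).
 rewrite (Rabs_left1 (u - v)) by lra. replace (- (u - v)) with (v - u) by ring. auto.
 rewrite Rabs_minus_sym, (Rabs_pos_eq (u - v)) by lra. apply P; lra.
Qed.

Lemma rcont_W u : 0 < u -> rcont (fun u => RtoC (W u)) u.
Proof.
 intros Hu e He. set (K := 2 / (u / 2) * W (u / 2 / 2)). assert (HK : 0 <= K). { apply Rmult_le_pos. pos.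
 apply W_nonneg; lra. } exists (Rmin (u / 2) (e / (K + 1))). split. pos. intros v Hv.
 pose proof (Rmin_l (u / 2) (e / (K + 1))). pose proof (Rmin_r (u / 2) (e / (K + 1))).
 assert (Rabs (v - u) < u / 2) by lra. apply Rabs_lt_between in H1. rewrite <- RtoC_minus, Cmod_R. eapply Rle_lt_trans.
 apply (W_lip (u / 2)); lra. fold K. apply Rle_lt_trans with ((K + 1) * Rabs (v - u)). fin.
 apply Rlt_le_trans with ((K + 1) * (e / (K + 1))). nra. right; field; lra.
Qed.

Lemma rcont_gW t : rcont (fun t => RtoC (W (exp t))) t.
Proof.
 apply (rcont_comp_R (fun u => RtoC (W u)) exp). apply rcont_W, exp_pos. apply (ex_derive_continuous exp).
 auto_derive; auto.
Qed.

Definition cW : R := W 1 * exp 1.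
Lemma cW_nonneg : 0 <= cW. Proof. apply Rmult_le_pos. apply W_nonneg; lra. pos. Qed.

Lemma gW_decay k t : 0 <= t -> W (exp t) * exp (k * t) <= cW * exp ((k + 1) ^ 2) * exp (- t).
Proof.
 intros Ht. assert (1 <= exp t) by pos. pose proof (W_le_exp (exp t) H) as H1. pose proof (W_nonneg 1 Rlt_0_1).
 le_via (W 1 * exp (- (exp t - 1)) * exp (k * t)). fin.
 replace (W 1 * exp (- (exp t - 1)) * exp (k * t)) with (W 1 * exp 1 * exp (k * t - exp t)).
 rewrite (Rmult_assoc (W 1 * exp 1)). le_mul_l. pos. apply exp_decay; auto. rewrite !Rmult_assoc, <- !exp_plus.
 do 2 f_equal. ring.
Qed.

(** Differentiation under the integral sign, with the quadratic remainder of the exponential as the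
    error. *)
Lemma param_entire G T : 0 <= T -> (forall t, rcont G t) -> Entire (fun s => CI (fun t => G t * cexp (RtoC t * s))%C 0 T).
Proof.
 intros HT HG z. exists (CI (fun t => G t * cexp (RtoC t * z) * RtoC t)%C 0 T).
 assert (R1 : forall s t, rcont (fun t => G t * cexp (RtoC t * s))%C t) by fin.
 assert (R2 : forall t, rcont (fun t => G t * cexp (RtoC t * z) * RtoC t)%C t) by (intros; apply rcont_mult; auto; eapply rdiff_rcont, rdiff_id).
 destruct (rcont_bounded (fun t => G t * cexp (RtoC t * z))%C 0 T HT) as [M [M0 HM]]; auto.
 set (Q := M * T ^ 2 * exp T * T). assert (HQ : 0 <= Q). { unfold Q; fin. } intros e He. exists (Rmin 1 (e / (Q + 1))).
 split. pos. intros w Hw. pose proof (Rmin_l 1 (e / (Q + 1))). pose proof (Rmin_r 1 (e / (Q + 1))).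
 set (h := (w - z)%C) in *. pose proof (Cmod_ge_0 h).
 assert (E : (CI (fun t => G t * cexp (RtoC t * w)) 0 T - CI (fun t => G t * cexp (RtoC t * z)) 0 T - CI (fun t => G t * cexp (RtoC t * z) * RtoC t) 0 T * h)%C = CI (fun t => (G t * cexp (RtoC t * z)) * (cexp (RtoC t * h) - 1 - RtoC t * h))%C 0 T).
 { rewrite (Cmult_comm _ h), <- (CI_scal h) by fin. rewrite <- !CI_minus; try (apply rcont_on_all; intros; auto).
 - apply CI_ext. intros t _. replace (RtoC t * w)%C with (RtoC t * z + RtoC t * h)%C by (unfold h; ring).
  rewrite cexp_plus. ring.
 - fin.
 - fin. } rewrite E. eapply Rle_trans. apply (CI_bound _ (M * (T ^ 2 * Cmod h ^ 2 * exp T))); auto.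
 - apply rcont_on_all. intros t. apply rcont_mult; auto. apply rcont_minus. fin. apply rcont_mult.
  eapply rdiff_rcont, rdiff_id. fin.
 - intros t Ht. rewrite Cmod_mult. apply Rmult_le_compat; try pos. auto. le_trans cexp_m1z_bound.
  rewrite Cmod_mult, Cmod_R, Rabs_pos_eq by lra. rewrite Rpow_mult_distr. apply Rmult_le_compat. pos. pos. fin.
  apply exp_le. nra.
 - rewrite Rminus_0_r. replace (M * (T ^ 2 * Cmod h ^ 2 * exp T) * T) with (Q * Cmod h * Cmod h) by (unfold Q; ring).
  le_mul_r; auto. le_via ((Q + 1) * (e / (Q + 1))). fin. right; field; lra.
Qed.

Lemma improper_CI1 f K : (forall t, rcont f t) -> 0 <= K -> (forall t, 0 <= t -> Cmod (f t) <= K * exp (- t)) ->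
  exists I, forall T, 0 <= T -> Cmod (I - CI f 0 T) <= K * exp (- T).
Proof.
 intros Hc HK H. assert (D : forall T T', 0 <= T <= T' -> Cmod (CI f 0 T' - CI f 0 T) <= K * exp (- T)). {
 intros T T' L. rewrite <- (CI_Chasles f 0 T T') by fin.
 replace (CI f 0 T + CI f T T' - CI f 0 T)%C with (CI f T T') by ring. apply CI_exp_ge; try lra. fin.
 intros; apply H; lra. } destruct (limit_rate (fun n => CI f 0 (INR n)) (fun n => K * exp (- INR n))) as [I HI]. {
 intros n m L. apply D. split; fin. } { intros e He. apply exp_neg_small; auto. } exists I. intros T HT.
 apply le_epsilon. intros e He. destruct (exp_neg_small K e HK He) as [N HN]. destruct (nfloor_ex T HT) as [M HM].
 set (n := max N (S M)). specialize (HN n ltac:(lia)). specialize (HI n). assert (T <= INR n). { le_via (INR (S M)).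
 rewrite S_INR; lra. fin. }
 replace (I - CI f 0 T)%C with ((CI f 0 (INR n) - CI f 0 T) + (I - CI f 0 (INR n)))%C by ring; fin.
Qed.

(** Riemann's integrand over [u >= 1] with [u = e^t], already folded so that [s] and [1 - s] enter
    symmetrically. *)
Definition Fi (s : C) (t : R) : C := (RtoC (W (exp t)) * (cexp (RtoC t * (s / 2)) + cexp (RtoC t * ((1 - s) / 2))))%C.
Definition KF (X : R) : R := 2 * cW * exp ((2 + X) ^ 2).
(** The integral is chosen through its quantitative tail bound, so that uniform convergence on discs
    is immediate. *)
Definition xiF (s : C) : C := epsilon (inhabits (RtoC 0)) (fun I => forall T, 0 <= T -> Cmod (I - CI (Fi s) 0 T) <= KF (Cmod s) * exp (- T)).

Lemma rcont_Fi s t : rcont (Fi s) t.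
Proof. apply rcont_mult. apply rcont_gW. fin. Qed.
Lemma KF_nonneg X : 0 <= KF X.
Proof. unfold KF. pose proof cW_nonneg; fin. Qed.
Lemma Re_half s : Re (s / 2)%C = Re s / 2.
Proof. unfold Re; simpl. field. Qed.

Lemma Fi_bound s t : 0 <= t -> Cmod (Fi s t) <= KF (Cmod s) * exp (- t).
Proof.
 intros Ht. unfold Fi. rewrite Cmod_mult, Cmod_R, Rabs_pos_eq by (apply W_nonneg, exp_pos).
 pose proof (W_nonneg (exp t) (exp_pos t)). set (k := (1 + Cmod s) / 2). pose proof (Cmod_ge_0 s).
 assert (Cmod (cexp (RtoC t * (s / 2)) + cexp (RtoC t * ((1 - s) / 2))) <= 2 * exp (k * t)). { le_trans Cmod_triangle.
 rewrite !Cmod_line, !Re_half. rewrite re_minus. pose proof (re_le_Cmod s) as R1. apply Rabs_le_between in R1.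
 simpl (Re 1). assert (exp (t * (Re s / 2)) <= exp (k * t)) by (apply exp_le; unfold k; nra).
 assert (exp (t * ((1 - Re s) / 2)) <= exp (k * t)) by (apply exp_le; unfold k; nra). lra. }
 le_via (2 * (W (exp t) * exp (k * t))). nra. unfold KF. pose proof (gW_decay k t Ht). pose proof cW_nonneg.
 assert (exp ((k + 1) ^ 2) <= exp ((2 + Cmod s) ^ 2)) by (apply exp_le; unfold k; nra).
 replace (2 * cW * exp ((2 + Cmod s) ^ 2) * exp (- t)) with (2 * (cW * exp ((2 + Cmod s) ^ 2) * exp (- t))) by ring.
 le_mul_l. lra. eapply Rle_trans; fin.
Qed.

Lemma xiF_spec s T : 0 <= T -> Cmod (xiF s - CI (Fi s) 0 T) <= KF (Cmod s) * exp (- T).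
Proof.
 apply (epsilon_spec (inhabits (RtoC 0)) (fun I => forall T, 0 <= T -> Cmod (I - CI (Fi s) 0 T) <= KF (Cmod s) * exp (- T))); auto.
 apply improper_CI1. apply rcont_Fi. apply KF_nonneg. apply Fi_bound.
Qed.

Lemma xiF_unique s I K : (forall T, 0 <= T -> Cmod (I - CI (Fi s) 0 T) <= K * exp (- T)) -> I = xiF s.
Proof.
 intros H. apply Ceq_small. intros e He. set (Q := Rmax 0 K + KF (Cmod s) + 1). pose proof (Rmax_l 0 K).
 pose proof (Rmax_r 0 K). pose proof (KF_nonneg (Cmod s)).
 destruct (exp_neg_small Q e ltac:(unfold Q; lra) He) as [N HN]. specialize (HN N (le_n _)).
 specialize (H (INR N) (pos_INR N)). pose proof (xiF_spec s (INR N) (pos_INR N)).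
 replace (I - xiF s)%C with ((I - CI (Fi s) 0 (INR N)) - (xiF s - CI (Fi s) 0 (INR N)))%C by ring.
 le_trans Cmod_minus_le. pose proof (exp_pos (- INR N)). unfold Q in HN. nra.
Qed.

Lemma xiF_bound s : Cmod (xiF s) <= KF (Cmod s).
Proof.
 pose proof (xiF_spec s 0 (Rle_refl _)) as H. rewrite CI_point, Ropp_0, exp_0 in H.
 replace (xiF s) with (xiF s - 0)%C by ring. lra.
Qed.

Lemma xiF_sym s : xiF (1 - s)%C = xiF s.
Proof.
 apply (xiF_unique s (xiF (1 - s)%C) (KF (Cmod (1 - s)%C))). intros T HT. pose proof (xiF_spec (1 - s)%C T HT) as H.
 rewrite (CI_ext (Fi s) (Fi (1 - s)%C)); auto. intros t _. unfold Fi. replace (1 - (1 - s))%C with s by ring. ring.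
Qed.
Lemma Cconj_half s : (Cconj s / 2)%C = Cconj (s / 2)%C.
Proof. apply C_ext; simpl; field. Qed.
Lemma xiF_conj s : xiF (Cconj s) = Cconj (xiF s).
Proof.
 symmetry. apply (xiF_unique _ _ (KF (Cmod s))). intros T HT. pose proof (xiF_spec s T HT) as H.
 replace (CI (Fi (Cconj s)) 0 T) with (Cconj (CI (Fi s) 0 T)). rewrite <- Cminus_conj, Cmod_conj; auto. symmetry.
 apply is_CI_unique. eapply is_CI_ext. 2: apply is_CI_conj, is_CI_cont, rcont_on_all, rcont_Fi. intros t _. unfold Fi.
 rewrite Cmult_conj, Cplus_conj, <- !cexp_conj, !Cmult_conj.
 replace (1 - Cconj s)%C with (Cconj (1 - s)%C) by (rewrite Cminus_conj; f_equal; apply C_ext; simpl; ring).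
 rewrite !Cconj_half. assert (RC : forall x, Cconj (RtoC x) = RtoC x) by (intros; apply C_ext; simpl; ring). congruence.
Qed.

Lemma xiF_entire : Entire xiF.
Proof.
 apply (unif_limit_entire (fun n s => CI (Fi s) 0 (INR n))).
 - intros n. pose proof (param_entire (fun t => RtoC (W (exp t))) (INR n) (pos_INR n) rcont_gW) as P.
  apply (Entire_ext (fun s => CI (fun t => RtoC (W (exp t)) * cexp (RtoC t * (s / 2))) 0 (INR n) + CI (fun t => RtoC (W (exp t)) * cexp (RtoC t * ((1 - s) / 2))) 0 (INR n))%C).
  { intros s. rewrite <- CI_plus by (apply rcont_on_all; intros; apply rcont_mult; [apply rcont_gW|apply rcont_line]).
  apply CI_ext. intros t _. unfold Fi. ring. } apply Entire_plus. apply (Entire_comp _ (fun s => s / 2)%C P); fin.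
  apply (Entire_comp _ (fun s => (1 - s) / 2)%C P); fin.
 - intros X e HX He. pose proof (KF_nonneg X). destruct (exp_neg_small (KF X) e H He) as [N HN]. exists N.
  intros n z Hn Hz. rewrite Cmod_minus_sym. eapply Rle_trans. apply xiF_spec; fin. specialize (HN n Hn).
  assert (KF (Cmod z) <= KF X). { unfold KF. pose proof cW_nonneg; fin. } pose proof (exp_pos (- INR n)). nra.
Qed.

Lemma sum_n_csum (f : nat -> C) n : sum_n (G := C_NormedModule) f n = csum (S n) f.
Proof. induction n. rewrite sum_O. symmetry; apply Cplus_0_l. rewrite sum_Sn, IHn; fin. Qed.
Lemma is_series_cser (f : nat -> C) l : is_series (K := C_AbsRing) (V := C_NormedModule) f l <-> cser f l.
Proof.
 rewrite (filterlim_Clim (sum_n (G := C_NormedModule) f) l). split; intros H e He; destruct (H e He) as [N HN].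
 - exists (S N). intros n Hn. destruct n; [lia|]. rewrite <- sum_n_csum. apply HN. lia.
 - exists N. intros n Hn. rewrite sum_n_csum; fin.
Qed.

(** Truncated Mellin integral of a single theta term; without truncation it is
    [(PI (n+1)^2)^(-p) Gamma(p)]. *)
Definition zI (p : C) (T : R) (n : nat) : C := CI (fun t => RtoC (wterm (exp t) n) * cexp (RtoC t * p))%C (- T) T.
Definition yn (n : nat) : R := PI * INR (S n) ^ 2.

Lemma yn_ge n : INR (S n) ^ 2 <= yn n /\ 1 <= yn n.
Proof. unfold yn. pose proof PI2_3_2. rewrite S_INR. pose proof (pos_INR n). nra. Qed.

Lemma rcont_wterm n t : rcont (fun t => RtoC (wterm (exp t) n)) t.
Proof. apply (rcont_Rd (fun t => exp (- (PI * INR (S n) ^ 2 * exp t)))). auto_derive; auto. Qed.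

Lemma zI_subst p T n : zI p T n = (cpowR (yn n) (- p) * CI (Gf p) (- (T - ln (yn n))) (T + ln (yn n)))%C.
Proof.
 destruct (yn_ge n) as [_ Hy]. set (c := ln (yn n)).
 pose proof (is_CI_subst (Gf p) (fun t => t + c) (fun _ => 1) (- T) T (fun x _ => rcont_Gf p _)) as S. cbv beta in S.
 replace (- T + c) with (- (T - c)) in S by ring. apply is_CI_unique. eapply is_CI_ext. 2: apply is_CI_scal, S. 2:{
 split. auto_derive; auto. apply continuous_const. } intros t _. unfold Gf. rewrite exp_plus.
 replace (exp c) with (yn n) by (unfold c; rewrite exp_ln; auto; lra). rewrite RtoC_plus, Cmult_plus_distr_r, cexp_plus.
 unfold cpowR. fold c. replace (- p * RtoC c)%C with (- (RtoC c * p))%C by ring.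
 replace (cexp (- (RtoC c * p)) * (RtoC 1 * (RtoC (exp (- (exp t * yn n))) * (cexp (RtoC t * p) * cexp (RtoC c * p)))))%C with ((cexp (- (RtoC c * p)) * cexp (RtoC c * p)) * (RtoC (exp (- (exp t * yn n))) * cexp (RtoC t * p)))%C by ring.
 rewrite cexp_opp. unfold wterm. fold (yn n). rewrite (Rmult_comm (exp t)). ring.
Qed.

(** The substitution shifts the window by [ln (yn n)], which may cost a factor [yn n] in the tail.
    For [Re p >= 2] the power in front still leaves [1 / yn n], summable over [n]. *)
Lemma zI_limit p T n : 2 <= Re p -> 0 <= T ->
  Cmod (cpowR (yn n) (- p) * / GP p - zI p T n)%C <= 2 * exp ((Re p + 1) ^ 2) * exp (- T) * / INR (S n) ^ 2.
Proof.
 intros Hp HT. destruct (yn_ge n) as [Hy1 Hy]. set (c := ln (yn n)).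
 assert (Hc : 0 <= c) by (unfold c; rewrite <- ln_1; apply Rcomplements.ln_le; lra). rewrite zI_subst. fold c.
 replace (cpowR (yn n) (- p) * / GP p - cpowR (yn n) (- p) * CI (Gf p) (- (T - c)) (T + c))%C with (cpowR (yn n) (- p) * (/ GP p - CI (Gf p) (- (T - c)) (T + c)))%C by ring.
 rewrite Cmod_mult, Cmod_cpow. set (K := exp ((Re p + 1) ^ 2)). pose proof (exp_pos ((Re p + 1) ^ 2)) as HK.
 le_via (exp (Re (- p)%C * c) * (K * (exp (- (T - c)) + exp (- (T + c))))). { le_mul_l. pos. apply Gamma_integral; lra.
 } rewrite re_opp. replace (- (T - c)) with (- T + c) by ring. replace (- (T + c)) with (- T + - c) by ring.
 rewrite !exp_plus. assert (E1 : exp (- Re p * c) * exp c <= exp (- c)) by (rewrite <- exp_plus; apply exp_le; nra).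
 assert (E2 : exp (- Re p * c) * exp (- c) <= exp (- c)) by (rewrite <- exp_plus; apply exp_le; nra).
 assert (E3 : exp (- c) <= / INR (S n) ^ 2). { rewrite exp_Ropp. unfold c. rewrite exp_ln by lra; fin. }
 pose proof (exp_pos (- T)). assert (0 < K * exp (- T)) by (pos). nra.
Qed.

Lemma zI_sum p T N : csum N (zI p T) = CI (fun t => RtoC (rsum N (wterm (exp t))) * cexp (RtoC t * p))%C (- T) T.
Proof.
 symmetry. apply is_CI_unique. induction N.
 - eapply is_CI_ext. 2: eapply is_CI_eq. 2: apply (is_CI_const (RtoC 0)). intros t _. simpl. ring. simpl. ring.
 - eapply is_CI_ext. 2: apply is_CI_plus. 2: exact IHN.
  2: apply is_CI_cont, rcont_on_all; intros; apply rcont_mult; [apply (rcont_wterm N)|apply rcont_line]. intros t _.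
  rewrite rsum_S, RtoC_plus. ring.
Qed.

(** The theta identity folds the negative half-line onto the positive one. The elementary terms it
    creates integrate to the fractions in [s] and [1 - s]. *)
Lemma theta_split s T : 0 <= T -> s <> RtoC 0 -> s <> RtoC 1 ->
  CI (fun t => RtoC (W (exp t)) * cexp (RtoC t * (s / 2)))%C (- T) T =
  (CI (Fi s) 0 T + (cexp (RtoC T * ((1 - s) / 2)) - 1) / (1 - s) - (1 - cexp (- (RtoC T * (s / 2)))) / s)%C.
Proof.
 intros HT H0 H1. assert (H1' : (1 - s)%C <> RtoC 0). { intros E. apply H1. replace s with (1 - (1 - s))%C by ring.
 rewrite E. ring. } set (f := fun t => (RtoC (W (exp t)) * cexp (RtoC t * (s / 2)))%C).
 assert (Rf : forall t, rcont f t) by (intros; apply rcont_mult; [apply rcont_gW|apply rcont_line]).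
 rewrite <- (CI_Chasles f (- T) 0 T) by fin. assert (S : is_CI (fun t => RtoC (-1) * f (Ropp t))%C 0 T (CI f 0 (- T))).
 { pose proof (is_CI_subst f (fun t => - t) (fun _ => -1) 0 T (fun x _ => Rf _)) as S. cbv beta in S.
 rewrite Ropp_0 in S. apply S. split. auto_derive; auto. apply continuous_const. }
 assert (E0 : CI f (- T) 0 = CI (fun t => f (- t)) 0 T). { symmetry. apply is_CI_unique. eapply is_CI_ext.
 2: eapply is_CI_eq. 2: apply (is_CI_scal (-1)), S. intros t _. simpl. ring.
 assert (CI f (- T) 0 + CI f 0 (- T) = CI f (- T) (- T))%C. { symmetry. apply is_CI_unique.
 apply is_CI_Chasles with 0; apply is_CI_cont, rcont_on_all; auto. } rewrite CI_point in H.
 replace (CI f (- T) 0) with (CI f (- T) 0 + CI f 0 (- T) - CI f 0 (- T))%C by ring. rewrite H. ring. } rewrite E0.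
 assert (Th : forall t, f (- t) = (RtoC (W (exp t)) * cexp (RtoC t * ((1 - s) / 2)) + / 2 * (cexp (RtoC t * ((1 - s) / 2)) - cexp (RtoC t * - (s / 2))))%C).
 { intros t. unfold f. pose proof (theta (exp t) (exp_pos t)) as Q. rewrite <- exp_Ropp in Q.
 assert (Es : sqrt (exp t) = exp (t / 2)). {
 replace (exp t) with (exp (t / 2) * exp (t / 2)) by (rewrite <- exp_plus; f_equal; field). apply sqrt_square; fin. }
 rewrite Es in Q. assert (Q' : W (exp (- t)) = ((1 + 2 * W (exp t)) * exp (t / 2) - 1) / 2) by lra. rewrite Q'.
 replace (RtoC t * ((1 - s) / 2))%C with (RtoC (t / 2) + RtoC t * - (s / 2))%C by (rewrite RtoC_div by lra; field; intros X; apply (f_equal Re) in X; simpl in X; lra).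
 rewrite cexp_plus, cexp_R. replace (RtoC (- t) * (s / 2))%C with (RtoC t * - (s / 2))%C by (rewrite RtoC_opp; ring).
 rewrite RtoC_div, RtoC_minus, RtoC_mult, RtoC_plus, RtoC_mult by lra. field. }
 assert (I1 : is_CI (fun t => / 2 * cexp (RtoC t * ((1 - s) / 2)))%C 0 T ((cexp (RtoC T * ((1 - s) / 2)) - 1) / (1 - s))%C).
 { eapply is_CI_eq. apply (is_CI_FTC (fun t => / (1 - s) * cexp (RtoC t * ((1 - s) / 2)))%C). intros t _.
 eapply rdiff_eq. apply rdiff_scal, rdiff_cexp_line. field; auto. fin.
 replace (0 * ((1 - s) / 2))%C with (RtoC 0) by ring. rewrite cexp_0. field. auto. }
 assert (I2 : is_CI (fun t => / 2 * cexp (RtoC t * - (s / 2)))%C 0 T ((1 - cexp (- (RtoC T * (s / 2)))) / s)%C). {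
 eapply is_CI_eq. apply (is_CI_FTC (fun t => - / s * cexp (RtoC t * - (s / 2)))%C). intros t _. eapply rdiff_eq.
 apply rdiff_scal, rdiff_cexp_line. field; auto. fin. replace (0 * - (s / 2))%C with (RtoC 0) by ring. rewrite cexp_0.
 replace (RtoC T * - (s / 2))%C with (- (RtoC T * (s / 2)))%C by ring. field. auto. }
 assert (I3 : is_CI (Fi s) 0 T (CI f 0 T + CI (fun t => RtoC (W (exp t)) * cexp (RtoC t * ((1 - s) / 2))) 0 T)%C). {
 eapply is_CI_ext. 2: apply is_CI_plus; apply is_CI_cont, rcont_on_all. 2: exact Rf.
 2: intros; apply rcont_mult; [apply rcont_gW|apply rcont_line]. intros t _. unfold Fi, f. ring. }
 rewrite (is_CI_unique _ _ _ _ I3).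
 rewrite (is_CI_unique (fun t => f (- t)) 0 T (CI (fun t => RtoC (W (exp t)) * cexp (RtoC t * ((1 - s) / 2))) 0 T + ((cexp (RtoC T * ((1 - s) / 2)) - 1) / (1 - s) - (1 - cexp (- (RtoC T * (s / 2)))) / s))%C).
 { ring. } eapply is_CI_ext. 2: apply is_CI_plus. 3: apply is_CI_minus; fin.
 2: apply is_CI_cont, rcont_on_all; intros; apply rcont_mult; [apply rcont_gW|apply rcont_line]. intros t _. rewrite Th.
 ring.
Qed.

(** The completed zeta function, as continued by its two polar terms. *)
Definition zV (s : C) : C := (xiF s + 1 / (s - 1) - 1 / s)%C.

Lemma inv_le_1 x : 1 <= x -> / x <= 1.
Proof. intros H. fin. Qed.

(** On [[-T, T]] the theta series converges uniformly, because [e^t] stays above [e^(-T)]. So [T] is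
    fixed first, and three errors remain: truncation of each term, of the series, and of the folded
    integral. *)
Lemma zeta_series s : 4 < Re s -> cser (fun n => cpowR (yn n) (- (s / 2)) * / GP (s / 2))%C (zV s).
Proof.
 intros Hs. set (p := (s / 2)%C). assert (Hp : 2 <= Re p) by (unfold p; rewrite Re_half; lra).
 assert (S0 : s <> RtoC 0) by (intros ->; simpl in Hs; lra). assert (S1 : s <> RtoC 1) by (intros ->; simpl in Hs; lra).
 assert (M0 : 1 <= Cmod s) by (pose proof (Re_le_Cmod s); lra). assert (M1 : 1 <= Cmod (1 - s)%C). {
 rewrite Cmod_minus_sym. pose proof (Re_le_Cmod (s - 1)%C). rewrite re_minus in H. simpl (Re 1) in H. lra. }
 assert (N1 : (1 - s)%C <> RtoC 0) by (intros E; rewrite E, Cmod_0 in M1; lra).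
 set (K := 4 * exp ((Re p + 1) ^ 2) + KF (Cmod s) + 2). assert (HK : 0 < K). { unfold K.
 pose proof (exp_pos ((Re p + 1) ^ 2)). pose proof (KF_nonneg (Cmod s)). lra. } intros e He.
 destruct (exp_neg_small K (e / 2) ltac:(lra) ltac:(lra)) as [T' HT]. specialize (HT T' (le_n _)).
 set (T := INR T') in *. assert (T0 : 0 <= T) by pos. set (c := exp (- T)) in *. assert (c0 : 0 < c) by pos.
 set (Q := 2 * T * exp (T * Re p) + 1). assert (HQ : 0 < Q). { unfold Q; fin. }
 destruct (W_lim c c0 (e / 2 / Q)) as [N HN]. pos. exists N. intros n Hn. specialize (HN n Hn).
 assert (A1 : Cmod (csum n (fun n => cpowR (yn n) (- p) * / GP p) - csum n (zI p T))%C <= 4 * exp ((Re p + 1) ^ 2) * c).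
 {
 replace (csum n (fun n => cpowR (yn n) (- p) * / GP p) - csum n (zI p T))%C with (csum n (fun n => cpowR (yn n) (- p) * / GP p - zI p T n))%C.
 2:{ clear. induction n; simpl. ring. rewrite IHn. ring. } le_trans csum_Cmod.
 le_via (2 * exp ((Re p + 1) ^ 2) * c * rsum n (fun j => / INR (S j) ^ 2)). rewrite <- rsum_scal. apply rsum_le.
 intros j _. apply zI_limit; auto. pose proof (inv_sq_sum n). pose proof (exp_pos ((Re p + 1) ^ 2)).
 assert (0 < 2 * exp ((Re p + 1) ^ 2) * c) by (pos). nra. }
 assert (A2 : Cmod (csum n (zI p T) - CI (fun t => RtoC (W (exp t)) * cexp (RtoC t * p)) (- T) T)%C <= e / 2). {
 assert (R1 : forall t, rcont (fun t => RtoC (W (exp t)) * cexp (RtoC t * p))%C t) by (intros; apply rcont_mult; [apply rcont_gW|apply rcont_line]).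
 assert (R2 : forall t, rcont (fun t => RtoC (rsum n (wterm (exp t))) * cexp (RtoC t * p))%C t). { intros t.
 apply rcont_mult; [|apply rcont_line]. clear. induction n. apply (rcont_const (RtoC 0)). eapply rcont_ext.
 2: apply rcont_plus; [exact IHn|apply (rcont_wterm n)]. intros u. simpl. rewrite RtoC_plus. auto. }
 rewrite zI_sum, <- CI_minus by fin. le_trans (CI_bound _ (e / 2 / Q * exp (T * Re p))). lra. fin.
 - intros t Ht.
  replace (RtoC (rsum n (wterm (exp t))) * cexp (RtoC t * p) - RtoC (W (exp t)) * cexp (RtoC t * p))%C with (RtoC (rsum n (wterm (exp t)) - W (exp t)) * cexp (RtoC t * p))%C by (rewrite RtoC_minus; ring).
  rewrite Cmod_mult, Cmod_line, Cmod_R. apply Rmult_le_compat; try apply Rabs_pos. pos.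
  assert (c <= exp t) by (apply exp_le; lra). pose proof (W_tail c (exp t) n c0 H). apply Rabs_le_between in HN.
  apply Rabs_le. lra. fin.
 - le_via (e / 2 / Q * Q). 2: right; field; lra. rewrite Rmult_assoc. le_mul_l. pos. unfold Q. lra. }
  assert (A3 : Cmod (CI (fun t => RtoC (W (exp t)) * cexp (RtoC t * p)) (- T) T - zV s)%C <= (KF (Cmod s) + 2) * c). {
  unfold p. rewrite theta_split by auto. unfold zV. fold p. pose proof (xiF_spec s T T0) as FS. fold c in FS.
  replace (CI (Fi s) 0 T + (cexp (RtoC T * ((1 - s) / 2)) - 1) / (1 - s) - (1 - cexp (- (RtoC T * p))) / s - (xiF s + 1 / (s - 1) - 1 / s))%C with (- (xiF s - CI (Fi s) 0 T) + (cexp (RtoC T * ((1 - s) / 2)) / (1 - s) + cexp (- (RtoC T * p)) / s))%C.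
  2:{
  assert ((s - 1)%C <> RtoC 0) by (intros E; apply N1; replace (1 - s)%C with (- (s - 1))%C by ring; rewrite E; ring).
  field. auto. } assert (B1 : Cmod (cexp (RtoC T * ((1 - s) / 2)) / (1 - s))%C <= c). { unfold Cdiv at 1.
  rewrite Cmod_mult, Cmod_inv by auto. rewrite Cmod_line, Re_half. unfold Cminus at 1. rewrite re_plus, re_opp.
  simpl (Re 1). rewrite <- (Rmult_1_r c). apply Rmult_le_compat. pos. pos. apply exp_le. nra. apply inv_le_1; auto. }
  assert (B2 : Cmod (cexp (- (RtoC T * p)) / s)%C <= c). { unfold Cdiv at 1. rewrite Cmod_mult, Cmod_inv by auto.
  replace (- (RtoC T * p))%C with (RtoC T * (- p))%C by ring. rewrite Cmod_line, re_opp. rewrite <- (Rmult_1_r c).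
  apply Rmult_le_compat. pos. pos. apply exp_le. nra. fin. } le_trans Cmod_triangle. rewrite Cmod_opp.
  le_trans Rplus_le_compat_l. apply Cmod_triangle. lra. }
  match goal with |- Cmod (?a - ?d) <= _ => match type of A2 with Cmod (?b - ?x) <= _ => replace (a - d)%C with ((a - b) + ((b - x) + (x - d)))%C by ring end end.
  le_trans Cmod_triangle. le_trans Rplus_le_compat_l. apply Cmod_triangle. unfold K in HT. lra.
Qed.

(** * Continuation, functional equation and growth of zeta *)

Section Zeta.
Variable Ez : C -> C.
Hypothesis HEz : zeta_ext Ez.

Lemma Ez_entire : Entire Ez.
Proof. apply Entire_iff. apply HEz. Qed.

(** [s (s-1)] times the completed zeta function; it takes the value 1 at 0 and at 1. *)
Definition Xi (s : C) : C := (s * (s - 1) * xiF s + 1)%C.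

Lemma two_neq : RtoC 2 <> RtoC 0.
Proof. pos. Qed.

Lemma Ez_right s : 4 < Re s -> (2 * Ez s)%C = (Xi s * cpowR PI (s / 2) * GP (s / 2 + 1))%C.
Proof.
 intros Hs. pose proof PI_RGT_0. assert (S0 : s <> RtoC 0) by (intros ->; simpl in Hs; lra).
 assert (S1 : (s - 1)%C <> RtoC 0). { intros E.
 assert (s = 1) by (replace s with (s - 1 + 1)%C by ring; rewrite E; ring). subst. simpl in Hs. lra. }
 assert (G0 : GP (s / 2)%C <> RtoC 0). { apply GP_neq_0, not_npint_pos. rewrite Re_half; lra. }
 assert (Cs : cser (dterm (fun _ => RtoC 1) s) (cpowR PI (s / 2) * GP (s / 2) * zV s)%C). { eapply cser_ext.
 2: apply cser_scal, zeta_series, Hs. intros n. unfold dterm. unfold yn. pose proof (INR_S_pos n).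
 rewrite cpow_mult_base by pos. replace (INR (S n) ^ 2) with (INR (S n) * INR (S n)) by ring.
 rewrite cpow_mult_base by auto. rewrite <- cpow_plus.
 replace (- (s / 2) + - (s / 2))%C with (- s)%C by (field; apply two_neq). rewrite (cpow_opp PI). field. split; auto.
 apply cpow_neq_0. } rewrite (proj2 HEz s _ ltac:(lra) (proj2 (is_series_cser _ _) Cs)). rewrite (GP_rec (s / 2)%C).
 unfold Xi, zV. field; pos.
Qed.

Lemma Xi_entire : Entire Xi.
Proof. apply Entire_plus. apply Entire_mult. fin. apply xiF_entire. fin. Qed.
(** Known for [Re s > 4], it spreads from a disc about 5 by the identity theorem. The argument
    [s/2 + 1] absorbs the factor [s] of [Xi] and keeps both sides entire. *)
Lemma Ez_Xi s : (2 * Ez s)%C = (Xi s * cpowR PI (s / 2) * GP (s / 2 + 1))%C.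
Proof.
 apply (punctured_eq (fun s => 2 * Ez s)%C (fun s => Xi s * cpowR PI (s / 2) * GP (s / 2 + 1))%C (RtoC 5) (1/2)); try lra.
 - apply Entire_mult. fin. apply Ez_entire.
 - apply Entire_mult. apply Entire_mult. apply Xi_entire. fin. apply Entire_comp. apply GP_entire. fin.
 - intros z Hz. apply Ez_right. pose proof (Re_le_Cmod (- (z - 5))%C) as R. rewrite Cmod_opp, re_opp in R.
  rewrite re_minus in R. simpl (Re 5) in R. lra.
Qed.

Lemma Ez_1_neq : Ez (RtoC 1) <> RtoC 0.
Proof.
 intros E. pose proof (Ez_Xi (RtoC 1)) as X. rewrite E, Cmult_0_r in X. assert (GP (1 / 2 + 1)%C <> RtoC 0). {
 apply GP_neq_0, not_npint_pos. simpl. lra. } unfold Xi in X.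
 replace (1 * (1 - 1) * xiF 1 + 1)%C with (RtoC 1) in X by ring. rewrite Cmult_1_l in X. symmetry in X. revert X.
 apply Cmult_neq_0; auto. apply cpow_neq_0.
Qed.

Lemma Xi_sym s : Xi (1 - Cconj s)%C = Cconj (Xi s).
Proof.
 unfold Xi. rewrite xiF_sym, xiF_conj, Cplus_conj, !Cmult_conj, Cminus_conj.
 assert (RC : Cconj (RtoC 1) = RtoC 1) by (apply C_ext; simpl; ring). rewrite RC. ring.
Qed.

Lemma zeta_star_Xi s : ~ npint (s / 2)%C -> s <> RtoC 1 -> zeta_star Ez s = (Xi s / (s * (s - 1)))%C.
Proof.
 intros Hs H1. unfold zeta_star. rewrite CGamma_GP by auto. assert (S0 : s <> RtoC 0). { intros ->. apply Hs. exists O.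
 simpl. replace (0 / 2)%C with (RtoC 0) by (field; apply two_neq). f_equal; ring. } assert (S1 : (s - 1)%C <> RtoC 0). {
 intros E. apply H1. replace s with (s - 1 + 1)%C by ring. rewrite E; ring. } pose proof (GP_neq_0 _ Hs) as G0.
 pose proof (GP_rec (s / 2)%C) as GR. assert (G1 : GP (s / 2 + 1)%C <> RtoC 0). { intros E. apply G0. rewrite GR, E.
 ring. }
 assert (Ez s = (Xi s * cpowR PI (s / 2) * GP (s / 2 + 1)) / 2)%C as -> by (rewrite <- Ez_Xi; field; apply two_neq).
 rewrite GR. rewrite cpow_opp. field. repeat split; auto. apply cpow_neq_0.
Qed.

(** Zeta is treated as an instance of the general completed function, so that its zeros are covered
    by the same analysis as those of [L_phi]. *)
Lemma zeta_Lstar s : zeta_star Ez s = Lstar 1 Ez (/ sqrt PI) 1 (fun _ => / 2) (fun _ => RtoC 0) s.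
Proof.
 unfold zeta_star, Lstar, Lcont. simpl cprod. simpl cpown. pose proof PI_RGT_0 as P. f_equal. f_equal.
 - unfold cpowR. f_equal. rewrite ln_Rinv by (apply sqrt_lt_R0; auto). assert (ln PI = ln (sqrt PI) + ln (sqrt PI)). {
  rewrite <- ln_mult by (apply sqrt_lt_R0; auto). rewrite sqrt_sqrt; lra. } rewrite H, RtoC_opp, RtoC_plus. field.
 - rewrite Cmult_1_l. f_equal. rewrite RtoC_inv by lra. field.
 - rewrite Cmult_1_r. auto.
Qed.

Lemma zeta_S3 : S3_with 1 Ez (/ sqrt PI) 1 (fun _ => / 2) (fun _ => RtoC 0) (RtoC 1).
Proof.
 pose proof PI_RGT_0 as P. split; [|split; [|split; [|split]]]; auto.
 - apply Rinv_0_lt_compat, sqrt_lt_R0; auto.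
 - split. lra. simpl; lra.
 - rewrite Cmod_R, Rabs_R1; auto.
 - intros s [A1 A2] [B1 B2]. rewrite <- !zeta_Lstar, Cmult_1_l. specialize (A2 O ltac:(lia)).
  specialize (B2 O ltac:(lia)).
  replace (RtoC (/ 2) * s + 0)%C with (s / 2)%C in A2 by (rewrite RtoC_inv by lra; field; apply two_neq).
  replace (RtoC (/ 2) * (1 - Cconj s) + 0)%C with ((1 - Cconj s) / 2)%C in B2 by (rewrite RtoC_inv by lra; field; apply two_neq).
  rewrite !zeta_star_Xi by auto. rewrite Xi_sym. unfold Cdiv. rewrite Cmult_conj, Cconj_conj.
  replace ((1 - Cconj s) * (1 - Cconj s - 1))%C with (Cconj (s * (s - 1)))%C. rewrite <- Cinv_conj, Cconj_conj; auto.
  + apply Cmult_neq_0; intros E. subst. apply A2. exists O. apply C_ext; simpl; field. apply A1.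
   replace s with (s - 1 + 1)%C by ring. rewrite E. ring.
  + rewrite Cmult_conj, Cminus_conj. assert (RC : Cconj (RtoC 1) = RtoC 1) by (apply C_ext; simpl; ring). rewrite RC.
   ring.
Qed.

(** Read off from [Ez_Xi]; the exponent 2 is not the true order but comes from the quadratic bounds
    for [xiF] and [GP]. *)
Lemma zeta_growth : exists K, 0 <= K /\ forall s, Cmod (Ez s) <= exp (K * (1 + Cmod s) ^ 2).
Proof.
 pose proof cW_nonneg as C0. exists (16 + 2 * cW + ln PI). pose proof PI2_3_2. assert (LP : 0 <= ln PI) by pos. split.
 lra. intros s. pose proof (Cmod_ge_0 s). set (x := Cmod s) in *. set (y := (1 + x) ^ 2).
 assert (Hy : 1 + 2 * x <= y) by (unfold y; nra). assert (E : Cmod (Ez s) <= Cmod (2 * Ez s)%C). {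
 rewrite Cmod_mult, Cmod_R, Rabs_pos_eq by lra. pose proof (Cmod_ge_0 (Ez s)). lra. } le_trans E.
 rewrite Ez_Xi, !Cmod_mult. assert (EX : Cmod (Xi s) <= exp ((8 + 2 * cW) * y)). { le_trans Cmod_triangle.
 rewrite Cmod_1, !Cmod_mult. pose proof (xiF_bound s) as F1. fold x in F1. assert (Cmod (s - 1)%C <= x + 1). {
 le_trans Cmod_minus_le. rewrite Cmod_1. unfold x; lra. }
 assert (F2 : Cmod s * Cmod (s - 1)%C * Cmod (xiF s) <= y * (2 * cW * exp (4 * y))). {
 apply Rmult_le_compat; try apply Cmod_ge_0. pos. fold x. unfold y. nra. le_trans F1. le_mul_l. lra. apply exp_le.
 unfold y. nra. } pose proof (exp_ineq1_le y) as G1. pose proof (exp_ineq1_le (2 * cW)) as G2.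
 assert (F3 : y * (2 * cW * exp (4 * y)) <= exp y * (exp (2 * cW) * exp (4 * y))) by fin. rewrite <- !exp_plus in F3.
 assert (F4 : y + (2 * cW + 4 * y) <= 5 * y + 2 * cW * y) by nra. assert (F5 : 1 <= exp (5 * y + 2 * cW * y)) by pos.
 assert (F6 : 2 * exp (5 * y + 2 * cW * y) <= exp ((8 + 2 * cW) * y)). {
 replace ((8 + 2 * cW) * y) with (3 * y + (5 * y + 2 * cW * y)) by ring. rewrite (exp_plus (3 * y)). le_mul_r. lra.
 pose proof (exp_ineq1_le (3 * y)). lra. } apply exp_le in F4. lra. }
 assert (EP : Cmod (cpowR PI (s / 2)) <= exp (ln PI * y)). { rewrite Cmod_cpow, Re_half. apply exp_le.
 pose proof (Re_le_Cmod s). fold x in H1. nra. } assert (EG : Cmod (GP (s / 2 + 1)%C) <= exp (4 * y)). {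
 le_trans GP_growth. apply exp_le. assert (Cmod (s / 2 + 1)%C <= x / 2 + 1). { le_trans Cmod_triangle. rewrite Cmod_1.
 unfold Cdiv. rewrite Cmod_mult, Cmod_inv by fin. rewrite Cmod_R, Rabs_pos_eq by lra. fold x. lra. }
 pose proof (Cmod_ge_0 (s / 2 + 1)%C). unfold y. nra. } le_via (exp ((8 + 2 * cW) * y) * exp (ln PI * y) * exp (4 * y)).
 { fin. } rewrite <- !exp_plus; fin.
Qed.
End Zeta.

(** * Dirichlet series with polynomially bounded coefficients *)

Lemma ln_INR_bounds n : 0 <= ln (INR (S n)) <= INR (S n).
Proof.
 assert (1 <= INR (S n)) by pos. split. pos. pose proof (exp_ineq1_le (ln (INR (S n)))). rewrite exp_ln in H0 by lra.
 lra.
Qed.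
Lemma INR_pow_exp n A : INR (S n) ^ A = exp (INR A * ln (INR (S n))).
Proof. rewrite <- exp_pow_n, exp_ln; fin. Qed.

(** Only positive indices are constrained; coefficient sequences have an irrelevant value at 0. *)
Definition PB (f : nat -> C) (A : nat) : Prop := exists K, 0 <= K /\ forall n, Cmod (f (S n)) <= K * INR (S n) ^ A.

Lemma PB_mono f A B : (A <= B)%nat -> PB f A -> PB f B.
Proof. intros L [K [K0 H]]. exists K. split; auto. intros n. le_trans H. le_mul_l; auto. apply Rle_pow; fin. Qed.

Definition flog (f : nat -> C) (n : nat) : C := (f n * RtoC (ln (INR n)))%C.

Lemma PB_log f A : PB f A -> PB (flog f) (S A).
Proof.
 intros [K [K0 H]]. exists K. split; auto. intros n. unfold flog. pose proof (ln_INR_bounds n).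
 rewrite Cmod_mult, Cmod_R, Rabs_pos_eq by lra. change (INR (S n) ^ S A) with (INR (S n) * INR (S n) ^ A).
 le_via (K * INR (S n) ^ A * INR (S n)); fin.
Qed.

Lemma dterm_Cmod f s j : Cmod (dterm f s j) = Cmod (f (S j)) * exp (- Re s * ln (INR (S j))).
Proof. unfold dterm. rewrite Cmod_mult, Cmod_cpow. auto. Qed.

Lemma PB_dterm f A k : PB f A -> exists K, 0 <= K /\ forall s j, INR A + INR k + 2 <= Re s -> Cmod (dterm f s j) * INR (S j) ^ k <= K * / INR (S j) ^ 2.
Proof.
 intros [K [K0 H]]. exists K. split; auto. intros s j Hs. rewrite dterm_Cmod. pose proof (ln_INR_bounds j) as L.
 replace (/ INR (S j) ^ 2) with (exp (- INR 2 * ln (INR (S j)))) by (rewrite <- Ropp_mult_distr_l, exp_Ropp, INR_pow_exp; auto).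
 le_via (K * INR (S j) ^ A * exp (- Re s * ln (INR (S j))) * INR (S j) ^ k). { fin. }
 rewrite !INR_pow_exp, !Rmult_assoc, <- !exp_plus. le_mul_l; auto. apply exp_le. simpl (INR 2). nra.
Qed.

Lemma PB_abs f A : PB f A -> exists K, 0 <= K /\ forall s n, INR A + 2 <= Re s -> rsum n (fun j => Cmod (dterm f s j)) <= K.
Proof.
 intros H. destruct (PB_dterm f A 0 H) as [K [K0 HK]]. exists (K * 2). split. lra. intros s n Hs.
 le_via (K * rsum n (fun j => / INR (S j) ^ 2)). rewrite <- rsum_scal. apply rsum_le. intros j _. specialize (HK s j).
 rewrite Rmult_1_r in HK. apply HK. simpl (INR 0). lra. le_mul_l; auto. apply inv_sq_sum.
Qed.

Lemma PB_cser f A s : PB f A -> INR A + 2 <= Re s -> exists l, cser (dterm f s) l.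
Proof. intros H Hs. destruct (PB_abs f A H) as [K [_ HK]]. apply (cser_exists _ K); fin. Qed.

(** The quadratic remainder of [n^(-s)] costs [(ln n)^2 n^|h| <= n^3], and summability asks for two
    more powers: hence [A + 5]. *)
Lemma Dser_deriv f A Fn s : PB f A -> (forall z, INR A + 2 <= Re z -> cser (dterm f z) (Fn z)) -> INR A + 5 <= Re s ->
  exists l, cser (dterm (flog f) s) l /\ cdiff Fn s (- l)%C.
Proof.
 intros H HF Hs. destruct (PB_cser (flog f) (S A) s (PB_log _ _ H)) as [l Hl]. rewrite S_INR; lra. exists l.
 split; auto. destruct (PB_dterm f A 3 H) as [K [K0 HK]].
 apply (cser_deriv (fun n z => dterm f z n) (fun n => (-1) * dterm (flog f) s n)%C (fun n => K * / INR (S n) ^ 2) (K * 2) 1).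
 - lra.
 - intros n. rewrite rsum_scal. le_mul_l; auto. apply inv_sq_sum.
 - intros n h Hh. set (L := ln (INR (S n))). pose proof (ln_INR_bounds n) as HL. fold L in HL. pose proof (INR_S_pos n).
  replace (dterm f (s + h) n - dterm f s n - -1 * dterm (flog f) s n * h)%C with (dterm f s n * (cexp (- (h * RtoC L)) - 1 - (- (h * RtoC L))))%C.
  2:{ unfold dterm, flog. replace (- (s + h))%C with (- s + - h)%C by ring. rewrite cpow_plus.
  replace (cpowR (INR (S n)) (- h)) with (cexp (- (h * RtoC L))). fold L. ring. unfold cpowR. fold L. f_equal. ring. }
  rewrite Cmod_mult. le_trans Rmult_le_compat_l. pos. apply cexp_m1z_bound.
  rewrite Cmod_opp, Cmod_mult, Cmod_R, Rabs_pos_eq by lra. assert (E1 : exp (Cmod h * L) <= INR (S n)). {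
  rewrite <- (exp_ln (INR (S n))) by auto. apply exp_le. fold L. nra. } specialize (HK s n ltac:(simpl (INR 3); lra)).
  le_via (Cmod h ^ 2 * (Cmod (dterm f s n) * INR (S n) ^ 3)). 2:{ fin. } rewrite Rpow_mult_distr.
  replace (Cmod (dterm f s n) * (Cmod h ^ 2 * L ^ 2 * exp (Cmod h * L))) with (Cmod h ^ 2 * (Cmod (dterm f s n) * (L ^ 2 * exp (Cmod h * L)))) by ring.
  le_mul_l. pos. le_mul_l. pos. replace (INR (S n) ^ 3) with (INR (S n) ^ 2 * INR (S n)) by ring; fin.
 - intros h Hh. apply HF. rewrite re_plus. pose proof (re_le_Cmod h) as R. apply Rabs_le_between in R. lra.
 - replace (- l)%C with (-1 * l)%C by ring. apply cser_scal; auto.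
Qed.

(** Dirichlet convolution; the divisors are written [S j]. *)
Definition conv (f g : nat -> C) (n : nat) : C := csum n (fun j => if Nat.eq_dec (n mod S j) 0 then (f (S j) * g (n / S j)%nat)%C else RtoC 0).

Lemma div_S_cases N d : (0 < d)%nat -> if Nat.eq_dec (S N mod d) 0 then (S N / d = S (N / d))%nat /\ (d * S (N / d) = S N)%nat else (S N / d = N / d)%nat.
Proof.
 intros Hd. pose proof (Nat.div_mod_eq N d) as E. pose proof (Nat.mod_upper_bound N d ltac:(lia)) as B.
 destruct (Nat.eq_dec (S (N mod d)) d) as [e|e].
 - assert (Q : (S N = d * S (N / d))%nat) by nia.
  assert (Q0 : (S N mod d = 0)%nat) by (rewrite Q, Nat.mul_comm; apply Nat.Div0.mod_mul). rewrite Q0.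
  destruct (Nat.eq_dec 0 0); [|lia]. rewrite Q at 1. rewrite Nat.mul_comm, Nat.div_mul; lia.
 - assert (Q1 : (S N / d = N / d)%nat). { symmetry. apply (Nat.div_unique (S N) d (N / d) (S (N mod d))); fin. }
  assert (Q2 : (S N mod d = S (N mod d))%nat). { symmetry. apply (Nat.mod_unique (S N) d (N / d) (S (N mod d))); fin. }
  rewrite Q2; fin.
Qed.

(** Summing over one divisor first gives partial sums of the other series up to [N / d]. From
    [N - 1] to [N] such a quotient moves exactly when [d] divides [N]. *)
Lemma conv_partial f g s N : csum N (dterm (conv f g) s) = csum N (fun j => dterm f s j * csum (N / S j) (dterm g s))%C.
Proof.
 induction N. auto. rewrite csum_S, IHN.
 assert (E : csum N (fun j => dterm f s j * csum (N / S j) (dterm g s))%C = csum (S N) (fun j => dterm f s j * csum (N / S j) (dterm g s))%C).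
 { rewrite csum_S. rewrite (Nat.div_small N (S N)) by lia. simpl (csum 0 _). ring. } rewrite E. unfold dterm at 3.
 unfold conv.
 replace (csum (S N) (fun j => if Nat.eq_dec (S N mod S j) 0 then (f (S j) * g (S N / S j)%nat)%C else RtoC 0) * cpowR (INR (S N)) (- s))%C with (csum (S N) (fun j => cpowR (INR (S N)) (- s) * (if Nat.eq_dec (S N mod S j) 0 then f (S j) * g (S N / S j)%nat else RtoC 0))%C) by (rewrite csum_scal; ring).
 rewrite <- csum_plus. apply csum_ext. intros j Hj. pose proof (div_S_cases N (S j) ltac:(lia)) as D.
 destruct (Nat.eq_dec (S N mod S j) 0).
 - destruct D as [D1 D2]. rewrite D1, csum_S. unfold dterm. rewrite <- D2, mult_INR, cpow_mult_base by fin. ring.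
 - rewrite D. ring.
Qed.

(** In [conv_partial] the inner sums tend to [G] for each divisor and are bounded, so Tannery's
    theorem applies. *)
Lemma Dser_mult f g A s F G : PB f A -> PB g A -> INR A + 2 <= Re s -> cser (dterm f s) F -> cser (dterm g s) G -> cser (dterm (conv f g) s) (F * G)%C.
Proof.
 intros Hf Hg Hs CF CG. destruct (PB_abs f A Hf) as [Kf [Kf0 HKf]]. destruct (PB_abs g A Hg) as [Kg [Kg0 HKg]].
 assert (BG : forall n, Cmod (csum n (dterm g s)) <= Kg) by (intros n; eapply Rle_trans; [apply csum_Cmod|apply HKg; auto]).
 assert (BG' : Cmod G <= Kg) by (apply (cser_bound _ _ _ BG); auto).
 destruct (tannery (fun N j => if lt_dec j N then Cmod (dterm f s j) * Cmod (csum (N / S j) (dterm g s) - G) else 0) (fun _ => 0) (fun j => (2 * Kg) * Cmod (dterm f s j)) (fun N => N) (2 * Kg * Kf) 0) as [S [S1 S2]].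
 - intros j e He. destruct (CG (e / (Cmod (dterm f s j) + 1))) as [N HN]. pos. exists (N * S j)%nat. intros n Hn.
  pose proof (Cmod_ge_0 (dterm f s j)). rewrite Rminus_0_r. destruct (lt_dec j n). 2:{ rewrite Rabs_R0; lra. }
  rewrite Rabs_pos_eq by (pos). assert (Cmod (csum (n / S j) (dterm g s) - G) <= e / (Cmod (dterm f s j) + 1)). {
  apply HN. apply Nat.div_le_lower_bound; lia. } le_via ((Cmod (dterm f s j) + 1) * (e / (Cmod (dterm f s j) + 1))).
  fin. right; field; lra.
 - intros n. rewrite rsum_scal; fin.
 - intros N j _. destruct (lt_dec j N). rewrite Rabs_pos_eq by (pos). rewrite Rmult_comm. le_mul_r. pos.
  le_trans Cmod_minus_le. specialize (BG (N / S j)%nat). lra. rewrite Rabs_R0; fin.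
 - intros N j Hj. destruct (lt_dec j N); [lia|auto].
 - assert (S = 0). { apply (rlim_unique _ _ _ S2). apply rlim_ext with (fun _ => 0). exists O. intros n _.
  replace (fun _ : nat => 0) with (fun _ : nat => 0 * 0) by (apply functional_extensionality; intros; ring).
  rewrite rsum_scal. ring. apply rlim_const. } subst S. intros e He. destruct (S1 (e/2) ltac:(lra)) as [N1 HN1].
  destruct (CF (e / 2 / (Kg + 1))) as [N2 HN2]. pos. exists (max N1 N2). intros n Hn. specialize (HN1 n ltac:(lia)).
  specialize (HN2 n ltac:(lia)). rewrite conv_partial.
  replace (csum n (fun j => dterm f s j * csum (n / S j) (dterm g s)) - F * G)%C with (csum n (fun j => dterm f s j * (csum (n / S j) (dterm g s) - G)) + (csum n (dterm f s) - F) * G)%C.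
  2:{
  assert (Q : forall (v : nat -> C) k, (csum k (fun j => dterm f s j * v j) - csum k (dterm f s) * G)%C = csum k (fun j => dterm f s j * (v j - G))%C).
  { induction k. simpl; ring. rewrite !csum_S, <- IHk. ring. } rewrite <- (Q (fun j => csum (n / S j) (dterm g s)) n).
  ring. } le_trans Cmod_triangle. replace e with (e / 2 + e / 2) by field. apply Rplus_le_compat.
  + le_trans csum_Cmod. rewrite Rminus_0_r in HN1. le_trans2 HN1. le_trans2 Rle_abs. apply rsum_le. intros j Hj.
   rewrite Cmod_mult. destruct (lt_dec j n); [lra|lia].
  + rewrite Cmod_mult. le_via (e / 2 / (Kg + 1) * (Kg + 1)). fin. right; field; lra.
Qed.

(** Uniqueness for general Dirichlet series: let [s -> +oo] after dividing by the first nonzero term. *)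
Lemma gen_uniq (h : nat -> C) (lam : nat -> R) sigma K : (forall j, lam j < lam (S j)) -> (forall n, rsum n (fun j => Cmod (h j) * exp (- (lam j * sigma))) <= K) ->
  (forall s, sigma <= s -> cser (fun j => h j * RtoC (exp (- (lam j * s))))%C (RtoC 0)) -> forall j, h j = RtoC 0.
Proof.
 intros Hl HK HC. assert (Mono : forall i j, (i <= j)%nat -> lam i <= lam j). { intros i j L. induction L. lra.
 specialize (Hl m). lra. } assert (K0 : 0 <= K) by (specialize (HK O); simpl in HK; lra).
 induction j as [j IH] using lt_wf_ind. apply NNPP. intros Hj. assert (Hj0 : 0 < Cmod (h j)) by pos.
 set (d := lam (S j) - lam j). assert (Hd : 0 < d) by (unfold d; specialize (Hl j); lra).
 set (c := Cmod (h j) * exp (- (lam j * sigma))). assert (Hc : 0 < c) by (apply Rmult_lt_0_compat; auto; pos).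
 assert (G : forall t, 0 <= t -> c * exp (d * t) <= K). { intros t Ht.
 set (u := fun i => (h i * RtoC (exp (- (lam i * (sigma + t)))))%C).
 set (u' := fun i => if Nat.eq_dec i j then RtoC 0 else u i). assert (C1 : cser u' (- u j)%C). { intros e He.
 destruct (HC (sigma + t) ltac:(lra) e He) as [N HN]. exists (max N (S j)). intros n Hn. specialize (HN n ltac:(lia)).
 assert (E : forall n, (S j <= n)%nat -> csum n u' = (csum n u - u j)%C). { clear.
 assert (E0 : csum j u' = csum j u) by (apply csum_ext; intros i Hi; unfold u'; destruct (Nat.eq_dec i j); [lia|auto]).
 induction n; intros L. lia. destruct (Nat.eq_dec n j). subst. rewrite !csum_S, E0. unfold u' at 1.
 destruct (Nat.eq_dec j j); [ring|lia]. rewrite !csum_S, IHn by lia. unfold u' at 1.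
 destruct (Nat.eq_dec n j); [lia|ring]. } rewrite E by lia. le_trans2 HN. right. f_equal. fold u. ring. }
 assert (B : Cmod (- u j)%C <= exp (- (lam (S j) * t)) * K). { apply (cser_abs_bound u'); auto. intros n.
 eapply Rle_trans. 2: le_mul_l; [pos|apply (HK n)]. rewrite <- rsum_scal. apply rsum_le. intros i _. unfold u'.
 destruct (Nat.eq_dec i j). rewrite Cmod_0; fin. destruct (lt_dec i j). unfold u. rewrite IH by auto.
 rewrite Cmult_0_l, Cmod_0. lra. unfold u. rewrite Cmod_mult, Cmod_exp.
 replace (exp (- (lam (S j) * t)) * (Cmod (h i) * exp (- (lam i * sigma)))) with (Cmod (h i) * (exp (- (lam (S j) * t)) * exp (- (lam i * sigma)))) by ring.
 le_mul_l. pos. rewrite <- exp_plus. apply exp_le. assert (lam (S j) <= lam i) by (apply Mono; lia). nra. }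
 rewrite Cmod_opp in B. unfold u in B. rewrite Cmod_mult, Cmod_exp in B. eapply Rmult_le_reg_l. pos. le_trans2 B. right.
 unfold c.
 replace (exp (- (lam (S j) * t)) * (Cmod (h j) * exp (- (lam j * sigma)) * exp (d * t))) with (Cmod (h j) * (exp (- (lam (S j) * t)) * (exp (- (lam j * sigma)) * exp (d * t)))) by ring.
 f_equal. rewrite <- !exp_plus. f_equal. unfold d. ring. }
 specialize (G (K / c / d) ltac:(apply Rmult_le_pos; [apply Rmult_le_pos; auto|]; pos)).
 pose proof (exp_ineq1_le (d * (K / c / d))). assert (c * (1 + d * (K / c / d)) = c + K) by (field; lra). nra.
Qed.

Lemma PB_conv f g A : PB f A -> PB g A -> PB (conv f g) (A + A + 1).
Proof.
 intros [K [K0 H]] [K' [K0' H']]. exists (K * K'). split. pos. intros n. set (x := INR (S n)).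
 assert (x0 : 1 <= x) by (unfold x; rewrite S_INR; pose proof (pos_INR n); lra). le_trans csum_Cmod.
 le_via (rsum (S n) (fun _ => K * x ^ A * (K' * x ^ A) * 1)).
 - apply rsum_le. intros j Hj. assert (P : 0 <= K * x ^ A * (K' * x ^ A) * 1) by fin.
  destruct (Nat.eq_dec (S n mod S j) 0) as [e|e]. 2:{ rewrite Cmod_0. auto. } rewrite Cmod_mult, Rmult_1_r.
  apply Rmult_le_compat; try pos.
  + le_trans H. le_mul_l; auto. apply pow_incr. split. pos. apply le_INR; lia.
  + assert (exists q, (S n / S j = S q)%nat /\ (q <= n)%nat) as [q [-> Hq]]. {
   assert (1 <= S n / S j)%nat by (apply Nat.div_le_lower_bound; lia).
   assert (S n / S j <= S n)%nat by (apply Nat.Div0.div_le_upper_bound; nia). exists (S n / S j - 1)%nat. lia. }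
   le_trans H'. le_mul_l; auto. apply pow_incr. split. pos. apply le_INR; lia.
 - rewrite rsum_scal.
  assert (E : forall k, rsum k (fun _ => 1) = INR k) by (induction k; [reflexivity|rewrite S_INR, <- IHk; reflexivity]).
  rewrite E. fold x. rewrite !pow_add; fin.
Qed.

Lemma PB_minus f g A : PB f A -> PB g A -> PB (fun n => f n - g n)%C A.
Proof.
 intros [K [K0 H]] [K' [K0' H']]. exists (K + K'). split. lra. intros n. le_trans Cmod_minus_le. specialize (H n).
 specialize (H' n). lra.
Qed.

Lemma Dser_uniq f g A : PB f A -> PB g A -> (exists s0, forall s, s0 <= s -> exists l, cser (dterm f (RtoC s)) l /\ cser (dterm g (RtoC s)) l) -> forall n, f (S n) = g (S n).
Proof.
 intros Hf Hg [s0 H] n. apply Ceq_minus. destruct (PB_abs _ A (PB_minus _ _ _ Hf Hg)) as [K [K0 HK]].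
 assert (EQ : forall s j, cpowR (INR (S j)) (- RtoC s) = RtoC (exp (- (ln (INR (S j)) * s)))). { intros s j.
 unfold cpowR. rewrite <- cexp_R. f_equal. rewrite RtoC_opp, RtoC_mult. ring. }
 apply (gen_uniq (fun n => f (S n) - g (S n))%C (fun j => ln (INR (S j))) (Rmax s0 (INR A + 2)) K).
 - intros j. fin.
 - intros k. le_trans2 ((HK (RtoC (Rmax s0 (INR A + 2))) k)). 2: apply Rmax_r. right. apply rsum_ext. intros j _.
  rewrite dterm_Cmod. do 2 f_equal. simpl (Re _). ring.
 - intros s Hs. destruct (H s) as [l [L1 L2]]. le_trans Rmax_l. apply Hs.
  replace (RtoC 0) with (l + (-1) * l)%C by ring. eapply cser_ext. 2: apply cser_plus; [apply L1|apply cser_scal, L2].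
  intros k. unfold dterm. rewrite EQ. ring.
Qed.

Lemma dterm_ext f g s l : (forall n, f (S n) = g (S n)) -> cser (dterm f s) l -> cser (dterm g s) l.
Proof. intros H. apply cser_ext. unfold dterm. congruence. Qed.

(** The hypothesis [a log = Lam conv a] is [-L' = (-L'/L) L] on coefficients; it avoids dividing
    Dirichlet series. *)
Lemma logderiv_series (E L : C -> C) E's a Lam A m s : cdiff E s E's -> (forall z, 1 < Re z -> E z = (cpown (z - 1) m * L z)%C) ->
  (forall z, INR A + 2 <= Re z -> cser (dterm a z) (L z)) -> PB a A -> PB Lam A -> (forall n, flog a (S n) = conv Lam a (S n)) -> INR A + 5 <= Re s -> L s <> RtoC 0 ->
  exists l, cser (dterm Lam s) l /\ (E's / E s)%C = (CN m / (s - 1) - l)%C.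
Proof.
 intros HE HL Ha PA PL HC Hs Ls. pose proof (pos_INR A).
 destruct (Dser_deriv a A L s PA ltac:(intros; apply Ha; lra) Hs) as [l [D1 D2]].
 destruct (PB_cser Lam A s PL ltac:(lra)) as [q Hq]. exists q. split; auto.
 pose proof (Dser_mult Lam a A s q (L s) PL PA ltac:(lra) Hq (Ha s ltac:(lra))) as M. assert (El : l = (q * L s)%C). {
 eapply cser_unique. 2: apply M. eapply dterm_ext; fin. } assert (S1 : (s - 1)%C <> RtoC 0). { intros X.
 apply (f_equal Re) in X. rewrite re_minus in X. simpl in X. lra. }
 assert (D3 : cdiff E s (CN m * (s - 1) ^ pred m * 1 * L s + (s - 1) ^ m * (- l))%C). {
 apply cdiff_ext_loc with (fun z => (z - 1) ^ m * L z)%C.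
 - exists 1. split. lra. intros w Hw. assert (1 < Re w). { pose proof (re_le_Cmod (w - s)%C) as R.
  apply Rabs_le_between in R. rewrite re_minus in R. lra. } rewrite HL by auto; fin.
 - apply cdiff_mult; auto. apply (cdiff_comp (fun z => z ^ m)%C (fun z => z - 1)%C). apply cdiff_pow. eapply cdiff_eq.
  fin. ring. } rewrite (cdiff_unique _ _ _ _ HE D3), HL by lra. replace (cpown (s - 1) m) with ((s - 1) ^ m)%C by fin.
  rewrite El. destruct m.
 - simpl. field. auto.
 - simpl pred. change ((s - 1) ^ S m)%C with ((s - 1) * (s - 1) ^ m)%C. field; pos.
Qed.

(** Differentiating [L = e^(Lb)] gives [L' = Lb' L]; uniqueness of Dirichlet coefficients turns this
    into a convolution identity. *)
Lemma exp_deriv_conv (L Lb : C -> C) a b A : (forall z, 1 < Re z -> cser (dterm a z) (L z)) -> (forall z, 1 < Re z -> cser (dterm b z) (Lb z) /\ L z = cexp (Lb z)) ->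
  PB a A -> PB b A -> forall n, flog a (S n) = conv (flog b) a (S n).
Proof.
 intros Ha Hb PA PB_. apply (Dser_uniq _ _ (S A + S A + 1)).
 - apply (PB_mono _ (S A)). lia. apply PB_log; auto.
 - apply PB_conv. apply PB_log; auto. apply (PB_mono _ A); auto.
 - exists (INR A + 5). intros s Hs. pose proof (pos_INR A).
  destruct (Dser_deriv a A L (RtoC s) PA ltac:(intros; apply Ha; lra) Hs) as [l [D1 D2]].
  destruct (Dser_deriv b A Lb (RtoC s) PB_ ltac:(intros; apply Hb; lra) Hs) as [lb [D3 D4]]. exists l. split; auto.
  assert (D5 : cdiff L (RtoC s) (cexp (Lb (RtoC s)) * (- lb))%C). { eapply cdiff_ext_loc. exists 1. split. lra.
  symmetry. apply Hb. pose proof (re_le_Cmod (w - RtoC s)%C) as R. apply Rabs_le_between in R. rewrite re_minus in R.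
  simpl (Re (RtoC s)) in R. lra. apply (cdiff_comp cexp Lb); auto; fin. } assert (R1 : 1 < Re (RtoC s)) by (simpl; lra).
  rewrite <- (proj2 (Hb _ R1)) in D5. pose proof (cdiff_unique _ _ _ _ D2 D5) as U. replace l with (lb * L (RtoC s))%C.
  apply (Dser_mult _ _ (S A)). apply PB_log; auto. apply (PB_mono _ A); auto. rewrite S_INR. simpl (Re _). lra. auto.
  auto. replace l with (- - l)%C by ring. rewrite U. ring.
Qed.

(** * Prime powers and the von Mangoldt function *)

Lemma divide_Z a b : Nat.divide a b <-> (Z.of_nat a | Z.of_nat b)%Z.
Proof.
 split; intros [c Hc].
 - exists (Z.of_nat c). lia.
 - exists (Z.abs_nat c); fin.
Qed.

Lemma prime_nat_ge2 p : prime_nat p -> (2 <= p)%nat.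
Proof. intros H. apply prime_ge_2 in H. lia. Qed.

Lemma prime_pow_base p q k : prime_nat p -> prime_nat q -> Nat.divide p (q ^ k) -> p = q.
Proof.
 intros Hp Hq H. apply divide_Z in H. rewrite Nat2Z.inj_pow in H. apply Nat2Z.inj.
 apply (prime_power_prime _ _ (Z.of_nat k)); auto. lia.
Qed.

Lemma Gauss_prime p d n : prime_nat p -> ~ Nat.divide p d -> Nat.divide d (p * n) -> Nat.divide d n.
Proof.
 intros Hp H D. apply divide_Z. apply (Gauss _ (Z.of_nat p)). rewrite <- Nat2Z.inj_mul. apply divide_Z; auto.
 apply rel_prime_sym, prime_rel_prime; auto. rewrite <- divide_Z; auto.
Qed.

Lemma divide_prime_pow p k : prime_nat p -> forall d, Nat.divide d (p ^ k) -> exists j, (j <= k)%nat /\ d = (p ^ j)%nat.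
Proof.
 intros Hp. pose proof (prime_nat_ge2 p Hp). induction k; intros d Hd.
 - exists O. apply Nat.divide_1_r in Hd. auto.
 - destruct (classic (Nat.divide p d)) as [[q Hq]|N].
  + subst d. rewrite (Nat.mul_comm q) in Hd. apply Nat.mul_divide_cancel_l in Hd; [|lia].
   destruct (IHk q Hd) as [j [J1 J2]]. exists (S j). split. lia. simpl; fin.
  + apply Gauss_prime in Hd; auto. destruct (IHk d Hd) as [j [J1 J2]]; fin.
Qed.

Lemma prime_factor_ex n : (2 <= n)%nat -> exists p, prime_nat p /\ Nat.divide p n.
Proof.
 induction n as [n IH] using lt_wf_ind. intros Hn. destruct (classic (prime_nat n)) as [P|P]. exists n. split; auto.
 apply Nat.divide_refl. destruct (not_prime_divide (Z.of_nat n) ltac:(lia) P) as [d [D1 D2]].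
 replace d with (Z.of_nat (Z.to_nat d)) in D2 by lia. apply divide_Z in D2.
 destruct (IH (Z.to_nat d) ltac:(lia) ltac:(lia)) as [p [P1 P2]]. exists p. split; auto. eapply Nat.divide_trans; eauto.
Qed.

Definition pp (n p k : nat) : Prop := prime_nat p /\ (1 <= k)%nat /\ n = (p ^ k)%nat.

Lemma pp_base n p k q j : pp n p k -> pp n q j -> p = q.
Proof.
 intros [P1 [P2 P3]] [Q1 [Q2 Q3]]. apply (prime_pow_base p q j); auto. rewrite <- Q3, P3. destruct k; [lia|].
 exists (p ^ k)%nat. simpl. lia.
Qed.

(** The von Mangoldt function; the base of a prime power is unique by [pp_base]. *)
Definition vM (n : nat) : R := epsilon (inhabits 0) (fun v => (exists p k, pp n p k /\ v = ln (INR p)) \/ ((~ exists p k, pp n p k) /\ v = 0)).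

Lemma vM_spec n : (exists p k, pp n p k /\ vM n = ln (INR p)) \/ ((~ exists p k, pp n p k) /\ vM n = 0).
Proof.
 apply (epsilon_spec (inhabits 0) (fun v => (exists p k, pp n p k /\ v = ln (INR p)) \/ ((~ exists p k, pp n p k) /\ v = 0))).
 destruct (classic (exists p k, pp n p k)) as [[p [k H]]|H]. exists (ln (INR p)); fin. fin.
Qed.
Lemma vM_bound n : 0 <= vM (S n) <= INR (S n).
Proof.
 destruct (vM_spec (S n)) as [[p [k [[H1 [H2 H3]] E]]]|[_ E]]; rewrite E. 2:{ pos. } pose proof (prime_nat_ge2 p H1).
 destruct p; [lia|]. pose proof (ln_INR_bounds p). split. lra. le_via (INR (S p)). lra. apply le_INR. rewrite H3.
 destruct k; [lia|]. simpl. pose proof (Nat.pow_nonzero (S p) k ltac:(lia)). nia.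
Qed.

(** The range [N] is separate from [n], so that the divisor sums of [n] and of [p n] can be compared
    term by term. *)
Definition vMsum (N n : nat) : R := rsum N (fun j => if Nat.eq_dec (n mod S j) 0 then vM (S j) else 0).

Lemma rsum_ind N i c : (i < N)%nat -> rsum N (fun j => if Nat.eq_dec j i then c else 0) = c.
Proof.
 intros H. rewrite (rsum_split i N) by lia.
 rewrite (rsum_ext i _ (fun _ => 0 * 0)) by (intros j Hj; destruct (Nat.eq_dec j i); [lia|ring]). rewrite rsum_scal.
 rewrite (rsum_split 1 (N - i)) by lia.
 rewrite (rsum_ext (N - i - 1) _ (fun _ => 0 * 0)) by (intros j Hj; destruct (Nat.eq_dec (i + (1 + j)) i); [lia|ring]).
 rewrite rsum_scal. simpl. destruct (Nat.eq_dec (i + 0) i); [ring|lia].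
Qed.

Lemma vMsum_ext N n : (1 <= n <= N)%nat -> vMsum N n = vMsum n n.
Proof.
 intros H. unfold vMsum. rewrite (rsum_split n N) by lia. rewrite (rsum_ext (N - n) _ (fun _ => 0 * 0)).
 rewrite rsum_scal. ring. intros j _. rewrite Nat.mod_small by lia. destruct (Nat.eq_dec n 0); [lia|ring].
Qed.

Lemma p_valuation p n : (2 <= p)%nat -> (1 <= n)%nat -> exists v, forall i, Nat.divide (p ^ i) n <-> (i <= v)%nat.
Proof.
 intros Hp Hn. assert (Mono : forall i j, (i <= j)%nat -> Nat.divide (p ^ j) n -> Nat.divide (p ^ i) n). { intros i j L.
 apply Nat.divide_trans. exists (p ^ (j - i))%nat. rewrite <- Nat.pow_add_r. f_equal. lia. }
 assert (Ex : exists v, ~ Nat.divide (p ^ S v) n /\ forall i, (i <= v)%nat -> Nat.divide (p ^ i) n). { apply NNPP.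
 intros N. assert (A : forall v i, (i <= v)%nat -> Nat.divide (p ^ i) n). { induction v; intros i Hi.
 replace i with O by lia. apply Nat.divide_1_l. destruct (Nat.eq_dec i (S v)). subst. apply NNPP; fin. apply IHv; lia. }
 specialize (A n n (le_n _)). apply Nat.divide_pos_le in A; [|lia]. pose proof (Nat.pow_gt_lin_r p n ltac:(lia)). lia. }
 destruct Ex as [v [V1 V2]]. exists v. split. intros D. destruct (le_lt_dec i v); auto. exfalso; fin. apply V2.
Qed.

(** Passing from [n] to [p n] creates exactly one new prime power divisor, [p^(v+1)], where [p^v] is
    the exact power of [p] in [n]. *)
Lemma vMsum_step p n : prime_nat p -> (1 <= n)%nat -> vMsum (p * n) (p * n) = vMsum n n + ln (INR p).
Proof.
 intros Hp Hn. pose proof (prime_nat_ge2 p Hp) as H2. rewrite <- (vMsum_ext (p * n) n) by nia.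
 destruct (p_valuation p n H2 Hn) as [v Hv]. set (d := (p ^ S v)%nat). assert (Hd : Nat.divide d (p * n)). {
 apply Nat.mul_divide_mono_l. apply Hv. lia. } assert (Hd1 : (1 <= d <= p * n)%nat). { split.
 pose proof (Nat.pow_nonzero p (S v)). lia. apply Nat.divide_pos_le; auto. nia. }
 rewrite <- (rsum_ind (p * n) (d - 1) (ln (INR p))) by lia. unfold vMsum. rewrite <- rsum_plus. apply rsum_ext.
 intros j _. assert (M : forall m, (m mod S j)%nat = O <-> Nat.divide (S j) m) by (intros; apply Nat.Lcm0.mod_divide).
 assert (Ppd : pp d p (S v)) by (split; [auto|split; [lia|reflexivity]]).
 destruct (vM_spec (S j)) as [[q [k [Hq E]]]|[NP E]]; rewrite E.
 - destruct (Nat.eq_dec q p) as [->|Nq].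
  + destruct Hq as [_ [Hk Ej]]. destruct k; [lia|].
   assert (D1 : Nat.divide (S j) n <-> (S k <= v)%nat) by (rewrite Ej; apply Hv).
   assert (D2 : Nat.divide (S j) (p * n) <-> (k <= v)%nat). { rewrite Ej. simpl.
   rewrite Nat.mul_divide_cancel_l by lia; fin. } assert (D3 : j = (d - 1)%nat <-> k = v). { split; intros X.
   assert (S j = d) by lia. rewrite Ej in H. apply Nat.pow_inj_r in H; lia. subst k; fin. }
   destruct (Nat.eq_dec ((p * n) mod S j) 0) as [a|a]; rewrite M in a; rewrite D2 in a; destruct (Nat.eq_dec (n mod S j) 0) as [b|b]; rewrite M in b; rewrite D1 in b; destruct (Nat.eq_dec j (d - 1)) as [c|c]; rewrite D3 in c; try lia; lra.
  + assert (D3 : j <> (d - 1)%nat). { intros X. apply Nq. apply (pp_base d q k p (S v)); auto.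
   replace d with (S j) by lia. auto. } assert (D : Nat.divide (S j) (p * n) <-> Nat.divide (S j) n). { split.
   destruct Hq as [Q1 [Q2 Q3]]. apply Gauss_prime; auto. rewrite Q3. intros X. apply Nq. symmetry.
   eapply prime_pow_base; eauto. intros [c ->]. exists (p * c)%nat. lia. } destruct (Nat.eq_dec j (d - 1)); [lia|].
   destruct (Nat.eq_dec ((p * n) mod S j) 0) as [a|a]; rewrite M, D in a; destruct (Nat.eq_dec (n mod S j) 0) as [b|b]; rewrite M in b; try tauto; lra.
 - destruct (Nat.eq_dec j (d - 1)). exfalso. apply NP. exists p, (S v). replace (S j) with d by lia. auto.
  destruct (Nat.eq_dec ((p * n) mod S j) 0), (Nat.eq_dec (n mod S j) 0); lra.
Qed.

Lemma vMsum_log n : (1 <= n)%nat -> vMsum n n = ln (INR n).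
Proof.
 induction n as [n IH] using lt_wf_ind. intros Hn. destruct (Nat.eq_dec n 1) as [->|N1].
 - unfold vMsum. simpl. rewrite ln_1. destruct (vM_spec 1) as [[p [k [[H1 [H2 H3]] E]]]|[_ E]]. 2: lra.
  pose proof (prime_nat_ge2 p H1). pose proof (Nat.pow_gt_lin_r p k ltac:(lia)). lia.
 - destruct (prime_factor_ex n ltac:(lia)) as [p [P1 [c Hc]]]. pose proof (prime_nat_ge2 p P1).
  assert (c < n /\ 1 <= c)%nat by nia. rewrite Hc, Nat.mul_comm, vMsum_step by fin. rewrite IH by lia.
  rewrite mult_INR, ln_mult; fin.
Qed.

Lemma conv_vM_one n : conv (fun n => RtoC (vM n)) (fun _ => RtoC 1) (S n) = flog (fun _ => RtoC 1) (S n).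
Proof.
 unfold flog. rewrite <- vMsum_log by lia. rewrite Cmult_1_l.
 assert (E : forall N, csum N (fun j => if Nat.eq_dec (S n mod S j) 0 then (RtoC (vM (S j)) * 1)%C else RtoC 0) = RtoC (rsum N (fun j => if Nat.eq_dec (S n mod S j) 0 then vM (S j) else 0))).
 { induction N. auto. rewrite csum_S, rsum_S, IHN, RtoC_plus. destruct (Nat.eq_dec (S n mod S N) 0); f_equal; ring. }
 apply E.
Qed.

(** Strong induction at [n = p^k]. All divisors [d] are powers of [p], where [a(d) a(n/d) = a(n)];
    comparison with the divisor sum of [vM], which is [ln n], leaves only the term [d = n]. *)
Lemma conv_vM_prime_power (a Lb : nat -> C) : a 1%nat = RtoC 1 -> (forall p, prime_nat p -> exists c, forall k, a (p ^ k)%nat = (c ^ k)%C) ->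
  (forall n, flog a (S n) = conv Lb a (S n)) -> (forall n, (~ exists p k, pp (S n) p k) -> Lb (S n) = RtoC 0) -> forall n, Lb (S n) = (a (S n) * RtoC (vM (S n)))%C.
Proof.
 intros A1 AP HC HS n. induction n as [n IH] using lt_wf_ind. destruct (vM_spec (S n)) as [[p [k [Hp E]]]|[NP E]]. 2:{
 rewrite E, HS by auto. ring. } clear E. destruct Hp as [P1 [P2 P3]]. destruct (AP p P1) as [c Hc]. specialize (HC n).
 pose proof (vMsum_log (S n) ltac:(lia)) as VL. unfold flog in HC. rewrite <- VL in HC. unfold conv, vMsum in HC.
 rewrite csum_S, rsum_S, RtoC_plus, Cmult_plus_distr_l in HC. rewrite Nat.Div0.mod_same, Nat.div_same in HC by lia.
 destruct (Nat.eq_dec 0 0) as [_|]; [|lia]. rewrite A1, Cmult_1_r in HC.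
 rewrite (csum_ext n _ (fun j => a (S n) * (RtoC (if Nat.eq_dec (S n mod S j) 0 then vM (S j) else 0)))%C) in HC.
 -
  assert (E : forall N, csum N (fun j => a (S n) * RtoC (if Nat.eq_dec (S n mod S j) 0 then vM (S j) else 0))%C = (a (S n) * RtoC (rsum N (fun j => if Nat.eq_dec (S n mod S j) 0 then vM (S j) else 0%R)))%C).
  { induction N. simpl. ring. rewrite csum_S, IHN, rsum_S, RtoC_plus. ring. } rewrite E in HC.
  match type of HC with (?x + ?y)%C = (?x + ?z)%C => replace z with (x + z - x)%C by ring; rewrite <- HC; ring end.
 - intros j Hj. destruct (Nat.eq_dec (S n mod S j) 0) as [e|e]. 2: ring. apply Nat.Lcm0.mod_divide in e.
  pose proof e as e'. rewrite P3 in e'. apply divide_prime_pow in e'; auto. destruct e' as [i [I1 I2]].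
  rewrite IH by lia. destruct e as [q Hq]. rewrite Hq at 1. rewrite Nat.div_mul by lia. assert (q = p ^ (k - i))%nat. {
  apply (Nat.mul_cancel_r q (p ^ (k - i)) (S j)). lia. rewrite <- Hq, P3, I2, <- Nat.pow_add_r. f_equal. lia. }
  rewrite P3, H, I2, !Hc. replace (c ^ k)%C with (c ^ i * c ^ (k - i))%C. ring. rewrite <- Cpow_add_r. f_equal. lia.
Qed.

(** * Rank one Euler products, and the explicit formulas for [L_phi] and zeta *)

Lemma cser_shift u l : cser u l -> cser (fun k => match k with O => RtoC 0 | S k' => u k' end) l.
Proof.
 intros H e He. destruct (H e He) as [N HN]. exists (S N). intros n Hn. destruct n; [lia|]. rewrite csum_shift.
 rewrite Cplus_0_l. apply HN. lia.
Qed.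

(** The Euler factor gives [(1 - g X)] times the power series of the [a(p^k)] equal to 1, but only
    at [X = p^(-s)]. Uniqueness for general Dirichlet series with exponents [k ln p] compares the
    coefficients, and the recursion [a(p^(k+1)) = g a(p^k)] follows. *)
Lemma euler_rank1_powers a A : PB a A -> euler_rank 1 a -> forall p, prime_nat p -> exists c, forall k, a (p ^ k)%nat = (c ^ k)%C.
Proof.
 intros [Ka [Ka0 HKa]] [c [_ Hc]] p Hp. exists (c 1%nat p). set (g := c 1%nat p). pose proof (prime_nat_ge2 p Hp) as P2.
 set (P := INR p). assert (HP : 2 <= P). { unfold P. change 2 with (INR 2); fin. } set (L := ln P).
 assert (HL : 0 < L) by (unfold L; rewrite <- ln_1; apply ln_increasing; lra).
 assert (EP : exp L = P) by (unfold L; rewrite exp_ln; lra).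
 set (h := fun k => (match k with O => a 1%nat - 1 | S k' => a (p ^ S k')%nat - g * a (p ^ k')%nat end)%C).
 assert (Bd : forall k, Cmod (a (p ^ k)%nat) <= Ka * exp (INR k * L) ^ A). { intros k.
 pose proof (Nat.pow_nonzero p k ltac:(lia)). destruct (p ^ k)%nat eqn:E; [lia|]. eapply Rle_trans. auto. right.
 rewrite <- E. rewrite pow_INR. rewrite <- exp_pow_n, EP. auto. } assert (Hh : forall k, h k = RtoC 0). {
 set (sg := INR A + 2). apply (gen_uniq h (fun k => INR k * L) sg ((1 + Ka * (1 + Cmod g)) * 2)).
 - intros j. rewrite S_INR. nra.
 - intros n. le_via ((1 + Ka * (1 + Cmod g)) * rsum n (fun j => (/ 2) ^ j)). 2:{ le_mul_l. pos. le_trans geom_sum_le.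
  lra. lra. } rewrite <- rsum_scal. apply rsum_le. intros j _. pose proof (Cmod_ge_0 g).
  assert (H1 : 1 <= exp (INR j * L) ^ A) by pos. assert (Cmod (h j) <= (1 + Ka * (1 + Cmod g)) * exp (INR j * L) ^ A). {
  destruct j.
 - le_trans Cmod_minus_le. rewrite Cmod_1. pose proof (Bd O) as B0. simpl (p ^ 0)%nat in B0.
  rewrite Rmult_0_l, exp_0, pow1 in *. nra.
 - le_trans Cmod_minus_le. rewrite Cmod_mult. pose proof (Bd (S j)) as B1. pose proof (Bd j) as B2.
  assert (exp (INR j * L) ^ A <= exp (INR (S j) * L) ^ A) by fin.
  assert (Cmod g * Cmod (a (p ^ j)%nat) <= Cmod g * (Ka * exp (INR (S j) * L) ^ A)). { le_mul_l; auto. nra. } nra. }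
  le_via ((1 + Ka * (1 + Cmod g)) * exp (INR j * L) ^ A * exp (- (INR j * L * sg))). fin. rewrite Rmult_assoc. le_mul_l.
  nra. rewrite exp_pow_n, <- exp_plus. le_via (exp (- L) ^ j). rewrite exp_pow_n. apply exp_le. unfold sg.
  pose proof (pos_INR j). nra. apply pow_incr. split. pos. rewrite exp_Ropp; fin.
 - intros s Hs. pose proof (pos_INR A). destruct (Hc p Hp (RtoC s)) as [lp [S1 S2]]. simpl; unfold sg in Hs; lra.
  apply is_series_cser in S1. set (X := cpowR (INR p) (- RtoC s)) in *. unfold Ppoly in S2. simpl in S2. fold g in S2.
  assert (EX : forall k, cpowR (INR p) (- (CN k * RtoC s)) = RtoC (exp (- (INR k * L * s)))). { intros k. unfold cpowR.
  fold P. fold L. rewrite <- cexp_R. f_equal. rewrite RtoC_opp, !RtoC_mult. ring. }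
  assert (EX1 : X = RtoC (exp (- (L * s)))). { unfold X.
  replace (RtoC s) with (CN 1 * RtoC s)%C by (simpl (INR 1); ring). rewrite EX. do 3 f_equal. simpl. ring. }
  replace (RtoC 0) with (lp + (- (g * X)) * lp + - (1))%C by (rewrite <- S2; ring). eapply cser_ext.
  2: apply cser_plus; [apply cser_plus; [exact S1|apply cser_scal, cser_shift, S1]|]. 2:{ exists 1%nat.
  instantiate (1 := fun k => match k with O => (- (1))%C | S _ => RtoC 0 end). destruct n; [lia|]. rewrite csum_shift.
  replace (csum n (fun _ => RtoC 0)) with (RtoC 0). replace (- (1) + 0 - - (1))%C with (RtoC 0) by ring.
  rewrite Cmod_0; lra. induction n; simpl; auto. rewrite <- IHn. ring. } intros k. cbv beta. rewrite EX.
  destruct k; unfold h.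
  + simpl. rewrite !Rmult_0_l, Ropp_0, exp_0. ring.
  + rewrite EX, EX1.
   replace (exp (- (INR (S k) * L * s))) with (exp (- (L * s)) * exp (- (INR k * L * s))) by (rewrite <- exp_plus; f_equal; rewrite S_INR; ring).
   rewrite RtoC_mult. ring. } induction k. specialize (Hh O). apply Ceq_minus. auto. specialize (Hh (S k)).
   apply Ceq_minus in Hh. rewrite Hh, IHk; fin.
Qed.

(** What the explicit formula provides about an entire function [E = (s-1)^m L] with zero divisor [n]; [Lam] are the coefficients of [-L'/L] and [W] a weight for which the sums over the zeros converge. *)
Definition EFdata (E : C -> C) (m : nat) (Lam : nat -> C) (n : C -> nat) : Prop :=
  (forall z, is_ord E z (n z)) /\
  (forall H a b LH, test H a b -> 1 < a -> cser (fun j => Lam (S j) * H (INR (S j)))%C LH ->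
     SumDiv (fun z => INR (n z)) (MT H a b) (CN m * MT H a b 1 - LH)%C) /\
  exists (W : C -> R) (M : R), (forall z, 0 <= W z) /\ (forall l, NoDup l -> lsumR (fun z => INR (n z) * W z) l <= M) /\
    forall H a b, test H a b -> 1 < a -> exists A, forall z, n z <> O -> Cmod (MT H a b z) <= A * W z.

Lemma EFdata_intro E L a Lam m K N : Entire E -> 0 <= K -> (forall z, Cmod (E z) <= exp (K * (1 + Cmod z) ^ N)) ->
  (forall z, 1 < Re z -> E z = (cpown (z - 1) m * L z)%C) -> (forall z, 5 <= Re z -> cser (dterm a z) (L z)) -> (forall z, 3 < Re z -> L z <> RtoC 0) ->
  PB a 3 -> PB Lam 3 -> (forall n, flog a (S n) = conv Lam a (S n)) -> exists n, EFdata E m Lam n.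
Proof.
 intros HE HK Hg HEL Ha HL PA PL HC. assert (Enz : forall z, 3 < Re z -> E z <> RtoC 0). { intros z Hz.
 rewrite HEL by lra. apply Cmult_neq_0; auto. apply Cpow_nz. intros X. apply (f_equal Re) in X. rewrite re_minus in X.
 simpl in X. lra. } assert (On : forall z, exists k, is_ord E z k). { intros z. apply ord_exists; auto. exists (RtoC 4).
 apply Enz. simpl; lra. } set (n := fun z => proj1_sig (constructive_indefinite_description _ (On z))).
 assert (Hn : forall z, is_ord E z (n z)) by (intros z; apply (proj2_sig (constructive_indefinite_description _ (On z)))).
 set (E' := fun z => proj1_sig (constructive_indefinite_description _ (HE z))).
 assert (HE' : forall z, cdiff E z (E' z)) by (intros z; apply (proj2_sig (constructive_indefinite_description _ (HE z)))).
 (* The abscissa 16 is a generous choice: zeros satisfy [Re z <= 3], and [logderiv_series] with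
    [A = 3] asks for [Re s >= 8]. *)
 assert (Hz : forall z, n z <> O -> Re z <= 16 - 3). { intros z H. destruct (Rle_dec (Re z) (16 - 3)); auto. exfalso.
 apply H. apply (ord_unique E z); auto. apply ord_zero_iff; auto. apply Enz. lra. }
 destruct (PB_abs Lam 3 PL) as [B [_ HB]]. assert (S16 : 3 < 16) by lra.
 assert (HL' : forall i : nat, exists l, cser (fun j => Lam (S j) * cpowR (INR (S j)) (- RtoC (16 + INR i)))%C l /\ (E' (RtoC (16 + INR i)) / E (RtoC (16 + INR i)))%C = (CN m / (RtoC (16 + INR i) - 1) - l)%C).
 { intros i. pose proof (pos_INR i).
 apply (logderiv_series E L (E' (RtoC (16 + INR i))) a Lam 3 m (RtoC (16 + INR i))); auto.
 intros z Hz0; apply Ha; simpl in Hz0; lra. simpl; lra. apply HL. simpl; lra. } exists n. split; [exact Hn|split].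
 - intros H a0 b0 LH HT Ha0 HLH. apply (explicit_formula E E' n K N m Lam 16 B); auto. intros J. apply HB. simpl; lra.
 - destruct (zeros_weight E n K N 16 HE Hn HK Hg S16 Hz) as [M HM].
  exists (fun z => / (1 + Cmod (z - RtoC 16)) ^ (N + 1)), M. split; [|split; auto].
  + intros z. pos.
  + intros H a0 b0 HT Ha0. apply (MT_weight n N 16 Hz H a0 b0 HT Ha0).
Qed.

Lemma S2_growth (E : C -> C) : (exists A B : R, forall s, Cmod (E s) <= A * exp (Rpower (1 + Cmod s) B)) ->
  exists K N, 0 <= K /\ forall z, Cmod (E z) <= exp (K * (1 + Cmod z) ^ N).
Proof.
 intros [A [B H]]. destruct (nfloor_ex (Rmax 0 B) (Rmax_l _ _)) as [N0 HN]. pose proof (Rmax_r 0 B).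
 exists (Rabs A + 1), (S N0). pose proof (Rabs_pos A). split. lra. intros z. pose proof (Cmod_ge_0 z) as Z.
 set (x := 1 + Cmod z) in *. assert (1 <= x) by (unfold x; lra). assert (E1 : Rpower x B <= x ^ S N0). {
 rewrite <- Rpower_pow by lra. apply Rle_Rpower; auto. rewrite S_INR. lra. } assert (E2 : 1 <= x ^ S N0) by pos.
 le_trans H. le_via (exp (Rabs A) * exp (x ^ S N0)).
 - le_trans Rmult_le_compat_r. pos. apply Rle_abs. apply Rmult_le_compat; auto. pos. pose proof (exp_ineq1_le (Rabs A)).
  lra. fin.
 - rewrite <- exp_plus. apply exp_le. nra.
Qed.

(** [K x^N] is at most [x^(N+1) + K^(N+1)], according to whether [K <= x] or not. *)
Lemma growth_S2 (E : C -> C) K N : 0 <= K -> (forall z, Cmod (E z) <= exp (K * (1 + Cmod z) ^ N)) -> exists A B : R, forall s, Cmod (E s) <= A * exp (Rpower (1 + Cmod s) B).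
Proof.
 intros HK H. exists (exp (K ^ S N)), (INR (S N)). intros s. pose proof (Cmod_ge_0 s). set (x := 1 + Cmod s) in *.
 le_trans H. fold x. rewrite Rpower_pow by (unfold x; lra). rewrite <- exp_plus. apply exp_le.
 assert (x0 : 0 <= x) by (unfold x; lra). pose proof (pow_le x N x0). pose proof (pow_le K N HK). simpl.
 destruct (Rle_dec K x). nra. assert (x ^ N <= K ^ N) by fin. nra.
Qed.

(** Minimality of [m]: a zero of [E] at [1] could be divided out. *)
Lemma mL_nonvanish a m E : is_mL a m -> S2_with a m E -> m <> O -> E (RtoC 1) <> RtoC 0.
Proof.
 intros [_ Hmin] [H1 [H2 H3]] Hm E0. destruct m as [|m']; [lia|].
 assert (G : exists E1, Entire E1 /\ forall z, E z = ((z - 1) * E1 z)%C). { apply Entire_iff in H1.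
 destruct (classic (exists z, E z <> RtoC 0)) as [Hex|Hn].
 - destruct (ord_exists E (RtoC 1) H1 Hex) as [k [g [G1 [G2 G3]]]]. destruct k.
  + exfalso. apply G2. rewrite <- E0, G3. ring.
  + exists (fun z => (z - 1) ^ k * g z)%C. split. fin. intros z. rewrite G3. simpl. ring.
 - exists (fun _ => RtoC 0). split. fin. intros z. replace (E z) with (RtoC 0). ring. apply NNPP; fin. }
  destruct G as [E1 [G1 G2]]. apply S2_growth in H2. destruct H2 as [K [N [K0 HK]]].
  assert (L : (S m' <= m')%nat); [|lia]. apply (Hmin m' E1). split; [|split].
 - apply Entire_iff; auto.
 (* Off the unit disc about 1 the division by [z - 1] costs nothing. A circle of radius 2, used
    twice if necessary, reaches such points; moduli increase by at most 4, whence the factor 5. *)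
 - apply (growth_S2 E1 (K * 5 ^ N) N). pos. intros z. apply (Entire_mean E1 z 2 G1 ltac:(lra)).
  assert (Far : forall v, 1 <= Cmod (v - 1)%C -> Cmod (E1 v) <= exp (K * (1 + Cmod v) ^ N)). { intros v Hv.
  le_trans2 HK. rewrite G2, Cmod_mult. pose proof (Cmod_ge_0 (E1 v)). nra. }
  assert (Near : forall z x, 1 <= x -> Cmod z <= 5 * x - 1 -> exp (K * (1 + Cmod z) ^ N) <= exp (K * 5 ^ N * x ^ N)). {
  clear -K0. intros z x Hx Hz. rewrite Rmult_assoc, <- Rpow_mult_distr; fin. } intros v Hv. pose proof (Cmod_ge_0 z).
  destruct (Rle_dec 1 (Cmod (v - 1)%C)) as [Hf|Hf].
  + eapply Rle_trans. auto. apply Near. lra. pose proof (Cmod_triangle (v - z) z) as T.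
   replace (v - z + z)%C with v in T by ring. lra.
  + apply (Entire_mean E1 v 2 G1 ltac:(lra)). intros w Hw. assert (1 <= Cmod (w - 1)%C). {
   pose proof (Cmod_triangle (w - 1) (1 - v)) as T. replace (w - 1 + (1 - v))%C with (w - v)%C in T by ring.
   rewrite (Cmod_minus_sym 1 v) in T. lra. } eapply Rle_trans. auto. apply Near. lra.
   pose proof (Cmod_triangle (w - v) (v - z + z)) as T1. replace (w - v + (v - z + z))%C with w in T1 by ring.
   pose proof (Cmod_triangle (v - z) z). lra.
 - intros s l Hs Hl. pose proof (H3 s l Hs Hl) as X. rewrite G2 in X. simpl in X. assert (S1 : (s - 1)%C <> RtoC 0). {
  intros Y. apply (f_equal Re) in Y. rewrite re_minus in Y. simpl in Y. lra. }
  replace (E1 s) with ((s - 1) * E1 s / (s - 1))%C by (field; auto). rewrite X. field. auto.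
Qed.

(** The coefficients [b n ln n] of [-L'/L] come from (S5) and are identified with [phi(n) vM(n)]
    through the convolution identity. The exponential in (S5) also gives the nonvanishing. *)
Lemma phi_EFdata phi m E : CL 1 phi -> S2_with (coef phi) m E ->
  (exists n, EFdata E m (fun n => phi (INR n) * RtoC (vM n))%C n) /\ Entire E /\ (forall z, 3 < Re z -> E z <> RtoC 0).
Proof.
 intros [_ [[K [K0 HK]] [[HS1 [_ [[b [B1 [[th [Kb [Hth B2]]] B3]]] _]]] HE1]]] [HE [HG HE2]]. apply Entire_iff in HE.
 destruct (S2_growth E HG) as [Kg [N [Kg0 HKg]]]. set (a := coef phi) in *. assert (PA2 : PB a 2). { exists K. split.
 lra. intros n. apply HK; fin. } assert (PB2 : PB b 1). { exists (Rmax 0 Kb). split. fin. intros n. eapply Rle_trans.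
 apply B2; lia. assert (X : 1 <= INR (S n)) by fin. apply Rmult_le_compat. 2: left; pos. 2: apply Rmax_r.
 - specialize (B2 (S n) ltac:(lia)). pose proof (Cmod_ge_0 (b (S n))).
  apply Rmult_le_reg_r with (Rpower (INR (S n)) th); fin.
 - rewrite <- (Rpower_pow 1) by lra. apply Rle_Rpower; auto. simpl; lra. }
  assert (EL : forall z, exists l, 1 < Re z -> is_series (dterm a z) l). { intros z.
  destruct (Rlt_dec 1 (Re z)) as [H|H]. 2: exists (RtoC 0); intros; lra.
  destruct (ex_series_le (V := C_CompleteNormedModule) (dterm a z) (fun n => Cmod (dterm a z n))) as [l Hl]; auto.
  intros; apply Rle_refl. fin. } set (L := fun z => proj1_sig (constructive_indefinite_description _ (EL z))).
  assert (HL : forall z, 1 < Re z -> is_series (dterm a z) (L z)) by (intros z; apply (proj2_sig (constructive_indefinite_description _ (EL z)))).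
  assert (ELb : forall z, exists lb, 1 < Re z -> is_series (dterm b z) lb /\ L z = cexp lb). { intros z.
  destruct (Rlt_dec 1 (Re z)) as [H|H]. 2: exists (RtoC 0); intros; lra.
  destruct (B3 z (L z) H (HL z H)) as [lb Hlb]; fin. }
  set (Lb := fun z => proj1_sig (constructive_indefinite_description _ (ELb z))).
  assert (HLb : forall z, 1 < Re z -> is_series (dterm b z) (Lb z) /\ L z = cexp (Lb z)) by (intros z; apply (proj2_sig (constructive_indefinite_description _ (ELb z)))).
  assert (HL' : forall z, 1 < Re z -> cser (dterm a z) (L z)) by (intros; apply is_series_cser; auto).
  assert (HEL : forall z, 1 < Re z -> E z = (cpown (z - 1) m * L z)%C) by fin.
  assert (Conv : forall n, flog a (S n) = conv (flog b) a (S n)). { apply (exp_deriv_conv L Lb a b 2); auto.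
  2: apply (PB_mono _ 1); auto. intros z Hz. destruct (HLb z Hz). split; auto. apply is_series_cser; auto. }
  pose proof (euler_rank1_powers a 2 PA2 HE1) as Pw. assert (A1 : a 1%nat = RtoC 1). { destruct (Pw 2%nat) as [c Hc].
  apply prime_2. specialize (Hc O); fin. } assert (VM : forall n, flog b (S n) = (a (S n) * RtoC (vM (S n)))%C). {
  apply conv_vM_prime_power; auto. intros n Hn. unfold flog. replace (b (S n)) with (RtoC 0). ring. apply NNPP; fin. }
  assert (Lnz : forall z, 3 < Re z -> L z <> RtoC 0). { intros z Hz. rewrite (proj2 (HLb z ltac:(lra))).
  apply cexp_neq_0. } split; [|split]; auto.
 - apply (EFdata_intro E L a _ m Kg N); auto.
  + intros z Hz. apply HL'. lra.
  + apply (PB_mono _ 2); auto.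
  + destruct PA2 as [Q [Q0 HQ]]. exists Q. split; auto. intros n.
   rewrite Cmod_mult, Cmod_R, Rabs_pos_eq by apply vM_bound. change (INR (S n) ^ 3) with (INR (S n) * INR (S n) ^ 2).
   rewrite (Rmult_comm (INR (S n))), <- Rmult_assoc. apply Rmult_le_compat; try apply vM_bound; fin.
  + intros n. rewrite Conv. apply csum_ext. intros j _. rewrite VM. auto.
 - intros z Hz. rewrite HEL by lra. apply Cmult_neq_0; auto. apply Cpow_nz. intros X. apply (f_equal Re) in X.
  rewrite re_minus in X. simpl in X. lra.
Qed.

Lemma zeta_EFdata Ez : zeta_ext Ez ->
  (exists n, EFdata Ez 1 (fun n => RtoC (vM n)) n) /\ (forall z, 3 < Re z -> Ez z <> RtoC 0).
Proof.
 intros HEz. destruct (zeta_growth Ez HEz) as [K [K0 HK]]. pose proof (Ez_entire Ez HEz) as HE.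
 set (a := fun _ : nat => RtoC 1). set (L := fun z => (Ez z / (z - 1))%C).
 assert (HS : forall z, 1 < Re z -> (z - 1)%C <> RtoC 0). { intros z Hz X. apply (f_equal Re) in X.
 rewrite re_minus in X. simpl in X. lra. } assert (PA : PB a 0). { exists 1. split. lra. intros n. unfold a.
 rewrite Cmod_1; fin. } assert (Ser : forall z, 2 <= Re z -> cser (dterm a z) (L z)). { intros z Hz.
 destruct (PB_cser a 0 z PA ltac:(simpl; lra)) as [l Hl]. unfold L.
 rewrite (proj2 HEz z l ltac:(lra) (proj2 (is_series_cser _ _) Hl)). replace ((z - 1) * l / (z - 1))%C with l; auto.
 field. apply HS; lra. } assert (Lnz : forall z, 3 < Re z -> L z <> RtoC 0). { intros z Hz E.
 specialize (Ser z ltac:(lra)). rewrite E in Ser.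
 (* For [n >= 2] one has [|n^(-z)| <= n^(-3) <= n^(-2) / 2], and these squares sum to at most 1; so
    the first term 1 cannot be cancelled. *)
 assert (T : forall n, rsum n (fun j => Cmod (dterm a z (S j))) <= / 2). { intros n. pose proof (inv_sq_sum (S n)) as I.
 rewrite (rsum_split 1 (S n)) in I by lia. replace (S n - 1)%nat with n in I by lia. simpl (rsum 1 _) in I.
 le_via (/ 2 * rsum n (fun j => / INR (S (1 + j)) ^ 2)).
 - rewrite <- rsum_scal. apply rsum_le. intros j _. rewrite dterm_Cmod. unfold a. rewrite Cmod_1, Rmult_1_l.
  pose proof (ln_INR_bounds (S j)). replace (- Re z * ln (INR (S (S j)))) with (- (Re z * ln (INR (S (S j))))) by ring.
  rewrite exp_Ropp, <- Rinv_mult. apply Rinv_le_contravar. pos. le_via (INR (S (S j)) ^ 3). le_mul_r. pos.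
  rewrite !S_INR. pose proof (pos_INR j). lra. rewrite INR_pow_exp. apply exp_le. simpl (INR 3). nra.
 - lra. } assert (C1 : cser (fun j => dterm a z (S j)) (0 - dterm a z 0)%C). { intros e He.
  destruct (Ser e He) as [N HN]. exists N. intros n Hn. specialize (HN (S n) ltac:(lia)). rewrite csum_shift in HN.
  le_trans2 HN. right. f_equal. ring. } pose proof (cser_abs_bound _ _ _ T C1) as B. assert (D0 : dterm a z 0 = RtoC 1).
  { unfold dterm, a, cpowR. simpl (INR 1). rewrite ln_1, Cmult_0_r, cexp_0. ring. } rewrite D0 in B.
  replace (0 - 1)%C with (- (1))%C in B by ring. rewrite Cmod_opp, Cmod_1 in B. lra. } split.
 - apply (EFdata_intro Ez L a _ 1 K 2); auto.
  + intros z Hz. unfold L. simpl. field; fin.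
  + intros z Hz. apply Ser. lra.
  + apply (PB_mono _ 0); auto.
  + apply (PB_mono _ 1). lia. exists 1. split. lra. intros n. rewrite Cmod_R, Rabs_pos_eq by apply vM_bound.
   rewrite Rmult_1_l, pow_1. apply vM_bound.
  + symmetry. apply conv_vM_one.
 - intros z Hz E. apply (Lnz z Hz). unfold L. rewrite E. field. apply HS; lra.
Qed.

(** * Zeros of the completed function *)

Lemma Cconj_R x : Cconj (RtoC x) = RtoC x.
Proof. apply C_ext; simpl; ring. Qed.

Lemma ord_affine f a b w k : a <> RtoC 0 -> is_ord f (a * w + b)%C k -> is_ord (fun z => f (a * z + b)%C) w k.
Proof.
 intros Ha [g [G1 [G2 G3]]]. exists (fun z => a ^ k * g (a * z + b))%C. split; [|split].
 - fin.
 - pos.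
 - intros z. rewrite G3. replace (a * z + b - (a * w + b))%C with (a * (z - w))%C by ring. rewrite Cpow_mult_l. ring.
Qed.

(** The reflection in the functional equation; both conjugations together keep it holomorphic. *)
Definition sharp (f : C -> C) (s : C) : C := Cconj (f (1 - Cconj s)%C).

Lemma sharp_entire f : Entire f -> Entire (sharp f).
Proof.
 intros H z. destruct (H (1 - Cconj z)%C) as [l Hl]. exists (- Cconj l)%C. intros e He.
 destruct (Hl e He) as [d [Hd K]]. exists d. split; auto. intros w Hw.
 assert (E : ((1 - Cconj w) - (1 - Cconj z))%C = (- Cconj (w - z))%C) by (rewrite Cminus_conj; ring).
 specialize (K (1 - Cconj w)%C). rewrite E, Cmod_opp, Cmod_conj in K. eapply Rle_trans. 2: apply K; auto. right.
 rewrite <- (Cmod_conj (f _ - _ - _)%C). f_equal. unfold sharp.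
 rewrite !Cminus_conj, Cmult_conj, Copp_conj, !Cminus_conj, !Cconj_conj. ring.
Qed.

Lemma sharp_ord f w k : is_ord f (1 - Cconj w)%C k -> is_ord (sharp f) w k.
Proof.
 intros [g [G1 [G2 G3]]]. exists (fun z => (- (1)) ^ k * sharp g z)%C. split; [|split].
 - apply Entire_mult. fin. apply sharp_entire; auto.
 - apply Cmult_neq_0. apply Cpow_nz. intros X. apply (f_equal Re) in X. simpl in X. lra. unfold sharp. intros X.
  apply G2. rewrite <- (Cconj_conj (g _)), X. apply Cconj_R.
 - intros z. unfold sharp. rewrite G3, Cmult_conj, Cpow_conj.
  replace (Cconj (1 - Cconj z - (1 - Cconj w))) with (- (1) * (z - w))%C by (rewrite !Cminus_conj, !Cconj_conj; ring).
  rewrite Cpow_mult_l. ring.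
Qed.

Lemma cprod_inv k F G : (forall j, (j < k)%nat -> F j = (/ G j)%C /\ G j <> RtoC 0) -> cprod k F = (/ cprod k G)%C.
Proof.
 induction k; intros H. simpl. field. rewrite !cprod_S, IHk by fin. destruct (H k ltac:(lia)) as [-> H2]. field.
 split; auto. apply cprod_neq_0. intros; apply H; lia.
Qed.

Section Star.
Variables (E : C -> C) (m : nat) (Q : R) (r : nat) (lam : nat -> R) (mu : nat -> C) (om : C) (n : C -> nat).
Hypothesis HE : Entire E.
Hypothesis Hn : forall z, is_ord E z (n z).
Hypothesis H3 : S3_with m E Q r lam mu om.
Hypothesis Hm : m <> O -> E (RtoC 1) <> RtoC 0.
Hypothesis Hnz : forall z, 3 < Re z -> E z <> RtoC 0.

(** Number of Gamma factors with a pole at [z]; all poles being simple, it is the order of the pole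
    of their product. *)
Fixpoint gam (k : nat) (z : C) : nat :=
  match k with O => O | S k' => (gam k' z + if excluded_middle_informative (npint (RtoC (lam k') * z + mu k')%C) then 1 else 0)%nat end.
Definition gD (k : nat) (s : C) : C := cprod k (fun j => GP (RtoC (lam j) * s + mu j)%C).
Definition Dm (s : C) : C := (gD r s * (s - 1) ^ m)%C.
Definition As (s : C) : C := (cpowR Q s * E s)%C.
Definition pole1 (z : C) : nat := if Ceq_dec z (RtoC 1) then m else O.
(** Subtraction of natural numbers is truncated, so a pole of the completed function counts as order
    0. *)
Definition ordL (z : C) : nat := (n z - (gam r z + pole1 z))%nat.

Lemma lam_neq j : (j < r)%nat -> RtoC (lam j) <> RtoC 0.
Proof. intros Hj X. apply (f_equal Re) in X. simpl in X. destruct H3 as [_ [_ [H _]]]. specialize (H j Hj). lra. Qed.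

Lemma gD_ord k z : (k <= r)%nat -> is_ord (gD k) z (gam k z).
Proof.
 induction k; intros Hk; unfold gD.
 - exists (fun _ => RtoC 1). split. fin. split. pos. intros z0. simpl. ring.
 - apply ord_mult. apply IHk; lia. apply ord_affine. apply lam_neq; lia. apply GP_ord.
Qed.

Lemma pow1_ord z : is_ord (fun s => (s - 1) ^ m)%C z (pole1 z).
Proof.
 unfold pole1. destruct (Ceq_dec z (RtoC 1)) as [->|Hz].
 - exists (fun _ => RtoC 1). split. fin. split. pos. intros; ring.
 - apply ord_zero_iff. fin. apply Cpow_nz. intros X. apply Hz. apply Ceq_minus; auto.
Qed.

Lemma Dm_ord z : is_ord Dm z (gam r z + pole1 z).
Proof. apply ord_mult. apply gD_ord; auto. apply pow1_ord. Qed.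

Lemma As_ord z : is_ord As z (n z).
Proof. change (n z) with (0 + n z)%nat. apply ord_mult; auto. apply ord_zero_iff. fin. apply cpow_neq_0. Qed.

Lemma ord_entire f z k : is_ord f z k -> Entire f.
Proof. intros [g [G1 [G2 G3]]]. apply (Entire_ext (fun s => (s - z) ^ k * g s)%C); fin. Qed.

Lemma ord_punctured f w k : is_ord f w k -> exists d, 0 < d /\ forall z, 0 < Cmod (z - w) < d -> f z <> RtoC 0.
Proof.
 intros [g [G1 [G2 G3]]]. destruct (Entire_nz_near g w G1 G2) as [d [Hd K]]. exists d. split; auto. intros z Hz.
 rewrite G3. apply Cmult_neq_0. apply Cpow_nz, Cmod_gt_0. lra. apply K; lra.
Qed.

Lemma regular_near w : exists d, 0 < d /\ forall z, 0 < Cmod (z - w) < d -> regular_pt r lam mu z.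
Proof.
 destruct (ord_punctured (gD r) w _ (gD_ord r w (le_n _))) as [d1 [D1 K1]].
 assert (O1 : exists k, is_ord (fun s => s - 1)%C w k). { apply ord_exists. fin. exists (RtoC 2). intros X.
 apply (f_equal Re) in X. simpl in X. lra. } destruct O1 as [k Hk]. destruct (ord_punctured _ w _ Hk) as [d2 [D2 K2]].
 exists (Rmin d1 d2). split. pos. intros z Hz. pose proof (Rmin_l d1 d2). pose proof (Rmin_r d1 d2).
 specialize (K1 z ltac:(lra)). specialize (K2 z ltac:(lra)). split.
 - intros ->. apply K2. ring.
 - intros j Hj Hp. apply K1. unfold gD. assert (G : GP (RtoC (lam j) * z + mu j)%C = RtoC 0). {
  destruct (GP_ord_pole _ Hp) as [g [G1 [G2 G3]]]. rewrite G3. ring. } clear -G Hj. induction r as [|k IHk]; [lia|].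
  rewrite cprod_S. destruct (Nat.eq_dec j k) as [<-|]. rewrite G. ring. rewrite IHk by lia. ring.
Qed.

Lemma regular_Dm s : regular_pt r lam mu s -> Dm s <> RtoC 0.
Proof.
 intros [H1 H2]. apply Cmult_neq_0. apply cprod_neq_0. intros j Hj. apply GP_neq_0. auto. apply Cpow_nz. intros X.
 apply H1, Ceq_minus. auto.
Qed.

Lemma Lstar_quot s : regular_pt r lam mu s -> Lstar m E Q r lam mu s = (As s / Dm s)%C.
Proof.
 intros Hs. pose proof (regular_Dm s Hs) as D. destruct Hs as [H1 H2]. unfold Lstar, Lcont, As.
 rewrite (cprod_inv r _ (fun j => GP (RtoC (lam j) * s + mu j)%C)). 2:{ split. apply CGamma_GP; fin.
 apply GP_neq_0; fin. } change (cpown (s - 1) m) with ((s - 1) ^ m)%C. unfold Dm in *. fold (gD r s). field. split.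
 apply Cpow_nz. intros X. apply H1, Ceq_minus. auto. intros X. apply D. rewrite X. ring.
Qed.

(** The functional equation with denominators cleared. Both sides are entire, so it holds everywhere
    once it holds near one point. *)
Lemma FE_entire s : (As s * sharp Dm s)%C = (om * sharp As s * Dm s)%C.
Proof.
 assert (EA : Entire As) by fin. assert (ED : Entire Dm) by (apply (ord_entire _ _ _ (Dm_ord 0))).
 (* Regularity is required at [s] and at its reflection; near 0 the reflection is near 1. *)
 destruct (regular_near 0) as [d1 [D1 K1]]. destruct (regular_near 1) as [d2 [D2 K2]].
 apply (punctured_eq (fun s => As s * sharp Dm s)%C (fun s => om * sharp As s * Dm s)%C 0 (Rmin d1 d2)).
 - apply Entire_mult; auto. apply sharp_entire; auto.
 - apply Entire_mult; auto. apply Entire_mult. fin. apply sharp_entire; auto.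
 - pos.
 - intros z Hz. pose proof (Rmin_l d1 d2). pose proof (Rmin_r d1 d2). replace (z - 0)%C with z in Hz by ring.
  assert (R1 : regular_pt r lam mu z) by (apply K1; replace (z - 0)%C with z by ring; lra).
  assert (R2 : regular_pt r lam mu (1 - Cconj z)%C). { apply K2. replace (1 - Cconj z - 1)%C with (- Cconj z)%C by ring.
  rewrite Cmod_opp, Cmod_conj. lra. } pose proof (regular_Dm z R1) as N1. pose proof (regular_Dm _ R2) as N2.
  destruct H3 as [_ [_ [_ [_ FE]]]]. specialize (FE z R1 R2). rewrite !Lstar_quot in FE by auto.
  assert (N3 : sharp Dm z <> RtoC 0). { unfold sharp. intros X. apply N2. rewrite <- (Cconj_conj (Dm _)), X.
  apply Cconj_R. } assert (FE' : (As z / Dm z)%C = (om * (sharp As z / sharp Dm z))%C). { rewrite FE. unfold Cdiv.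
  rewrite Cmult_conj, Cinv_conj by auto; fin. }
  replace (As z * sharp Dm z)%C with (As z / Dm z * Dm z * sharp Dm z)%C by (field; auto). rewrite FE'. field. auto.
Qed.

Lemma om_neq : om <> RtoC 0.
Proof. intros X. destruct H3 as [_ [_ [_ [H _]]]]. rewrite X, Cmod_0 in H. lra. Qed.

Lemma FE_ord z : (n z + (gam r (RtoC 1 - Cconj z)%C + pole1 (RtoC 1 - Cconj z)%C) = n (RtoC 1 - Cconj z)%C + (gam r z + pole1 z))%nat.
Proof.
 eapply ord_unique. apply ord_mult. apply As_ord. apply sharp_ord, Dm_ord.
 apply (ord_ext (fun s => om * (sharp As s * Dm s))%C). intros s. rewrite FE_entire. ring.
 change (n (RtoC 1 - Cconj z)%C + (gam r z + pole1 z))%nat with (0 + (n (RtoC 1 - Cconj z)%C + (gam r z + pole1 z)))%nat.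
 apply ord_mult. apply ord_zero_iff. fin. apply om_neq. apply ord_mult. apply sharp_ord, As_ord. apply Dm_ord.
Qed.

(** Near [z] the completed function is [(s-z)^(n z)] over [(s-z)^(gam + pole)] times a unit, so
    positive order means that the truncated subtraction is exact. *)
Lemma Lstar_zeros z k : zero_of_order (Lstar m E Q r lam mu) z k <-> (1 <= k)%nat /\ k = ordL z.
Proof.
 destruct (As_ord z) as [g1 [A1 [A2 A3]]]. destruct (Dm_ord z) as [g2 [B1 [B2 B3]]].
 destruct (regular_near z) as [d [Hd K]]. destruct (Entire_nz_near g2 z B1 B2) as [d' [Hd' K']].
 pose proof (Rmin_l d d') as ML. pose proof (Rmin_r d d') as MR. set (d0 := Rmin d d') in *.
 assert (D0 : 0 < d0) by (apply Rmin_pos; auto).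
 assert (Lq : forall s, 0 < Cmod (s - z) < d0 -> ((s - z) ^ (gam r z + pole1 z) * g2 s * Lstar m E Q r lam mu s = (s - z) ^ n z * g1 s)%C).
 { intros s Hs. assert (R1 : regular_pt r lam mu s) by (apply K; lra). rewrite Lstar_quot, <- B3, <- A3 by auto. field.
 apply regular_Dm; auto. } unfold ordL. split.
 - intros [Hk [r0 [g [R0 [G1 [G2 G3]]]]]]. assert (E0 : (n z = k + (gam r z + pole1 z))%nat); [|lia].
  apply (pow_unit_eq g1 (fun s => g s * g2 s)%C z _ _ (Rmin d0 r0)); auto.
  + pos.
  + fin.
  + apply ccont_mult. destruct (proj1 (holo_at_iff _ _) (G1 z ltac:(rewrite Cmod_self; lra))) as [l Hl].
   eapply cdiff_ccont; eauto. fin.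
  + pos.
  + intros s Hs. pose proof (Rmin_l d0 r0). pose proof (Rmin_r d0 r0). rewrite <- Lq, G3 by lra.
   rewrite (Cpow_add_r _ k). change (cpown (s - z) k) with ((s - z) ^ k)%C. ring.
 - intros [Hk Ek]. split; auto. exists d0, (fun s => g1 s / g2 s)%C. split; [|split; [|split]]; auto.
  + intros s Hs. apply holo_at_iff. destruct (A1 s) as [l1 L1]. destruct (B1 s) as [l2 L2]. eexists.
   apply cdiff_div; eauto. apply K'; lra.
  + pos.
  + intros s Hs. assert (Z : (s - z)%C <> RtoC 0) by (apply Cmod_gt_0; lra).
   assert (N2 : g2 s <> RtoC 0) by (apply K'; lra). assert (P : ((s - z) ^ (gam r z + pole1 z))%C <> RtoC 0) by pos.
   specialize (Lq s Hs). assert (En : n z = (gam r z + pole1 z + k)%nat) by lia.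
   rewrite En, (Cpow_add_r _ (gam r z + pole1 z)) in Lq. change (cpown (s - z) k) with ((s - z) ^ k)%C.
   replace (Lstar m E Q r lam mu s) with ((s - z) ^ (gam r z + pole1 z) * g2 s * Lstar m E Q r lam mu s / ((s - z) ^ (gam r z + pole1 z) * g2 s))%C by (field; auto).
   rewrite Lq. field. auto.
Qed.

Lemma gam_right z : 0 < Re z -> gam r z = O.
Proof.
 intros Hz. assert (G : forall k, (k <= r)%nat -> gam k z = O). { induction k; intros Hk; auto. simpl.
 rewrite IHk by lia. destruct (excluded_middle_informative (npint (RtoC (lam k) * z + mu k)%C)) as [X|X]; auto. exfalso.
 revert X. apply not_npint_pos. destruct H3 as [_ [_ [L _]]]. destruct (L k ltac:(lia)). rewrite re_plus.
 replace (Re (RtoC (lam k) * z)%C) with (lam k * Re z) by (destruct z; simpl; ring). nra. } auto.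
Qed.

Lemma refl_one z : (1 - Cconj z)%C = RtoC 1 <-> z = RtoC 0.
Proof.
 split. intros X. assert (Cconj z = RtoC 0). { replace (Cconj z) with (1 - (1 - Cconj z))%C by ring. rewrite X. ring. }
 rewrite <- (Cconj_conj z), H. apply Cconj_R. intros ->. rewrite Cconj_R. ring.
Qed.

Lemma Re_refl z : Re (1 - Cconj z)%C = 1 - Re z.
Proof. auto. Qed.

Lemma n_right z : 3 < Re z -> n z = O.
Proof. intros Hz. apply (ord_unique E z); auto. apply ord_zero_iff; auto. Qed.

Lemma n_one : m <> O -> n (RtoC 1) = O.
Proof. intros H. apply (ord_unique E (RtoC 1)); auto. apply ord_zero_iff; auto. Qed.

(** Says where truncation matters. For [Re z > 0] there are no Gamma poles, and at 1 the function
    [E] does not vanish if [m > 0]. For [Re z <= 0] the functional equation bounds the Gamma poles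
    by zeros of [E], except at 0, where the pole at 1 is reflected and [gam] exceeds [n] by [m]. *)
Lemma ordL_eq z : INR (ordL z) = INR (n z) - INR (gam r z) + (if Ceq_dec z (RtoC 0) then INR m else 0).
Proof.
 assert (G : (ordL z + gam r z = n z + if Ceq_dec z (RtoC 0) then m else 0)%nat). { unfold ordL.
 destruct (Rlt_dec 0 (Re z)) as [Hz|Hz].
 - rewrite gam_right by auto. destruct (Ceq_dec z (RtoC 0)) as [->|_]. simpl in Hz; lra. unfold pole1.
  destruct (Ceq_dec z (RtoC 1)) as [->|_]; [|lia]. destruct (Nat.eq_dec m 0). lia. rewrite n_one by auto. lia.
 - pose proof (FE_ord z) as F. rewrite (gam_right (1 - Cconj z)%C) in F by (rewrite Re_refl; lra).
  assert (P1 : pole1 z = O). { unfold pole1. destruct (Ceq_dec z (RtoC 1)) as [->|_]; auto. simpl in Hz; lra. }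
  rewrite P1 in *. unfold pole1 in F.
  destruct (Ceq_dec (1 - Cconj z)%C (RtoC 1)) as [e|e]; destruct (Ceq_dec z (RtoC 0)) as [e0|e0]; rewrite refl_one in e; try tauto.
  + rewrite (proj2 (refl_one z) e) in F. destruct (Nat.eq_dec m 0) as [M|M]. lia. rewrite n_one in F by auto. lia.
  + lia. } apply (f_equal INR) in G. rewrite !plus_INR in G. destruct (Ceq_dec z (RtoC 0)); simpl in *; lra.
Qed.

Lemma ordL_le z : (ordL z <= n z)%nat. Proof. apply Nat.le_sub_l. Qed.

(** On the right [E] does not vanish; on the left the functional equation reduces to that. *)
Lemma ordL_strip z : ordL z <> O -> -2 <= Re z <= 3.
Proof.
 split; apply Rnot_lt_le; intros X; apply H; unfold ordL.
 - pose proof (FE_ord z) as F. rewrite (n_right (1 - Cconj z)%C) in F by (rewrite Re_refl; lra). lia.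
 - rewrite n_right by auto. lia.
Qed.
End Star.

(** * Sums over the poles of the Gamma factors *)

Definition ind (P : C -> Prop) (z : C) : R := if excluded_middle_informative (P z) then 1 else 0.

Lemma ind_range P z : 0 <= ind P z <= 1.
Proof. unfold ind. destruct (excluded_middle_informative (P z)); lra. Qed.

Lemma seq_lsum (zs : nat -> C) (Wt : C -> R) : (forall z, 0 <= Wt z) -> forall N l, NoDup l -> (forall z, In z l -> (exists n, z = zs n) -> exists n, (n < N)%nat /\ z = zs n) ->
  lsumR (fun z => ind (fun z => exists n, z = zs n) z * Wt z) l <= rsum N (fun n => Wt (zs n)).
Proof.
 intros HW. induction N; intros l Hl Hz.
 - le_via (lsumR (fun z => 0 * Wt z) l). 2: rewrite lsumR_scal; simpl; lra. apply lsumR_le. intros z Iz. unfold ind.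
  destruct (excluded_middle_informative (exists n, z = zs n)) as [e|e]; [|lra]. destruct (Hz z Iz e) as [k [Hk _]]. lia.
 - rewrite rsum_S. destruct (in_dec Ceq_dec (zs N) l) as [I|I].
  + apply in_split in I. destruct I as [l1 [l2 ->]]. pose proof (NoDup_remove_1 _ _ _ Hl) as N1.
   pose proof (NoDup_remove_2 _ _ _ Hl) as N2.
   rewrite (lsumR_perm _ _ (zs N :: l1 ++ l2)) by (symmetry; apply Permutation_middle).
   assert (IH : lsumR (fun z => ind (fun z => exists n, z = zs n) z * Wt z) (l1 ++ l2) <= rsum N (fun n => Wt (zs n))).
   { apply IHN; auto. intros z Iz e. destruct (Hz z) as [k [K1 K2]]; auto. apply in_app_iff in Iz. apply in_app_iff.
   simpl. tauto. exists k. split; auto. destruct (Nat.eq_dec k N); [|lia]. congruence. } simpl.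
   pose proof (ind_range (fun z => exists n, z = zs n) (zs N)). specialize (HW (zs N)). nra.
  + specialize (HW (zs N)). eapply Rle_trans. apply IHN; auto. 2: lra. intros z Iz e.
   destruct (Hz z Iz e) as [k [K1 K2]]. exists k. split; auto. destruct (Nat.eq_dec k N); [|lia]. congruence.
Qed.

Lemma list_index (zs : nat -> C) l : exists N, forall z, In z l -> (exists n, z = zs n) -> exists n, (n < N)%nat /\ z = zs n.
Proof.
 induction l as [|w l [N HN]]. exists O. intros z []. destruct (classic (exists n, w = zs n)) as [[k Hk]|H].
 - exists (max N (S k)). intros z [<-|Iz] e. exists k. split; auto. lia. destruct (HN z Iz e) as [j [J1 J2]]. exists j.
  split; auto. lia.
 - exists N. intros z [<-|Iz] e. tauto. auto.
Qed.

Lemma SD_seq (zs : nat -> C) (F : C -> C) q M : 0 <= q < 1 -> 0 <= M -> (forall n, Cmod (F (zs n)) <= M * q ^ n) ->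
  exists S, SumDiv (ind (fun z => exists n, z = zs n)) F S /\ Cmod S <= M / (1 - q).
Proof.
 intros Hq HM HF.
 assert (B : forall l, NoDup l -> lsumR (fun z => ind (fun z => exists n, z = zs n) z * Cmod (F z)) l <= M / (1 - q)). {
 intros l Hl. destruct (list_index zs l) as [N HN].
 le_trans (seq_lsum zs (fun z => Cmod (F z)) ltac:(intros; pos) N l Hl HN). le_via (M * rsum N (fun j => q ^ j)).
 rewrite <- rsum_scal. apply rsum_le; auto. le_mul_l; auto. apply geom_sum_le; auto. }
 destruct (SD_exists (ind (fun z => exists n, z = zs n)) F (fun z => Cmod (F z)) (M / (1 - q))) as [S HS]; auto.
 - apply ind_range.
 - intros; lra.
 - exists S. split; auto. apply le_epsilon. intros e He. destruct (HS e He) as [l0 [N0 H0]].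
  specialize (H0 l0 N0 (incl_refl _)).
  replace S with (wsum (ind (fun z => exists n, z = zs n)) F l0 - (wsum (ind (fun z => exists n, z = zs n)) F l0 - S))%C by ring.
  le_trans Cmod_minus_le. apply Rplus_le_compat; auto. le_trans lsumC_Cmod. le_trans2 ((B l0 N0)). apply lsumR_le.
  intros z _. rewrite Cmod_mult, Cmod_R, Rabs_pos_eq by apply ind_range. lra.
Qed.

Lemma MT_bound H a b M kap z t : test H a b -> 2 <= a -> 0 <= M -> (forall u, a <= u <= b -> Cmod (H u) <= M * u ^ kap) -> Re z + INR kap <= - t -> 0 <= t ->
  Cmod (MT H a b z) <= M * ln (b / a) * exp (- (t * ln 2)).
Proof.
 intros HT Ha HM HH Hz Ht. pose proof (test_rcont H a b z HT) as Hc. destruct HT as [_ [a0 [ab _]]].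
 assert (I : is_RInt (fun u => M * exp (- (t * ln 2)) * / u) a b (M * exp (- (t * ln 2)) * ln b - M * exp (- (t * ln 2)) * ln a)).
 {
 apply (is_RInt_derive (fun u => M * exp (- (t * ln 2)) * ln u)); intros u Hu; rewrite Rmin_left, Rmax_right in Hu by auto.
 auto_derive; lra. apply (ex_derive_continuous (fun u => M * exp (- (t * ln 2)) * / u)). auto_derive; lra. }
 eapply Rle_trans. eapply is_CI_bound. apply ab. 2: apply is_CI_cont, Hc. 2: apply I.
 - intros u Hu. assert (u0 : 0 < u) by lra. cbv beta. rewrite Cmod_mult, Cmod_cpow. assert (L2 : ln 2 <= ln u) by fin.
  assert (L0 : 0 <= ln 2) by pos. le_via (M * u ^ kap * exp (Re (z - 1)%C * ln u)). fin.
  rewrite <- (exp_ln u) at 1 by auto. rewrite exp_pow_n, !Rmult_assoc, <- exp_plus. le_mul_l; auto.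
  rewrite <- (exp_ln u) at 3 by auto. rewrite <- exp_Ropp, <- exp_plus. apply exp_le. rewrite re_minus. simpl (Re 1).
  nra.
 - right. rewrite ln_div by lra. ring.
Qed.

Lemma MT_scale H a b c z : test H a b -> 0 < c -> MT (fun v => H (/ c * v)) (c * a) (c * b) z = (cpowR c z * MT H a b z)%C.
Proof.
 intros HT Hc. pose proof (test_rcont H a b z HT) as R1. destruct HT as [HC [a0 [ab _]]]. unfold MT.
 rewrite <- CI_scal by auto. set (f := fun v => (H (/ c * v)%R * cpowR v (z - 1))%C).
 assert (S : is_CI (fun u => RtoC c * f (c * u)%R)%C a b (CI f (c * a) (c * b))). {
 apply (is_CI_subst f (fun u => c * u) (fun _ => c)); intros u Hu; rewrite Rmin_left, Rmax_right in Hu by auto.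
 - assert (0 < c * u) by nra. apply rcont_mult. apply (CkP_rcont O (fun v => H (/ c * v))); auto.
  apply CkP_comp_scale; fin. eapply rdiff_rcont, rdiff_cpow; auto.
 - split. auto_derive; auto; ring. apply continuous_const. } apply is_CI_unique in S. rewrite <- S. apply CI_ext.
  intros u Hu. rewrite Rmin_left in Hu by auto. unfold f. rewrite <- Rmult_assoc, Rinv_l, Rmult_1_l by lra.
  rewrite cpow_mult_base by lra.
  replace (cpowR c z) with (cpowR c 1 * cpowR c (z - 1))%C by (rewrite <- cpow_plus; f_equal; ring).
  rewrite cpow_1 by auto. ring.
Qed.

Lemma test_scale H a b x : test H a b -> 0 < x -> test (fun u => H (x * u)) (a / x) (b / x).
Proof.
 intros [H1 [H2 [H3 H4]]] Hx. split; [|split; [|split]].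
 - intros k. apply CkP_comp_scale; auto.
 - pos.
 - fin.
 - intros u Hu Hd. apply H4. nra. destruct Hd as [Hd|Hd]; [left|right].
  + apply Rmult_lt_reg_r with (/ x). pos. replace (x * u * / x) with u by (field; lra). auto.
  + apply Rmult_lt_reg_r with (/ x). pos. replace (x * u * / x) with u by (field; lra). auto.
Qed.

Lemma test_ln H a b : test H a b -> 0 <= ln (b / a).
Proof.
 intros [_ [a0 [ab _]]]. rewrite <- ln_1. apply Rcomplements.ln_le. lra. apply Rmult_le_reg_r with a. lra. unfold Rdiv.
 rewrite Rmult_assoc, Rinv_l; lra.
Qed.

Lemma int0inf_MT1 H a b : test H a b -> int0inf H = MT H a b 1.
Proof.
 intros HT. pose proof (test_rcont H a b 1 HT) as R1. destruct HT as [HC [a0 [ab H4]]].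
 apply (int0inf_support H a b); auto. eapply is_CI_ext. 2: apply is_CI_cont, R1. intros u _.
 replace (1 - 1)%C with (RtoC 0) by ring. rewrite cpow_0. ring.
Qed.

Lemma cser_finite u N : (forall j, (N <= j)%nat -> u j = RtoC 0) -> cser u (csum N u).
Proof.
 exists N. intros n Hn. replace (csum n u) with (csum N u). rewrite Cmod_self; lra. induction Hn; auto.
 rewrite csum_S, <- IHHn, H by auto. ring.
Qed.

(** * Sums over zeros of the completed function, and the comparison of the two formulas *)

Section StarSum.
Variables (E : C -> C) (m : nat) (Q : R) (r : nat) (lam : nat -> R) (mu : nat -> C) (om : C) (n : C -> nat) (Lam : nat -> C).
Hypothesis HE : Entire E.
Hypothesis HD : EFdata E m Lam n.
Hypothesis H3 : S3_with m E Q r lam mu om.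
Hypothesis Hm : m <> O -> E (RtoC 1) <> RtoC 0.
Hypothesis Hnz : forall z, 3 < Re z -> E z <> RtoC 0.

Let Hn : forall z, is_ord E z (n z) := proj1 HD.
Let oL := ordL m r lam mu n.

(** The weight bound is available only for supports to the right of 1. Rescaling by [c = 2/a] costs
    [c^(-Re z)], which is bounded because the zeros lie in the strip of [ordL_strip]. *)
Lemma Lstar_sum_ex H a b : test H a b -> exists S, SumDiv (fun z => INR (oL z)) (MT H a b) S.
Proof.
 intros HT. pose proof HD as HD0. destruct HD0 as [_ [_ [Wt [M [W0 [WM WT]]]]]]. assert (a0 : 0 < a) by apply HT.
 set (c := 2 / a). assert (c0 : 0 < c) by (apply Rdiv_lt_0_compat; lra).
 assert (HT' : test (fun v => H (/ c * v)) (c * a) (c * b)). { replace (c * a) with (a / / c) by (field; lra).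
 replace (c * b) with (b / / c) by (field; lra). apply test_scale; fin. } destruct (WT _ _ _ HT') as [A HA]. unfold c.
 replace (2 / a * a) with 2 by (field; lra). lra. set (Kc := exp (3 * Rabs (ln c)) * Rabs A). assert (K0 : 0 <= Kc). {
 apply Rmult_le_pos; fin. } apply (SD_exists _ _ (fun z => Kc * Wt z) (Kc * M)).
 - intros; pos.
 - intros l Hl. rewrite (lsumR_ext _ (fun z => Kc * (INR (oL z) * Wt z))) by (intros; ring). rewrite lsumR_scal.
  le_mul_l; auto. le_trans2 ((WM l Hl)). apply lsumR_le. intros z _. le_mul_r; auto. apply le_INR. apply ordL_le.
 - intros z Hz. assert (Hz' : oL z <> O) by (intros X; apply Hz; rewrite X; reflexivity).
  pose proof (ordL_strip E m Q r lam mu om n HE Hn H3 Hm Hnz z Hz') as St.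
  assert (Hnz' : n z <> O) by (pose proof (ordL_le m r lam mu n z); unfold oL in Hz'; lia). specialize (HA z Hnz').
  rewrite MT_scale, Cmod_mult, Cmod_cpow in HA by auto.
  replace (Cmod (MT H a b z)) with (exp (- (Re z * ln c)) * (exp (Re z * ln c) * Cmod (MT H a b z))) by (rewrite <- Rmult_assoc, <- exp_plus, Rplus_opp_l, exp_0; ring).
  unfold Kc. rewrite Rmult_assoc. apply Rmult_le_compat. pos. pos.
  + apply exp_le. pose proof (Rle_abs (ln c)). pose proof (Rle_abs (- ln c)). rewrite Rabs_Ropp in *. nra.
  + le_trans HA. le_mul_r; auto. apply Rle_abs.
Qed.

(** [ordL_eq] expresses the divisor as that of [E], minus the Gamma poles, plus [m] times the point
    0; the three sums are added. *)
Lemma Lstar_sum_small H a b LH SG : test H a b -> 1 < a -> cser (fun j => Lam (S j) * H (INR (S j)))%C LH -> SumDiv (fun z => INR (gam lam mu r z)) (MT H a b) SG ->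
  SumDiv (fun z => INR (oL z)) (MT H a b) (CN m * MT H a b 1 - LH + - SG + CN m * MT H a b 0)%C.
Proof.
 intros HT Ha HL HG. pose proof HD as HD0. destruct HD0 as [_ [EF _]]. specialize (EF H a b LH HT Ha HL). eapply SD_ext.
 3: apply SD_plus; [apply SD_plus; [apply EF|]|].
 3: replace (- SG)%C with (RtoC (-1) * SG)%C by ring; apply SD_scal, HG. 3: apply SD_scal, SD_indicator.
 2: intros; reflexivity. intros z. rewrite (ordL_eq E m Q r lam mu om n HE Hn H3 Hm).
 destruct (Ceq_dec z (RtoC 0)) as [e|e]; destruct (Ceq_dec z 0) as [e'|e']; try contradiction; ring.
Qed.

Lemma Lstar_sum_zeros F F' S0 : (forall z, F z = F' z) -> SumDiv (fun z => INR (oL z)) F S0 -> sum_over_zeros (Lstar m E Q r lam mu) F' S0.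
Proof.
 intros HF HS. apply (SD_zeros _ _ oL (fun z => INR (oL z))); auto. apply (Lstar_zeros E m Q r lam mu om n Hn H3 Hm).
 eapply SD_ext. tauto. auto. auto.
Qed.

End StarSum.

(** The poles of one factor have real part at most [-j / lam], so for [u >= 2] the transforms decay
    geometrically with ratio [2^(-1/lam)]. The constant depends on the Gamma data only. *)
Lemma gamma_sums lam mu k : (forall j, (j < k)%nat -> 0 < lam j /\ 0 <= Re (mu j)) -> exists K, 0 <= K /\ forall H a b M, test H a b -> 2 <= a -> 0 <= M -> (forall u, a <= u <= b -> Cmod (H u) <= M) ->
  exists SG, SumDiv (fun z => INR (gam lam mu k z)) (MT H a b) SG /\ Cmod SG <= K * (M * ln (b / a)).
Proof.
 induction k; intros L.
 - exists 0. split. lra. exists (RtoC 0). split. 2: rewrite Cmod_0; lra. exists nil. split. constructor. intros l _ _.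
  unfold wsum. rewrite (lsumC_ext _ (fun z => 0 * MT H a b z)%C) by fin. rewrite lsumC_scal, Cmult_0_l, Cmod_self. lra.
 - destruct (IHk ltac:(intros; apply L; lia)) as [K [K0 HK]]. destruct (L k ltac:(lia)) as [L1 L2].
  assert (Ln2 : 0 < ln 2) by (rewrite <- ln_1; apply ln_increasing; lra). set (q := exp (- (ln 2 / lam k))).
  assert (Hq : 0 <= q < 1) by (apply exp_neg_lt1, Rdiv_lt_0_compat; auto). exists (K + / (1 - q)). split. pos.
  intros H a b M HT Ha HM HH. destruct (HK H a b M HT Ha HM HH) as [SG [S1 S2]].
  set (zs := fun j => ((- CN j - mu k) / RtoC (lam k))%C). assert (Ln : RtoC (lam k) <> RtoC 0) by fin.
  pose proof (test_ln H a b HT) as Lab. destruct (SD_seq zs (MT H a b) q (M * ln (b / a)) Hq) as [S' [T1 T2]].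
  + pos.
  + intros j.
   assert (Ej : q ^ j = exp (- (INR j / lam k * ln 2))) by (unfold q; rewrite exp_pow_n; f_equal; field; lra).
   rewrite Ej. apply (MT_bound H a b M 0); auto.
   * intros u Hu. rewrite Rmult_1_r. auto.
   * simpl (INR 0). unfold zs, Cdiv. rewrite <- RtoC_inv by lra.
    replace (Re ((- CN j - mu k) * RtoC (/ lam k))%C) with ((- INR j - Re (mu k)) * / lam k) by (destruct (mu k); simpl; ring).
    assert (0 < / lam k) by pos. nra.
   * pos.
  + exists (SG + S')%C. split. 2: eapply Rle_trans; [apply Cmod_triangle|]; unfold Rdiv in T2; lra. eapply SD_ext.
   3: apply SD_plus; [apply S1|apply T1]. 2: reflexivity. intros z. simpl gam. rewrite plus_INR. unfold ind.
   assert (Eq : npint (RtoC (lam k) * z + mu k)%C <-> exists j, z = zs j). { split; intros [j Hj]; exists j; unfold zs.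
   replace (- CN j)%C with (RtoC (lam k) * z + mu k)%C by (rewrite Hj, RtoC_opp; auto). field; auto. rewrite Hj.
   unfold zs. rewrite RtoC_opp. field; auto. }
   destruct (excluded_middle_informative (exists j, z = zs j)); destruct (excluded_middle_informative (npint (RtoC (lam k) * z + mu k)%C)); try reflexivity; tauto.
Qed.

(** The trivial zeros of zeta, apart from the pole of the Gamma factor at [0]. *)
Lemma zeta_gamma_sum H a b M : test H a b -> 2 <= a -> 0 <= M -> (forall u, a <= u <= b -> Cmod (H u) <= M * u ^ 2) ->
  exists S', SumDiv (fun z => INR (gam (fun _ => / 2) (fun _ => RtoC 0) 1 z)) (MT H a b) (MT H a b 0 + S')%C /\ Cmod S' <= 2 * (M * ln (b / a)).
Proof.
 intros HT Ha HM HH. set (zs := fun j => RtoC (- (2 * INR (S j)))). pose proof (test_ln H a b HT) as Lab.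
 destruct (SD_seq zs (MT H a b) (/ 2) (M * ln (b / a)) ltac:(lra)) as [S' [T1 T2]].
 - pos.
 (* At [-2(j+1)] the growth [u^2] is absorbed and the exponent left is [-2j <= -j]. *)
 - intros j. replace ((/ 2) ^ j) with (exp (- (INR j * ln 2))). apply (MT_bound H a b M 2); auto. unfold zs.
  rewrite S_INR. simpl. pose proof (pos_INR j). lra. pos.
  rewrite Ropp_mult_distr_r, <- exp_pow_n, exp_Ropp, exp_ln by lra. auto.
 - exists S'. split. 2: lra. eapply SD_ext. 3: apply SD_plus; [apply SD_indicator|apply T1]. 2: reflexivity. intros z.
  simpl gam. unfold ind. assert (Eq : npint (RtoC (/ 2) * z + 0)%C <-> z = RtoC 0 \/ exists j, z = zs j). { split.
 - intros [j Hj]. assert (Z : z = RtoC (- (2 * INR j))). {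
  replace z with (2 * (RtoC (/ 2) * z + 0))%C by (rewrite RtoC_inv by lra; field). rewrite Hj, <- RtoC_mult. f_equal.
  ring. } destruct j. left. rewrite Z. simpl. f_equal. ring. fin.
 - intros [->|[j ->]]. exists O. simpl. rewrite Ropp_0. ring. exists (S j). unfold zs. rewrite <- RtoC_mult, Cplus_0_r.
  f_equal. field. } assert (Dj : z = RtoC 0 -> ~ exists j, z = zs j). { intros -> [j Hj]. apply (f_equal Re) in Hj.
  unfold zs in Hj. cbn [Re RtoC fst] in Hj. pose proof (INR_S_pos j); fin. }
  destruct (Ceq_dec z 0) as [e|e]; destruct (excluded_middle_informative (exists j, z = zs j)) as [f|f]; destruct (excluded_middle_informative (npint (RtoC (/ 2) * z + 0)%C)) as [g|g]; rewrite Eq in g; simpl; try lra; tauto.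
Qed.

Theorem theorem1 (phi h : R -> C) (m : nat) (E : C -> C) (Q : R) (r : nat)
    (lam : nat -> R) (mu : nat -> C) (om : C) (Ez : C -> C) :
  CL 1 phi -> C0inf h ->
  is_mL (coef phi) m -> S2_with (coef phi) m E ->
  S3_with m E Q r lam mu om ->
  zeta_ext Ez ->
  exists Z1 Z2 : R -> C,
    (forall x, 0 < x ->
       sum_over_zeros (Lstar m E Q r lam mu)
         (fun rho => int0inf (fun u => Cdiv (Cmult (h (x * u)) (cpowR u rho)) (RtoC u)))
         (Z1 x)) /\
    (forall x, 0 < x ->
       sum_over_zeros (zeta_star Ez)
         (fun rho => int0inf (fun u =>
            Cdiv (Cmult (Cmult (h (x * u)) (phi u)) (cpowR u rho)) (RtoC u)))
         (Z2 x)) /\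
    exists K delta, 0 < delta /\
      forall x, 0 < x < delta ->
        Cmod (Cminus
          (Cminus (Cmult (CN m) (int0inf (fun u => h (x * u)))) (Z1 x))
          (Cminus (int0inf (fun u => Cmult (h (x * u)) (phi u))) (Z2 x))) <= K.
Proof.
 intros HC [Hh [a [b [a0 [ab Hs]]]]] HmL H2 H3 HEz. destruct (phi_EFdata phi m E HC H2) as [[n HD] [HE Hnz]].
 pose proof (mL_nonvanish _ _ _ HmL H2) as Hm. destruct (zeta_EFdata Ez HEz) as [[nz HDz] Hnzz].
 pose proof (Ez_entire Ez HEz) as HEe. pose proof (zeta_S3 Ez HEz) as H3z. pose proof (Ez_1_neq Ez HEz) as Hmz.
 destruct HC as [Hphi [[K [K0 HK]] _]]. set (hx := fun x u => h (x * u)).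
 set (gx := fun x u => (h (x * u)%R * phi u)%C). assert (Th : test h a b) by (split; [apply csmooth_CkP; auto|auto]).
 assert (Thx : forall x, 0 < x -> test (hx x) (a / x) (b / x)) by (intros x Hx; apply test_scale; auto).
 assert (Tgx : forall x, 0 < x -> test (gx x) (a / x) (b / x)). { intros x Hx. destruct (Thx x Hx) as [A1 [A2 [A3 A4]]].
 split; [|split; [|split]]; auto. intros k. apply CkP_mult. auto. apply csmooth_CkP; auto. intros u Hu Hd. unfold gx.
 pose proof (A4 u Hu Hd) as X. unfold hx in X. rewrite X. ring. } set (o1 := ordL m r lam mu n).
 set (o2 := ordL 1 1 (fun _ => / 2) (fun _ => RtoC 0) nz).
 (* The sums are chosen for every [x > 0], as the statement asks; the explicit formula determines
    them only for small [x]. *)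
 set (Z1 := fun x => epsilon (inhabits (RtoC 0)) (fun S => SumDiv (fun z => INR (o1 z)) (MT (hx x) (a / x) (b / x)) S)).
 set (Z2 := fun x => epsilon (inhabits (RtoC 0)) (fun S => SumDiv (fun z => INR (o2 z)) (MT (gx x) (a / x) (b / x)) S)).
 assert (HZ1 : forall x, 0 < x -> SumDiv (fun z => INR (o1 z)) (MT (hx x) (a / x) (b / x)) (Z1 x)). { intros x Hx.
 apply epsilon_spec. apply (Lstar_sum_ex E m Q r lam mu om n _ HE HD H3 Hm Hnz); auto. }
 assert (HZ2 : forall x, 0 < x -> SumDiv (fun z => INR (o2 z)) (MT (gx x) (a / x) (b / x)) (Z2 x)). { intros x Hx.
 apply epsilon_spec. apply (Lstar_sum_ex Ez 1 _ _ _ _ _ nz _ HEe HDz H3z (fun _ => Hmz) Hnzz); auto. } exists Z1, Z2.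
 split; [|split].
 - intros x Hx. apply (Lstar_sum_zeros E m Q r lam mu om n _ HD H3 Hm (MT (hx x) (a / x) (b / x))); auto. symmetry.
  apply (int0inf_MT (hx x)); auto.
 - intros x Hx.
  replace (zeta_star Ez) with (Lstar 1 Ez (/ sqrt PI) 1 (fun _ => / 2) (fun _ => RtoC 0)) by (apply functional_extensionality; intros; symmetry; apply zeta_Lstar).
  apply (Lstar_sum_zeros Ez 1 _ _ _ _ _ nz _ HDz H3z (fun _ => Hmz) (MT (gx x) (a / x) (b / x))); auto. symmetry.
  apply (int0inf_MT (gx x)); auto.
 - destruct (rcont_bounded h a b ab) as [M [M0 HM]]. intros t Ht. apply (CkP_rcont O). apply csmooth_CkP; auto. lra.
  destruct (gamma_sums lam mu r (proj1 (proj2 (proj2 H3)))) as [Kg [Kg0 HKg]]. set (l := ln (b / a)).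
  (* [x < a/2] puts the supports into [u >= 2], as [MT_bound] requires. The three terms of the
     constant bound the Gamma poles of [L_phi], the [m]-fold point 0, and the trivial zeros of
     zeta. *)
  exists (Kg * (M * l) + INR m * (M * l) + 2 * (M * K * l)), (a / 2). split. lra. intros x Hx.
  assert (x0 : 0 < x) by lra. specialize (Thx x x0). specialize (Tgx x x0). specialize (HZ1 x x0).
  specialize (HZ2 x x0). assert (A2 : 2 <= a / x). { apply Rmult_le_reg_r with x; auto. unfold Rdiv.
  rewrite Rmult_assoc, Rinv_l by lra. lra. } assert (El : ln (b / x / (a / x)) = l). { unfold l. f_equal. field. lra. }
  assert (Bh : forall u, a / x <= u <= b / x -> Cmod (hx x u) <= M). { intros u Hu. apply HM. split.
  replace a with (x * (a / x)) by (field; lra); fin. replace b with (x * (b / x)) by (field; lra); fin. }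
  assert (Bg : forall u, a / x <= u <= b / x -> Cmod (gx x u) <= M * K * u ^ 2). { intros u Hu. unfold gx.
  rewrite Cmod_mult, Rmult_assoc. apply Rmult_le_compat; try pos. fin. apply HK. lra. }
  destruct (HKg _ _ _ M Thx A2 M0 Bh) as [SG [SG1 SG2]].
  destruct (zeta_gamma_sum _ _ _ (M * K) Tgx A2 ltac:(nra) Bg) as [S' [SZ1 SZ2]]. rewrite El in SG2, SZ2.
  (* Beyond [b / x] the test functions vanish, so both sums over [n] are one and the same finite
     sum. *)
  destruct (nfloor_ex (b / x)) as [N HN]. pos.
  set (u := fun j => (phi (INR (S j)) * RtoC (vM (S j)) * hx x (INR (S j)))%C). assert (Hu : cser u (csum N u)). {
  apply cser_finite. intros j Hj. unfold u. destruct Thx as [_ [_ [_ Z]]]. rewrite Z. ring. pos. right.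
  apply Rlt_le_trans with (INR (S N)). rewrite S_INR. lra. fin. }
  assert (Hu' : cser (fun j => RtoC (vM (S j)) * gx x (INR (S j)))%C (csum N u)) by (eapply cser_ext; [|apply Hu]; intros j; unfold u, gx, hx; ring).
  pose proof (Lstar_sum_small E m Q r lam mu om n _ HE HD H3 Hm _ _ _ _ _ Thx ltac:(lra) Hu SG1) as F1.
  pose proof (Lstar_sum_small Ez 1 _ _ _ _ _ nz _ HEe HDz H3z (fun _ => Hmz) _ _ _ _ _ Tgx ltac:(lra) Hu' SZ1) as F2.
  rewrite (SD_unique _ _ _ _ HZ1 F1), (SD_unique _ _ _ _ HZ2 F2). change (fun u => h (x * u)) with (hx x).
  change (fun u => (h (x * u)%R * phi u)%C) with (gx x). rewrite (int0inf_MT1 _ _ _ Thx), (int0inf_MT1 _ _ _ Tgx).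
  simpl (INR 1).
  (* The integrals, the sum over [n] and the two contributions of zeta at 0 have cancelled; only
     bounded terms are left. *)
  match goal with |- Cmod ?w <= _ => replace w with (SG - CN m * MT (hx x) (a / x) (b / x) 0 - S')%C by ring end.
  pose proof (MT_bound (hx x) _ _ M 0 0 0 Thx A2 M0 ltac:(intros; rewrite pow_O, Rmult_1_r; auto) ltac:(simpl; lra) ltac:(lra)) as B0.
  rewrite El, Rmult_0_l, Ropp_0, exp_0 in B0. le_trans Cmod_minus_le. apply Rplus_le_compat; auto.
  le_trans Cmod_minus_le. rewrite Cmod_mult, Cmod_R, Rabs_pos_eq by pos; fin.
Qed.
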